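(* Let $T>0$, $\lambda\ge 0$, $\epsilon>0$ be constants and $d,p\ge 1$ integers. Let $\mathcal Y\subset\mathbb R^d$ be compact and let $\ell:\mathbb R^d\times\mathcal Y\to[0,\infty)$ be a continuous function of $2$-growth. Let $f:\mathbb R^d\to\mathbb R^p$ be Lipschitz continuous, identify $\mathbb R^m$ ($m=dp$) with the space of real $d\times p$ matrices, and let $v(x,\theta)=\theta f(x)$ for $x\in\mathbb R^d$, $\theta\in\mathbb R^m$. Let $\mu_0\in\mathcal P_c(\mathbb R^d\times\mathcal Y)$. For $\mu\in C([0,T];(\mathcal P_2(\mathbb R^d\times\mathcal Y),W_2))$ and $\theta\in L^2(0,T;\mathbb R^m)$ set $$J(\mu,\theta)=\int_{\mathbb R^d\times\mathcal Y}\ell\,d\mu_T+\int_0^T\int_{\mathbb R^d\times\mathcal Y}\Big(\frac{\lambda}{2}|v(x,\theta_t)|^2+\frac{\epsilon}{2}|\theta_t|^2\Big)\,d\mu_t(x,y)\,dt .$$ Let $S$ be the set of pairs $(\mu,\theta)\in C([0,T];(\mathcal P_2(\mathbb R^d\times\mathcal Y),W_2))\times L^2(0,T;\mathbb R^m)$ such that $\mu$ solves, in the sense of distributions, $$\partial_t\mu_t+\mathrm{div}_x\big(\mu_t\,v(x,\theta_t)\big)=0\ \text{ in }(0,T)\times\mathbb R^d\times\mathcal Y,\qquad \mu_t|_{t=0}=\mu_0 .$$ Then there exists $(\mu^*,\theta^* )\in S$ with $J(\mu^*,\theta^* )=\inf_{(\mu,\theta)\in S}J(\mu,\theta)$.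
   Context: $\mathcal P(X)$ is the set of Borel probability measures on a metric space $X$; $\mathcal P_c(X)$ is the set of those with compact support; $\mathcal P_2(X)$ is the set of those with finite second moment; $W_2$ is the $L^2$-Wasserstein distance, $W_2(\mu^1,\mu^2)^2=\inf_{\pi}\int d(x_1,x_2)^2\,d\pi(x_1,x_2)$ over all couplings $\pi$ of $\mu^1,\mu^2$. $\mathbb R^d\times\mathcal Y$ carries the Euclidean metric, and matrices carry the Euclidean (Frobenius) norm. $C([0,T];(\mathcal P_2,W_2))$ is the set of curves continuous with respect to $W_2$. A function $g:X\to\mathbb R$ on a metric space $(X,d)$ has $2$-growth if there are $A,B\ge0$ and $\bar x\in X$ with $|g(x)|\le A+B\,d(x,\bar x)^2$ for all $x\in X$. Distributional solution: a narrowly continuous curve $\mu:[0,T]\to\mathcal P(\mathbb R^d\times\mathcal Y)$ solves $\partial_t\mu_t+\mathrm{div}_x(v_t\mu_t)=0$ for Borel vector fields $v_t:\mathbb R^d\to\mathbb R^d$ (here $v_t=v(\cdot,\theta_t)$) if $$\int_0^T\int_{\mathbb R^d\times\mathcal Y}\big(\partial_t\psi_t(x,y)+\nabla_x\psi_t(x,y)\cdot v_t(x)\big)\,d\mu_t(x,y)\,dt=0$$ for every $\psi\in C_c^\infty((0,T)\times\mathbb R^d\times\mathcal Y)$, where the latter means restrictions to $(0,T)\times\mathbb R^d\times\mathcal Y$ of functions in $C_c^\infty((0,T)\times\mathbb R^d\times\mathbb R^d)$. *)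

(* Defs.v *)
From HB Require Import structures.
From mathcomp Require Import all_boot all_order all_algebra.
From mathcomp Require Import all_classical all_reals all_analysis.

Set Implicit Arguments.
Unset Strict Implicit.
Unset Printing Implicit Defensive.

Import Order.TTheory GRing.Theory Num.Theory.
Import numFieldNormedType.Exports.

Local Open Scope classical_set_scope.
Local Open Scope ring_scope.

Notation borel X := (g_sigma_algebraType (@open X)).

(* The canonical norm of the library on matrices is the max norm: it induces
   the right topology, but every metric quantity below is Euclidean. *)
Definition enorm (R : realType) (m n : nat) (A : 'M[R]_(m, n)) : R :=
  Num.sqrt (\sum_i \sum_j A i j ^+ 2).

Section state_space.
Context {R : realType} {d : nat}.

(* Elements are pairs (x, y).  For Y a compact subset of R^d, the metric space
   R^d x Y is the closed subset RdY Y, and Borel probability measures on it are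
   identified with Borel probability measures on R^d x R^d giving it mass 1. *)
Definition state := ('cV[R]_d * 'cV[R]_d)%type.

Definition eucl_dist (z w : state) : R :=
  Num.sqrt (enorm (z.1 - w.1) ^+ 2 + enorm (z.2 - w.2) ^+ 2).

Definition RdY (Y : set 'cV[R]_d) : set state := setT `*` Y.

Definition two_growth (D : set state) (g : state -> R) : Prop :=
  exists A B : R, exists zbar : state,
    [/\ 0 <= A, 0 <= B, D zbar &
        forall z, D z -> `|g z| <= A + B * eucl_dist z zbar ^+ 2].

Definition Pborel (D : set state) : set (probability (borel state) R) :=
  [set mu | mu D = 1%E].

Definition msupport (mu : probability (borel state) R) : set state :=
  [set z | forall U : set state, open U -> U z -> (0 < mu U)%E].

Definition Pc (D : set state) : set (probability (borel state) R) :=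
  [set mu | Pborel D mu /\ compact (msupport mu)].

Definition P2 (D : set state) : set (probability (borel state) R) :=
  [set mu | Pborel D mu /\ exists2 zbar, D zbar &
     (\int[mu]_(z in D) (eucl_dist z zbar ^+ 2)%:E < +oo)%E].

Definition is_coupling (mu1 mu2 : probability (borel state) R)
    (pi : probability (borel state * borel state)%type R) : Prop :=
  forall A : set (borel state), measurable A ->
    pi (A `*` setT) = mu1 A /\ pi (setT `*` A) = mu2 A.

Definition W2 (mu1 mu2 : probability (borel state) R) : \bar R :=
  sqrte (ereal_inf
    [set (\int[pi]_z (eucl_dist z.1 z.2 ^+ 2)%:E)%E | pi in is_coupling mu1 mu2]).

(* Curves are total functions of time; only their restriction to [0, T] is
   ever used. *)
Definition W2_curve (T : R) (D : set state)
    (mu : R -> probability (borel state) R) : Prop :=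
  (forall t, t \in `[0, T] -> P2 D (mu t)) /\
  (forall t, t \in `[0, T] ->
     W2 (mu s) (mu t) @[s --> within `[0, T] (nbhs t)] --> 0%E).

Definition narrowly_continuous (T : R) (D : set state)
    (mu : R -> probability (borel state) R) : Prop :=
  (forall t, t \in `[0, T] -> Pborel D (mu t)) /\
  forall phi : state -> R, {within D, continuous phi} ->
    (exists M : R, forall z, D z -> `|phi z| <= M) ->
    {within `[0, T], continuous (fun t => \int[mu t]_(z in D) phi z)}.

End state_space.
Arguments state : clear implicits.

Section test_functions.
Context {R : realType}.

Fixpoint Ck (V : normedModType R) (k : nat) (g : V -> R) : Prop :=
  continuous g /\
  if k is k'.+1 then
    forall v, (forall x, derivable g x v) /\ Ck k' ('D_v g)
  else True.

Definition smooth (V : normedModType R) (g : V -> R) : Prop :=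
  forall k, Ck k g.

(* A function in C_c^oo ((0,T) x R^d x R^d), extended by 0 to all times. *)
Definition test_function (d : nat) (T : R) (psi : R * state R d -> R) : Prop :=
  [/\ smooth psi,
      compact (closure [set q | psi q != 0]) &
      closure [set q | psi q != 0] `<=` `]0, T[ `*` setT].

Definition dt (d : nat) (psi : R * state R d -> R) (q : R * state R d) : R :=
  'D_((1, (0, 0)) : R * state R d) psi q.

Definition grad_x (d : nat) (psi : R * state R d -> R) (q : R * state R d) :
  'cV[R]_d :=
  \col_i 'D_((0, (delta_mx i 0, 0)) : R * state R d) psi q.

End test_functions.

Section control_problem.
Context {R : realType} {d p : nat}.

Definition elipschitz (f : 'cV[R]_d -> 'cV[R]_p) : Prop :=
  exists2 L : R, 0 <= L & forall x x', enorm (f x - f x') <= L * enorm (x - x').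

Definition velocity (f : 'cV[R]_d -> 'cV[R]_p) (x : 'cV[R]_d)
    (theta : 'M[R]_(d, p)) : 'cV[R]_d := theta *m f x.

(* A control is any representative of its a.e. class; nothing below
   distinguishes two representatives. *)
Definition in_L2 (T : R) (theta : R -> 'M[R]_(d, p)) : Prop :=
  measurable_fun `[0, T]
    (theta : measurableTypeR R -> borel 'M[R]_(d, p)) /\
  (\int[lebesgue_measure]_(t in `[0%R, T]) (enorm (theta t) ^+ 2)%:E < +oo)%E.

Definition solves_continuity (T : R) (Y : set 'cV[R]_d)
    (v : R -> 'cV[R]_d -> 'cV[R]_d)
    (mu : R -> probability (borel (state R d)) R) : Prop :=
  narrowly_continuous T (RdY Y) mu /\
  forall psi : R * state R d -> R, test_function T psi ->
    (\int[lebesgue_measure]_(t in `[0%R, T]) \int[mu t]_(z in RdY Y)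
       (dt psi (t, z) +
        \sum_i grad_x psi (t, z) i 0 * v t z.1 i 0)%:E = 0)%E.

Definition J (T lambda eps : R) (Y : set 'cV[R]_d) (l : state R d -> R)
    (f : 'cV[R]_d -> 'cV[R]_p) (mu : R -> probability (borel (state R d)) R)
    (theta : R -> 'M[R]_(d, p)) : \bar R :=
  (\int[mu T]_(z in RdY Y) (l z)%:E +
   \int[lebesgue_measure]_(t in `[0%R, T]) \int[mu t]_(z in RdY Y)
     (lambda / 2 * enorm (velocity f z.1 (theta t)) ^+ 2 +
      eps / 2 * enorm (theta t) ^+ 2)%:E)%E.

(* The initial condition is equality of measures, i.e. on measurable sets
   only: the value of a measure elsewhere is unspecified in the library. *)
Definition admissible (T : R) (Y : set 'cV[R]_d) (f : 'cV[R]_d -> 'cV[R]_p)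
    (mu0 : probability (borel (state R d)) R) :
    set ((R -> probability (borel (state R d)) R) * (R -> 'M[R]_(d, p))) :=
  [set mt | [/\ W2_curve T (RdY Y) mt.1,
                in_L2 T mt.2,
                solves_continuity T Y
                  (fun t x => velocity f x (mt.2 t)) mt.1 &
                forall A : set (borel (state R d)), measurable A ->
                  mt.1 0 A = mu0 A]].

End control_problem.

(* Main.v *)
(* The direct method.  Write Phi for the flow of x' = theta_t f(x), which is a
   Caratheodory equation with weight in L^1(0,T).

   Uniqueness: if mu solves the continuity equation driven by theta and phi is a
   Lipschitz function with compact support, then E_t[phi o Phi(t, b)] does not
   depend on t.  Indeed its mollification is an admissible test function in space,
   and the equation makes the increments of its expectation over [s, t] small
   compared with the weight of [s, t].  Hence mu_t is the push-forward of mu_0 by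
   Phi(0, t); conversely every control produces an admissible pair in this way, and
   J becomes a functional of theta alone.  As f enters the running cost through a
   square, that cost is q_t(theta_t) for a nonnegative quadratic form q_t whose
   coefficients are second moments of f along the flow.

   Existence: as eps > 0, a minimising sequence of controls is bounded in L^2, and it
   converges weakly along an ultrafilter.  The error made by replacing theta_n by its
   limit theta in the equation for the trajectories is an oscillating integral, small
   uniformly in time and in the initial point, so the flows converge uniformly on the
   compact support of mu_0, and so do the terminal costs and the moments.  Lower
   semicontinuity of the running cost follows from q_t(theta_n - theta) >= 0. *)

Require Import Defs.
From HB Require Import structures.
From mathcomp Require Import all_boot all_order all_algebra.
From mathcomp Require Import all_classical all_reals all_analysis.
From mathcomp Require Import measurable_realfun ring lra.

Set Implicit Arguments.
Unset Strict Implicit.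
Unset Printing Implicit Defensive.
Import Order.TTheory GRing.Theory Num.Theory.
Import numFieldNormedType.Exports.
Local Open Scope classical_set_scope.
Local Open Scope ring_scope.

(* [lra] inspects every hypothesis up to conversion, which is slow in large
   contexts: keep only order statements and equations. *)
Ltac arith := repeat match goal with H : ?P |- _ =>
  lazymatch P with is_true (Order.le _ _) => fail | is_true (Order.lt _ _) => fail
  | @eq _ _ _ => fail | _ => clear H end end; lra.

(** Two lacks of regularity shape every estimate. The control is only square integrable in time, so
    a trajectory need not have a derivative at a given instant; derivatives are replaced by
    increments over [s, t], measured against the integral of a weight [w] and passed from short
    windows to the whole interval by continuous induction. And [f] is only Lipschitz, so the flow is
    only Lipschitz in space. The transported function is mollified at a scale [eta], and the price
    is a commutator: shifting the mollified function by a displacement frozen at the centre of the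
    averaging ball costs a multiple of [eta] times the weight of [s, t]. This term does not shrink
    under subdivision, but it adds up to a multiple of [eta], which then tends to 0; all other
    errors are of smaller order than the weight. On the existence side, an ultrafilter gives the
    limits of all bounded scalar sequences at once, and turns uniform convergence on a compact set
    into convergence along sequences of points. The running cost couples a weakly convergent control
    with moments of the flow; its affine minorants pass to the limit because these moments converge
    uniformly in time. *)

HB.lock Definition Int {R : realType} (a b : R) (f : R -> R) : R := \int[lebesgue_measure]_(r in `[a, b]) f r.

(** * Integrals on intervals and Gronwall's inequality *)

Section integrals_on_intervals.
Context {R : realType}.
Implicit Types (a b c s t : R) (f g w : R -> R).

Definition itg a b f := lebesgue_measure.-integrable `[a, b] (EFin \o f).

Lemma measurable_cc a b : measurable (`[a, b]%classic : set (measurableTypeR R)).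
Proof. exact: measurable_itv. Qed.

Lemma itgS a b s t f : a <= s -> t <= b -> itg a b f -> itg s t f.
Proof.
move=> as_ tb; apply: integrableS => //; exact: measurable_cc || idtac.
by move=> r /=; rewrite !in_itv/= => /andP[sr rt]; rewrite (le_trans as_)//= (le_trans rt).
Qed.

Lemma itg_measurable a b f : itg a b f -> measurable_fun `[a, b] f.
Proof. by move=> /(measurable_int lebesgue_measure)/measurable_EFinP. Qed.

Lemma itg_dom a b f g : measurable_fun `[a, b] f -> itg a b g ->
  (forall r, a <= r <= b -> `|f r| <= g r) -> itg a b f.
Proof.
move=> mf ig fg; apply: le_integrable ig => //.
- exact/measurable_EFinP.
- move=> r; rewrite /= in_itv/= => /fg h; rewrite lee_fin.
  exact: le_trans (ler_norm _).
Qed.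

Lemma itgD a b f g : itg a b f -> itg a b g -> itg a b (fun r => f r + g r).
Proof. by move=> fi gi; exact: (integrableD _ fi gi). Qed.

Lemma itgZ a b k f : itg a b f -> itg a b (fun r => k * f r).
Proof. by move=> fi; exact: (integrableZl _ k fi). Qed.

Lemma itgB a b f g : itg a b f -> itg a b g -> itg a b (fun r => f r - g r).
Proof. by move=> fi gi; exact: (integrableB _ fi gi). Qed.

Lemma itg_cst a b k : itg a b (fun=> k).
Proof.
apply: measurable_bounded_integrable => //.
- by rewrite /= lebesgue_measure_itv/=; case: ifP; rewrite ?ltry.
- exact: bounded_cst.
Qed.

Lemma itg_norm a b f : itg a b f -> itg a b (fun r => `|f r|).
Proof. exact: integrable_norm. Qed.

Lemma itg_bounded a b f k : measurable_fun `[a, b] f ->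
  (forall r, a <= r <= b -> `|f r| <= k) -> itg a b f.
Proof. by move=> mf fk; apply: (itg_dom mf (itg_cst a b k)). Qed.

Lemma itg_sum a b (I : Type) (s : seq I) (F : I -> R -> R) :
  (forall i, itg a b (F i)) -> itg a b (fun r => \sum_(i <- s) F i r).
Proof.
move=> FI; elim: s => [|i s ih].
  by under eq_fun do rewrite big_nil; exact: itg_cst.
by under eq_fun do rewrite big_cons; exact: itgD.
Qed.

Lemma itg_eq a b f g : (forall r, a <= r <= b -> f r = g r) -> itg a b f -> itg a b g.
Proof.
move=> fg; apply: eq_integrable => // r; rewrite inE/= in_itv/= => h.
by rewrite fg.
Qed.

Lemma Int_eq a b f g : (forall r, a <= r <= b -> f r = g r) -> Int a b f = Int a b g.
Proof. by move=> fg; rewrite Int.unlock; apply: eq_Rintegral => r; rewrite inE/= in_itv/= => /fg. Qed.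

Lemma IntD a b f g : itg a b f -> itg a b g ->
  Int a b (fun r => f r + g r) = Int a b f + Int a b g.
Proof. by move=> fi gi; rewrite Int.unlock RintegralD. Qed.

Lemma IntB a b f g : itg a b f -> itg a b g ->
  Int a b (fun r => f r - g r) = Int a b f - Int a b g.
Proof. by move=> fi gi; rewrite Int.unlock RintegralB. Qed.

Lemma IntZ a b k f : itg a b f -> Int a b (fun r => k * f r) = k * Int a b f.
Proof. by move=> fi; rewrite Int.unlock RintegralZl. Qed.

Lemma Int_cst a b k : a <= b -> Int a b (fun=> k) = k * (b - a).
Proof.
move=> ab; rewrite Int.unlock Rintegral_cst//= lebesgue_measure_itv/= lte_fin.
by case: ltgtP ab => // -> _; rewrite subrr.
Qed.

Lemma Int_sum a b (I : Type) (s : seq I) (F : I -> R -> R) :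
  (forall i, itg a b (F i)) ->
  Int a b (fun r => \sum_(i <- s) F i r) = \sum_(i <- s) Int a b (F i).
Proof.
move=> FI; elim: s => [|i s ih].
  rewrite big_nil; under Int_eq do rewrite big_nil.
  by rewrite Int.unlock Rintegral_cst// mul0r.
rewrite big_cons -ih -IntD//; last exact: itg_sum.
by apply: Int_eq => r _; rewrite big_cons.
Qed.

Lemma Int_le a b f g : itg a b f -> itg a b g ->
  (forall r, a <= r <= b -> f r <= g r) -> Int a b f <= Int a b g.
Proof. by move=> fi gi fg; rewrite Int.unlock; apply: le_Rintegral => // r; rewrite /= in_itv/= => /fg. Qed.

Lemma Int_ge0 a b f : (forall r, a <= r <= b -> 0 <= f r) -> 0 <= Int a b f.
Proof. by move=> f0; rewrite Int.unlock; apply: Rintegral_ge0 => r; rewrite /= in_itv/= => /f0. Qed.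

Lemma Int_norm a b f g : itg a b f -> itg a b g ->
  (forall r, a <= r <= b -> `|f r| <= g r) -> `|Int a b f| <= Int a b g.
Proof.
move=> fi gi fg; apply: (@le_trans _ _ (Int a b (fun r => `|f r|))).
  by rewrite Int.unlock; exact: le_normr_Rintegral.
by apply: Int_le => //; exact: itg_norm.
Qed.

Lemma Int_pt a f : Int a a f = 0.
Proof. by rewrite Int.unlock set_itv1 Rintegral_set1. Qed.

Lemma Int_split a b c f : a <= b -> b <= c -> itg a c f ->
  Int a c f = Int a b f + Int b c f.
Proof.
move=> ab bc fi; rewrite Int.unlock -(Rintegral_itv_obnd_cbnd (r := b) (b := BRight c)); last first.
  apply: integrableS fi => //.
  by move=> r /=; rewrite !in_itv/= => /andP[sr rt]; rewrite (le_trans ab)//= ltW.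
by rewrite -(@Rintegral_itvB _ _ (BLeft a)) ?bnd_simp// addrC subrK.
Qed.

(** Absolute continuity of the integral, in the local form needed by continuous induction: the
    primitive of [w] is continuous at [r]. It supplies the radius [d] in the local estimates
    below. *)
Lemma Int_small a b w : itg a b w ->
  (forall r, a <= r <= b -> 0 <= w r) ->
  forall r e : R, a <= r <= b -> 0 < e -> exists2 d : R, 0 < d &
  forall s t, a <= s -> s <= t -> t <= b -> r - d < s -> t < r + d -> Int s t w <= e.
Proof.
move=> iw w0 r e rab e0.
have ab : a <= b by case/andP : rab; exact: le_trans.
have : {within `[a, b], continuous (fun t => Int a t w)}.
  by rewrite Int.unlock; exact: parameterized_integral_continuous.
move=> /subspace_continuousP => /(_ r).
rewrite /= in_itv/= => /(_ rab).
move=> /cvgrPdist_lt /(_ (e / 2)) /=; rewrite divr_gt0// => /(_ isT).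
rewrite near_withinE => -[d /= d0 H].
exists d => // s t as_ st tb rs tr.
have asp : `|Int a r w - Int a s w| < e / 2.
  apply: H; first by rewrite /= ltr_norml; apply/andP; split; arith.
  by rewrite /= in_itv/= as_/=; arith.
have atp : `|Int a r w - Int a t w| < e / 2.
  apply: H; first by rewrite /= ltr_norml; apply/andP; split; arith.
  by rewrite /= in_itv/= tb/= andbT; arith.
have := @Int_split a s t w as_ st (itgS (lexx _) tb iw).
by move: asp atp; rewrite !ltr_norml => /andP[? ?] /andP[? ?]; arith.
Qed.

(* Continuous induction: a transitive relation that holds locally holds globally. *)
Lemma local_to_global (P : R -> R -> Prop) a b : a <= b ->
  (forall s t u, a <= s -> s <= t -> t <= u -> u <= b -> P s t -> P t u -> P s u) ->
  (forall r, a <= r <= b -> exists2 d : R, 0 < d & forall s t, a <= s -> s <= t -> t <= b ->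
     r - d < s -> t < r + d -> P s t) ->
  P a b.
Proof.
move=> ab trP loc.
pose S := [set t | a <= t <= b /\ P a t].
have Sa : S a.
  split; first by rewrite lexx.
  have [|d d0] := loc a; first by rewrite lexx.
  by apply => //; arith.
have supS : has_sup S by split; [exists a | exists b => t [/andP[]]].
have ac : a <= sup S by apply: ub_le_sup => //; case: supS.
have cb : sup S <= b by apply: ge_sup; [exists a | move=> t [/andP[]]].
have [|d d0 H] := loc (sup S); first by rewrite ac.
have [t0 [/andP[at0 t0b] Pt0] ct0] := sup_adherent d0 supS.
have t0c : t0 <= sup S by apply: ub_le_sup; [case: supS | split => //; exact/andP].
(* A time beyond [sup S] unless [b] cuts it off; as [t1] turns out to belong to [S], [b] must cut it
   off. *)
pose t1 := Num.min b (sup S + d / 2).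
have t0t1 : t0 <= t1 by rewrite /t1 le_min t0b/=; arith.
have t1b : t1 <= b by rewrite /t1 ge_min lexx.
have t1c : t1 <= sup S + d / 2 by rewrite /t1 ge_min lexx orbT.
have St1 : S t1.
  split; first by rewrite t1b andbT (le_trans at0).
  by apply: (trP _ t0) => //; apply: H => //; arith.
have : t1 <= sup S by apply: ub_le_sup => //; case: supS.
rewrite /t1 ge_min => /orP[bc|]; last by move=> ?; arith.
have -> : b = t1 by apply/eqP; rewrite eq_le t1b andbT /t1 le_min lexx/=; arith.
by case: St1.
Qed.

(** Such bounds add up over adjacent intervals, so continuous induction applies. [B] plays the role
    of a clock, in practice built from a primitive of the weight. *)
Lemma local_increments (G B : R -> R) (k : R) a b : a <= b ->
  (forall r, a <= r <= b -> exists2 d : R, 0 < d & forall s t, a <= s -> s <= t -> t <= b ->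
     r - d < s -> t < r + d -> `|G t - G s| <= k * (B t - B s)) ->
  `|G b - G a| <= k * (B b - B a).
Proof.
move=> ab; apply: (@local_to_global (fun s t => `|G t - G s| <= k * (B t - B s))) => //.
move=> s t u _ _ _ _ h1 h2.
have -> : G u - G s = (G u - G t) + (G t - G s) by ring.
apply: le_trans (ler_normD _ _) _.
by apply: le_trans (lerD h2 h1) _; rewrite -mulrDr addrA subrK.
Qed.

(** A fundamental theorem of calculus for [g] merely integrable: instead of a derivative, the
    increments of [G] match the integral of [g] locally, up to an arbitrarily small multiple of the
    increment of [B]. By [local_increments] the difference of [G] and the primitive of [g] has no
    increment. *)
Lemma FTC_local (G g B : R -> R) a b : a <= b -> itg a b g ->
  (forall e r : R, 0 < e -> a <= r <= b ->
   exists2 d : R, 0 < d & forall s t, a <= s -> s <= t -> t <= b ->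
     r - d < s -> t < r + d -> `|G t - G s - Int s t g| <= e * (B t - B s)) ->
  G b - G a = Int a b g.
Proof.
move=> ab ig loc.
apply/eqP; rewrite -subr_eq0 -normr_le0; apply/ler_addgt0Pr => e e0; rewrite add0r.
pose k := e / (`|B b - B a| + 1).
have B0 : 0 < `|B b - B a| + 1 by rewrite ltr_wpDl.
have k0 : 0 < k by rewrite divr_gt0.
have := @local_increments (fun t => G t - Int a t g) B k a b ab.
have -> : G b - Int a b g - (G a - Int a a g) = G b - G a - Int a b g.
  by rewrite Int_pt; ring.
move=> H; apply: le_trans (H _) _.
  move=> r rab; have [d d0 L] := loc k r k0 rab; exists d => // s t as_ st tb rs tr.
  rewrite (@Int_split a s t)//; last exact: itgS ig.
  rewrite (_ : _ - _ = G t - G s - Int s t g); first exact: L.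
  by ring.
rewrite /k -mulrA ler_piMr ?(ltW e0)// mulrC ler_pdivrMr// mul1r.
by apply: le_trans (ler_norm _) _; rewrite lerDl.
Qed.

(** The mean value estimate for the exponential, from [1 + x <= exp x] used at both ends: [exp x *
    (y - x) <= exp y - exp x <= exp y * (y - x)], and both extreme slopes are within [e] of
    [exp z]. *)
Lemma expR_increment_lin (x y z e : R) :
  (forall u, Num.min x y <= u <= Num.max x y -> `|expR u - expR z| <= e) ->
  `|expR y - expR x - expR z * (y - x)| <= e * `|y - x|.
Proof.
have le_case x' y' : x' <= y' ->
  (forall u, x' <= u <= y' -> `|expR u - expR z| <= e) ->
  `|expR y' - expR x' - expR z * (y' - x')| <= e * `|y' - x'|.
  move=> xy h.
  have hx := h x'; have hy := h y'; rewrite !lexx xy/= in hx hy.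
  move/(_ isT): hx; move/(_ isT): hy; rewrite !ler_norml => /andP[y1 y2] /andP[x1 x2].
  rewrite (ger0_norm (x := y' - x')); last arith.
  have h1 := expR_ge1Dx (x' - y'); have h2 := expR_ge1Dx (y' - x').
  have yE : expR x' = expR y' * expR (x' - y') by rewrite -expRD; congr expR; ring.
  have xE : expR y' = expR x' * expR (y' - x') by rewrite -expRD; congr expR; ring.
  have p1 := expR_gt0 x'; have p2 := expR_gt0 y'.
  have q1 : expR y' - expR x' <= expR y' * (y' - x').
    by rewrite yE -{1}[expR y']mulr1 -mulrBr ler_pM2l//; arith.
  have q2 : expR x' * (y' - x') <= expR y' - expR x'.
    by rewrite xE; nra.
  have q3 : expR y' * (y' - x') <= (expR z + e) * (y' - x') by apply: ler_wpM2r; arith.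
  have q4 : (expR z - e) * (y' - x') <= expR x' * (y' - x') by apply: ler_wpM2r; arith.
  by apply/andP; split; nra.
move=> h; case: (leP x y) => xy.
  by apply: le_case => // u; move: (h u); rewrite (min_idPl xy) (max_idPr xy).
rewrite -normrN (_ : - (expR y - _ - _) = expR x - expR y - expR z * (x - y)); last by ring.
rewrite -[`|y - x|]normrN opprB; apply: le_case; first exact: ltW.
by move=> u; move: (h u); rewrite (min_idPr (ltW xy)) (max_idPl (ltW xy)).
Qed.

Lemma between_dist (x y u z d : R) : `|x - z| < d -> `|y - z| < d ->
  (x <= u) || (y <= u) -> (u <= x) || (u <= y) -> `|u - z| < d.
Proof.
rewrite !ltr_norml => /andP[? ?] /andP[? ?] h1 h2.
by apply/andP; case/orP: h1 => ?; case/orP: h2 => ?; split; arith.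
Qed.

Lemma itgM a b f (h : R -> R) k : itg a b f -> measurable_fun `[a, b] h ->
  (forall r, a <= r <= b -> `|h r| <= k) -> itg a b (fun r => f r * h r).
Proof.
move=> fi mh hk; apply: (@itg_dom _ _ _ (fun r => k * `|f r|)).
- by apply: measurable_funM => //; exact: itg_measurable fi.
- by apply: itgZ; exact: itg_norm.
- by move=> r /hk h0; rewrite normrM mulrC ler_wpM2r.
Qed.

Lemma continuous_Int a b f : a <= b -> itg a b f ->
  {within `[a, b], continuous (fun t => Int a t f)}.
Proof. by rewrite Int.unlock; exact: parameterized_integral_continuous. Qed.

Lemma within_continuous_measurable a b f :
  {within `[a, b], continuous f} -> measurable_fun `[a, b] f.
Proof. by move=> cf; apply: subspace_continuous_measurable_fun. Qed.

Lemma measurable_Int a b f : itg a b f -> measurable_fun `[a, b] (fun t => Int a t f).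
Proof.
move=> fi; case: (leP a b) => ab; last by rewrite set_itv_ge -?leNgt//; exact: measurable_fun_set0.
by apply: within_continuous_measurable; exact: continuous_Int.
Qed.

Lemma Int_nonneg_le a b s t w : (forall r, a <= r <= b -> 0 <= w r) -> itg a b w ->
  a <= s -> s <= t -> t <= b -> Int a s w <= Int a t w.
Proof.
move=> w0 iw as_ st tb; rewrite (@Int_split a s t)//; last exact: itgS iw.
by rewrite lerDl; apply: Int_ge0 => r /andP[sr rt]; apply: w0; apply/andP; split; arith.
Qed.

Lemma expR_weight_reverse (x y : R) :
  expR (2 * x) * - (expR (- 2 * x) - expR (- 2 * y)) = expR (2 * (x - y)) - 1.
Proof.
have e1 : expR (2 * x) * expR (- 2 * x) = 1 by rewrite mulNr expRN divff// gt_eqF// expR_gt0.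
have e2 : expR (2 * x) * expR (- 2 * y) = expR (2 * (x - y)).
  by rewrite -expRD; congr expR; ring.
by rewrite mulrN mulrBr e1 e2 opprB.
Qed.

Section exponential_weight.
Variables (a b : R) (w : R -> R).
Hypotheses (ab : a <= b) (iw : itg a b w) (w0 : forall r, a <= r <= b -> 0 <= w r).
Let A t := Int a t w.

Lemma itg_expR_weight c : itg a b (fun r => w r * expR (c * A r)).
Proof.
apply: (@itgM _ _ _ _ (expR (`|c| * A b)) iw).
  apply: (@measurableT_comp _ _ _ _ _ _ expR); first exact: measurable_expR.
  apply: measurable_funM; first exact: measurable_cst.
  exact: measurable_Int.
move=> r /andP[ar rb]; rewrite (ger0_norm (expR_ge0 _)) ler_expR.
apply: le_trans (ler_norm _) _; rewrite normrM ler_wpM2l//.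
rewrite ger0_norm; first exact: (Int_nonneg_le w0).
by apply: Int_ge0 => q /andP[? ?]; apply: w0; apply/andP; split; arith.
Qed.

(** The chain rule for [exp (c A)], where the primitive [A] of [w] need not be differentiable. It
    goes through [FTC_local] with [A] itself as clock. *)
Lemma Int_expR_weight c s t : a <= s -> s <= t -> t <= b ->
  c * Int s t (fun r => w r * expR (c * A r)) = expR (c * A t) - expR (c * A s).
Proof.
move=> as_ st tb; rewrite -IntZ; last exact: itgS (itg_expR_weight c).
apply/esym; apply: (@FTC_local (fun t => expR (c * A t)) _ A) => //.
  by apply: itgZ; exact: itgS (itg_expR_weight c).
move=> e r e0 /andP[sr rt].
(* Linearising the exponential and freezing it under the integral each cost [k * |c|] times the
   increment of [A], hence at most half of [e] times that increment. *)
pose k := e / (2 * (`|c| + 1)).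
have c1 : 0 < `|c| + 1 by rewrite ltr_wpDl.
have k0 : 0 < k by rewrite divr_gt0// mulr_gt0.
have [d1 d10 H1] : exists2 d : R, 0 < d & forall y, `|y - c * A r| < d -> `|expR y - expR (c * A r)| <= k.
  have /cvgrPdist_le /(_ k k0) := @continuous_expR R (c * A r).
  move=> [d /= d0 H]; exists d => // y yd; rewrite distrC; apply: H => /=.
  by rewrite distrC.
have [||d d0 H2] := @Int_small a b w iw w0 r (d1 / (2 * (`|c| + 1))).
- by apply/andP; split; arith.
- by rewrite divr_gt0// mulr_gt0.
have AE p q : a <= p -> p <= q -> q <= b -> A q = A p + Int p q w.
  by move=> ap pq qb; rewrite /A (@Int_split a p q)//; exact: itgS iw.
have Anear p : s <= p <= t -> r - d < p -> p < r + d -> `|c * A p - c * A r| < d1.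
  move=> /andP[sp pt] rp pr; rewrite -mulrBr normrM.
  have : `|A p - A r| <= d1 / (2 * (`|c| + 1)).
    case: (leP p r) => pr'.
      rewrite (AE p r)//; [|arith..].
      rewrite opprD addrA subrr sub0r normrN ger0_norm; first by apply: H2; arith.
      by apply: Int_ge0 => q /andP[? ?]; apply: w0; apply/andP; split; arith.
    rewrite (AE r p)//; [|arith..].
    rewrite addrAC subrr add0r ger0_norm; first by apply: H2; arith.
    by apply: Int_ge0 => q /andP[? ?]; apply: w0; apply/andP; split; arith.
  move=> h; apply: (@le_lt_trans _ _ ((`|c| + 1) * (d1 / (2 * (`|c| + 1))))).
    by apply: ler_pM => //; arith.
  have -> : (`|c| + 1) * (d1 / (2 * (`|c| + 1))) = d1 / 2 by field; rewrite gt_eqF.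
  by arith.
exists d => // p q sp pq qt rp qr.
have ap : a <= p := le_trans as_ sp.
have qb : q <= b := le_trans qt tb.
have Apq : A q - A p = Int p q w by rewrite (AE p q)// addrAC subrr add0r.
have Apq0 : 0 <= A q - A p.
  by rewrite Apq; apply: Int_ge0 => x /andP[? ?]; apply: w0; apply/andP; split; arith.
have h1 : `|expR (c * A q) - expR (c * A p) - expR (c * A r) * (c * A q - c * A p)|
    <= k * `|c * A q - c * A p|.
  apply: expR_increment_lin => u /andP[]; rewrite ge_min le_max => u1 u2.
  apply: H1.
  have pt' : s <= p <= t by rewrite sp (le_trans pq).
  have qt' : s <= q <= t by rewrite qt (le_trans sp).
  have pr' : p < r + d by exact: le_lt_trans qr.
  have rq' : r - d < q by exact: lt_le_trans pq.
  by apply: (between_dist (Anear p pt' rp pr') (Anear q qt' rq' qr)).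
have h2 : `|Int p q (fun r0 => c * (w r0 * expR (c * A r0))) - Int p q (fun r0 => c * expR (c * A r) * w r0)|
   <= Int p q (fun r0 => (`|c| * k) * w r0).
  have i1 : itg p q (fun r0 => c * (w r0 * expR (c * A r0))).
    by apply: itgZ; apply: itgS (itg_expR_weight c).
  have i2 k' : itg p q (fun r0 => k' * w r0) by apply: itgZ; apply: itgS iw.
  rewrite -IntB//; apply: Int_norm; [exact: itgB|exact: i2|].
  move=> x /andP[px xq].
  have xab : a <= x <= b by rewrite (le_trans as_) ?(le_trans sp)//= (le_trans xq) ?(le_trans qt).
  have -> : c * (w x * expR (c * A x)) - c * expR (c * A r) * w x =
      c * w x * (expR (c * A x) - expR (c * A r)) by rewrite mulrBr mulrA [c * _ * w x]mulrAC.
  rewrite !normrM (ger0_norm (w0 xab)).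
  rewrite [X in _ <= X]mulrAC; apply: ler_wpM2l.
    by rewrite mulr_ge0// w0.
  apply: H1; apply: Anear; first by rewrite (le_trans sp)//= (le_trans xq).
    exact: lt_le_trans px.
  exact: le_lt_trans qr.
have iw' := itgS ap qb iw; have iew := itgS ap qb (itg_expR_weight c).
move: h2; rewrite !IntZ//.
rewrite -Apq => h2; rewrite -mulrBr normrM (ger0_norm Apq0) in h1.
have kc : k * (`|c| + 1) = e / 2 by rewrite /k invfM; field; rewrite gt_eqF.
set E1 := expR (c * A q) in h1 *; set E2 := expR (c * A p) in h1 *.
rewrite (_ : _ - _ - _ = (E1 - E2 - expR (c * A r) * (c * (A q - A p))) -
  (c * Int p q (fun r0 => w r0 * expR (c * A r0)) - c * expR (c * A r) * (A q - A p))); last by ring.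
rewrite mulrBr in h1.
apply: le_trans (ler_normB _ _) _.
rewrite mulrBr; apply: le_trans (lerD h1 h2) _.
have : k * `|c| * (A q - A p) <= e / 2 * (A q - A p).
  by apply: ler_wpM2r => //; rewrite -kc ler_wpM2l ?ltW//; arith.
arith.
Qed.

(** For the supremum [sup S] of [u exp (- 2 A)], the integral inequality and the fact that
    [2 w exp (2 A)] integrates to [exp (2 A) - 1] give [sup S <= k + sup S / 2], so [sup S <= 2 k].
    The exponent 2 produces the factor 1/2, and the bound [M] makes the supremum finite; [u] need
    only be measurable. *)
Lemma gronwall (u : R -> R) (k M : R) : 0 <= k -> measurable_fun `[a, b] u ->
  (forall t, a <= t <= b -> 0 <= u t <= M) ->
  (forall t, a <= t <= b -> u t <= k + Int a t (fun r => w r * u r)) ->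
  forall t, a <= t <= b -> u t <= 2 * k * expR (2 * A t).
Proof.
move=> k0 mu uM H.
have A0 t : a <= t <= b -> 0 <= A t.
  by move=> /andP[? ?]; apply: Int_ge0 => q /andP[? ?]; apply: w0; apply/andP; split; arith.
pose S := [set u t * expR (- (2 * A t)) | t in `[a, b]].
have uM' t : a <= t <= b -> u t * expR (- (2 * A t)) <= M.
  move=> tab; have /andP[u0 u1] := uM _ tab; apply: le_trans u1.
  by rewrite ler_piMr// -[leRHS]expR0 ler_expR; have := A0 _ tab; arith.
have hS : has_sup S.
  split; first by exists (u a * expR (- (2 * A a))); exists a => //=; rewrite in_itv/= lexx.
  by exists M => _ [t /= + <-]; rewrite in_itv/=; exact: uM'.
have uS t : a <= t <= b -> u t <= sup S * expR (2 * A t).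
  move=> tab; rewrite -ler_pdivrMr ?expR_gt0// -expRN.
  by apply: ub_le_sup; [case: hS|exists t => //=; rewrite in_itv].
have S0 : 0 <= sup S.
  have aab : a <= a <= b by rewrite lexx.
  have : 0 <= sup S * expR (2 * A a).
    by apply: le_trans (uS _ aab); have /andP[] := uM _ aab.
  by rewrite pmulr_lge0// expR_gt0.
have key t : a <= t <= b -> u t <= k + sup S * (expR (2 * A t) - 1) / 2.
  move=> tab; have /andP[at_ tb] := tab.
  apply: le_trans (H _ tab) _; rewrite lerD2l.
  have mS : itg a b (fun r => w r * u r).
    by apply: (itgM iw mu (k := M)) => r /uM/andP[? ?]; rewrite ger0_norm.
  have e2 : 2 * Int a t (fun r => w r * expR (2 * A r)) = expR (2 * A t) - 1.
    by rewrite Int_expR_weight// /A Int_pt mulr0 expR0.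
  rewrite -e2 (_ : _ / 2 = sup S * Int a t (fun r => w r * expR (2 * A r))); last by field.
  rewrite -IntZ; last by apply: itgS (itg_expR_weight 2).
  apply: Int_le; [exact: itgS mS| |].
    by apply: itgZ; apply: itgS (itg_expR_weight 2).
  move=> r /andP[ar rt]; rewrite mulrCA; apply: ler_wpM2l.
    by apply: w0; apply/andP; split; arith.
  by apply: uS; apply/andP; split; arith.
have S2 : sup S <= k + sup S / 2.
  apply: ge_sup; first by case: hS.
  move=> _ [t /= + <-]; rewrite in_itv/= => tab.
  have E0 := expR_gt0 (2 * A t).
  rewrite expRN ler_pdivrMr//; apply: le_trans (key _ tab) _.
  have E1 : 1 <= expR (2 * A t) by rewrite -[leLHS]expR0 ler_expR; have := A0 _ tab; arith.
  by nra.
move=> t tab; apply: le_trans (uS _ tab) _.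
by apply: ler_wpM2r; [exact: expR_ge0|arith].
Qed.

(** The same argument with the weight [exp (2 (A b - A t))], run from [b] downwards. It bounds the
    start of a trajectory by its end. *)
Lemma gronwall_backward (u : R -> R) (k M : R) : 0 <= k -> measurable_fun `[a, b] u ->
  (forall t, a <= t <= b -> 0 <= u t <= M) ->
  (forall t, a <= t <= b -> u t <= k + Int t b (fun r => w r * u r)) ->
  forall t, a <= t <= b -> u t <= 2 * k * expR (2 * (A b - A t)).
Proof.
move=> k0 mu uM H.
have A0 t : a <= t <= b -> 0 <= A b - A t.
  by move=> /andP[? ?]; rewrite subr_ge0; exact: (Int_nonneg_le w0).
pose S := [set u t * expR (- (2 * (A b - A t))) | t in `[a, b]].
have uM' t : a <= t <= b -> u t * expR (- (2 * (A b - A t))) <= M.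
  move=> tab; have /andP[u0 u1] := uM _ tab; apply: le_trans u1.
  by rewrite ler_piMr// -[leRHS]expR0 ler_expR; have := A0 _ tab; arith.
have hS : has_sup S.
  split; first by exists (u a * expR (- (2 * (A b - A a)))); exists a => //=; rewrite in_itv/= lexx.
  by exists M => _ [t /= + <-]; rewrite in_itv/=; exact: uM'.
have uS t : a <= t <= b -> u t <= sup S * expR (2 * (A b - A t)).
  move=> tab; rewrite -ler_pdivrMr ?expR_gt0// -expRN.
  by apply: ub_le_sup; [case: hS|exists t => //=; rewrite in_itv].
have S0 : 0 <= sup S.
  have aab : a <= a <= b by rewrite lexx.
  have : 0 <= sup S * expR (2 * (A b - A a)).
    by apply: le_trans (uS _ aab); have /andP[] := uM _ aab.
  by rewrite pmulr_lge0// expR_gt0.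
have key t : a <= t <= b -> u t <= k + sup S * (expR (2 * (A b - A t)) - 1) / 2.
  move=> tab; have /andP[at_ tb] := tab.
  apply: le_trans (H _ tab) _; rewrite lerD2l.
  have mS : itg a b (fun r => w r * u r).
    by apply: (itgM iw mu (k := M)) => r /uM/andP[? ?]; rewrite ger0_norm.
  have e2 : 2 * (expR (2 * A b) * Int t b (fun r => w r * expR (- 2 * A r))) =
      expR (2 * (A b - A t)) - 1.
    rewrite mulrCA -[X in _ * X]opprK -mulNr Int_expR_weight//.
    exact: expR_weight_reverse.
  rewrite -e2 (_ : _ / 2 = sup S * expR (2 * A b) * Int t b (fun r => w r * expR (- 2 * A r))); last by field.
  rewrite -IntZ; last by apply: itgS (itg_expR_weight (- 2)).
  apply: Int_le; [exact: itgS mS| |].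
    by apply: itgZ; apply: itgS (itg_expR_weight (- 2)).
  move=> r /andP[ar rt]; rewrite mulrCA; apply: ler_wpM2l.
    by apply: w0; apply/andP; split; arith.
  rewrite -mulrA -expRD (_ : _ + _ = 2 * (A b - A r)); last by ring.
  by apply: uS; apply/andP; split; arith.
have S2 : sup S <= k + sup S / 2.
  apply: ge_sup; first by case: hS.
  move=> _ [t /= + <-]; rewrite in_itv/= => tab.
  have E0 := expR_gt0 (2 * (A b - A t)).
  rewrite expRN ler_pdivrMr//; apply: le_trans (key _ tab) _.
  have E1 : 1 <= expR (2 * (A b - A t)) by rewrite -[leLHS]expR0 ler_expR; have := A0 _ tab; arith.
  by nra.
move=> t tab; apply: le_trans (uS _ tab) _.
by apply: ler_wpM2r; [exact: expR_ge0|arith].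
Qed.

End exponential_weight.

End integrals_on_intervals.

(** * Caratheodory differential equations *)

Section sup_norm.
Context {R : realType}.

Lemma mx_norm_bigmax m n (A : 'M[R]_(m, n)) :
  `|A| = \big[Num.max/0]_ij `|A ij.1 ij.2|.
Proof. exact: mx_normrE. Qed.

Lemma mx_norm_le m n (A : 'M[R]_(m, n)) (k : R) : 0 <= k ->
  (forall i j, `|A i j| <= k) -> `|A| <= k.
Proof.
move=> k0 Ak; rewrite mx_norm_bigmax; apply: bigmax_le => // -[i j] _ /=; exact: Ak.
Qed.

Lemma le_mx_norm m n (A : 'M[R]_(m, n)) i j : `|A i j| <= `|A|.
Proof.
by rewrite mx_norm_bigmax; apply: (le_bigmax _ (fun ij => `|A ij.1 ij.2|) (i, j)).
Qed.

Lemma cV_norm_le n (x : 'cV[R]_n) (k : R) : 0 <= k -> (forall i, `|x i 0| <= k) -> `|x| <= k.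
Proof. by move=> k0 xk; apply: mx_norm_le => // i j; rewrite ord1. Qed.

Lemma measurable_ext d d' (T : measurableType d) (T' : measurableType d') (D : set T)
  (f g : T -> T') : f =1 g -> measurable_fun D f -> measurable_fun D g.
Proof. by move=> /funext ->. Qed.

Lemma measurable_norm_cV d (T : measurableType d) n (D : set T) (X : T -> 'cV[R]_n) :
  (forall i, measurable_fun D (fun t => X t i 0)) -> measurable_fun D (fun t => `|X t|).
Proof.
move=> mX; apply: (measurable_ext (f := fun t => \big[Num.max/0]_ij `|X t ij.1 ij.2|)).
  by move=> t; rewrite mx_norm_bigmax.
elim: (index_enum _) => [|[i j] s ih].
  by apply: (measurable_ext (f := fun=> (0 : R))) => [t|]; [rewrite big_nil|exact: measurable_cst].
apply: (measurable_ext (f := (fun t => `|X t i 0|) \max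
   (fun t => \big[Num.max/0]_(ij <- s) `|X t ij.1 ij.2|))).
  by move=> t; rewrite big_cons/= (ord1 j).
by apply: measurable_maxr => //; apply: measurableT_comp => //; exact: mX.
Qed.

Lemma measurable_coordB d (T : measurableType d) n (D : set T) (X Y : T -> 'cV[R]_n) :
  (forall i, measurable_fun D (fun t => X t i 0)) ->
  (forall i, measurable_fun D (fun t => Y t i 0)) ->
  forall i, measurable_fun D (fun t => (X t - Y t) i 0).
Proof.
move=> mX mY i; apply: (measurable_ext (f := fun t => X t i 0 - Y t i 0)).
  by move=> t; rewrite !mxE.
exact: measurable_funB.
Qed.

Lemma half_power (M E p : R) : p != 0 -> M * E / (2 * p) = M / p * (E / 2).
Proof. by move=> p0; field. Qed.

(** Adding and subtracting the tail [2 C / 2 ^ k] of the geometric series turns [u] into a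
    nonincreasing sequence [a] above a nondecreasing sequence [b]; the limit comes with its rate. *)
Lemma geometric_limit (u : nat -> R) (C : R) : (forall k, `|u k.+1 - u k| <= C / 2 ^+ k) ->
  exists l, forall k, `|u k - l| <= 2 * C / 2 ^+ k.
Proof.
move=> uC.
have e2 k : 2 * C / 2 ^+ k.+1 = C / 2 ^+ k.
  have k0 : (2 : R) ^+ k != 0 by rewrite expf_neq0.
  by rewrite exprS; field.
pose a k := u k + 2 * C / 2 ^+ k; pose b k := u k - 2 * C / 2 ^+ k.
have C0 : 0 <= C by have := le_trans (normr_ge0 _) (uC 0); rewrite expr0 divr1.
have Ck k : 0 <= C / 2 ^+ k by rewrite divr_ge0// exprn_ge0.
have aS k n : a (k + n)%N <= a k.
  elim: n => [|n ih]; first by rewrite addn0.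
  apply: le_trans ih; rewrite addnS /a e2.
  by have := uC (k + n)%N; rewrite ler_norml => /andP[_]; set v := C / _; rewrite -mulrA -/v; lra.
have bS k n : b k <= b (k + n)%N.
  elim: n => [|n ih]; first by rewrite addn0.
  apply: le_trans ih _; rewrite addnS /b e2.
  by have := uC (k + n)%N; rewrite ler_norml => /andP[+ _]; set v := C / _; rewrite -mulrA -/v; lra.
have ba k n : b k <= a n.
  apply: le_trans (bS k n) _; apply: le_trans (aS n k).
  rewrite addnC /a /b; set v := 2 * C / _.
  have v0 : 0 <= v by rewrite /v -mulrA mulr_ge0.
  lra.
have hs : has_sup (range b) by split; [exists (b 0%N); exists 0%N|exists (a 0%N) => _ [k _ <-]].
exists (sup (range b)) => k.
have h1 : b k <= sup (range b) by apply: ub_le_sup; [case: hs|exists k].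
have h2 : sup (range b) <= a k by apply: ge_sup; [case: hs|move=> _ [n _ <-]].
by rewrite ler_norml; apply/andP; move: h1 h2; rewrite /a /b; set v := 2 * C / _; split; lra.
Qed.

Lemma geometric_cvg (u : nat -> R) (C l : R) : (forall k, `|u k - l| <= C / 2 ^+ k) ->
  u @ \oo --> l.
Proof.
move=> uC.
have v0 : (fun k => C / 2 ^+ k) @ \oo --> (0 : R).
  have -> : (fun k => C / 2 ^+ k) = geometric C (2^-1 : R).
    by apply/funext => k; rewrite /geometric/= exprVn.
  by apply: cvg_geometric; rewrite ger0_norm ?invr_ge0// invf_lt1// ltr1n.
apply/cvgrPdist_le => e e0; move/cvgrPdist_le : v0 => /(_ e e0); apply: filterS => k.
rewrite sub0r normrN distrC => h; apply: le_trans (uC k) (le_trans (ler_norm _) h).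
Qed.

End sup_norm.

Section caratheodory_ode.
Context {R : realType} {n : nat}.
Notation V := 'cV[R]_n.
Implicit Types (F : R -> V -> V) (x y : V) (X Y : R -> V).

Definition VInt (a b : R) (G : R -> V) : V := \col_i Int a b (fun r => G r i 0).

Lemma VInt_norm (a b : R) (G : R -> V) (w : R -> R) : a <= b -> (forall i, measurable_fun `[a, b] (fun r => G r i 0)) ->
  itg a b w -> (forall r, a <= r <= b -> `|G r| <= w r) -> `|VInt a b G| <= Int a b w.
Proof.
move=> ab mG iw Gw.
have G1 i r : a <= r <= b -> `|G r i 0| <= w r.
  by move=> /Gw; apply: le_trans; exact: le_mx_norm.
apply: cV_norm_le => [|i].
  by apply: Int_ge0 => r /Gw; exact: le_trans.
by rewrite mxE; apply: Int_norm => //; [exact: itg_dom (mG i) iw (G1 i) | exact: G1].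
Qed.

(** One integrable weight bounds both the Lipschitz constant and the growth. Measurability is asked
    of superpositions with measurable curves, which is what the integral equation involves. *)
Record caratheodory (a b : R) F (w : R -> R) : Prop := Caratheodory {
  car_itg : itg a b w;
  car_w0 : forall r, a <= r <= b -> 0 <= w r;
  car_lip : forall r x y, a <= r <= b -> `|F r x - F r y| <= w r * `|x - y|;
  car_growth : forall r x, a <= r <= b -> `|F r x| <= w r * (1 + `|x|);
  car_measurable : forall s t X, a <= s -> s <= t -> t <= b ->
    (forall i, measurable_fun `[s, t] (fun r => X r i 0)) ->
    forall i, measurable_fun `[s, t] (fun r => F r (X r) i 0) }.

(** The equation in integral form. The bound on [X] keeps the integrand dominated by a multiple of
    the weight and makes Gronwall's inequality applicable. *)
Definition solution (a b : R) F x X : Prop :=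
  [/\ forall i, measurable_fun `[a, b] (fun r => X r i 0),
      exists M : R, forall t, a <= t <= b -> `|X t| <= M &
      forall t, a <= t <= b -> X t = x + VInt a t (fun r => F r (X r))].

Lemma caratheodoryS a b s t F w : a <= s -> t <= b ->
  caratheodory a b F w -> caratheodory s t F w.
Proof.
move=> as_ tb [h1 h2 h3 h4 h5].
have le_in r : s <= r <= t -> a <= r <= b.
  by move=> /andP[sr rt]; rewrite (le_trans as_)//= (le_trans rt).
split; first exact: itgS h1.
- by move=> r /le_in; exact: h2.
- by move=> r x y /le_in; exact: h3.
- by move=> r x /le_in; exact: h4.
- by move=> p q X sp pq qt; apply: h5 => //; [exact: le_trans sp|exact: le_trans tb].
Qed.

Section one_field.
Variables (a b : R) (F : R -> V -> V) (w : R -> R).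
Hypotheses (ab : a <= b) (cF : caratheodory a b F w).
Let iw := car_itg cF.
Let w0 := car_w0 cF.
Let A t := Int a t w.
Let K := expR (2 * A b).

Let A_ge0 t : a <= t <= b -> 0 <= A t.
Proof.
by move=> /andP[at_ tb]; apply: Int_ge0 => r /andP[ar rt]; rewrite w0// ar (le_trans rt).
Qed.

Let A_le t : a <= t <= b -> A t <= A b.
Proof. by move=> /andP[at_ tb]; exact: (Int_nonneg_le w0). Qed.

Let expA_le t : a <= t <= b -> expR (2 * A t) <= K.
Proof. by move=> tab; rewrite ler_expR ler_wpM2l// A_le. Qed.

Lemma measurable_prefix t (g : R -> R) : t <= b -> measurable_fun `[a, b] g ->
  measurable_fun `[a, t] g.
Proof.
move=> tb; apply: measurable_funS => // r /=; rewrite !in_itv/= => /andP[-> rt].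
exact: le_trans tb.
Qed.

Lemma itg_field_coord s t X M i : a <= s -> s <= t -> t <= b ->
  (forall i, measurable_fun `[s, t] (fun r => X r i 0)) ->
  (forall r, s <= r <= t -> `|X r| <= M) -> itg s t (fun r => F r (X r) i 0).
Proof.
move=> as_ st tb mX XM; apply: (@itg_dom _ _ _ _ (fun r => (1 + M) * w r)).
- exact: (car_measurable cF).
- by apply: itgZ; exact: itgS iw.
- move=> r /[dup] /XM XrM /andP[sr rt].
  have rab : a <= r <= b by rewrite (le_trans as_)//= (le_trans rt).
  apply: le_trans (le_mx_norm _ _ _) _; apply: le_trans (car_growth cF _ rab) _.
  by rewrite mulrC ler_wpM2r ?w0// lerD2l.
Qed.

Lemma VIntB_field t X Y : a <= t <= b -> (forall i, measurable_fun `[a, t] (fun r => X r i 0)) ->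
  (forall i, measurable_fun `[a, t] (fun r => Y r i 0)) ->
  (exists M : R, forall r, a <= r <= t -> `|X r| <= M) ->
  (exists M : R, forall r, a <= r <= t -> `|Y r| <= M) ->
  `|VInt a t (fun r => F r (X r)) - VInt a t (fun r => F r (Y r))| <=
  Int a t (fun r => w r * `|X r - Y r|).
Proof.
move=> /andP[at_ tb] mX mY [M XM] [N YN].
have -> : VInt a t (fun r => F r (X r)) - VInt a t (fun r => F r (Y r)) =
    VInt a t (fun r => F r (X r) - F r (Y r)).
  apply/colP => i; rewrite !mxE -IntB; last 2 first.
    by apply: (@itg_field_coord _ _ _ M).
    by apply: (@itg_field_coord _ _ _ N).
  by apply: Int_eq => r _; rewrite !mxE.
have mF (Z : R -> V) : (forall i, measurable_fun `[a, t] (fun r => Z r i 0)) ->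
    forall i, measurable_fun `[a, t] (fun r => F r (Z r) i 0) by exact: (car_measurable cF).
apply: VInt_norm => //.
- exact: measurable_coordB (mF X mX) (mF Y mY).
- apply: (@itgM _ _ _ _ _ (M + N)).
  + exact: itgS iw.
  + by apply: (measurable_norm_cV (X := fun r => X r - Y r)); exact: measurable_coordB.
  + by move=> r art; rewrite normr_id (le_trans (ler_normB _ _))// lerD ?XM ?YN.
- by move=> r /andP[ar rt]; apply: (car_lip cF); rewrite ar (le_trans rt).
Qed.

(** Picard iteration, converging on the whole interval at once: measured against [exp (2 A t)], each
    step contracts by the factor 1/2, because [w exp (2 A)] integrates to at most
    [exp (2 A) / 2]. *)
Lemma solution_exists x : exists X, solution a b F x X.
Proof.
pose X := fix X k := if k is k'.+1 then fun t => x + VInt a t (fun r => F r (X k' r))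
  else fun=> x.
have mbX k : (forall i, measurable_fun `[a, b] (fun r => X k r i 0)) /\
    exists M : R, forall t, a <= t <= b -> `|X k t| <= M.
  elim: k => [|k [mk [M kM]]] /=; first by split=> //; exists `|x|.
  split.
    move=> i; apply: (measurable_ext (f := fun t => x i 0 + Int a t (fun r => F r (X k r) i 0))).
      by move=> t; rewrite !mxE.
    by apply: measurable_funD => //; apply: measurable_Int; exact: (@itg_field_coord _ _ _ M).
  exists (`|x| + Int a b (fun r => (1 + M) * w r)) => t /andP[at_ tb].
  apply: le_trans (ler_normD _ _) _; rewrite lerD2l.
  have M0 : 0 <= M by apply: le_trans (kM a _); rewrite ?lexx.
  apply: (@le_trans _ _ (Int a t (fun r => (1 + M) * w r))).
    apply: VInt_norm => //.
    - by apply: (car_measurable cF) => // i; exact: measurable_prefix.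
    - by apply: itgZ; exact: itgS iw.
    - move=> r /andP[ar rt]; have rab : a <= r <= b by rewrite ar (le_trans rt).
      apply: le_trans (car_growth cF _ rab) _.
      by rewrite mulrC ler_wpM2r ?w0// lerD2l kM.
  apply: (@Int_nonneg_le _ a b) => //; last exact: itgZ.
  by move=> r rab; rewrite mulr_ge0// ?w0// addr_ge0.
(* Bounds the first increment [X 1 - X 0], where the field is evaluated at the constant [x]. *)
pose M := A b * (1 + `|x|).
have step k t : a <= t <= b -> `|X k.+1 t - X k t| <= M * expR (2 * A t) / 2 ^+ k.
  elim: k t => [|k ih] t /andP[at_ tb].
    rewrite expr0 divr1 /= [x + _]addrC addrK.
    have At0 : 0 <= A t by rewrite A_ge0// at_.
    apply: (@le_trans _ _ (Int a t (fun r => (1 + `|x|) * w r))).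
      apply: VInt_norm => //.
      - exact: (car_measurable cF).
      - by apply: itgZ; exact: itgS iw.
      - move=> r /andP[ar rt]; rewrite mulrC; apply: (car_growth cF).
        by rewrite ar (le_trans rt).
    rewrite IntZ; last exact: itgS iw.
    rewrite mulrC -[leLHS]mulr1; apply: ler_pM => //; first by rewrite mulr_ge0// addr_ge0.
      by rewrite /M ler_wpM2r ?addr_ge0// A_le// at_.
    by rewrite -[leLHS]expR0 ler_expR mulr_ge0.
  have le_t r : a <= r <= t -> a <= r <= b.
    by move=> /andP[-> rt]; rewrite (le_trans rt).
  have -> : X k.+2 t - X k.+1 t =
      VInt a t (fun r => F r (X k.+1 r)) - VInt a t (fun r => F r (X k r)).
    by rewrite [X k.+2]/= [in X in _ - X]/= opprD addrACA subrr add0r.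
  have [mk [Mk hk]] := mbX k; have [mk1 [Mk1 hk1]] := mbX k.+1.
  apply: (le_trans (VIntB_field _ _ _ _ _)); first by rewrite at_.
  - by move=> i; exact: measurable_prefix.
  - by move=> i; exact: measurable_prefix.
  - by exists Mk1 => r /le_t; exact: hk1.
  - by exists Mk => r /le_t; exact: hk.
  pose c := M / 2 ^+ k.
  have c0 : 0 <= c by rewrite divr_ge0 ?exprn_ge0// mulr_ge0// ?addr_ge0// A_ge0// ab lexx.
  have ie : itg a t (fun r => w r * expR (2 * A r)).
    by apply: itgS (itg_expR_weight iw w0 2).
  apply: (@le_trans _ _ (Int a t (fun r => c * (w r * expR (2 * A r))))).
    apply: Int_le; [|exact: itgZ|].
      apply: (@itgM _ _ _ _ _ (Mk1 + Mk)); first exact: itgS iw.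
        apply: (measurable_norm_cV (X := fun r => X k.+1 r - X k r)).
        by apply: measurable_coordB => i; exact: measurable_prefix.
      move=> r /le_t rab; rewrite normr_id.
      by apply: le_trans (ler_normB _ _) _; apply: lerD; [exact: hk1|exact: hk].
    move=> r /le_t rab; rewrite mulrCA ler_wpM2l ?w0//.
    by rewrite /c mulrAC; exact: ih.
  rewrite IntZ//.
  have e2 := @Int_expR_weight _ a b w iw w0 2 a t (lexx a) at_ tb.
  rewrite [Int a a w]Int_pt mulr0 expR0 in e2.
  have -> : M * expR (2 * A t) / 2 ^+ k.+1 = c * (expR (2 * A t) / 2).
    by rewrite /c exprS half_power// expf_neq0.
  apply: ler_wpM2l => //.
  by rewrite ler_pdivlMr// mulrC e2; lra.
have MK0 : 0 <= M * K by rewrite mulr_ge0 ?expR_ge0// mulr_ge0// ?addr_ge0// A_ge0// ab lexx.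
have stepK t k i : a <= t <= b -> `|X k.+1 t i 0 - X k t i 0| <= M * K / 2 ^+ k.
  move=> tab; have := le_mx_norm (X k.+1 t - X k t) i 0; rewrite !mxE => /le_trans; apply.
  apply: le_trans (step k t tab) _; rewrite ler_wpM2r ?invr_ge0 ?exprn_ge0// ler_wpM2l ?expA_le//.
  by rewrite mulr_ge0// ?addr_ge0// A_ge0// ab lexx.
(* Limits are chosen for all pairs of a time and a coordinate at once; outside [a, b] nothing is
   required and the value is 0. *)
have /choice[Z ZP] : forall p : R * 'I_n, exists l, a <= p.1 <= b ->
    forall k, `|X k p.1 p.2 0 - l| <= 2 * (M * K) / 2 ^+ k.
  move=> [t i]; have [tab|ntab] := boolP (a <= t <= b); last by exists 0.
  have [l lP] := geometric_limit (fun k => stepK t k i tab).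
  by exists l.
pose Xl t := \col_i Z (t, i).
have XlP t k : a <= t <= b -> `|X k t - Xl t| <= 2 * (M * K) / 2 ^+ k.
  move=> tab; apply: cV_norm_le => [|i]; first by rewrite divr_ge0 ?exprn_ge0// mulr_ge0.
  rewrite mxE [(- Xl t) _ _]mxE [Xl t _ _]mxE; exact: (ZP (t, i) tab k).
have mXl i : measurable_fun `[a, b] (fun t => Xl t i 0).
  apply: (@measurable_fun_cvg _ _ _ _ (fun k t => X k t i 0)).
    by move=> k; case: (mbX k).
  move=> t /=; rewrite in_itv/= => tab.
  apply: (@geometric_cvg _ _ (2 * (M * K))) => k; rewrite mxE; exact: (ZP (t, i)).
have bXl t : a <= t <= b -> `|Xl t| <= `|x| + 2 * (M * K).
  move=> tab; have := XlP t 0%N tab; rewrite expr0 divr1 /= distrC => h.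
  by rewrite -[Xl t](subrK x) addrC; apply: le_trans (ler_normD _ _) _; rewrite lerD2l.
exists Xl; split => //; first by exists (`|x| + 2 * (M * K)).
move=> t /andP[at_ tb]; apply/eqP; rewrite -subr_eq0 -normr_le0.
have tab : a <= t <= b by rewrite at_.
have le_t r : a <= r <= t -> a <= r <= b by move=> /andP[-> rt]; rewrite (le_trans rt).
have MK2 : 0 <= 2 * (M * K) by rewrite mulr_ge0.
(* The residual of the equation is at most the distance from [Xl] to an iterate, plus such a
   distance multiplied by the total weight [A b]. *)
pose C := 2 * (M * K) * (1 + A b).
have bound k : `|Xl t - (x + VInt a t (fun r => F r (Xl r)))| <= C / 2 ^+ k.
  rewrite -(subrK (X k.+1 t) (Xl t)) -addrA.
  apply: le_trans (ler_normD _ _) _; rewrite distrC.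
  have -> : X k.+1 t - (x + VInt a t (fun r => F r (Xl r))) =
      VInt a t (fun r => F r (X k r)) - VInt a t (fun r => F r (Xl r)).
    by rewrite [X k.+1]/= opprD addrACA subrr add0r.
  have [mk [Mk hk]] := mbX k.
  have h1 : `|X k.+1 t - Xl t| <= 2 * (M * K) / 2 ^+ k.
    apply: le_trans (XlP t k.+1 tab) _; rewrite ler_wpM2l//.
    by rewrite lef_pV2 ?posrE ?exprn_gt0// ler_eXn2l// ltr1n.
  have h2 : Int a t (fun r => w r * `|X k r - Xl r|) <= A b * (2 * (M * K) / 2 ^+ k).
    apply: (@le_trans _ _ (Int a t (fun r => (2 * (M * K) / 2 ^+ k) * w r))).
      apply: Int_le; [|by apply: itgZ; exact: itgS iw|].
        apply: (@itgM _ _ _ _ _ (2 * (M * K) / 2 ^+ k)); first exact: itgS iw.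
          apply: (measurable_norm_cV (X := fun r => X k r - Xl r)).
          by apply: measurable_coordB => i; exact: measurable_prefix.
        by move=> r /le_t rab; rewrite normr_id; exact: XlP.
      by move=> r /le_t rab; rewrite mulrC ler_wpM2r ?w0//; exact: XlP.
    rewrite IntZ; last exact: itgS iw.
    rewrite mulrC; apply: ler_wpM2r; last exact: A_le.
    by rewrite divr_ge0// exprn_ge0.
  rewrite /C mulrDr mulr1 mulrDl; apply: lerD => //.
  apply: le_trans (VIntB_field tab _ _ _ _) _.
  - by move=> i; exact: measurable_prefix.
  - by move=> i; exact: measurable_prefix.
  - by exists Mk => r /le_t; exact: hk.
  - by exists (`|x| + 2 * (M * K)) => r /le_t; exact: bXl.
  by apply: le_trans h2 _; rewrite mulrC mulrAC.
have := @geometric_cvg R (fun=> `|Xl t - (x + VInt a t (fun r => F r (Xl r)))|) C 0.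
have C0 : 0 <= C by have := le_trans (normr_ge0 _) (bound 0%N); rewrite expr0 divr1.
move=> /(_ _)/(cvg_lim (@Rhausdorff R)) <-; last by move=> k; rewrite subr0 normr_id.
by rewrite lim_cst.
Qed.

Lemma solution_Int_norm s t x X M : solution a b F x X -> a <= s -> s <= t -> t <= b ->
  (forall r, s <= r <= t -> `|X r| <= M) -> `|X t - X s| <= (1 + M) * Int s t w.
Proof.
move=> [mX [N XN] eX] as_ st tb XM.
have sb := le_trans st tb; have at_ := le_trans as_ st.
have le_in r : s <= r <= t -> a <= r <= b.
  by move=> /andP[sr rt]; rewrite (le_trans as_)//= (le_trans rt).
have mXs i : measurable_fun `[s, t] (fun r => X r i 0).
  apply: measurable_funS (mX i) => // r /=; rewrite !in_itv/=; exact: le_in.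
have -> : X t - X s = VInt s t (fun r => F r (X r)).
  rewrite (eX t) ?at_// (eX s) ?as_// opprD addrACA subrr add0r.
  apply/colP => i; rewrite !mxE (@Int_split _ a s t)//; first by rewrite addrAC subrr add0r.
  apply: (@itg_field_coord _ _ _ N) => //.
    by move=> j; exact: measurable_prefix.
  by move=> r /andP[ar rt]; apply: XN; rewrite ar (le_trans rt).
rewrite -IntZ; last exact: itgS iw.
apply: VInt_norm => //.
- exact: (car_measurable cF).
- by apply: itgZ; exact: itgS iw.
- move=> r /[dup] /XM XrM /le_in rab; apply: le_trans (car_growth cF _ rab) _.
  by rewrite mulrC ler_wpM2r ?w0// lerD2l.
Qed.

Lemma solution_start x X : solution a b F x X -> X a = x.
Proof.
move=> [_ _ ->]; last by rewrite lexx.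
by apply/colP => i; rewrite !mxE Int_pt addr0.
Qed.

(** Gronwall for [1 + |X|], the quantity in which the growth condition is linear without constant
    term. *)
Lemma solution_bound x X : solution a b F x X ->
  forall t, a <= t <= b -> 1 + `|X t| <= 2 * (1 + `|x|) * K.
Proof.
move=> [mX [N XN] eX] t tab.
have N0 : 0 <= N by apply: le_trans (XN t tab).
apply: (@le_trans _ _ (2 * (1 + `|x|) * expR (2 * A t))); last first.
  by rewrite ler_wpM2l ?expA_le// mulr_ge0// addr_ge0.
apply: (@gronwall _ a b w ab iw w0 (fun r => 1 + `|X r|) _ (1 + N)) => //.
- by apply: measurable_funD => //; exact: measurable_norm_cV.
- by move=> r rab; rewrite addr_ge0//= lerD2l XN.
- move=> r /andP[ar rb]; rewrite -addrA lerD2l [X in `|X|]eX ?ar//.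
  apply: le_trans (ler_normD _ _) _; rewrite lerD2l; apply: VInt_norm => //.
  + by apply: (car_measurable cF) => // i; exact: measurable_prefix.
  + apply: (@itgM _ _ _ _ _ (1 + N)); first exact: itgS iw.
      by apply: measurable_funD => //; apply: measurable_norm_cV => i; exact: measurable_prefix.
    move=> q /andP[aq qr]; rewrite ger0_norm ?addr_ge0// lerD2l XN// aq.
    exact: le_trans rb.
  + by move=> q /andP[aq qr]; apply: (car_growth cF); rewrite aq (le_trans qr).
Qed.

(** Backward Gronwall: a trajectory that ends in a ball starts in a larger one. This keeps the
    support of a function bounded when the function is pulled back by the flow. *)
Lemma solution_start_bound x X : solution a b F x X -> 1 + `|x| <= 2 * (1 + `|X b|) * K.
Proof.
move=> sX; have := sX; move=> [mX [N XN] eX].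
have aab : a <= a <= b by rewrite lexx.
have N0 : 0 <= N by apply: le_trans (XN a aab).
have -> : K = expR (2 * (A b - A a)) by rewrite /K /A Int_pt subr0.
rewrite -(solution_start sX).
apply: (@gronwall_backward _ a b w ab iw w0 (fun r => 1 + `|X r|) _ (1 + N)) => //.
- by apply: measurable_funD => //; exact: measurable_norm_cV.
- by move=> r rab; rewrite addr_ge0//= lerD2l XN.
- move=> r /andP[ar rb]; rewrite -addrA lerD2l.
  have le_in q : r <= q <= b -> a <= q <= b by move=> /andP[rq ->]; rewrite (le_trans ar).
  have mXr i : measurable_fun `[r, b] (fun r => X r i 0).
    by apply: measurable_funS (mX i) => // q /=; rewrite !in_itv/=; exact: le_in.
  have -> : X r = X b - VInt r b (fun r => F r (X r)).
    rewrite (eX b) ?ab ?lexx// (eX r) ?ar// -addrA; congr (_ + _).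
    apply/colP => i; rewrite !mxE (@Int_split _ a r b)//; first by rewrite addrK.
    exact: (@itg_field_coord _ _ _ N).
  apply: le_trans (ler_normB _ _) _; rewrite lerD2l; apply: VInt_norm => //.
  + exact: (car_measurable cF).
  + apply: (@itgM _ _ _ _ _ (1 + N)); first exact: itgS iw.
      by apply: measurable_funD => //; exact: measurable_norm_cV.
    by move=> q /le_in qab; rewrite ger0_norm ?addr_ge0// lerD2l XN.
  + by move=> q /le_in qab; apply: (car_growth cF).
Qed.

Lemma solution_lipschitz x y X Y : solution a b F x X -> solution a b F y Y ->
  forall t, a <= t <= b -> `|X t - Y t| <= 2 * K * `|x - y|.
Proof.
move=> [mX [M XM] eX] [mY [N YN] eY] t tab.
apply: (@le_trans _ _ (2 * `|x - y| * expR (2 * A t))); last first.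
  by rewrite mulrAC ler_wpM2r// ler_wpM2l// expA_le.
have mXY := measurable_coordB mX mY.
apply: (@gronwall _ a b w ab iw w0 (fun r => `|X r - Y r|) _ (M + N)) => //.
- exact: measurable_norm_cV.
- move=> r rab; rewrite normr_ge0/=; apply: le_trans (ler_normB _ _) _.
  by rewrite lerD ?XM ?YN.
- move=> r /[dup] rab /andP[ar rb]; rewrite [X in `|X - _|]eX// [X in `|_ - X|]eY//.
  rewrite opprD addrACA; apply: le_trans (ler_normD _ _) _; rewrite lerD2l.
  have le_r q : a <= q <= r -> a <= q <= b by move=> /andP[-> qr]; rewrite (le_trans qr).
  apply: VIntB_field => //.
  + by move=> i; exact: measurable_prefix.
  + by move=> i; exact: measurable_prefix.
  + by exists M => q /le_r; exact: XM.
  + by exists N => q /le_r; exact: YN.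
Qed.

Lemma solution_restart x X t : a <= t <= b -> solution a b F x X -> solution t b F (X t) X.
Proof.
move=> /andP[at_ tb] [mX [M XM] eX].
have le_in q : t <= q <= b -> a <= q <= b by move=> /andP[tq ->]; rewrite (le_trans at_).
split.
- by move=> i; apply: measurable_funS (mX i) => // q /=; rewrite !in_itv/=; exact: le_in.
- by exists M => q /le_in; exact: XM.
- move=> r /[dup] /le_in rab /andP[tr rb]; rewrite (eX r)// (eX t) ?at_// -addrA; congr (_ + _).
  apply/colP => i; rewrite !mxE (@Int_split _ a t r)//.
  apply: (@itg_field_coord _ _ _ M) => //; first by case/andP: rab.
    by move=> j; exact: measurable_prefix.
  by move=> q /andP[aq qr]; apply: XM; rewrite aq (le_trans qr).
Qed.

End one_field.
End caratheodory_ode.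

(** * Mollification *)

Section integrals_of_continuous_functions.
Context {R : realType}.
Implicit Types (a b c : R) (f g : R -> R).

Lemma itg_continuous a b f : continuous f -> itg a b f.
Proof.
move=> cf; apply: continuous_compact_integrable; first exact: segment_compact.
exact: continuous_subspaceT.
Qed.

Lemma Int_shift a b c g : a <= b -> continuous g ->
  Int a b (fun s => g (s + c)) = Int (a + c) (b + c) g.
Proof.
move=> ab cg; rewrite Int.unlock; congr fine.
have dF x : is_derive x (1 : R) (fun s : R => s + c) 1.
  by apply: is_derive_eq; rewrite addr0.
have F'E : derive1 (fun s : R => s + c) = cst 1.
  by apply/funext => x; rewrite derive1E; apply: derive_val.
rewrite (@integration_by_substitution_increasing _ (fun s => s + c) g a b ab).
- by apply: eq_integral => x _; rewrite F'E /= mulr1.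
- by move=> x y _ _; rewrite ltrD2r.
- by rewrite F'E => x _; exact: cst_continuous.
- by rewrite F'E; exact: is_cvg_cst.
- by rewrite F'E; exact: is_cvg_cst.
- have cF : continuous (fun s : R => s + c).
    by move=> x; apply: cvgD; [exact: cvg_id|exact: cvg_cst].
  split=> //.
  + by apply: cvg_at_right_filter; exact: cF.
  + by apply: cvg_at_left_filter; exact: cF.
- exact: continuous_subspaceT.
Qed.

Lemma Int_support a b a' b' f : a' <= a -> a <= b -> b <= b' -> itg a' b' f ->
  (forall s, s <= a -> f s = 0) -> (forall s, b <= s -> f s = 0) ->
  Int a' b' f = Int a b f.
Proof.
move=> aa ab bb fi fa fb.
have ab' := le_trans aa ab.
rewrite (@Int_split _ a' b b' f)// (@Int_split _ a' a b f)//; last exact: itgS fi.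
have z p q : (forall s, p <= s <= q -> f s = 0) -> Int p q f = 0.
  move=> f0; rewrite (@Int_eq _ _ _ _ (fun=> 0))//.
  by rewrite Int.unlock Rintegral_cst// mul0r.
rewrite (z a' a); last by move=> s /andP[_]; exact: fa.
by rewrite (z b b') ?add0r ?addr0// => s /andP[+ _]; exact: fb.
Qed.

End integrals_of_continuous_functions.

(** * Differentiation with quadratic remainders, and smoothness *)

Section quantitative_differentiation.
Context {R : realType} {U : normedModType R}.
Implicit Types (g D : U -> R) (e v z : U).

Definition lip (K : R) g := forall z z', `|g z - g z'| <= K * `|z - z'|.

Definition bounded_by (M : R) g := forall z, `|g z| <= M.

(** [D] is the derivative of [g] along [e], with a quadratic remainder uniform in [z]. Unlike the
    bare existence of a limit, this estimate passes through integrals and linear combinations with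
    explicit constants. *)
Definition qd (C : R) e g D :=
  forall z (t : R), `|g (z + t *: e) - g z - t * D z| <= C * t ^+ 2.

Lemma lip_continuous K g : lip K g -> continuous g.
Proof.
move=> gK z; apply/cvgrPdist_lt => e e0.
near=> z'; apply: le_lt_trans (gK _ _) _.
apply: (@le_lt_trans _ _ ((`|K| + 1) * `|z - z'|)).
  by rewrite ler_wpM2r// (le_trans (ler_norm _))// lerDl.
rewrite mulrC -ltr_pdivlMr ?ltr_wpDl//.
by near: z'; apply: cvgr_dist_lt => //; rewrite divr_gt0// ltr_wpDl.
Unshelve. all: by end_near. Qed.

Lemma taylor_derive C e g d z :
  (forall t, `|g (z + t *: e) - g z - t * d| <= C * t ^+ 2) ->
  derivable g z e /\ 'D_e g z = d.
Proof.
move=> H.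
have lim0 : (fun t => t^-1 *: ((g \o shift z) (t *: e) - g z)) @ (0 : R)^' --> d.
  apply/cvgrPdist_le => ep ep0.
  near=> t.
  have t0 : t != 0 by near: t; exact: nbhs_dnbhs_neq.
  have -> : d - t^-1 *: ((g \o shift z) (t *: e) - g z) =
      - t^-1 * (g (z + t *: e) - g z - t * d).
    rewrite /= [t *: e + z]addrC /GRing.scale/=.
    by move: (g (z + _)) (g z) => x y; field.
  rewrite normrM normrN normfV; apply: (@le_trans _ _ (`|t|^-1 * (C * t ^+ 2))).
    by rewrite ler_wpM2l ?invr_ge0.
  have -> : `|t|^-1 * (C * t ^+ 2) = C * `|t|.
    have nt0 : `|t| != 0 by rewrite normr_eq0.
    by rewrite -[t ^+ 2]real_normK ?num_real//; field.
  apply: (@le_trans _ _ ((`|C| + 1) * `|t|)).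
    by rewrite ler_wpM2r// (le_trans (ler_norm _))// lerDl.
  rewrite mulrC -ler_pdivlMr ?ltr_wpDl//.
  by near: t; apply: dnbhs0_le; rewrite divr_gt0// ltr_wpDl.
split; first by apply/cvg_ex; exists d.
exact/cvg_lim.
Unshelve. all: by end_near. Qed.

Lemma qd_derive C e g D z : qd C e g D -> derivable g z e /\ 'D_e g z = D z.
Proof. by move=> H; exact: (taylor_derive (H z)). Qed.

Lemma lipZ K g k : lip K g -> lip (`|k| * K) (fun z => k * g z).
Proof. by move=> gK z z'; rewrite -mulrBr normrM -mulrA ler_wpM2l. Qed.

Lemma lipD K K' g g' : lip K g -> lip K' g' -> lip (K + K') (fun z => g z + g' z).
Proof.
move=> gK gK' z z'; rewrite opprD addrACA mulrDl.
by apply: le_trans (ler_normD _ _) _; exact: lerD.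
Qed.

Lemma qdZ C e g D k : qd C e g D -> qd (`|k| * C) e (fun z => k * g z) (fun z => k * D z).
Proof.
move=> H z t; rewrite [t * _]mulrCA -!mulrBr normrM -mulrA ler_wpM2l//.
Qed.

Lemma qdD C C' e g g' D D' : qd C e g D -> qd C' e g' D' ->
  qd (C + C') e (fun z => g z + g' z) (fun z => D z + D' z).
Proof.
move=> H H' z t; rewrite mulrDr mulrDl.
have -> : g (z + t *: e) + g' (z + t *: e) - (g z + g' z) - (t * D z + t * D' z) =
  (g (z + t *: e) - g z - t * D z) + (g' (z + t *: e) - g' z - t * D' z) by ring.
by apply: le_trans (ler_normD _ _) _; exact: lerD.
Qed.

(* First-order expansion along several directions, one direction at a time. *)
Lemma qd_combination (C L : R) (I : Type) (s : seq I) (c : I -> R) (e : I -> U)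
    (g : U -> R) (D : I -> U -> R) : 0 <= C -> 0 <= L -> (forall i, `|e i| <= 1) ->
  (forall i, qd C (e i) g (D i)) -> (forall i, lip L (D i)) ->
  forall z, `|g (z + \sum_(i <- s) c i *: e i) - g z - \sum_(i <- s) c i * D i z| <=
    (C + L) * (\sum_(i <- s) `|c i|) ^+ 2.
Proof.
move=> C0 L0 e1 qg lD z; elim: s => [|i s ih].
  by rewrite !big_nil addr0 !subrr normr0 expr0n mulr0.
rewrite !big_cons; set v := \sum_(j <- s) c j *: e j in ih *.
set S := \sum_(j <- s) `|c j| in ih *; set P := \sum_(j <- s) c j * D j z in ih *.
have vS : `|v| <= S.
  apply: le_trans (ler_norm_sum _ _ _) _; apply: ler_sum => j _.
  by rewrite normrZ ler_piMr.
have -> : z + (c i *: e i + v) = z + v + c i *: e i by rewrite addrA addrAC.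
have h1 := qg i (z + v) (c i).
have h2 : `|c i * (D i (z + v) - D i z)| <= `|c i| * (L * S).
  rewrite normrM ler_wpM2l//; apply: le_trans (lD i _ _) _.
  by rewrite addrAC subrr add0r ler_wpM2l.
set g1 := g (z + v + c i *: e i) in h1 *; set g2 := g (z + v) in h1 ih *.
have -> : g1 - g z - (c i * D i z + P) = (g1 - g2 - c i * D i (z + v)) +
   c i * (D i (z + v) - D i z) + (g2 - g z - P) by ring.
apply: le_trans (ler_normD _ _) _; apply: le_trans (lerD (ler_normD _ _) (lexx _)) _.
apply: le_trans (lerD (lerD h1 h2) ih) _.
have S0 : 0 <= S by apply: sumr_ge0 => j _.
have c2 : c i ^+ 2 = `|c i| ^+ 2 by rewrite real_normK ?num_real.
rewrite c2; move: (`|c i|) (normr_ge0 (c i)) => k k0 {h1 h2 ih}.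
have : 0 <= C * k * S by rewrite !mulr_ge0.
have : 0 <= L * k * S by rewrite !mulr_ge0.
have : 0 <= L * k ^+ 2 by rewrite !mulr_ge0// exprn_ge0.
rewrite !expr2; nra.
Qed.

Section smooth_class.
Variables (I : finType) (e : I -> U) (Cl : set (U -> R)).
Hypothesis e1 : forall i, `|e i| <= 1.
Hypothesis e_span : forall v, exists c : I -> R, v = \sum_i c i *: e i.
Hypothesis Cl_lip : forall g, Cl g -> exists K, lip K g.
Hypothesis Cl_qd : forall g i, Cl g -> exists D, exists C, Cl D /\ qd C (e i) g D.

(** The span is needed because [smooth] differentiates along every vector: a derivative along [v] is
    a combination of derivatives along the [e i], and such a combination need not lie in [Cl]. *)
Let lin (g : U -> R) := exists s : seq (R * (U -> R)),
  (forall p, p \in s -> Cl p.2) /\ g = fun z => \sum_(p <- s) p.1 * p.2 z.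

Let lin_lip g : lin g -> exists K, lip K g.
Proof.
move=> [s [sC ->]]; elim: s sC => [|p s ih] sC.
  by exists 0 => z z'; rewrite !big_nil subrr normr0 mul0r.
have [|K HK] := ih; first by move=> q qs; apply: sC; rewrite in_cons qs orbT.
have [|K' HK'] := @Cl_lip p.2; first by apply: sC; rewrite mem_head.
exists (`|p.1| * K' + K) => z z'; rewrite !big_cons.
exact: (lipD (lipZ p.1 HK') HK).
Qed.

Let lin_add g g' : lin g -> lin g' -> lin (fun z => g z + g' z).
Proof.
move=> [s [sC ->]] [s' [sC' ->]]; exists (s ++ s'); split.
  by move=> p; rewrite mem_cat => /orP[/sC|/sC'].
by apply/funext => z; rewrite big_cat.
Qed.

Let lin_scale g k : lin g -> lin (fun z => k * g z).
Proof.
move=> [s [sC ->]]; exists [seq (k * p.1, p.2) | p <- s]; split.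
  by move=> p /mapP[q qs ->]; exact: sC qs.
by apply/funext => z; rewrite big_map mulr_sumr; apply: eq_bigr => p _; rewrite mulrA.
Qed.

Let Cl_lin g : Cl g -> lin g.
Proof.
move=> Cg; exists [:: (1, g)]; split; first by move=> p; rewrite inE => /eqP ->.
by apply/funext => z; rewrite big_seq1 mul1r.
Qed.

Let lin_qd g v : lin g -> exists D C, lin D /\ qd C v g D.
Proof.
suff Cl_case h : Cl h -> exists D C, lin D /\ qd C v h D.
  move=> [s [sC ->]]; elim: s sC => [|p s ih] sC.
    exists (fun=> 0), 0; split; first by exists [::]; split=> //; apply/funext => z; rewrite big_nil.
    by move=> z t; rewrite !big_nil mulr0 !subrr normr0 mul0r.
  have [|D [C [lD qD]]] := ih; first by move=> q qs; apply: sC; rewrite in_cons qs orbT.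
  have [|D' [C' [lD' qD']]] := Cl_case p.2; first by apply: sC; rewrite mem_head.
  exists (fun z => p.1 * D' z + D z), (`|p.1| * C' + C); split.
    by apply: lin_add => //; exact: lin_scale.
  by move=> z t; rewrite !big_cons; exact: (qdD (qdZ p.1 qD') qD).
move=> Ch; have [c ->] := e_span v.
have /choice[F FP] : forall i, exists D : (U -> R) * R, Cl D.1 /\ qd D.2 (e i) h D.1.
  by move=> i; have [D [C H]] := @Cl_qd h i Ch; exists (D, C).
have /choice[K KP] : forall i, exists K, lip K (F i).1.
  by move=> i; apply: Cl_lip; case: (FP i).
pose C0 := \sum_i `|(F i).2|; pose L0 := \sum_i `|K i|.
exists (fun z => \sum_i c i * (F i).1 z), ((C0 + L0) * (\sum_i `|c i|) ^+ 2); split.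
  elim: (index_enum I) => [|i s ih].
    by exists [::]; split=> //; apply/funext => z; rewrite !big_nil.
  have -> : (fun z => \sum_(j <- i :: s) c j * (F j).1 z) =
      fun z => c i * (F i).1 z + \sum_(j <- s) c j * (F j).1 z.
    by apply/funext => z; rewrite big_cons.
  by apply: lin_add => //; apply: lin_scale; apply: Cl_lin; case: (FP i).
have le_tot (G : I -> R) i : G i <= \sum_j `|G j|.
  rewrite (bigD1 i)//=; apply: le_trans (ler_norm _) _; rewrite lerDl.
  by apply: sumr_ge0.
move=> z t; have := @qd_combination C0 L0 I (index_enum I) (fun i => t * c i) e h (fun i => (F i).1).
move=> /(_ _ _ e1 _ _ z).
have -> : \sum_i (t * c i) *: e i = t *: \sum_i c i *: e i.
  by rewrite scaler_sumr; apply: eq_bigr => i _; rewrite scalerA.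
have -> : \sum_i t * c i * (F i).1 z = t * \sum_i c i * (F i).1 z.
  by rewrite mulr_sumr; apply: eq_bigr => i _; rewrite mulrA.
have -> : \sum_i `|t * c i| = `|t| * \sum_i `|c i|.
  by rewrite mulr_sumr; apply: eq_bigr => i _; rewrite normrM.
rewrite exprMn real_normK ?num_real// [t ^+ 2 * _]mulrC mulrA; apply.
- exact: sumr_ge0.
- exact: sumr_ge0.
- move=> i y u; have [_ /(_ y u) H] := FP i; apply: le_trans H _.
  by rewrite ler_wpM2r ?sqr_ge0// le_tot.
- move=> i y y'; apply: le_trans (KP i y y') _.
  by rewrite ler_wpM2r// le_tot.
Qed.

(** Induction on the order of differentiation: the span is stable under all directional derivatives,
    and its members are Lipschitz, hence continuous. *)
Lemma smooth_of_class g : Cl g -> smooth g.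
Proof.
move=> /Cl_lin lg k; elim: k g lg => [|k ih] g lg; have [K gK] := lin_lip lg.
  by split=> //; exact: lip_continuous gK.
split; first exact: lip_continuous gK.
move=> v; have [D [C [lD qD]]] := lin_qd v lg.
split; first by move=> z; case: (qd_derive z qD).
suff -> : 'D_v g = D by exact: ih.
by apply/funext => z; case: (qd_derive z qD).
Qed.

End smooth_class.

End quantitative_differentiation.

(** * Convolutions along lines *)

Section convolution.
Context {R : realType} {U : normedModType R}.
Implicit Types (g h D : U -> R) (e v z : U) (a : R -> R).

(** The interval [-1, 1] contains the support of the kernels used, with room for a shift by at most
    1/2. *)
Definition conv e a g z : R := Int (- 1) 1 (fun s => a s * g (z - s *: e)).

Let m11 : (- 1 : R) <= 1. Proof. by rewrite lerN10 || arith. Qed.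

Let Int_cst11 (k : R) : Int (- 1) 1 (fun=> k) = 2 * k.
Proof. by rewrite Int_cst// mulrC; congr (_ * _); ring. Qed.

Let line_continuous g e z : continuous g -> continuous (fun s : R => g (z - s *: e)).
Proof.
move=> cg s; apply: (@cvg_comp _ _ _ (fun s : R => z - s *: e) g _ (nbhs (z - s *: e))).
  by apply: cvgB; [exact: cvg_cst|apply: cvgZr_tmp; exact: cvg_id].
exact: cg.
Qed.

Lemma conv_continuous_integrand a g e z : continuous a -> continuous g ->
  continuous (fun s => a s * g (z - s *: e)).
Proof. by move=> ca cg s; apply: cvgM; [exact: ca|exact: line_continuous]. Qed.

Lemma conv_itg a g e z : continuous a -> continuous g ->
  itg (- 1) 1 (fun s => a s * g (z - s *: e)).
Proof. by move=> ca cg; apply/itg_continuous/conv_continuous_integrand. Qed.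

Lemma conv_dist a g h e z z' (A c : R) : continuous a -> continuous g -> continuous h ->
  (forall s, `|a s| <= A) -> (forall s, `|g (z - s *: e) - h (z' - s *: e)| <= c) ->
  `|conv e a g z - conv e a h z'| <= 2 * A * c.
Proof.
move=> ca cg ch aA gh; rewrite /conv -IntB; [|exact: conv_itg..].
rewrite -mulrA -Int_cst11; apply: Int_norm.
- by apply: itgB; exact: conv_itg.
- exact: itg_cst.
- by move=> s _; rewrite -mulrBr normrM ler_pM.
Qed.

Lemma conv_lip a g e (A K : R) : continuous a -> (forall s, `|a s| <= A) -> lip K g ->
  lip (2 * A * K) (conv e a g).
Proof.
move=> ca aA gK z z'; rewrite -[2 * A * K * _]mulrA.
apply: conv_dist => //; try exact: lip_continuous gK.
by move=> s; apply: le_trans (gK _ _) _; rewrite opprB addrA subrK.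
Qed.

Lemma conv0 a e : conv e a (fun=> 0) = fun=> 0.
Proof.
apply/funext => z; rewrite /conv (@Int_eq _ _ _ _ (fun=> 0)) ?Int_cst11 ?mulr0//.
by move=> s _; rewrite mulr0.
Qed.

Lemma conv_bound a g e (A M : R) : continuous a -> continuous g -> (forall s, `|a s| <= A) ->
  bounded_by M g -> bounded_by (2 * A * M) (conv e a g).
Proof.
move=> ca cg aA gM z.
rewrite -[conv e a g z]subr0 -[X in _ - X](congr1 (@^~ z) (conv0 a e)).
apply: conv_dist => // [|s]; first exact: cst_continuous.
by rewrite subr0; exact: gM.
Qed.

Lemma convB a g h e z : continuous a -> continuous g -> continuous h ->
  conv e a (fun z => g z - h z) z = conv e a g z - conv e a h z.
Proof.
move=> ca cg ch; rewrite /conv -IntB; [|exact: conv_itg..].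
by apply: Int_eq => s _; rewrite mulrBr.
Qed.

Lemma conv_qd a g D e e' (A C : R) : continuous a -> continuous g -> continuous D ->
  (forall s, `|a s| <= A) -> qd C e' g D -> qd (2 * A * C) e' (conv e a g) (conv e a D).
Proof.
move=> ca cg cD aA H z t; rewrite /conv -IntZ; last exact: conv_itg.
rewrite -!IntB; first last; [exact: conv_itg|exact: conv_itg| |..].
- by apply: itgZ; exact: conv_itg.
- by apply: itgB; exact: conv_itg.
rewrite -[2 * A * C * _]mulrA -[2 * A * _]mulrA -Int_cst11; apply: Int_norm.
- by apply: itgB; [apply: itgB; exact: conv_itg|apply: itgZ; exact: conv_itg].
- exact: itg_cst.
- move=> s _; rewrite [t * _]mulrCA -!mulrBr normrM ler_pM//.
  by have := H (z - s *: e) t; rewrite [z - _ + _]addrAC.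
Qed.

(** The derivative falls on the kernel, so [g] need only be continuous and bounded. For [|t| <= 1/2]
    a change of variable moves the shift from [g] to [a]; for larger [t] the three terms are bounded
    separately, with [1 <= 4 t ^ 2] and [|t| <= 2 t ^ 2], which accounts for the constants 16 and
    4. *)
Lemma conv_qd_kernel a a' g e (A A' C M eta : R) : continuous a -> continuous a' -> continuous g ->
  (forall s, `|a s| <= A) -> (forall s, `|a' s| <= A') ->
  (forall s t, `|a (s + t) - a s - t * a' s| <= C * t ^+ 2) -> eta <= 1 / 2 ->
  (forall s, eta <= `|s| -> a s = 0) -> bounded_by M g ->
  qd ((2 * C + 16 * A + 4 * A') * M) e (conv e a g) (conv e a' g).
Proof.
move=> ca ca' cg aA aA' aC eta1 a0 gM z t.
have A0 : 0 <= A := le_trans (normr_ge0 _) (aA 0).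
have A'0 : 0 <= A' := le_trans (normr_ge0 _) (aA' 0).
have M0 : 0 <= M := le_trans (normr_ge0 _) (gM 0).
have C0 : 0 <= C by have := le_trans (normr_ge0 _) (aC 0 1); rewrite expr1n mulr1.
have b1 := conv_bound e ca cg aA gM (z + t *: e).
have b2 := conv_bound e ca cg aA gM z.
have b3 := conv_bound e ca' cg aA' gM z.
have t2 : 0 <= t ^+ 2 by exact: sqr_ge0.
have [t1|t1] := leP `|t| (1 / 2); last first.
  have tt : `|t| <= 2 * t ^+ 2.
    by rewrite -[t ^+ 2]real_normK ?num_real// expr2; nra.
  have t4 : 1 <= 4 * t ^+ 2.
    by rewrite -[t ^+ 2]real_normK ?num_real// expr2; nra.
  apply: le_trans (ler_normB _ _) _; apply: le_trans (lerD (ler_normB _ _) (lexx _)) _.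
  rewrite normrM.
  have h3 : `|t| * `|conv e a' g z| <= 2 * t ^+ 2 * (2 * A' * M) by apply: ler_pM.
  apply: le_trans (lerD (lerD b1 b2) h3) _.
  have : 2 * A * M <= 4 * t ^+ 2 * (2 * A * M).
    by rewrite -[leLHS]mul1r; apply: ler_wpM2r => //; rewrite mulr_ge0// mulr_ge0.
  have : 0 <= C * M * t ^+ 2 by apply: mulr_ge0 => //; exact: mulr_ge0.
  arith.
have cat : continuous (fun u => a (u + t)).
  move=> u; apply: (@cvg_comp _ _ _ (fun u : R => u + t) a _ (nbhs (u + t))); last exact: ca.
  by apply: cvgD; [exact: cvg_id|exact: cvg_cst].
have ch := @conv_continuous_integrand (fun u => a (u + t)) g e z cat cg.
have shiftE : conv e a g (z + t *: e) = Int (- 1) 1 (fun s => a (s + t) * g (z - s *: e)).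
  move: t1; rewrite ler_norml => /andP[t1 t1'].
  rewrite /conv (@Int_eq _ _ _ _ (fun s => (fun u => a (u + t) * g (z - u *: e)) (s + - t))); last first.
    move=> s _ /=; rewrite subrK; congr (_ * g _).
    by rewrite scalerBl opprB addrAC -addrA [- _ + _]addrC.
  rewrite (Int_shift (- t) m11 ch).
  (* The shifted interval and [-1, 1] both contain the support of the integrand, thanks to
     [eta <= 1/2] and [|t| <= 1/2]; the two integrals are compared through [-2, 2]. *)
  rewrite -(@Int_support _ (- 1 - t) (1 - t) (- 2) 2); first last.
  - by move=> s hs; rewrite a0 ?mul0r// ger0_norm; arith.
  - by move=> s hs; rewrite a0 ?mul0r// ler0_norm; arith.
  - exact: itg_continuous.
  - arith.
  - arith.
  - arith.
  apply: Int_support => //; try arith.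
  - exact: itg_continuous.
  - by move=> s hs; rewrite a0 ?mul0r// ler0_norm; arith.
  - by move=> s hs; rewrite a0 ?mul0r// ger0_norm; arith.
rewrite shiftE {1}/conv -IntB; [|exact: itg_continuous|exact: conv_itg].
rewrite /conv -IntZ; last exact: conv_itg.
rewrite -IntB; first last.
- by apply: itgZ; exact: conv_itg.
- by apply: itgB; [exact: itg_continuous|exact: conv_itg].
apply: (@le_trans _ _ (2 * (C * t ^+ 2 * M))).
  rewrite -Int_cst11; apply: Int_norm.
  - apply: itgB; last by apply: itgZ; exact: conv_itg.
    by apply: itgB; [exact: itg_continuous|exact: conv_itg].
  - exact: itg_cst.
  - move=> s _; rewrite [t * (_ * _)]mulrA -!mulrBl normrM ler_pM//; exact: aC.
have : 0 <= (16 * A + 4 * A') * M * t ^+ 2 by rewrite mulr_ge0// mulr_ge0// addr_ge0// mulr_ge0.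
arith.
Qed.

(** An average of values of [g] taken within [eta], as [a] is nonnegative with mass 1. *)
Lemma conv_local a g e z (r c eta : R) : continuous a -> continuous g -> `|e| <= 1 ->
  (forall s, 0 <= a s) -> Int (- 1) 1 a = 1 -> (forall s, eta <= `|s| -> a s = 0) ->
  (forall z', `|z' - z| <= r + eta -> `|g z'| <= c) ->
  forall z', `|z' - z| <= r -> `|conv e a g z'| <= c.
Proof.
move=> ca cg e1 a_ge0 a1 a0 gc z' z'r.
rewrite -[c]mulr1 -a1 -IntZ; last exact: itg_continuous.
apply: Int_norm; [exact: conv_itg|by apply: itgZ; exact: itg_continuous|].
move=> s _; rewrite normrM (ger0_norm (a_ge0 s)) mulrC.
have [es|se] := leP eta `|s|; first by rewrite a0// !mulr0.
apply: ler_wpM2r => //; apply: gc; rewrite addrAC.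
apply: le_trans (ler_normB _ _) _; apply: lerD => //.
by rewrite normrZ (le_trans _ (ltW se))// ler_piMr.
Qed.

Lemma conv_zero a g e z (r eta : R) : `|e| <= 1 -> (forall s, eta <= `|s| -> a s = 0) ->
  (forall z', `|z' - z| <= r + eta -> g z' = 0) ->
  forall z', `|z' - z| <= r -> conv e a g z' = 0.
Proof.
move=> e1 a0 gc z' z'r; rewrite /conv (@Int_eq _ _ _ _ (fun=> 0)) ?Int_cst11 ?mulr0//.
move=> s _; have [es|se] := leP eta `|s|; first by rewrite a0// mul0r.
rewrite gc ?mulr0// addrAC.
apply: le_trans (ler_normB _ _) _; apply: lerD => //.
by rewrite normrZ (le_trans _ (ltW se))// ler_piMr.
Qed.

Lemma conv_shift a g e v z : conv e a (fun z => g (z + v)) z = conv e a g (z + v).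
Proof. by apply: Int_eq => s _; rewrite addrAC. Qed.

Lemma conv_cst a e k z : continuous a -> Int (- 1) 1 a = 1 -> conv e a (fun=> k) z = k.
Proof.
move=> ca a1; rewrite /conv (@Int_eq _ _ _ _ (fun s => k * a s)).
  by rewrite IntZ ?a1 ?mulr1//; exact: itg_continuous.
by move=> s _; rewrite mulrC.
Qed.

End convolution.

(** [a k] is the k-th derivative of [a 0], encoded by Taylor remainders to match [qd]. The upper
    bound on [eta] leaves the room for shifts used in [conv_qd_kernel]. *)
Record smoothing_kernel {R : realType} (eta : R) (a : nat -> R -> R) : Prop := Kernel {
  ker_eta : 0 < eta <= 1 / 2;
  ker_bounded : forall k, exists A : R, forall s, `|a k s| <= A;
  ker_lip : forall k, exists L : R, forall s t, `|a k s - a k t| <= L * `|s - t|;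
  ker_taylor : forall k, exists C : R, forall s t,
    `|a k (s + t) - a k s - t * a k.+1 s| <= C * t ^+ 2;
  ker_support : forall k s, eta <= `|s| -> a k s = 0;
  ker_ge0 : forall s, 0 <= a 0%N s;
  ker_mass : Int (- 1) 1 (a 0%N) = 1 }.

Section mollifier.
Context {R : realType} {U : normedModType R}.
Variables (eta : R) (a : nat -> R -> R).
Hypothesis ka : smoothing_kernel eta a.
Implicit Types (g h D : U -> R) (e v z : U) (L : seq (U * nat)).

Let ca k : continuous (a k).
Proof. by have [K H] := ker_lip ka k; exact: (lip_continuous (K := K)). Qed.

(* One-dimensional convolution in each direction [p.1] of [L], with the [p.2]-th
   derivative of the kernel: only integrals over an interval are needed. *)
Definition mollk L g : U -> R := foldr (fun p h => conv p.1 (a p.2) h) g L.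

Definition moll (E : seq U) g := mollk [seq (e, 0%N) | e <- E] g.

(** How one derivative along [e] acts on the list: the order of the kernel convolved in that
    direction goes up by one. *)
Fixpoint bumpk L e := if L is p :: L' then
  if p.1 == e then (p.1, p.2.+1) :: L' else p :: bumpk L' e else [::].

Lemma unzip1_bumpk L e : unzip1 (bumpk L e) = unzip1 L.
Proof. by elim: L => //= -[e' k] L ih /=; case: ifP => //= _; rewrite ih. Qed.

Lemma mollk_lip L : exists2 C : R, 0 <= C & forall g K, lip K g -> lip (C * K) (mollk L g).
Proof.
elim: L => [|p L [C C0 ih]]; first by exists 1 => // g K gK; rewrite mul1r.
have [A aA] := ker_bounded ka p.2; have A0 : 0 <= A := le_trans (normr_ge0 _) (aA 0).
exists (2 * A * C); first by rewrite !mulr_ge0.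
by move=> g K gK; rewrite -mulrA; apply: conv_lip => //; exact: ih.
Qed.

Lemma mollk_continuous L g K : lip K g -> continuous (mollk L g).
Proof. by move=> gK; have [C _ H] := mollk_lip L; exact: lip_continuous (H _ _ gK). Qed.

Lemma mollk_bound L : exists2 C : R, 0 <= C &
  forall g K M, lip K g -> bounded_by M g -> bounded_by (C * M) (mollk L g).
Proof.
elim: L => [|p L [C C0 ih]]; first by exists 1 => // g K M _ gM; rewrite mul1r.
have [A aA] := ker_bounded ka p.2; have A0 : 0 <= A := le_trans (normr_ge0 _) (aA 0).
exists (2 * A * C); first by rewrite !mulr_ge0.
move=> g K M gK gM; rewrite -mulrA; apply: conv_bound => //.
  exact: mollk_continuous gK.
exact: ih gM.
Qed.

(** Only the convolution in the direction [e] is differentiated, through its kernel. Those applied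
    before it merely supply a bounded continuous function, those applied after it preserve the
    remainder estimate. *)
Lemma mollk_qd L e : e \in unzip1 L -> exists2 C : R, 0 <= C &
  forall g K M, lip K g -> bounded_by M g -> qd (C * M) e (mollk L g) (mollk (bumpk L e) g).
Proof.
elim: L => //= -[e' k] L ih; rewrite in_cons /=.
have [A aA] := ker_bounded ka k; have A0 : 0 <= A := le_trans (normr_ge0 _) (aA 0).
have [eE|ne] := eqVneq e' e.
  move=> _; have [C0 C00 Hb] := mollk_bound L.
  have [A' aA'] := ker_bounded ka k.+1; have A'0 : 0 <= A' := le_trans (normr_ge0 _) (aA' 0).
  have [C HC] := ker_taylor ka k.
  have C1 : 0 <= C by have := le_trans (normr_ge0 _) (HC 0 1); rewrite expr1n mulr1.
  exists ((2 * C + 16 * A + 4 * A') * C0); first by rewrite mulr_ge0// !addr_ge0// mulr_ge0.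
  move=> g K M gK gM; rewrite -mulrA -eE /=; apply: (@conv_qd_kernel _ _ (a k) (a k.+1) _ _ A A' C _ eta) => //.
  - exact: mollk_continuous gK.
  - by have /andP[] := ker_eta ka.
  - exact: ker_support.
  - exact: Hb gM.
move=> /= /ih[C C0 H]; exists (2 * A * C); first by rewrite !mulr_ge0.
move=> g K M gK gM /=; rewrite -mulrA; apply: conv_qd => //.
- exact: mollk_continuous gK.
- exact: mollk_continuous gK.
- exact: H gM.
Qed.

Lemma mollkB L g h K K' z : lip K g -> lip K' h ->
  mollk L (fun z => g z - h z) z = mollk L g z - mollk L h z.
Proof.
move=> gK hK; elim: L z => //= p L ih z.
rewrite -convB//; [|exact: mollk_continuous gK|exact: mollk_continuous hK].
by congr conv; apply/funext => z'; exact: ih.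
Qed.

Lemma mollk_shift L g v z : mollk L (fun z => g (z + v)) z = mollk L g (z + v).
Proof.
elim: L z => //= p L ih z; rewrite -conv_shift.
by congr conv; apply/funext => z'; exact: ih.
Qed.

Lemma mollk_zero L g z : (forall e, e \in unzip1 L -> `|e| <= 1) ->
  (forall z', `|z' - z| <= eta *+ size L -> g z' = 0) -> mollk L g z = 0.
Proof.
move=> L1 g0.
(* Generalised to a ball of radius [r]: each one-dimensional convolution consumes [eta], so the
   induction on [L] runs with a growing radius. *)
suff H r : (forall z', `|z' - z| <= r + eta *+ size L -> g z' = 0) ->
    forall z', `|z' - z| <= r -> mollk L g z' = 0.
  by apply: (H 0) => [z'|]; rewrite ?add0r ?subrr ?normr0//; exact: g0.
elim: L L1 r {g0} => [|p L ih] L1 r H.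
  by move=> z' z'r; apply: H; rewrite addr0.
apply: (@conv_zero _ _ _ _ _ _ _ eta).
- by apply: L1; rewrite mem_head.
- exact: ker_support.
apply: ih => [e eL|z' hz']; first by apply: L1; rewrite in_cons eL orbT.
by apply: H; rewrite mulrS addrA.
Qed.

Lemma lip_cst (k : R) : lip 0 (fun _ : U => k).
Proof. by move=> z z'; rewrite subrr normr0 mul0r. Qed.

Lemma moll_cst E k z : moll E (fun=> k) z = k.
Proof.
rewrite /moll; elim: E z => //= e E' ih z.
rewrite -[RHS](@conv_cst _ _ (a 0%N) e k z)//; last exact: ker_mass ka.
by congr conv; apply/funext => z'; exact: ih.
Qed.

Section averaging.
Variable E : seq U.
Hypothesis E1 : forall e, e \in E -> `|e| <= 1.

(** Only the values within the total averaging radius enter. The commutator estimate needs this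
    local form, since its error grows with the distance from the centre. *)
Lemma moll_local g z K c : lip K g ->
  (forall z', `|z' - z| <= eta *+ size E -> `|g z'| <= c) -> `|moll E g z| <= c.
Proof.
move=> gK g0.
suff H r : (forall z', `|z' - z| <= r + eta *+ size E -> `|g z'| <= c) ->
    forall z', `|z' - z| <= r -> `|moll E g z'| <= c.
  by apply: (H 0) => [z'|]; rewrite ?add0r ?subrr ?normr0//; exact: g0.
rewrite /moll; elim: E E1 r {g0} => [|e E' ih] E1' r H.
  by move=> z' z'r; apply: H; rewrite addr0.
apply: (@conv_local _ _ _ _ _ _ _ _ eta) => //.
- exact: mollk_continuous gK.
- by apply: E1'; rewrite mem_head.
- exact: ker_ge0 ka.
- exact: ker_mass ka.
- exact: ker_support.
apply: ih => [e' eL|z' hz']; first by apply: E1'; rewrite in_cons eL orbT.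
by apply: H; rewrite mulrS addrA.
Qed.

Lemma moll_near g K z : 0 <= K -> lip K g ->
  `|moll E g z - g z| <= K * (eta *+ size E).
Proof.
move=> K0 gK.
have -> : moll E g z - g z = moll E (fun z' => g z' - g z) z.
  by rewrite /moll (mollkB _ _ gK (lip_cst _)) -/(moll E (fun=> g z)) moll_cst.
apply: (@moll_local _ _ K) => [|z' hz'].
  by move=> z1 z2; rewrite opprB addrA subrK; exact: gK.
by apply: le_trans (gK _ _) _; exact: ler_wpM2l.
Qed.

End averaging.
End mollifier.

(** * A smooth kernel with compact support *)

Section mean_value_bounds.
Context {R : realType}.
Variables (f df : R -> R).
Hypothesis fdf : forall x : R, is_derive x 1 f (df x).

Let cf : continuous f.
Proof. by move=> x; apply/differentiable_continuous/derivable1_diffP; case: (fdf x). Qed.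

Let mvt x y : exists2 c, Num.min x y <= c <= Num.max x y & f y - f x = df c * (y - x).
Proof.
wlog xy : x y / x <= y.
  move=> H; case: (leP x y) => xy.
    by have := H x y xy; rewrite (min_idPl xy) (max_idPr xy).
  have [c cyx e] := H y x (ltW xy).
  exists c; first by rewrite (min_idPl (ltW xy)) (max_idPr (ltW xy)) in cyx.
  by rewrite -opprB e -mulrN opprB.
have [] := @MVT_segment R f df x y xy (fun z _ => fdf z).
  exact: continuous_subspaceT.
by move=> c; rewrite in_itv/= => cxy e; exists c; rewrite ?(min_idPl xy) ?(max_idPr xy).
Qed.

Lemma derive_bounded_lip K : (forall x, `|df x| <= K) -> forall x y, `|f x - f y| <= K * `|x - y|.
Proof.
by move=> dK x y; have [c _ ->] := mvt y x; rewrite normrM ler_wpM2r.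
Qed.

Lemma derive_lip_taylor K : (forall x y, `|df x - df y| <= K * `|x - y|) ->
  forall s t, `|f (s + t) - f s - t * df s| <= K * t ^+ 2.
Proof.
move=> dK s t; have [c cst ->] := mvt s (s + t).
have cs : `|c - s| <= `|t|.
  move: cst; rewrite ler_norml; case: (leP 0 t) => t0.
    have ts : s <= s + t by lra.
    rewrite (min_idPl ts) (max_idPr ts) (ger0_norm t0) => /andP[? ?]; apply/andP; split; lra.
  have ts : s + t <= s by lra.
  rewrite (min_idPr ts) (max_idPl ts) (ltr0_norm t0) => /andP[? ?]; apply/andP; split; lra.
have K0 : 0 <= K by have := le_trans (normr_ge0 _) (dK 1 0); rewrite subr0 normr1 mulr1.
have -> : df c * (s + t - s) - t * df s = (df c - df s) * t by ring.
rewrite normrM -[t ^+ 2]real_normK ?num_real// expr2 mulrA ler_wpM2r//.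
by apply: le_trans (dK _ _) _; rewrite ler_wpM2l.
Qed.

End mean_value_bounds.

Section bump.
Context {R : realType}.

Lemma is_derive_change (f : R -> R) (x df df' : R) :
  is_derive x 1 f df -> df = df' -> is_derive x 1 f df'.
Proof. by move=> h <-. Qed.

Implicit Types (s u x : R) (p : {poly R}).

Lemma is_derive_horner p x : is_derive x 1 (fun s : R => p.[s]) p^`().[x].
Proof.
elim/poly_ind: p => [|p c ih].
  rewrite deriv0 horner0 [X in is_derive _ _ X](_ : _ = cst 0); first exact: is_derive_cst.
  by apply/funext => s; rewrite horner0.
rewrite [X in is_derive _ _ X](_ : _ = (fun s => p.[s]) * id + cst c); last first.
  by apply/funext => s; rewrite !hornerE.
apply: is_derive_eq.
by rewrite derivD derivM derivX derivC !hornerE /= /GRing.scale/= !mulr1 addrC [x * _]mulrC.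
Qed.

(* The functions [u ^- m * exp (- 1 / u)], extended by [0] to [u <= 0]. *)
Definition flat m u : R := if 0 < u then u^-1 ^+ m * expR (- u^-1) else 0.

Lemma flat_le0 m u : u <= 0 -> flat m u = 0.
Proof. by rewrite /flat ltNge => ->. Qed.

Lemma flat_mul m u : u * flat m.+1 u = flat m u.
Proof.
rewrite /flat; case: ifP => [u0|]; last by rewrite mulr0.
by rewrite exprS !mulrA mulfV ?mul1r// gt_eqF.
Qed.

(** One term of the exponential series, [(1 / u) ^ (m + 2) / (m + 2)! <= exp (1 / u)], gives
    quadratic decay at 0, hence a zero derivative there. *)
Lemma flat_bound m u : `|flat m u| <= ((m.+2)`!)%:R * u ^+ 2.
Proof.
rewrite /flat; case: ifP => [u0|_]; last by rewrite normr0 mulr_ge0// ?ler0n// sqr_ge0.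
have v0 : 0 < u^-1 by rewrite invr_gt0.
rewrite ger0_norm; last by rewrite mulr_ge0// ?exprn_ge0 ?expR_ge0// ltW.
rewrite expRN ler_pdivrMr ?expR_gt0//.
have := expR_ge1Dxn m.+1 (ltW v0).
set E := expR _ => h.
have {h} h : u^-1 ^+ m.+2 <= (m.+2)`!%:R * E.
  rewrite mulrC -ler_pdivrMr ?ltr0n ?fact_gt0//; apply: le_trans h; lra.
have -> : u^-1 ^+ m = u ^+ 2 * u^-1 ^+ m.+2.
  have un : u != 0 by rewrite gt_eqF.
  by rewrite -(addn2 m) exprD mulrCA -exprMn mulfV// expr1n mulr1.
by rewrite [leRHS]mulrAC [leRHS]mulrC ler_wpM2l// sqr_ge0.
Qed.

Lemma is_derive_flat m u : is_derive u 1 (flat m) (flat m.+2 u - m%:R * flat m.+1 u).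
Proof.
have [u0|u0|->] := ltgtP u 0.
- rewrite !flat_le0 ?ltW// mulr0 subr0.
  apply: (@near_eq_is_derive R R R (cst 0)).
  by near=> v; rewrite flat_le0//; apply: ltW; near: v; exact: lt_nbhsl.
- apply: (@near_eq_is_derive R R R ((fun v : R => v^-1 ^+ m) * (fun v : R => expR (- v^-1)))).
    by near=> v; rewrite /flat ifT//; near: v; exact: lt_nbhsr.
  have un : u != 0 by rewrite gt_eqF.
  have dV : is_derive u 1 (fun v : R => v^-1) (- u^-1 ^+ 2).
    apply: DeriveDef; first by apply: derivableV => //; exact: derivable_id.
    by rewrite deriveV ?derive_id /GRing.scale/= ?mulr1 ?exprVn//; exact: derivable_id.
  have dE : is_derive u 1 (fun v : R => expR (- v^-1)) (expR (- u^-1) * u^-1 ^+ 2).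
    apply: (@is_derive1_comp _ expR (fun v : R => - v^-1)).
    by have := is_deriveN dV; rewrite opprK.
  have dX := is_deriveX m dV; rewrite exprfctE in dX.
  have := is_deriveM dX dE.
  move/is_derive_change; apply; rewrite /GRing.scale/=.
  rewrite /flat u0; move: (expR _) => E.
  case: m {dX} => [|m] /=; first by rewrite !expr0 !mul0r !mulr0; ring.
  by rewrite !exprS; ring.
- rewrite !flat_le0// mulr0 subr0.
  have [] := @taylor_derive R R ((m.+2)`!%:R) 1 (flat m) 0 0; last exact: DeriveDef.
  move=> t; rewrite add0r mulr0 subr0 (flat_le0 m (lexx 0)) subr0 [t *: 1]mulr1.
  exact: flat_bound.
Unshelve. all: by end_near. Qed.

Definition bump p m s : R := p.[s] * flat m (1 - s ^+ 2).

(** The identities [flat m u = u ^ 2 flat (m + 2) u] and [flat (m + 1) u = u flat (m + 2) u] bring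
    all terms of the derivative over the common factor [flat (m + 2)]. *)
Definition bump_deriv_poly p m : {poly R} :=
  p^`() * (1 - 'X ^+ 2) ^+ 2 + (2 * m%:R)%:P * 'X * p * (1 - 'X ^+ 2) - 2%:P * 'X * p.

Lemma is_derive_bump p m s : is_derive s 1 (bump p m) (bump (bump_deriv_poly p m) m.+2 s).
Proof.
have dq : is_derive s 1 (fun s : R => 1 - s ^+ 2) (- (2 * s)).
  have := @is_derive_horner (1 - 'X ^+ 2) s.
  rewrite [X in is_derive _ _ X _ -> _](_ : _ = (fun s : R => 1 - s ^+ 2)); last first.
    by apply/funext => x; rewrite !hornerE.
  move/is_derive_change; apply; rewrite derivB derivC derivXn !hornerE /=.
  by congr (- _); ring.
have := is_deriveM (is_derive_horner p s) 
  (@is_derive1_comp _ (flat m) (fun s : R => 1 - s ^+ 2) s _ _ (is_derive_flat m _) dq).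
move/is_derive_change; apply; rewrite /= /GRing.scale/= /bump /bump_deriv_poly !hornerE /=.
rewrite -[flat m (1 - _)]flat_mul -[flat m.+1 (1 - _)]flat_mul.
move: (flat _ _) => E; move: (p.[s]) (p^`().[s]) => x y; ring.
Qed.

Lemma bump_support p m s : 1 <= `|s| -> bump p m s = 0.
Proof.
move=> s1; rewrite /bump flat_le0 ?mulr0// subr_le0.
by rewrite -[s ^+ 2]real_normK ?num_real// expr_ge1.
Qed.

Lemma bump_continuous p m : continuous (bump p m).
Proof.
by move=> x; apply/differentiable_continuous/derivable1_diffP; case: (is_derive_bump p m x).
Qed.

Lemma bump_bounded p m : exists A : R, forall s, `|bump p m s| <= A.
Proof.
have [c _ H] : exists2 c : R, c \in `[(-1), 1] &
    forall t, t \in `[(-1), 1] -> `|bump p m t| <= `|bump p m c|.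
  apply: (@EVT_max R (fun s => `|bump p m s|)); first lra.
  apply: continuous_subspaceT => x; apply: cvg_norm; exact: bump_continuous.
exists `|bump p m c| => s; have [s1|s1] := leP 1 `|s|; first by rewrite bump_support ?normr0.
by apply: H; rewrite in_itv/= -ler_norml ltW.
Qed.

(** The successive derivatives of [exp (- 1 / (1 - s ^ 2))], each a polynomial times a flat
    factor. *)
Fixpoint bump_seq k : {poly R} * nat :=
  if k is k'.+1 then (bump_deriv_poly (bump_seq k').1 (bump_seq k').2, (bump_seq k').2.+2)
  else (1, 0%N).

Lemma smoothing_kernel_exists (eta : R) : 0 < eta <= 1 / 2 -> exists a, smoothing_kernel eta a.
Proof.
move=> /andP[eta0 eta1].
have en : eta != 0 by rewrite gt_eqF.
pose b k := bump (bump_seq k).1 (bump_seq k).2.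
have bS k x : is_derive x 1 (b k) (b k.+1 x) by exact: is_derive_bump.
have bb k : exists A : R, forall s, `|b k s| <= A by exact: bump_bounded.
have bl k : exists L : R, forall s t, `|b k s - b k t| <= L * `|s - t|.
  by have [A HA] := bb k.+1; exists A; exact: derive_bounded_lip.
have bt k : exists C : R, forall s t, `|b k (s + t) - b k s - t * b k.+1 s| <= C * t ^+ 2.
  by have [L HL] := bl k.+1; exists L; exact: derive_lip_taylor.
have b0 s : 0 <= b 0%N s.
  rewrite /b /bump /= hornerC mul1r /flat; case: ifP => // _.
  by rewrite expr0 mul1r expR_ge0.
pose h s := b 0%N (s / eta).
have ch : continuous h.
  move=> s; apply: (@cvg_comp _ _ _ (fun s : R => s / eta) (b 0%N) _ (nbhs (s / eta))).
    by apply: cvgM; [exact: cvg_id|exact: cvg_cst].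
  exact: bump_continuous.
have e2 : - (eta / 2) <= eta / 2 by lra.
(* On the middle half of the support [q ^ 2 <= 1/4], so the bump is at least [exp (- 4/3)]; this
   makes the mass positive and the normalisation possible. *)
have hI : 0 < Int (- 1) 1 h.
  apply: (@lt_le_trans _ _ (Int (- (eta / 2)) (eta / 2) (fun=> expR (- (4 / 3))))).
    by rewrite Int_cst// mulr_gt0 ?expR_gt0//; lra.
  apply: (@le_trans _ _ (Int (- (eta / 2)) (eta / 2) h)).
    apply: Int_le; [exact: itg_cst|exact: itg_continuous|].
    move=> s /andP[s1 s2]; rewrite /h /b /bump /= hornerC mul1r /flat.
    set q := s / eta.
    have q1 : q ^+ 2 <= 1 / 4.
      have : - (1 / 2) <= q <= 1 / 2.
        by rewrite /q ler_pdivlMr// ler_pdivrMr//; apply/andP; split; lra.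
      move=> /andP[? ?]; rewrite expr2; nra.
    have q0 : 0 < 1 - q ^+ 2 by lra.
    rewrite ifT// expr0 mul1r ler_expR lerN2 -[4 / 3]invrK lef_pV2 ?posrE//; last by lra.
  have z (x y : R) : 0 <= Int x y h by apply: Int_ge0 => r _; exact: b0.
  have c1 := @Int_split R (- 1) (- (eta / 2)) 1 h.
  have c2 := @Int_split R (- (eta / 2)) (eta / 2) 1 h.
  rewrite c1; [|lra|lra|exact: itg_continuous].
  rewrite c2; [|lra|lra|exact: itg_continuous].
  have := z (- 1) (- (eta / 2)); have := z (eta / 2) 1; lra.
pose c := (Int (- 1) 1 h)^-1.
have c0 : 0 < c by rewrite invr_gt0.
pose a k s := c * eta^-1 ^+ k * b k (s / eta).
have ck k : 0 <= c * eta^-1 ^+ k by rewrite mulr_ge0 ?(ltW c0)// exprn_ge0// invr_ge0 ltW.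
have nV : `|eta^-1| = eta^-1 by rewrite gtr0_norm// invr_gt0.
exists a; split.
- by rewrite eta0.
- move=> k; have [A HA] := bb k; exists (c * eta^-1 ^+ k * A) => s.
  by rewrite normrM ger0_norm// ler_wpM2l.
- move=> k; have [L HL] := bl k; exists (c * eta^-1 ^+ k * (L * eta^-1)) => s t.
  rewrite -mulrBr normrM ger0_norm// -[leRHS]mulrA ler_wpM2l//.
  apply: le_trans (HL _ _) _; rewrite -mulrBl normrM nV.
  by rewrite [`|s - t| * _]mulrC mulrA.
- move=> k; have [C HC] := bt k; exists (c * eta^-1 ^+ k * (C * (eta^-1) ^+ 2)) => s t.
  have -> : a k (s + t) - a k s - t * a k.+1 s =
      c * eta^-1 ^+ k * (b k (s / eta + t / eta) - b k (s / eta) - t / eta * b k.+1 (s / eta)).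
    by rewrite /a exprS -mulrDl; move: (b k _) (b k _) (b k.+1 _) => x y z; ring.
  rewrite normrM ger0_norm// -[leRHS]mulrA ler_wpM2l//.
  by apply: le_trans (HC _ _) _; rewrite exprMn mulrA mulrAC.
- move=> k s hs; rewrite /a /b bump_support ?mulr0// normrM nV.
  by rewrite ler_pdivlMr// mul1r.
- by move=> s; rewrite /a expr0 mulr1 mulr_ge0 ?(ltW c0).
- have -> : a 0%N = fun s => c * h s by apply/funext => s; rewrite /a expr0 mulr1.
  by rewrite IntZ; [rewrite /c mulVf// gt_eqF|exact: itg_continuous].
Qed.

End bump.

(** * Borel measures on the state space *)

Section generated_measurability.
Context {T : pointedType} (G : set (set T)).

Lemma generated_measurable_fun (R : realType) (f : T -> R) :
  (forall a b : R, G (f @^-1` `]a, b[)) ->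
  measurable_fun setT (f : g_sigma_algebraType G -> R).
Proof.
move=> Gf; apply: (measurability _ (RGenOpens.measurableE R)) => // _ [U [a [b ->]] <-].
by rewrite setTI; apply: sub_sigma_algebra.
Qed.

Lemma generated_measurable_map (T' : pointedType) (G' : set (set T')) (f : T -> T') :
  (forall U, G' U -> G (f @^-1` U)) ->
  measurable_fun setT (f : g_sigma_algebraType G -> g_sigma_algebraType G').
Proof.
move=> Gf; apply: (@measurability _ _ _ (g_sigma_algebraType G') _ _ G') => // _ [U GU <-].
by rewrite setTI; apply: sub_sigma_algebra; exact: Gf.
Qed.

Lemma generated_measurable_fun_within (R : realType) (D : set T) (f : T -> R) :
  measurable (D : set (g_sigma_algebraType G)) ->
  (forall a b : R, exists2 V, G V & V `&` D = f @^-1` `]a, b[ `&` D) ->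
  measurable_fun (D : set (g_sigma_algebraType G)) f.
Proof.
move=> mD Gf; apply: (measurability _ (RGenOpens.measurableE R)) => // _ [U [a [b ->]] <-].
have [V GV VD] := Gf a b.
by rewrite setIC -VD; apply: measurableI => //; exact: sub_sigma_algebra.
Qed.

End generated_measurability.

Section borel_state.
Context {R : realType} {n : nat}.
Notation S := (state R n).

Lemma closed_state_measurable (C : set S) : closed C -> measurable (C : set (borel S)).
Proof.
move=> cC; rewrite -[C]setCK; apply: measurableC; apply: sub_sigma_algebra.
exact: closed_openC.
Qed.

Lemma continuous_state_measurable (f : S -> R) : continuous f ->
  measurable_fun setT (f : borel S -> R).
Proof.
move=> cf; apply: generated_measurable_fun => a b; exact: open_comp.
Qed.

Lemma continuous_state_measurable_map (f : S -> S) : continuous f ->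
  measurable_fun setT (f : borel S -> borel S).
Proof. by move=> cf; apply: generated_measurable_map => U oU; apply: open_comp. Qed.

Lemma within_continuous_state_measurable (D : set S) (f : S -> R) : closed D ->
  {within D, continuous f} -> measurable_fun (D : set (borel S)) f.
Proof.
move=> cD cf; apply: generated_measurable_fun_within.
  exact: closed_state_measurable.
move=> a b; have oP : open (f @^-1` `]a, b[ : set (subspace D)).
  by apply: open_comp => [x _|]; [exact: cf|exact: interval_open].
by have [V oV VD] := (open_subspaceP _ _).1 oP; exists V.
Qed.

End borel_state.

Section expectations.
Context d {T : measurableType d} {R : realType}.
Variables (mu : probability T R) (D : set T).
Hypotheses (mD : measurable D) (muD : mu D = 1%E).
Implicit Types f g : T -> R.

Definition Ex f : R := \int[mu]_(z in D) f z.

Lemma bounded_integrable f (M : R) : measurable_fun D f -> (forall z, D z -> `|f z| <= M) ->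
  mu.-integrable D (EFin \o f).
Proof.
move=> mf fM; apply: measurable_bounded_integrable => //.
  exact: le_lt_trans (probability_le1 mu mD) (ltry _).
by exists M; split; [exact: num_real|move=> x Mx z /fM h; apply: le_trans h (ltW Mx)].
Qed.

Lemma Ex_norm_le f (M : R) : measurable_fun D f -> (forall z, D z -> `|f z| <= M) -> `|Ex f| <= M.
Proof.
move=> mf fM; have fi := bounded_integrable mf fM.
apply: le_trans (le_normr_Rintegral mD fi) _.
have : \int[mu]_(z in D) `|f z| <= \int[mu]_(z in D) M.
  apply: le_Rintegral => //; first exact: integrable_norm.
  by apply: (@bounded_integrable _ `|M|).
by rewrite Rintegral_cst//= [X in fine X](_ : _ = 1%E) ?mulr1; [exact: le_trans|exact: muD].
Qed.

Lemma ExB f g : mu.-integrable D (EFin \o f) -> mu.-integrable D (EFin \o g) ->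
  Ex (fun z => f z - g z) = Ex f - Ex g.
Proof. exact: RintegralB. Qed.

Lemma ExD f g : mu.-integrable D (EFin \o f) -> mu.-integrable D (EFin \o g) ->
  Ex (fun z => f z + g z) = Ex f + Ex g.
Proof. exact: RintegralD. Qed.

Lemma ExZ f k : mu.-integrable D (EFin \o f) -> Ex (fun z => k * f z) = k * Ex f.
Proof. exact: RintegralZl. Qed.

Lemma Ex_eq f g : (forall z, D z -> f z = g z) -> Ex f = Ex g.
Proof. by move=> fg; apply: eq_Rintegral => z; rewrite inE => /fg. Qed.

Lemma Ex_sum (I : Type) (s : seq I) (F : I -> T -> R) :
  (forall i, mu.-integrable D (EFin \o F i)) ->
  Ex (fun z => \sum_(i <- s) F i z) = \sum_(i <- s) Ex (F i).
Proof.
move=> FI; have H s' : mu.-integrable D (EFin \o (fun z => \sum_(i <- s') F i z)).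
  elim: s' => [|i s' ih].
    have -> : EFin \o (fun z => \sum_(i <- [::]) F i z) = cst 0%E.
      by apply/funext => z; rewrite /= big_nil.
    exact: integrable0.
  have -> : EFin \o (fun z => \sum_(j <- i :: s') F j z) =
      (EFin \o F i) \+ (EFin \o (fun z => \sum_(i <- s') F i z)).
    by apply/funext => z; rewrite /= big_cons.
  exact: integrableD.
elim: s => [|i s ih].
  rewrite big_nil (@Ex_eq _ (fun=> 0)); last by move=> z _; rewrite big_nil.
  by rewrite /Ex Rintegral_cst// mul0r.
rewrite big_cons -ih -ExD//; apply: Ex_eq => z _; rewrite big_cons//.
Qed.

Lemma Ex_EFin f : mu.-integrable D (EFin \o f) ->
  (\int[mu]_(z in D) (f z)%:E)%E = (Ex f)%:E.
Proof. by move=> fi; rewrite /Ex /Rintegral fineK//; exact: integrable_fin_num. Qed.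

End expectations.

Section open_sets_from_lipschitz_functions.
Context {R : realType} {U : normedModType R}.
Variable O : set U.
Hypothesis oO : open O.

(** The supremum of this set is the distance from [z] to the complement of [O], capped at 1; the cap
    keeps it finite when [O] is everything. *)
Let depth_set z := [set r : R | 0 <= r <= 1 /\ forall z', `|z' - z| < r -> O z'].

Let depth z : R := sup (depth_set z).

Let depth_has_sup z : has_sup (depth_set z).
Proof.
split; last by exists 1 => r [/andP[]].
by exists 0; split; [rewrite lexx ler01|move=> z'; rewrite ltNge normr_ge0].
Qed.

Let depth_ge0 z : 0 <= depth z.
Proof.
apply: ub_le_sup; first by case: (depth_has_sup z).
by split; [rewrite lexx ler01|move=> z'; rewrite ltNge normr_ge0].
Qed.

Let depth_le z z' : depth z <= depth z' + `|z - z'|.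
Proof.
apply: ge_sup; first by case: (depth_has_sup z).
move=> r [/andP[r0 r1] rO].
have [rz|rz] := leP r `|z - z'|; first by apply: le_trans rz _; rewrite lerDr depth_ge0.
rewrite -lerBlDr; apply: ub_le_sup; first by case: (depth_has_sup z').
split; first by rewrite subr_ge0 ltW//= (le_trans _ r1)// gerBl.
move=> y hy; apply: rO; rewrite -(subrK z' y) -addrA.
by apply: le_lt_trans (ler_normD _ _) _; rewrite -ltrBrDr [`|z' - z|]distrC.
Qed.

Let depth_gt0 z : O z -> 0 < depth z.
Proof.
move=> Oz; have /nbhs_ballP[e /= e0 eO] : nbhs z O by exact: open_nbhs_nbhs.
apply: (@lt_le_trans _ _ (Num.min e 1)); first by rewrite lt_min e0 ltr01.
apply: ub_le_sup; first by case: (depth_has_sup z).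
split; first by rewrite le_min (ltW e0) ler01/= ge_min lexx orbT.
move=> z'; rewrite lt_min => /andP[h _]; apply: eO; rewrite -ball_normE /ball_/=.
by rewrite distrC.
Qed.

Let depth_out z : ~ O z -> depth z = 0.
Proof.
move=> nOz; apply/eqP; rewrite eq_le depth_ge0 andbT; apply: ge_sup.
  by case: (depth_has_sup z).
move=> r [/andP[r0 _] rO]; rewrite leNgt; apply/negP => r1; apply: nOz; apply: rO.
by rewrite subrr normr0.
Qed.

Let max_diff (a b c e k : R) : `|a - b| <= k -> `|c - e| <= k -> `|Num.min a c - Num.min b e| <= k.
Proof.
rewrite !ler_norml => /andP[? ?] /andP[? ?]; apply/andP.
by rewrite !minEle; do 2 case: ifPn; rewrite -?ltNge; split; lra.
Qed.

Let max_diff0 (a b k : R) : 0 <= k -> `|a - b| <= k -> `|Num.max 0 a - Num.max 0 b| <= k.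
Proof.
move=> k0; rewrite !ler_norml => /andP[? ?]; apply/andP.
by rewrite !maxEle; do 2 case: ifPn; rewrite -?ltNge; split; lra.
Qed.

(** Multiples of the depth, truncated at 1, eventually reach 1 at every point of [O] and vanish off
    [O]; the minimum with the positive part of [n - |z|] gives bounded support. *)
Lemma open_lipschitz_approximation : exists phi : nat -> U -> R,
  [/\ forall n, exists2 K, 0 <= K & lip K (phi n),
      forall n z, 0 <= phi n z <= 1,
      forall n, exists rho, forall z, rho <= `|z| -> phi n z = 0 &
      forall z, phi n z @[n --> \oo] --> (\1_O z : R)].
Proof.
exists (fun n z => Num.min (Num.min 1 (n%:R * depth z)) (Num.max 0 (n%:R - `|z|))); split.
- move=> n; exists (n%:R + 1); first by rewrite addr_ge0.
  move=> z z'; have k0 : 0 <= `|z - z'| by [].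
  have n0 : (0 : R) <= n%:R by [].
  have h1 : `|depth z - depth z'| <= `|z - z'|.
    have := depth_le z z'; have := depth_le z' z; rewrite [`|z' - z|]distrC ler_norml => ? ?.
    by apply/andP; split; lra.
  have h2 : `| `|z| - `|z'| | <= `|z - z'| by exact: ler_dist_dist.
  apply: max_diff.
    apply: max_diff; first by rewrite subrr normr0 mulr_ge0// addr_ge0.
    rewrite -mulrBr normrM ger0_norm//; apply: (@le_trans _ _ (n%:R * `|z - z'|)).
      exact: ler_wpM2l.
    by apply: ler_wpM2r => //; rewrite lerDl.
  apply: max_diff0; first by rewrite mulr_ge0// addr_ge0.
  have -> : n%:R - `|z| - (n%:R - `|z'|) = - (`|z| - `|z'|) by ring.
  rewrite normrN; apply: le_trans h2 _; rewrite -[leLHS]mul1r.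
  by apply: ler_wpM2r => //; rewrite lerDr.
- move=> n z; rewrite le_min le_min ler01/= mulr_ge0//= le_max lexx/=.
  by rewrite ge_min ge_min lexx.
- move=> n; exists n%:R => z zn.
  rewrite (_ : Num.max 0 _ = 0); last by apply/max_idPl; rewrite subr_le0.
  by apply/min_idPr; rewrite le_min ler01 mulr_ge0.
- move=> z; rewrite indicE; have [Oz|nOz] := pselect (O z); last first.
    rewrite memNset//= depth_out//; apply: cvg_near_cst; apply: nearW => n.
    rewrite mulr0 (_ : Num.min 1 0 = 0); last exact/min_idPr.
    by apply/min_idPl; rewrite le_max lexx.
  rewrite mem_set//=; apply: cvg_near_cst; near=> n.
  have h1 : 1 <= n%:R * depth z.
    rewrite -ler_pdivrMr ?depth_gt0//; near: n; exact: nbhs_infty_ger.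
  have h2 : 1 <= n%:R - `|z|.
    by rewrite lerBrDr; near: n; exact: nbhs_infty_ger.
  by rewrite (min_idPl h1); apply/min_idPl; rewrite le_max h2 orbT.
Unshelve. all: by end_near. Qed.

End open_sets_from_lipschitz_functions.

Section measures_determined_by_lipschitz_functions.
Context {R : realType} {n : nat}.
Notation S := (state R n).

Lemma eq_borel_measure (m1 m2 : probability (borel S) R) :
  (forall (phi : S -> R) (K rho : R), 0 <= K -> lip K phi -> (forall z, 0 <= phi z <= 1) ->
     (forall z, rho <= `|z| -> phi z = 0) ->
     \int[m1]_z phi z = \int[m2]_z phi z) ->
  forall A : set (borel S), measurable A -> m1 A = m2 A.
Proof.
move=> H A mA.
apply: (@g_sigma_algebra_measure_unique _ R (borel S) (@open S) _ (fun=> setT) _ _ m1 m2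
  _ _ _ A mA) => //.
- exact: sub_sigma_algebra.
- by move=> _; exact: openT.
- by rewrite bigcup_const//; exists 0%N.
- by move=> U V; exact: openI.
- move=> U oU.
  have [phi [lphi phi01 sphi cphi]] := open_lipschitz_approximation oU.
  have mphi k : measurable_fun setT (phi k : borel S -> R).
    have [K _ lK] := lphi k; apply: continuous_state_measurable.
    exact: lip_continuous lK.
  have conv m : (\int[m : probability (borel S) R]_z (phi k z)%:E)%E @[k --> \oo] --> m U.
    have mU : measurable (U : set (borel S)) by exact: sub_sigma_algebra.
    have indU : (\int[m]_z (\1_U z)%:E = m U)%E by rewrite integral_indic ?setIT.
    rewrite -indU; apply: (@dominated_cvg _ _ _ m setT measurableT (fun k z => (phi k z)%:E)
      (EFin \o \1_U) (cst 1%E)) => //.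
    + by move=> k; apply/measurable_EFinP; exact: mphi.
    + by move=> z _; apply: cvg_EFin; [exact: nearW|exact: cphi].
    + by apply: finite_measure_integrable_cst.
    + move=> k z _; rewrite lee_fin; have /andP[p0 p1] := phi01 k z.
      by rewrite ger0_norm.
  have e k : (\int[m1]_z (phi k z)%:E = \int[m2]_z (phi k z)%:E)%E.
    have [K K0 lK] := lphi k; have [rho srho] := sphi k.
    have := H (phi k) K rho K0 lK (phi01 k) srho.
    have ii (m : probability (borel S) R) : m.-integrable setT (EFin \o phi k).
      apply: (@bounded_integrable _ _ _ _ _ _ _ 1) => //.
      by move=> z _; have /andP[p0 p1] := phi01 k z; rewrite ger0_norm.
    by move=> h; rewrite (Ex_EFin measurableT (ii m1)) (Ex_EFin measurableT (ii m2)); congr EFin.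
  have := conv m2; rewrite -(funext e) => c2.
  by apply: (cvg_unique _ (conv m1) c2).
- by move=> _; exact: le_lt_trans (probability_le1 m1 measurableT) (ltry _).
Qed.

End measures_determined_by_lipschitz_functions.

Lemma window_order (R : realFieldType) (s t T d d' eta : R) : 0 < s -> s < t -> t < T ->
  0 < eta -> 0 < d -> 0 < d' -> eta <= d / 2 -> eta <= d' / 2 -> eta <= s / 2 ->
  eta <= (T - t) / 2 -> eta <= (t - s) / 4 ->
  [/\ [/\ eta < s, t < T - eta, s + eta < t - eta, s < T - eta & eta < t],
      [/\ s - d < s - eta, s + eta < s + d, t - d' < t - eta & t + eta < t + d'],
      [/\ 0 <= s - eta, s - eta <= s + eta & s + eta <= T] &
      [/\ 0 <= t - eta, t - eta <= t + eta & t + eta <= T]].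
Proof. by move=> *; split; split; lra. Qed.

(** * The weak formulation *)

Section time_tests.
Context {R : realType}.

(** A time factor together with its derivatives, [al k] being the k-th, in the encoding used for
    kernels. *)
Record time_test (T : R) (al : nat -> R -> R) : Prop := TimeTest {
  tt_bounded : forall k, exists A : R, forall s, `|al k s| <= A;
  tt_lip : forall k, exists L : R, forall s t, `|al k s - al k t| <= L * `|s - t|;
  tt_taylor : forall k, exists C : R, forall s t,
    `|al k (s + t) - al k s - t * al k.+1 s| <= C * t ^+ 2;
  tt_support : exists c e, [/\ 0 < c, e < T & forall r, al 0%N r != 0 -> c <= r <= e] }.

Section window.
Variables (eta : R) (a : nat -> R -> R).
Hypothesis ka : smoothing_kernel eta a.

Let ca k : continuous (a k).
Proof. by have [K H] := ker_lip ka k; exact: (lip_continuous (K := K)). Qed.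

Let ia x y k : itg x y (a k). Proof. exact: itg_continuous. Qed.
Let eta0 : 0 < eta. Proof. by case/andP: (ker_eta ka). Qed.
Let eta1 : eta <= 1 / 2. Proof. by case/andP: (ker_eta ka). Qed.

Let Int0 x y : (forall r, x <= r <= y -> eta <= `|r|) -> Int x y (a 0%N) = 0.
Proof.
move=> h; rewrite (@Int_eq _ _ _ _ (fun=> 0)); last by move=> r /h; exact: ker_support.
by rewrite Int.unlock Rintegral_cst// mul0r.
Qed.

(** A smoothed Heaviside step, rising from 0 to 1 on [-eta, eta]. *)
Definition rise (r : R) : R := Int (- 1) r (a 0%N).

Lemma rise_diff x y : x <= y -> rise y - rise x = Int x y (a 0%N).
Proof.
move=> xy; have e1 := eta1; have e0 := eta0.
have neg r : r < - 1 -> rise r = 0.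
  move=> r1; rewrite /rise Int.unlock set_itv_ge ?Rintegral_set0// bnd_simp -ltNge.
  by rewrite ltNge -leNgt bnd_simp in r1 * || idtac.
case: (leP (- 1) x) => x1.
  by rewrite /rise (@Int_split _ (- 1) x y)//; ring.
rewrite (neg x)// subr0; case: (leP (- 1) y) => y1; last first.
  rewrite neg// Int0// => r /andP[_ ry]; rewrite ler0_norm; lra.
rewrite (@Int_split _ x (- 1) y)// ?ltW//.
rewrite (Int0 (x := x)) ?add0r// => r /andP[_ ry]; rewrite ler0_norm; lra.
Qed.

Lemma rise_homo x y : x <= y -> rise x <= rise y.
Proof.
by move=> xy; rewrite -subr_ge0 rise_diff//; apply: Int_ge0 => r _; exact: (ker_ge0 ka r).
Qed.

Lemma rise0 r : r <= - eta -> rise r = 0.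
Proof.
move=> re; have e1 := eta1; have e0 := eta0.
rewrite -[rise r](subrK (rise (- eta))).
have -> : rise r - rise (- eta) = 0.
  rewrite -opprB rise_diff// Int0 ?oppr0// => q /andP[_ qe]; rewrite ler0_norm; lra.
rewrite add0r /rise Int0// => q /andP[_ qe]; rewrite ler0_norm; lra.
Qed.

Lemma rise1 r : eta <= r -> rise r = 1.
Proof.
move=> re; have e1 := eta1; have e0 := eta0.
have r1 : rise 1 = 1 by exact: ker_mass ka.
have re1 : rise eta = 1.
  apply/eqP; rewrite -subr_eq0 -r1 -opprB rise_diff; last lra.
  rewrite Int0 ?oppr0// => q /andP[eq _]; rewrite ger0_norm; lra.
apply/eqP; rewrite -subr_eq0 -re1 rise_diff// Int0// => q /andP[eq _].
rewrite ger0_norm; lra.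
Qed.

Lemma rise_01 r : 0 <= rise r <= 1.
Proof.
have e0 := eta0; apply/andP; split.
  by rewrite -(@rise0 (- eta - `|r|)) ?rise_homo//; have := ler_norm (- r); rewrite normrN; have := normr_ge0 r; lra.
by rewrite -(@rise1 (eta + `|r|)) ?rise_homo//; have := ler_norm r; have := normr_ge0 r; lra.
Qed.

Lemma rise_lip A : (forall s, `|a 0%N s| <= A) -> forall x y, `|rise x - rise y| <= A * `|x - y|.
Proof.
move=> aA x y; wlog xy : x y / y <= x.
  move=> H; case: (leP y x) => [|/ltW] xy; first exact: H.
  by rewrite distrC [`|x - y|]distrC; exact: H.
rewrite rise_diff// (ger0_norm (x := x - y)) ?subr_ge0//.
by rewrite -Int_cst//; apply: Int_norm => //; exact: itg_cst.
Qed.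

Lemma rise_taylor L : (forall s t, `|a 0%N s - a 0%N t| <= L * `|s - t|) ->
  forall s t, `|rise (s + t) - rise s - t * a 0%N s| <= L * t ^+ 2.
Proof.
move=> aL s t.
have L0 : 0 <= L by have := le_trans (normr_ge0 _) (aL 1 0); rewrite subr0 normr1 mulr1.
have key x y : x <= y -> (x <= s <= y) -> `|Int x y (a 0%N) - (y - x) * a 0%N s| <= L * (y - x) ^+ 2.
  move=> xy /andP[xs sy]; rewrite [_ * a 0%N s]mulrC -Int_cst// -IntB//; last exact: itg_cst.
  rewrite expr2 mulrA -Int_cst//; apply: Int_norm.
  - by apply: itgB => //; exact: itg_cst.
  - exact: itg_cst.
  - move=> r /andP[xr ry]; apply: le_trans (aL _ _) _; apply: ler_wpM2l => //.
    by rewrite ler_norml; apply/andP; split; lra.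
case: (leP 0 t) => t0.
  rewrite rise_diff; last lra.
  have := key s (s + t); rewrite [s + t - s]addrAC subrr add0r; apply; lra.
rewrite -normrN.
have -> : - (rise (s + t) - rise s - t * a 0%N s) = (rise s - rise (s + t)) - (s - (s + t)) * a 0%N s by ring.
rewrite rise_diff; last lra.
have -> : t ^+ 2 = (s - (s + t)) ^+ 2 by ring.
by apply: key; lra.
Qed.

(** The smoothed indicator of [s, t] and its derivatives; the first derivative is a bump at [s]
    minus a bump at [t]. *)
Definition window (s t : R) (k : nat) (r : R) : R :=
  if k is k'.+1 then a k' (r - s) - a k' (r - t) else rise (r - s) - rise (r - t).

Lemma window_time_test T s t : eta < s -> s <= t -> t < T - eta -> time_test T (window s t).
Proof.
move=> es st tT; have e0 := eta0; split.
- case=> [|k].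
    exists 2 => r; have := rise_01 (r - s); have := rise_01 (r - t).
    by rewrite ler_norml /window => /andP[? ?] /andP[? ?]; apply/andP; split; lra.
  have [A aA] := ker_bounded ka k; exists (A + A) => r /=.
  by apply: le_trans (ler_normB _ _) _; exact: lerD.
- have dd (F : R -> R) L : (forall x y, `|F x - F y| <= L * `|x - y|) -> forall x y,
    `|F (x - s) - F (x - t) - (F (y - s) - F (y - t))| <= (L + L) * `|x - y|.
    move=> FL x y.
    have -> : F (x - s) - F (x - t) - (F (y - s) - F (y - t)) =
      (F (x - s) - F (y - s)) - (F (x - t) - F (y - t)) by ring.
    apply: le_trans (ler_normB _ _) _; rewrite mulrDl; apply: lerD.
      by apply: le_trans (FL _ _) _; rewrite opprB addrA subrK.
    by apply: le_trans (FL _ _) _; rewrite opprB addrA subrK.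
  case=> [|k].
    have [A aA] := ker_bounded ka 0; exists (A + A) => x y /=.
    exact: (dd rise A (rise_lip aA)).
  have [L aL] := ker_lip ka k; exists (L + L) => x y /=; exact: (dd (a k) L aL).
- have dd (F F' : R -> R) C : (forall x y, `|F (x + y) - F x - y * F' x| <= C * y ^+ 2) ->
    forall x y, `|F (x + y - s) - F (x + y - t) - (F (x - s) - F (x - t)) -
        y * (F' (x - s) - F' (x - t))| <= (C + C) * y ^+ 2.
    move=> FC x y.
    have -> : F (x + y - s) - F (x + y - t) - (F (x - s) - F (x - t)) -
        y * (F' (x - s) - F' (x - t)) =
      (F (x - s + y) - F (x - s) - y * F' (x - s)) - (F (x - t + y) - F (x - t) - y * F' (x - t)).
      by rewrite [x - s + y]addrAC [x - t + y]addrAC; ring.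
    by apply: le_trans (ler_normB _ _) _; rewrite mulrDl; apply: lerD.
  case=> [|k].
    have [L aL] := ker_lip ka 0; exists (L + L) => x y /=.
    exact: (dd rise (a 0%N) L (rise_taylor aL)).
  have [C aC] := ker_taylor ka k; exists (C + C) => x y /=; exact: (dd (a k) (a k.+1) C aC).
- exists (s - eta), (t + eta); split; [lra|lra|] => r /=.
  move=> /eqP nz; apply/andP; split; rewrite leNgt; apply/negP => hr; apply: nz.
    by rewrite !rise0 ?subrr//; lra.
  by rewrite !rise1 ?subrr//; lra.
Qed.

Lemma window_01 s t r : s <= t -> 0 <= window s t 0 r <= 1.
Proof.
move=> st; rewrite /window; have := rise_01 (r - s); have := rise_01 (r - t).
have : rise (r - t) <= rise (r - s) by apply: rise_homo; lra.
by move=> ? /andP[? ?] /andP[? ?]; apply/andP; split; lra.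
Qed.

Lemma window_mean (m : R -> R) (T s e : R) : eta < s -> s < T - eta ->
  measurable_fun `[0, T] m -> (exists M : R, forall r : R, 0 <= r <= T -> `|m r| <= M) ->
  (forall r : R, s - eta <= r <= s + eta -> `|m r - m s| <= e) ->
  `|Int 0 T (fun r => a 0%N (r - s) * m r) - m s| <= e.
Proof.
move=> es sT mm [M mM] me; have e0 := eta0; have e1 := eta1.
have cs : continuous (fun r => a 0%N (r - s)).
  move=> r; apply: (@cvg_comp _ _ _ (fun r => r - s) (a 0%N) _ (nbhs (r - s))); last exact: ca.
  by apply: cvgB; [exact: cvg_id|exact: cvg_cst].
have T0 : 0 <= T by arith.
have mass : Int 0 T (fun r => a 0%N (r - s)) = 1.
  rewrite (@Int_shift _ 0 T (- s) (a 0%N))// add0r -(ker_mass ka).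
  have lo r : r <= - eta -> a 0%N r = 0.
    by move=> hr; apply: (ker_support ka); rewrite ler0_norm; arith.
  have hi r : eta <= r -> a 0%N r = 0.
    by move=> hr; apply: (ker_support ka); rewrite ger0_norm; arith.
  rewrite (@Int_support _ (- eta) eta (- s))//; [|lra..].
  by rewrite (@Int_support _ (- eta) eta (- 1))//; arith.
have i1 : itg 0 T (fun r => a 0%N (r - s) * m r).
  by apply: (@itgM _ _ _ _ _ M) => //; exact: itg_continuous.
have i2 k : itg 0 T (fun r => k * a 0%N (r - s)) by apply: itgZ; exact: itg_continuous.
rewrite -[m s]mulr1 -mass -IntZ; last exact: itg_continuous.
rewrite -IntB// -[e]mulr1 -mass -IntZ; last exact: itg_continuous.
apply: Int_norm => //; first exact: itgB.
move=> r _; rewrite [m s * _]mulrC -mulrBr normrM (ger0_norm (ker_ge0 ka _)) mulrC.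
have [rs|rs] := leP eta `|r - s|; first by rewrite (ker_support ka) ?mulr0.
apply: ler_wpM2r; first exact: (ker_ge0 ka (r - s)).
by apply: me; move: rs; rewrite ltr_norml => /andP[? ?]; apply/andP; split; arith.
Qed.

(** The window and the indicator of [s, t] differ only in the two transition zones; in each zone
    either function contributes at most [e], whence the factor 4. *)
Lemma window_integral (G : R -> R) (T s t e : R) : eta < s -> s + eta < t - eta -> t < T - eta ->
  itg 0 T G -> Int (s - eta) (s + eta) (fun r => `|G r|) <= e ->
  Int (t - eta) (t + eta) (fun r => `|G r|) <= e ->
  `|Int 0 T (fun r => window s t 0 r * G r) - Int s t G| <= 4 * e.
Proof.
move=> es st tT iG h1 h2; have e0 := eta0.
have o1 : 0 <= s - eta by arith.
have o2 : s - eta <= s by arith.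
have o3 : s <= s + eta by arith.
have o4 : s + eta <= t - eta by arith.
have o5 : t - eta <= t by arith.
have o6 : t <= t + eta by arith.
have o7 : t + eta <= T by arith.
have o8 : s - eta <= s + eta by arith.
have o9 : t - eta <= t + eta by arith.
have oA : s + eta <= t by arith.
have oB : s <= t by arith.
have oC : t - eta <= T by arith.
have oD : s + eta <= T by arith.
have oE : s - eta <= T by arith.
have oF : 0 <= s + eta by arith.
have oG : 0 <= t - eta by arith.
have oH : 0 <= s by arith.
have oI : t <= T by arith.
have cw : continuous (window s t 0).
  have [L HL] := tt_lip (@window_time_test T s t es (ltac:(arith)) tT) 0.
  exact: (lip_continuous (K := L)).
have w01 r := @window_01 s t r (ltac:(arith)).
have wlt r : r <= s - eta -> window s t 0 r = 0.
  by move=> ?; rewrite /window !rise0 ?subrr//; arith.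
have wgt r : t + eta <= r -> window s t 0 r = 0.
  by move=> ?; rewrite /window !rise1 ?subrr//; arith.
have wmid r : s + eta <= r <= t - eta -> window s t 0 r = 1.
  by move=> /andP[? ?]; rewrite /window (rise1 (r := r - s)) ?(rise0 (r := r - t)) ?subr0//; arith.
have iwG : itg 0 T (fun r => G r * window s t 0 r).
  apply: (@itgM _ _ _ _ _ 1) => //; first by apply: measurable_funTS; exact: continuous_measurable_fun.
  by move=> r _; have /andP[? ?] := w01 r; rewrite ger0_norm.
have {}iwG : itg 0 T (fun r => window s t 0 r * G r).
  by apply: itg_eq iwG => r _; rewrite mulrC.
have sub x y : 0 <= x -> y <= T -> itg x y (fun r => window s t 0 r * G r).
  by move=> ? ?; exact: itgS iwG.
have subG x y : 0 <= x -> y <= T -> itg x y G by move=> ? ?; exact: itgS iG.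
have nrm x y : 0 <= x -> y <= T -> `|Int x y (fun r => window s t 0 r * G r)| <= Int x y (fun r => `|G r|).
  move=> x0 yT; apply: Int_norm; [exact: sub|by apply: itg_norm; exact: subG|].
  by move=> r _; rewrite normrM; have /andP[? ?] := w01 r; rewrite ger0_norm// ler_piMl.
have nrmG x y : 0 <= x -> y <= T -> `|Int x y G| <= Int x y (fun r => `|G r|).
  by move=> x0 yT; apply: Int_norm; [exact: subG|by apply: itg_norm; exact: subG|].
have zero x y : (forall r, x <= r <= y -> window s t 0 r = 0) ->
    Int x y (fun r => window s t 0 r * G r) = 0.
  move=> h; rewrite (@Int_eq _ _ _ _ (fun=> 0)); last by move=> r /h ->; rewrite mul0r.
  by rewrite Int.unlock Rintegral_cst// mul0r.
have n1 := nrm (s - eta) (s + eta) o1 oD.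
have n2 := nrm (t - eta) (t + eta) oG o7.
have n3 := nrmG s (s + eta) oH oD.
have n4 := nrmG (t - eta) t oG oI.
have absI x y z : 0 <= x -> x <= y -> y <= z -> z <= T ->
   Int x z (fun r => `|G r|) = Int x y (fun r => `|G r|) + Int y z (fun r => `|G r|).
  by move=> ? ? ? ?; apply: Int_split => //; apply: itg_norm; exact: subG.
have pos x y : 0 <= Int x y (fun r => `|G r|) by apply: Int_ge0.
have q1 := absI (s - eta) s (s + eta) o1 o2 o3 oD.
have q2 := absI (t - eta) t (t + eta) oG o5 o6 o7.
have p1 := pos (s - eta) s; have p2 := pos t (t + eta).
rewrite (@Int_split _ 0 (s - eta) T _ o1 oE (sub _ _ (lexx 0) (lexx T))).
rewrite (@Int_split _ (s - eta) (s + eta) T _ o8 oD (sub _ _ o1 (lexx T))).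
rewrite (@Int_split _ (s + eta) (t - eta) T _ o4 oC (sub _ _ oF (lexx T))).
rewrite (@Int_split _ (t - eta) (t + eta) T _ o9 o7 (sub _ _ oG (lexx T))).
rewrite (@Int_split _ s (s + eta) t _ o3 oA (subG _ _ oH oI)).
rewrite (@Int_split _ (s + eta) (t - eta) t _ o4 o5 (subG _ _ oF oI)).
rewrite (zero 0 (s - eta)); last by move=> r /andP[_]; exact: wlt.
rewrite (zero (t + eta) T); last by move=> r /andP[+ _]; exact: wgt.
rewrite (@Int_eq _ (s + eta) (t - eta) (fun r => window s t 0 r * G r) G); last first.
  by move=> r /wmid ->; rewrite mul1r.
clear wlt wgt wmid zero absI nrm nrmG sub subG w01 cw iwG iG pos.
move: n1 n2 n3 n4; rewrite !ler_norml => /andP[? ?] /andP[? ?] /andP[? ?] /andP[? ?].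
by apply/andP; split; arith.
Qed.

End window.

Section weak_derivative.
Variables (m G : R -> R) (T : R).
Hypotheses (T0 : 0 < T) (cm : {within `[0, T], continuous m}) (iG : itg 0 T G).

Let osc (s e : R) : 0 <= s <= T -> 0 < e -> exists2 d : R, 0 < d &
  forall r, 0 <= r <= T -> `|r - s| <= d -> `|m r - m s| <= e.
Proof.
move=> sT e0; move: cm => /subspace_continuousP => /(_ s).
rewrite /= in_itv/= => /(_ sT) /cvgrPdist_lt /(_ e e0) /=.
rewrite near_withinE => -[d /= d0 Hd].
exists (d / 2) => [|r rT rs]; first lra.
rewrite distrC ltW//; apply: Hd; last by rewrite /= in_itv.
by rewrite /= distrC; apply: le_lt_trans rs _; lra.
Qed.

Let bounded_m : exists M : R, forall r : R, 0 <= r <= T -> `|m r| <= M.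
Proof.
have [c _ Hc] : exists2 c : R, c \in `[0, T] & forall t, t \in `[0, T] -> `|m t| <= `|m c|.
  apply: (@EVT_max R (fun s => `|m s|)); first exact: ltW.
  by move=> x; apply: continuous_comp; [exact: cm|exact: norm_continuous].
by exists `|m c| => r; exact: Hc.
Qed.

Let small_G (s e : R) : 0 <= s <= T -> 0 < e -> exists2 d : R, 0 < d & forall x y,
  0 <= x -> x <= y -> y <= T -> s - d < x -> y < s + d -> Int x y (fun r => `|G r|) <= e.
Proof.
by move=> sT e0; apply: (@Int_small R 0 T _ (itg_norm iG) _ s e sT e0) => r _.
Qed.

Hypothesis H : forall al, time_test T al ->
  Int 0 T (fun r => al 1%N r * m r + al 0%N r * G r) = 0.

Let min8 (x1 x2 x3 x4 x5 x6 x7 x8 : R) : 0 < x1 -> 0 < x2 -> 0 < x3 -> 0 < x4 ->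
  0 < x5 -> 0 < x6 -> 0 < x7 -> 0 < x8 -> exists2 y : R, 0 < y &
  (y <= x1 /\ y <= x2 /\ y <= x3 /\ y <= x4) /\ (y <= x5 /\ y <= x6 /\ y <= x7 /\ y <= x8).
Proof.
move=> h1 h2 h3 h4 h5 h6 h7 h8.
pose y := Num.min (Num.min (Num.min x1 x2) (Num.min x3 x4))
  (Num.min (Num.min x5 x6) (Num.min x7 x8)).
exists y; first by rewrite /y !lt_min h1 h2 h3 h4 h5 h6 h7 h8.
have : y <= y by [].
by rewrite {2}/y !le_min => /andP[/andP[/andP[-> ->] /andP[-> ->]] /andP[/andP[-> ->] /andP[-> ->]]].
Qed.

Let near_pt (x y z : R) : x - z <= y <= x + z -> `|y - x| <= z.
Proof. by move=> /andP[? ?]; rewrite ler_norml; apply/andP; split; lra. Qed.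

Let combine (x y z w ms mt k : R) : `|x - ms| <= k -> `|y - mt| <= k -> `|z - w| <= 4 * k ->
  x - y + z = 0 -> `|mt - ms - w| <= 8 * k.
Proof.
rewrite !ler_norml => /andP[? ?] /andP[? ?] /andP[? ?] ?.
by apply/andP; split; lra.
Qed.

(** Testing with a window: the derivative of the test picks up averages of [m] near [s] and near
    [t], the test itself picks up the integral of [G]. A narrow kernel makes the three errors
    small. *)
Let weak_derivative_inner (s t : R) : 0 < s -> s < t -> t < T -> m t - m s = Int s t G.
Proof.
move=> s0 st tT; apply/eqP; rewrite -subr_eq0 -normr_le0; apply/ler_addgt0Pr => e e0.
rewrite add0r.
have k0 : 0 < e / 8 by lra.
have sT : 0 <= s <= T by apply/andP; split; lra.
have tT' : 0 <= t <= T by apply/andP; split; lra.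
have mm := within_continuous_measurable cm.
have [M mM] := bounded_m.
have [d1 d10 H1] := osc sT k0; have [d2 d20 H2] := osc tT' k0.
have [d3 d30 H3] := small_G sT k0; have [d4 d40 H4] := small_G tT' k0.
have [||||||||eta eta0 [[l1 [l2 [l3 l4]]] [l5 [l6 [l7 l8]]]]] :=
  @min8 d1 d2 (d3 / 2) (d4 / 2) (s / 2) ((T - t) / 2) ((t - s) / 4) (1 / 2) => //; try lra.
have [a ka] : exists a, smoothing_kernel eta a.
  by apply: smoothing_kernel_exists; rewrite eta0 l8.
have [[es tTe ste sTe et] [ o1 o2 o3 o4] [ o5 o6 o7] [ o8 o9 oA]] :=
  window_order s0 st tT eta0 d30 d40 l3 l4 l5 l6 l7.
have tw := window_time_test ka es (ltW st) tTe.
have b1 : `|Int 0 T (fun r => a 0%N (r - s) * m r) - m s| <= e / 8.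
  apply: (window_mean ka es sTe mm (ex_intro _ M mM)) => r /[dup] rs /andP[r1 r2].
  by apply: H1; [rewrite (le_trans o5)//= (le_trans r2)|exact: le_trans (near_pt rs) l1].
have b2 : `|Int 0 T (fun r => a 0%N (r - t) * m r) - m t| <= e / 8.
  apply: (window_mean ka et tTe mm (ex_intro _ M mM)) => r /[dup] rs /andP[r1 r2].
  by apply: H2; [rewrite (le_trans o8)//= (le_trans r2)|exact: le_trans (near_pt rs) l2].
have b3 : `|Int 0 T (fun r => window a s t 0 r * G r) - Int s t G| <= 4 * (e / 8).
  by apply: (window_integral ka es ste tTe iG); [exact: H3|exact: H4].
have ica u : itg 0 T (fun r => a 0%N (r - u) * m r).
  apply: (@itgM _ _ _ _ _ M) => //; apply: itg_continuous.
  have [L aL] := ker_lip ka 0%N.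
  apply: (@lip_continuous R R L) => x y; apply: le_trans (aL _ _) _.
  by rewrite opprB addrA subrK.
have iw : itg 0 T (fun r => window a s t 0 r * G r).
  have [A HA] := tt_bounded tw 0%N; have [L HL] := tt_lip tw 0%N.
  apply: (@itg_eq _ _ _ (fun r => G r * window a s t 0 r)) => [r _|]; first by rewrite mulrC.
  apply: (@itgM _ _ _ _ _ A) => //.
  apply: measurable_funTS; apply: continuous_measurable_fun.
  exact: (@lip_continuous R R L).
have -> : e = 8 * (e / 8) by rewrite mulrC mulfVK.
apply: (combine b1 b2 b3); rewrite -[RHS](H tw) -IntB// -IntD//; last exact: itgB.
apply: Int_eq => r _; congr (_ + _).
by rewrite /= mulrBl.
Qed.

Let left_sum (mr m0 ms x y e : R) : `|mr - m0| <= e / 2 -> `|x| <= e / 2 -> ms - mr = y ->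
  `|ms - m0 - (x + y)| <= e.
Proof.
by rewrite !ler_norml => /andP[? ?] /andP[? ?] ?; apply/andP; split; lra.
Qed.

Let right_sum (mr mT ms x y e : R) : `|mr - mT| <= e / 2 -> `|y| <= e / 2 -> mr - ms = x ->
  `|mT - ms - (x + y)| <= e.
Proof.
by rewrite !ler_norml => /andP[? ?] /andP[? ?] ?; apply/andP; split; lra.
Qed.

Let weak_derivative_left (s : R) : 0 < s -> s < T -> m s - m 0 = Int 0 s G.
Proof.
move=> s0 sT; apply/eqP; rewrite -subr_eq0 -normr_le0; apply/ler_addgt0Pr => e e0.
rewrite add0r.
have T00 : (0 : R) <= 0 <= T by rewrite lexx ltW.
have e2 : 0 < e / 2 by lra.
have [d1 d10 H1] := osc T00 e2; have [d3 d30 H3] := small_G T00 e2.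
have [||||||||r r0 [[l1 [l2 [l3 l4]]] _]] := @min8 d1 (d3 / 2) (s / 2) s 1 1 1 1 => //; try lra.
have rs : r < s by lra.
have rT : r <= T by lra.
have o1 : 0 - d3 < 0 by lra.
have o2 : r < 0 + d3 by lra.
have h := weak_derivative_inner r0 rs sT.
have h1 : `|m r - m 0| <= e / 2.
  by apply: H1; [rewrite (ltW r0) rT|rewrite subr0 gtr0_norm].
have h2 : `|Int 0 r G| <= e / 2.
  apply: le_trans (H3 0 r (lexx 0) (ltW r0) rT o1 o2).
  by apply: Int_norm => //; [|apply: itg_norm]; apply: itgS iG.
rewrite (@Int_split _ 0 r s G (ltW r0) (ltW rs)); last exact: itgS (ltW sT) iG.
exact: left_sum h1 h2 h.
Qed.

Let weak_derivative_right (s : R) : 0 <= s -> s < T -> m T - m s = Int s T G.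
Proof.
move=> s0 sT; apply/eqP; rewrite -subr_eq0 -normr_le0; apply/ler_addgt0Pr => e e0.
rewrite add0r.
have TT : 0 <= T <= T by rewrite lexx ltW.
have e2 : 0 < e / 2 by lra.
have [d1 d10 H1] := osc TT e2; have [d3 d30 H3] := small_G TT e2.
have [||||||||q q0 [[l1 [l2 [l3 l4]]] _]] := @min8 d1 (d3 / 2) ((T - s) / 2) 1 1 1 1 1 => //; try lra.
pose r := T - q.
have rT : r < T by rewrite /r; lra.
have rs : s < r by rewrite /r; lra.
have r0 : 0 <= r := le_trans s0 (ltW rs).
have o1 : T - d3 < r by rewrite /r; lra.
have o2 : T < T + d3 by lra.
have h : m r - m s = Int s r G.
  move: s0 rs; rewrite le_eqVlt => /orP[/eqP <-|s0] rs; last exact: weak_derivative_inner.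
  exact: weak_derivative_left.
have h1 : `|m r - m T| <= e / 2.
  apply: H1; first by rewrite r0 ltW.
  by rewrite /r addrAC subrr add0r normrN gtr0_norm.
have h2 : `|Int r T G| <= e / 2.
  apply: le_trans (H3 r T r0 (ltW rT) (lexx T) o1 o2).
  by apply: Int_norm => //; [|apply: itg_norm]; apply: itgS iG.
rewrite (@Int_split _ s r T G (ltW rs) (ltW rT)); last exact: itgS iG.
exact: right_sum h1 h2 h.
Qed.

(** Tests vanish near 0 and [T], so the formula is obtained first for interior times; continuity of
    [m] and integrability of [G] extend it to the end points. *)
Lemma weak_derivative_FTC s t : 0 <= s -> s <= t -> t <= T -> m t - m s = Int s t G.
Proof.
move=> s0; rewrite le_eqVlt => /orP[/eqP <- _|st tT]; first by rewrite Int_pt subrr.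
move: tT; rewrite le_eqVlt => /orP[/eqP tT|tT].
  by move: st; rewrite tT; exact: weak_derivative_right.
move: s0 st; rewrite le_eqVlt => /orP[/eqP <-|s0] st; last exact: weak_derivative_inner.
exact: weak_derivative_left.
Qed.

End weak_derivative.

End time_tests.

(** * Tensor test functions and the increments of expectations *)

Section euclidean_norm.
Context {R : realType}.

Lemma enorm_sqr m n (A : 'M[R]_(m, n)) : enorm A ^+ 2 = \sum_i \sum_j A i j ^+ 2.
Proof. by rewrite sqr_sqrtr// sumr_ge0// => i _; apply: sumr_ge0 => j _; exact: sqr_ge0. Qed.

Lemma enorm_ge0 m n (A : 'M[R]_(m, n)) : 0 <= enorm A.
Proof. exact: sqrtr_ge0. Qed.

Lemma norm_le_enorm m n (A : 'M[R]_(m, n)) : `|A| <= enorm A.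
Proof.
apply: mx_norm_le => [|i j]; first exact: enorm_ge0.
rewrite -(ler_pXn2r (n := 2))// ?nnegrE ?enorm_ge0// enorm_sqr.
rewrite -normrX ger0_norm ?sqr_ge0// (bigD1 i)//= (bigD1 j)//= -addrA lerDl addr_ge0//.
  by apply: sumr_ge0 => k _; exact: sqr_ge0.
by apply: sumr_ge0 => k _; apply: sumr_ge0 => q _; exact: sqr_ge0.
Qed.

Lemma enorm_le_norm m n (A : 'M[R]_(m, n)) : enorm A <= (m * n)%:R * `|A|.
Proof.
have H0 : 0 <= (m * n)%:R * `|A| by rewrite mulr_ge0.
rewrite -(ler_pXn2r (n := 2))// ?nnegrE ?enorm_ge0// enorm_sqr exprMn.
apply: (@le_trans _ _ (\sum_(i < m) \sum_(j < n) `|A| ^+ 2)).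
  apply: ler_sum => i _; apply: ler_sum => j _.
  by rewrite -[leLHS]ger0_norm ?sqr_ge0// normrX lerXn2r ?nnegrE//; exact: le_mx_norm.
rewrite sumr_const card_ord sumr_const card_ord -mulrnA -[leLHS]mulr_natl mulnC.
rewrite ler_wpM2r ?sqr_ge0// -natrX ler_nat expnS expn1.
by case: (m * n)%N => // k; rewrite leq_pmulr.
Qed.

(** One constant for all later estimates. [Lf >= 1] is arranged so that the entries of the control
    are dominated by [field_weight]. *)
Lemma elipschitz_sup n p (f : 'cV[R]_n -> 'cV[R]_p) : elipschitz f ->
  exists Lf : R, [/\ 1 <= Lf, forall x x', `|f x - f x'| <= Lf * `|x - x'| &
    forall x, `|f x| <= Lf * (1 + `|x|)].
Proof.
move=> [L L0 fL]; pose K := L * (n * 1)%:R; have K0 : 0 <= K by rewrite mulr_ge0.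
have fK x x' : `|f x - f x'| <= K * `|x - x'|.
  apply: le_trans (norm_le_enorm _) _; apply: le_trans (fL _ _) _.
  by rewrite /K -mulrA ler_wpM2l// enorm_le_norm.
exists (K + `|f 0| + 1); split; first by rewrite lerDr addr_ge0.
  by move=> x x'; apply: le_trans (fK _ _) _; rewrite ler_wpM2r// -addrA lerDl addr_ge0.
move=> x; rewrite -[f x](subrK (f 0)); apply: le_trans (ler_normD _ _) _.
have := fK x 0; rewrite subr0 => h.
rewrite mulrDr mulr1 !mulrDl mul1r; have := mulr_ge0 (normr_ge0 (f 0)) (normr_ge0 x).
have := normr_ge0 x; lra.
Qed.

End euclidean_norm.

Section state_basis.
Context {R : realType} {n : nat}.
Notation S := (state R n).

Definition state_basis (k : 'I_n + 'I_n) : S := match k with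
  | inl i => (delta_mx i 0, 0)
  | inr i => (0, delta_mx i 0) end.

Definition state_basis_seq : seq S := [seq state_basis k | k <- enum {: 'I_n + 'I_n}].

Lemma norm_pair (x y : 'cV[R]_n) : `|(x, y) : S| = Num.max `|x| `|y|.
Proof. by []. Qed.

Lemma norm_fst (z : S) : `|z.1| <= `|z|.
Proof. by case: z => x y; rewrite norm_pair le_max lexx. Qed.

Lemma norm_snd (z : S) : `|z.2| <= `|z|.
Proof. by case: z => x y; rewrite norm_pair le_max lexx orbT. Qed.

Lemma norm_pair_le (x y : 'cV[R]_n) (k : R) : `|x| <= k -> `|y| <= k -> `|(x, y) : S| <= k.
Proof. by rewrite norm_pair ge_max => -> ->. Qed.

Lemma norm_delta (i : 'I_n) : `|delta_mx i 0 : 'cV[R]_n| <= 1.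
Proof.
apply: cV_norm_le => // k; rewrite mxE; case: (_ && _); rewrite ?normr1 ?normr0//.
Qed.

Lemma state_basis_norm k : `|state_basis k| <= 1.
Proof.
by case: k => i; apply: norm_pair_le; rewrite ?normr0 ?norm_delta.
Qed.

Lemma cV_span (x : 'cV[R]_n) : x = \sum_i x i 0 *: delta_mx i 0.
Proof.
rewrite {1}(matrix_sum_delta x); apply: eq_bigr => i _.
by rewrite big_ord1.
Qed.

Lemma fst_sum (I : Type) (s : seq I) (F : I -> S) : (\sum_(i <- s) F i).1 = \sum_(i <- s) (F i).1.
Proof. by elim: s => [|i s ih]; rewrite ?big_nil// !big_cons -ih. Qed.

Lemma snd_sum (I : Type) (s : seq I) (F : I -> S) : (\sum_(i <- s) F i).2 = \sum_(i <- s) (F i).2.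
Proof. by elim: s => [|i s ih]; rewrite ?big_nil// !big_cons -ih. Qed.

Lemma state_ext (z z' : S) : z.1 = z'.1 -> z.2 = z'.2 -> z = z'.
Proof. by case: z z' => x y [x' y'] /= -> ->. Qed.

Lemma state_span_fst (x : 'cV[R]_n) :
  ((x, 0) : S) = \sum_i x i 0 *: state_basis (inl i).
Proof.
apply: state_ext; rewrite /= ?fst_sum ?snd_sum; first exact: cV_span.
by rewrite big1// => i _; rewrite /= scaler0.
Qed.

Lemma state_span (z : S) :
  z = \sum_k (match k with inl i => z.1 i 0 | inr i => z.2 i 0 end) *: state_basis k.
Proof.
rewrite big_sumType/=.
have -> : \sum_(i < n) z.2 i 0 *: state_basis (inr i) = ((0, z.2) : S).
  apply/esym; apply: state_ext; rewrite /= ?fst_sum ?snd_sum; last exact: cV_span.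
  by rewrite big1// => i _; rewrite /= scaler0.
rewrite -state_span_fst; case: z => x y /=.
by apply: state_ext; rewrite /= ?addr0 ?add0r.
Qed.

Lemma compact_ball_cV (rho : R) : compact [set x : 'cV[R]_n | `|x| <= rho].
Proof.
have [r0|r0] := ltP rho 0.
  rewrite (_ : [set _ | _] = set0); first exact: compact0.
  by apply/seteqP; split=> // x /= h; have := le_lt_trans h r0; rewrite normr_lt0.
have c : compact [set v : 'rV[R]_n | forall i, `[- rho, rho]%classic (v 0 i)].
  by apply: (@rV_compact R n (fun=> `[- rho, rho]%classic)) => i; exact: segment_compact.
rewrite (_ : [set _ | _] = (@trmx R 1 n) @` [set v : 'rV[R]_n | forall i, `[- rho, rho]%classic (v 0 i)]).
  apply: continuous_compact => //; apply: continuous_subspaceT.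
  move=> v A [P nP PA]; exists (fun i j => P j i) => [i j|w wP].
    by have := nP j i; rewrite mxE.
  by apply: PA => i j; rewrite mxE; exact: wP.
apply/seteqP; split => [x /= xr|_ [v /= vr <-]].
  exists x^T; last by rewrite trmxK.
  by move=> i; rewrite mxE in_itv/= -ler_norml; apply: le_trans xr; exact: le_mx_norm.
apply: cV_norm_le => // i; rewrite mxE ler_norml.
by have := vr i; rewrite in_itv.
Qed.

Lemma compact_ball_state (rho : R) : compact [set z : S | `|z| <= rho].
Proof.
rewrite (_ : [set _ | _] = [set x : 'cV[R]_n | `|x| <= rho] `*` [set x : 'cV[R]_n | `|x| <= rho]).
  by apply: compact_setX; exact: compact_ball_cV.
by apply/seteqP; split => -[x y] /=; rewrite norm_pair ge_max => /andP.
Qed.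

End state_basis.

Section product_tests.
Context {R : realType} {n : nat}.
Notation S := (state R n).
Notation Q := (R * S)%type.
Variables (eta : R) (a : nat -> R -> R).
Hypothesis ka : smoothing_kernel eta a.
Notation E := (@state_basis_seq R n).

Let eb (k : option ('I_n + 'I_n)) : Q :=
  if k is Some k' then (0, state_basis k') else (1, (0, 0)).

Let norm_Q (t : R) (z : S) : `|(t, z) : Q| = Num.max `|t| `|z|.
Proof. by []. Qed.

Let eb1 k : `|eb k| <= 1.
Proof.
case: k => [k|] /=; rewrite norm_Q ge_max.
  by rewrite normr0 ler01 state_basis_norm.
by rewrite normr1 lexx (_ : (0, 0) = 0 :> S)// normr0 ler01.
Qed.

Let eb_span (v : Q) : exists c : option ('I_n + 'I_n) -> R, v = \sum_k c k *: eb k.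
Proof.
case: v => t z.
exists (fun k => if k is Some k' then match k' with inl i => z.1 i 0 | inr i => z.2 i 0 end else t).
rewrite (bigD1 None)//=.
rewrite (reindex_omap Some id) /=; last by case.
rewrite (eq_bigl xpredT); last by move=> k; rewrite eqxx.
have f1 (I : Type) (s : seq I) (F : I -> Q) : \sum_(i <- s) F i = (\sum_(i <- s) (F i).1, \sum_(i <- s) (F i).2).
  by elim: s => [|i s ih]; rewrite ?big_nil// !big_cons ih.
rewrite f1; congr pair => /=.
  by rewrite big1 ?addr0; [exact/esym/mulr1|move=> k _; rewrite scaler0].
by rewrite {1}(state_span z) (_ : t *: (0, 0) = 0 :> S) ?add0r// scaler0.
Qed.

Lemma state_basis_seqP k : state_basis k \in E.
Proof. by apply: map_f; rewrite mem_enum. Qed.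

Lemma state_basis_seq1 e : e \in E -> `|e| <= 1.
Proof. by move=> /mapP[k _ ->]; exact: state_basis_norm. Qed.

Variables (g : S -> R) (K M rho : R).
Hypotheses (K0 : 0 <= K) (gK : lip K g) (gM : bounded_by M g) (g0 : forall z, rho <= `|z| -> g z = 0).
Variables (T : R) (al : nat -> R -> R).
Hypothesis tal : time_test T al.

(** Products of a derivative of the time factor with a mollification of any order: the lists [L]
    vary only in their orders, so derivatives along the basis stay in the class. *)
Let Cl : set (Q -> R) := [set h | exists k L, unzip1 L = E /\
  h = fun q => al k q.1 * mollk a L g q.2].

Lemma mollk_outside L z : unzip1 L = E -> rho + eta *+ size E <= `|z| -> mollk a L g z = 0.
Proof.
move=> LE hz; have -> : mollk a L g z = 0; last by [].
apply: (mollk_zero ka); first by rewrite LE; exact: state_basis_seq1.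
have <- : size E = size L by rewrite -LE size_map.
move=> z' hz'; apply: g0; rewrite -(lerD2r (eta *+ size E)); apply: le_trans hz _.
rewrite -[z](subrK z'); apply: le_trans (ler_normD _ _) _.
by rewrite addrC lerD2l distrC.
Qed.

Let tensor_qd k i L : unzip1 L = E -> exists C : R, qd C (eb i)
  (fun q : Q => al k q.1 * mollk a L g q.2)
  (fun q : Q => al (if i is None then k.+1 else k) q.1 *
     mollk a (if i is Some j then bumpk L (state_basis j) else L) g q.2).
Proof.
move=> LE; case: i => [i|].
  have [A aA] := tt_bounded tal k; have A0 : 0 <= A := le_trans (normr_ge0 _) (aA 0).
  have [C C0 h] := @mollk_qd _ _ _ _ ka L (state_basis i) (ltac:(rewrite LE; exact: state_basis_seqP)).
  exists (A * (C * M)) => -[t z] s /=; rewrite scaler0 addr0 [s * _]mulrCA -!mulrBr normrM -mulrA.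
  by apply: ler_pM => //; exact: h gK gM z s.
have [A aA] := tt_taylor tal k; have [C C0 h] := mollk_bound ka L.
exists (A * (C * M)) => -[t z] s /=; rewrite (_ : s *: (0, 0) = 0 :> S); last by rewrite scaler0.
rewrite addr0 mulrA -!mulrBl normrM (_ : s *: 1 = s); last exact: mulr1.
rewrite mulrAC; apply: ler_pM => //; exact: h gK gM z.
Qed.

Lemma tensor_smooth L : unzip1 L = E -> smooth (fun q : Q => al 0 q.1 * mollk a L g q.2).
Proof.
move=> LE; apply: (@smooth_of_class _ _ _ eb Cl eb1 eb_span) => //; last by exists 0%N, L.
- move=> _ [k [L' [L'E ->]]].
  have [A aA] := tt_bounded tal k; have [B aB] := tt_lip tal k.
  have [C1 C10 h1] := mollk_lip ka L'; have [C2 C20 h2] := mollk_bound ka L'.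
  have A0 : 0 <= A := le_trans (normr_ge0 _) (aA 0).
  have B0 : 0 <= B by have := le_trans (normr_ge0 _) (aB 1 0); rewrite subr0 normr1 mulr1.
  have M0 : 0 <= C2 * M := le_trans (normr_ge0 _) (h2 g K M gK gM 0).
  exists (A * (C1 * K) + B * (C2 * M)) => -[t z] [t' z'] /=.
  have -> : al k t * mollk a L' g z - al k t' * mollk a L' g z' =
    al k t * (mollk a L' g z - mollk a L' g z') + (al k t - al k t') * mollk a L' g z'.
    by move: (mollk _ _ _ z) (mollk _ _ _ z') (al k t) (al k t') => *; ring.
  apply: le_trans (ler_normD _ _) _; rewrite !normrM mulrDl -!mulrA; apply: lerD.
    rewrite [C1 * (K * _)]mulrA; apply: ler_pM => //; apply: le_trans (h1 g K gK z z') _.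
    by rewrite ler_wpM2l ?mulr_ge0// norm_Q le_max lexx orbT.
  have q := h2 g K M gK gM z'.
  rewrite [C2 * (M * _)]mulrA [C2 * M * _]mulrC mulrA.
  apply: ler_pM => //; apply: le_trans (aB _ _) _; rewrite ler_wpM2l//.
  by rewrite norm_Q le_max lexx.
- move=> _ k [k' [L' [L'E ->]]]; have [C qC] := tensor_qd k' k L'E.
  exists (fun q => al (if k is None then k'.+1 else k') q.1 *
    mollk a (if k is Some i then bumpk L' (state_basis i) else L') g q.2), C; split => //.
  exists (if k is None then k'.+1 else k'), (if k is Some i then bumpk L' (state_basis i) else L').
  by split=> //; case: k {qC} => // k; rewrite unzip1_bumpk.
Qed.

Lemma tensor_test_function L : unzip1 L = E ->
  test_function T (fun q : Q => al 0 q.1 * mollk a L g q.2).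
Proof.
move=> LE; have [c [e [c0 eT sal]]] := tt_support tal.
pose B := `[c, e]%classic `*` [set z : S | `|z| <= rho + eta *+ size E].
have cB : compact B.
  apply: compact_setX; [exact: segment_compact|exact: compact_ball_state].
have clB : closed B by apply: compact_closed => //; exact: norm_hausdorff.
have sub : closure [set q : Q | al 0 q.1 * mollk a L g q.2 != 0] `<=` B.
  move=> q cq; apply: clB; move: q cq; apply: closure_subset => -[t z] /= nz.
  split; rewrite /= ?in_itv/=; first by apply: sal; apply: contraNneq nz => ->; rewrite mul0r.
  rewrite leNgt; apply: contraNN nz => /ltW h; apply/eqP.
  by rewrite (mollk_outside LE h) mulr0.
split; first exact: tensor_smooth.
  by apply: subclosed_compact sub => //; exact: closed_closure.
move=> [t z] /sub [/=]; rewrite in_itv/= => /andP[ct te] _; split=> //=.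
by rewrite in_itv/= (lt_le_trans c0 ct) (le_lt_trans te eT).
Qed.

Lemma tensor_dt L t z : unzip1 L = E ->
  dt (fun q : Q => al 0 q.1 * mollk a L g q.2) (t, z) = al 1 t * mollk a L g z.
Proof.
by move=> LE; have [C /(@qd_derive _ _ _ _ _ _ (t, z))[_]] := tensor_qd 0 None LE.
Qed.

Lemma tensor_grad L t z i : unzip1 L = E ->
  grad_x (fun q : Q => al 0 q.1 * mollk a L g q.2) (t, z) i 0 =
  al 0 t * mollk a (bumpk L (state_basis (inl i))) g z.
Proof.
move=> LE; rewrite mxE.
by have [C /(@qd_derive _ _ _ _ _ _ (t, z))[_]] := tensor_qd 0 (Some (inl i)) LE.
Qed.

End product_tests.

Section real_integrability.
Context d {T : measurableType d} {R : realType} (m : {measure set T -> \bar R}) (D : set T).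
Hypothesis mD : measurable D.

Lemma integrable_realZ (f : T -> R) (k : R) : m.-integrable D (EFin \o f) ->
  m.-integrable D (EFin \o (fun z => k * f z)).
Proof. by move=> fi; apply: (integrableZl mD k fi). Qed.

Lemma integrable_realD (f g : T -> R) : m.-integrable D (EFin \o f) ->
  m.-integrable D (EFin \o g) -> m.-integrable D (EFin \o (fun z => f z + g z)).
Proof. by move=> fi gi; apply: (integrableD mD fi gi). Qed.

Lemma integrable_real_sum (I : Type) (s : seq I) (F : I -> T -> R) :
  (forall i, m.-integrable D (EFin \o F i)) ->
  m.-integrable D (EFin \o (fun z => \sum_(i <- s) F i z)).
Proof.
move=> iF; elim: s => [|i s ih].
  rewrite (_ : _ \o _ = cst 0%E); first exact: integrable0.
  by apply/funext => z /=; rewrite big_nil.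
rewrite (_ : _ \o _ = EFin \o (fun z => F i z + \sum_(i <- s) F i z)); last first.
  by apply/funext => z /=; rewrite big_cons.
exact: integrable_realD.
Qed.

End real_integrability.

Section weak_formula.
Context {R : realType} {n p : nat}.
Notation S := (state R n).
Notation E := (@state_basis_seq R n).
Variables (T Lf : R) (Y : set 'cV[R]_n) (f : 'cV[R]_n -> 'cV[R]_p).
Variables (mu : R -> probability (borel S) R) (theta : R -> 'M[R]_(n, p)).
Hypotheses (T0 : 0 < T) (cY : compact Y) (Lf0 : 0 <= Lf).
Hypothesis fL : forall x x', `|f x - f x'| <= Lf * `|x - x'|.
Hypothesis fG : forall x, `|f x| <= Lf * (1 + `|x|).
Hypothesis ith : forall i j, itg 0 T (fun r => theta r i j).
Hypothesis sol : solves_continuity T Y (fun t x => velocity f x (theta t)) mu.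

Lemma closed_RdY : closed (RdY Y : set S).
Proof.
have cl : closed Y by apply: compact_closed => //; exact: norm_hausdorff.
rewrite (_ : RdY Y = snd @^-1` Y); last by apply/seteqP; split=> z //= [].
by apply: closed_comp => // z _; exact: cvg_snd.
Qed.

Lemma measurable_RdY : measurable (RdY Y : set (borel S)).
Proof. exact: closed_state_measurable closed_RdY. Qed.

Lemma solution_mass r : 0 <= r <= T -> mu r (RdY Y) = 1%E.
Proof. by move=> rT; case: sol => -[h _] _; apply: h; rewrite in_itv. Qed.

Lemma continuous_expectation_integrable phi (M r : R) : continuous phi -> bounded_by M phi ->
  (mu r).-integrable (RdY Y) (EFin \o phi).
Proof.
move=> cphi phiM; apply: (@bounded_integrable _ _ _ _ _ measurable_RdY _ M) => //.
by apply: measurable_funTS; exact: continuous_state_measurable.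
Qed.

Lemma expectation_continuous phi (M : R) : continuous phi -> bounded_by M phi ->
  {within `[0, T], continuous (fun t => Ex (mu t) (RdY Y) phi)}.
Proof.
move=> cphi phiM; case: sol => -[_ h] _; apply: h; last by exists M => z _; exact: phiM.
exact: continuous_subspaceT.
Qed.

Lemma continuous_f_coord j : continuous (fun z : S => f z.1 j 0).
Proof.
apply: (@lip_continuous _ _ Lf) => z z'.
have -> : f z.1 j 0 - f z'.1 j 0 = (f z.1 - f z'.1) j 0 by rewrite !mxE.
apply: le_trans (le_mx_norm _ _ _) _; apply: le_trans (fL _ _) _.
by rewrite ler_wpM2l//; exact: (norm_fst (z - z')).
Qed.

Variables (eta : R) (a : nat -> R -> R).
Hypothesis ka : smoothing_kernel eta a.

Section one_test_function.
Variables (g : S -> R) (K M rho : R).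
Hypotheses (K0 : 0 <= K) (gK : lip K g) (gM : bounded_by M g).
Hypothesis g0 : forall z, rho <= `|z| -> g z = 0.

(** The coefficient of [theta i j] when the gradient of the mollified function is paired with the
    velocity. *)
Definition flux L (i : 'I_n) (j : 'I_p) (z : S) : R :=
  mollk a (bumpk L (state_basis (inl i))) g z * f z.1 j 0.

Lemma flux_continuous L i j : continuous (flux L i j).
Proof.
move=> z; apply: cvgM; last exact: continuous_f_coord.
exact: (@mollk_continuous _ _ _ _ ka (bumpk L (state_basis (inl i))) g K gK z).
Qed.

Lemma flux_bounded L i j : unzip1 L = E -> exists C : R, bounded_by C (flux L i j).
Proof.
move=> LE; have [C C0 h] := mollk_bound ka (bumpk L (state_basis (inl i))).
have LE' : unzip1 (bumpk L (state_basis (inl i))) = E by rewrite unzip1_bumpk.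
exists (C * M * (Lf * (1 + `|rho + eta *+ size E|))) => z; rewrite /flux normrM.
have [hz|hz] := leP (rho + eta *+ size E) `|z|.
  rewrite (mollk_outside ka g0 LE' hz) normr0 mul0r.
  by rewrite !mulr_ge0// ?addr_ge0// (le_trans _ (gM 0)).
apply: ler_pM => //; first exact: h gK gM z.
apply: le_trans (le_mx_norm _ _ _) _; apply: le_trans (fG _) _.
rewrite ler_wpM2l// lerD2l; apply: le_trans (norm_fst z) _.
by apply: le_trans (ltW hz) _; exact: ler_norm.
Qed.

(** Testing with a time factor times the mollified [g] says that its expectation has the integrand
    on the right as weak derivative in time. Narrow continuity of [mu] provides the continuity
    required to integrate it. *)
Lemma weak_formula L s t : unzip1 L = E -> 0 <= s -> s <= t -> t <= T ->
  Ex (mu t) (RdY Y) (mollk a L g) - Ex (mu s) (RdY Y) (mollk a L g) =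
  Int s t (fun r => \sum_i \sum_j theta r i j * Ex (mu r) (RdY Y) (flux L i j)).
Proof.
move=> LE; have [C C0 hC] := mollk_bound ka L.
have bh := hC g K M gK gM; have ch := @mollk_continuous _ _ _ _ ka L g K gK.
have mD := measurable_RdY.
have imol r := continuous_expectation_integrable r ch bh.
have iflux i j r : (mu r).-integrable (RdY Y) (EFin \o flux L i j).
  have [B hB] := flux_bounded i j LE.
  exact: (continuous_expectation_integrable r (@flux_continuous L i j) hB).
pose m r := Ex (mu r) (RdY Y) (mollk a L g).
pose P i j r := Ex (mu r) (RdY Y) (flux L i j).
have cP i j : {within `[0, T], continuous (P i j)}.
  have [B hB] := flux_bounded i j LE.
  exact: (expectation_continuous (@flux_continuous L i j) hB).
have iG : itg 0 T (fun r => \sum_i \sum_j theta r i j * P i j r).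
  apply: itg_sum => i; apply: itg_sum => j.
  have [B hB] := flux_bounded i j LE.
  apply: (@itgM _ _ _ _ _ B) => //; first exact: within_continuous_measurable.
  move=> r rT; apply: Ex_norm_le => //; first exact: solution_mass.
  by apply: measurable_funTS; apply: continuous_state_measurable; exact: flux_continuous.
apply: (@weak_derivative_FTC _ m) => //; first exact: expectation_continuous ch bh.
move=> al tal; case: sol => _ /(_ _ (tensor_test_function ka K0 gK gM g0 tal LE)) H.
rewrite Int.unlock /Rintegral.
rewrite [X in fine X](_ : _ = 0%E)//; rewrite -[RHS]H; apply: eq_integral => r _.
have isum i : (mu r).-integrable (RdY Y) (EFin \o (fun z => \sum_j theta r i j * flux L i j z)).
  apply: (@integrable_real_sum _ _ _ (mu r) _ mD _ _ (fun j z => theta r i j * flux L i j z)) => j.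
  exact: (integrable_realZ mD _ (iflux i j r)).
have isum2 : (mu r).-integrable (RdY Y)
    (EFin \o (fun z => \sum_i \sum_j theta r i j * flux L i j z)).
  exact: (@integrable_real_sum _ _ _ (mu r) _ mD _ _ (fun i z => \sum_j theta r i j * flux L i j z)).
have eqn z : dt (fun q : R * S => al 0 q.1 * mollk a L g q.2) (r, z) +
    \sum_i grad_x (fun q : R * S => al 0 q.1 * mollk a L g q.2) (r, z) i 0 *
      velocity f z.1 (theta r) i 0 =
    al 1 r * mollk a L g z + al 0 r * \sum_i \sum_j theta r i j * flux L i j z.
  rewrite (tensor_dt ka gK gM tal _ _ LE); congr (_ + _); rewrite mulr_sumr.
  apply: eq_bigr => i _; rewrite (tensor_grad ka gK gM tal _ _ _ LE) !mxE -mulrA; congr (_ * _).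
  rewrite mulr_sumr; apply: eq_bigr => j _; rewrite /flux mulrCA; congr (_ * _).
transitivity (\int[mu r]_(z in RdY Y) (al 1%N r * mollk a L g z +
    al 0%N r * \sum_i \sum_j theta r i j * flux L i j z)%:E)%E; last first.
  by apply: eq_integral => z _; rewrite eqn.
have i1 := integrable_realZ mD (al 1 r) (imol r).
have i2 := integrable_realZ mD (al 0 r) isum2.
rewrite Ex_EFin//; last exact: (integrable_realD mD i1 i2).
rewrite (ExD mD i1 i2).
rewrite !ExZ// Ex_sum//; congr (_ * _ + _ * _)%:E; apply: eq_bigr => i _.
rewrite Ex_sum//; last by move=> j; exact: (integrable_realZ mD _ (iflux i j r)).
by apply: eq_bigr => j _; rewrite ExZ.
Qed.

End one_test_function.

End weak_formula.

(** * The flow of a control *)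

Section measurability_from_coordinates.
Context {R : realType} d (T : measurableType d) (D : set T) (mD : measurable D).

Lemma measurable_norm_mx m n (X : T -> 'M[R]_(m, n)) :
  (forall i j, measurable_fun D (fun t => X t i j)) -> measurable_fun D (fun t => `|X t|).
Proof.
move=> mX; apply: (measurable_ext (f := fun t => \big[Num.max/0]_ij `|X t ij.1 ij.2|)).
  by move=> t; rewrite mx_norm_bigmax.
elim: (index_enum _) => [|[i j] s ih].
  by apply: (measurable_ext (f := fun=> (0 : R))) => [t|]; [rewrite big_nil|exact: measurable_cst].
apply: (measurable_ext (f := (fun t => `|X t i j|) \max
   (fun t => \big[Num.max/0]_(ij <- s) `|X t ij.1 ij.2|))).
  by move=> t; rewrite big_cons.
by apply: measurable_maxr => //; apply: measurableT_comp => //; exact: mX.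
Qed.

Lemma rational_matrix m n (A : 'M[R]_(m, n)) (e : R) : 0 < e ->
  exists Q : 'M[rat]_(m, n), `|A - map_mx ratr Q| <= e.
Proof.
move=> e0; have H ij : exists q : rat, `|A ij.1 ij.2 - ratr q| <= e.
  have /rat_in_itvoo[q] : A ij.1 ij.2 < A ij.1 ij.2 + e by rewrite ltrDl.
  rewrite in_itv/= => /andP[h1 h2]; exists q.
  by rewrite distrC ger0_norm ?subr_ge0 ?(ltW h1)// lerBlDl ltW.
have [Q HQ] := choice H; exists (\matrix_(i, j) Q (i, j)).
by apply: mx_norm_le => [|i j]; [exact: ltW|rewrite !mxE; exact: (HQ (i, j))].
Qed.

(** An open set of matrices is a countable union of balls with rational centres and radii
    [1 / (k + 1)], and the norm is measurable from the coordinates; [F] keeps only the balls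
    contained in [U]. *)
Lemma measurable_preimage_open m n (X : T -> 'M[R]_(m, n)) (U : set 'M[R]_(m, n)) :
  (forall i j, measurable_fun D (fun t => X t i j)) -> open U -> measurable (D `&` X @^-1` U).
Proof.
move=> mX oU.
pose F (qk : 'M[rat]_(m, n) * nat) : set T :=
  if `[< forall A, `|A - map_mx ratr qk.1| < qk.2.+1%:R^-1 -> U A >]
  then D `&` [set t | `|X t - map_mx ratr qk.1| < qk.2.+1%:R^-1] else set0.
have -> : D `&` X @^-1` U = \bigcup_qk F qk.
  apply/seteqP; split=> [t [Dt Ut]|t [[q k] _]]; last first.
    by rewrite /F; case: asboolP => // h /= [Dt /h].
  have /nbhs_ballP[e /= e0 eU] : nbhs (X t) U by exact: open_nbhs_nbhs.
  have [k kE] : exists k : nat, k.+1%:R^-1 < e / 2.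
    have [N _ HN] := near_infty_natSinv_lt (PosNum (divr_gt0 e0 (ltr0n R 2))).
    by exists N; apply: (HN N) => /=.
  have k0 : (0 : R) < k.+1%:R^-1 / 2 by rewrite divr_gt0.
  have [q hq] := rational_matrix (X t) k0; exists (q, k) => //; rewrite /F asboolT /=.
    split=> //=; apply: le_lt_trans hq _; rewrite ltr_pdivrMr// mulr_natr mulr2n ltrDl.
    by rewrite invr_gt0.
  move=> A hA; apply: eU; rewrite -ball_normE /ball_/=.
  apply: le_lt_trans (ler_distD (map_mx ratr q) _ _) _.
  rewrite (splitr e); apply: ler_ltD; last by rewrite distrC (lt_trans hA).
  apply: le_trans hq _; apply: ltW; apply: le_lt_trans kE.
  by rewrite ler_pdivrMr// ler_peMr// ?ler1n// invr_ge0.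
apply: countable_bigcupT_measurable => //.
move=> [q k]; rewrite /F; case: asboolP => // _ /=.
have mN : measurable_fun D (fun t => `|X t - map_mx ratr q|).
  apply: measurable_norm_mx => i j; apply: (measurable_ext (f := fun t => X t i j - ratr (q i j))).
    by move=> t; rewrite !mxE.
  by apply: measurable_funB.
rewrite [X in D `&` X](_ : _ = (fun t => `|X t - map_mx ratr q|) @^-1` `]-oo, k.+1%:R^-1[%classic).
  exact: mN.
by apply/seteqP; split=> t /=; rewrite in_itv.
Qed.

Lemma measurable_borel_mx m n (X : T -> 'M[R]_(m, n)) :
  (forall i j, measurable_fun D (fun t => X t i j)) ->
  measurable_fun D (X : T -> borel 'M[R]_(m, n)).
Proof.
move=> mX; apply: (@measurability _ _ _ (borel 'M[R]_(m, n)) _ _ (@open _)) => // _ [U oU <-].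
exact: measurable_preimage_open.
Qed.

Lemma measurable_continuous_coord m n (X : T -> 'M[R]_(m, n)) (phi : 'M[R]_(m, n) -> R) :
  (forall i j, measurable_fun D (fun t => X t i j)) -> continuous phi ->
  measurable_fun D (fun t => phi (X t)).
Proof.
move=> mX cphi; apply: (measurability _ (RGenOpens.measurableE R)) => // _ [U [a [b ->]] <-].
apply: (@measurable_preimage_open _ _ X (phi @^-1` `]a, b[)) => //.
by apply: open_comp => // x _; exact: cphi.
Qed.

End measurability_from_coordinates.

Section linear_control_field.
Context {R : realType} {n p : nat}.
Variables (T Lf : R) (f : 'cV[R]_n -> 'cV[R]_p) (theta : R -> 'M[R]_(n, p)).
Hypotheses (Lf1 : 1 <= Lf).
Hypothesis fL : forall x x', `|f x - f x'| <= Lf * `|x - x'|.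
Hypothesis fG : forall x, `|f x| <= Lf * (1 + `|x|).
Hypothesis ith : forall i j, itg 0 T (fun r => theta r i j).

Definition field_weight (r : R) : R := Lf * \sum_i \sum_j `|theta r i j|.

Let Lf0 : 0 <= Lf. Proof. exact: le_trans ler01 Lf1. Qed.

Lemma field_weight_ge0 r : 0 <= field_weight r.
Proof. by rewrite mulr_ge0// sumr_ge0// => i _; apply: sumr_ge0. Qed.

Lemma itg_field_weight : itg 0 T field_weight.
Proof. by apply: itgZ; apply: itg_sum => i; apply: itg_sum => j; exact: itg_norm. Qed.

Lemma sum_le_field_weight r : \sum_i \sum_j `|theta r i j| <= field_weight r.
Proof. by rewrite ler_peMl// sumr_ge0// => i _; apply: sumr_ge0. Qed.

Lemma norm_mul_le (A : 'M[R]_(n, p)) (x : 'cV[R]_p) :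
  `|A *m x| <= (\sum_i \sum_j `|A i j|) * `|x|.
Proof.
have s0 (i : 'I_n) : 0 <= \sum_j `|A i j| by exact: sumr_ge0.
apply: cV_norm_le => [|i]; first by rewrite mulr_ge0// sumr_ge0.
rewrite mxE; apply: (@le_trans _ _ ((\sum_j `|A i j|) * `|x|)).
  rewrite mulr_suml; apply: le_trans (ler_norm_sum _ _ _) _; apply: ler_sum => j _.
  by rewrite normrM ler_wpM2l// le_mx_norm.
by rewrite ler_wpM2r// [leRHS](bigD1 i)//= lerDl sumr_ge0.
Qed.

Lemma field_caratheodory : caratheodory 0 T (fun r x => theta r *m f x) field_weight.
Proof.
split.
- exact: itg_field_weight.
- by move=> r _; exact: field_weight_ge0.
- move=> r x y _; rewrite -mulmxBr; apply: le_trans (norm_mul_le _ _) _.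
  rewrite /field_weight [Lf * _]mulrC -mulrA ler_wpM2l// sumr_ge0// => i _; exact: sumr_ge0.
- move=> r x _; apply: le_trans (norm_mul_le _ _) _.
  rewrite /field_weight [Lf * _]mulrC -mulrA ler_wpM2l// sumr_ge0// => i _; exact: sumr_ge0.
- move=> s t X s0 st tT mX i.
  apply: (measurable_ext (f := fun r => \sum_j theta r i j * f (X r) j 0)).
    by move=> r; rewrite mxE.
  apply: measurable_sum => j; apply: measurable_funM.
    by apply: itg_measurable; exact: itgS (ith i j).
  apply: (@measurable_continuous_coord _ _ _ _ _ _ _ X (fun x => f x j 0)) => //.
    by move=> k l; rewrite (ord1 l); exact: mX.
  apply: (@lip_continuous _ _ Lf) => x x'.
  have -> : f x j 0 - f x' j 0 = (f x - f x') j 0 by rewrite !mxE.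
  exact: le_trans (le_mx_norm _ _ _) (fL _ _).
Qed.

End linear_control_field.

Section flow.
Context {R : realType} {n : nat}.
Notation V := 'cV[R]_n.
Variables (T : R) (F : R -> V -> V) (w : R -> R) (Phi : R -> V -> R -> V).
Hypothesis cF : caratheodory 0 T F w.
Hypothesis sPhi : forall s x, 0 <= s <= T -> solution s T F x (Phi s x).
Let K := expR (2 * Int 0 T w).

Lemma flow_exists : exists Psi : R -> V -> R -> V,
  forall s x, 0 <= s <= T -> solution s T F x (Psi s x).
Proof.
have H (sx : R * V) : exists X, 0 <= sx.1 <= T -> solution sx.1 T F sx.2 X.
  have [/andP[s0 sT]|h] := boolP (0 <= sx.1 <= T); last by exists (fun=> 0).
  by have [X sX] := solution_exists sT (caratheodoryS s0 (lexx T) cF) sx.2; exists X.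
by have [G HG] := choice H; exists (fun s x => G (s, x)) => s x; exact: (HG (s, x)).
Qed.

Lemma solutionS a b c x X : b <= c -> solution a c F x X -> solution a b F x X.
Proof.
move=> bc [mX [M XM] eX].
have inb r : a <= r <= b -> a <= r <= c by move=> /andP[-> rb]; exact: le_trans rb bc.
split.
- by move=> i; apply: measurable_funS (mX i) => // q /=; rewrite !in_itv/=; exact: inb.
- by exists M => r /inb; exact: XM.
- by move=> r /inb; exact: eX.
Qed.

Section times.
Variables s t : R.
Hypotheses (s0 : 0 <= s) (st : s <= t) (tT : t <= T).

Let sT : 0 <= s <= T. Proof. by rewrite s0 (le_trans st). Qed.
Let t0 : 0 <= t. Proof. exact: le_trans s0 st. Qed.
Let sol x : solution s t F x (Phi s x). Proof. exact: solutionS (sPhi x sT). Qed.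
Let cFst : caratheodory s t F w. Proof. exact: caratheodoryS s0 tT cF. Qed.
Let tst : s <= t <= t. Proof. by rewrite st lexx. Qed.

Lemma weight_le : Int s t w <= Int 0 T w.
Proof.
have iw := car_itg cF; have T0 : 0 <= T := le_trans t0 tT.
rewrite (@Int_split _ 0 s T w)//; [|exact: le_trans tT].
rewrite (@Int_split _ s t T w)//; last exact: itgS iw.
have w0 := car_w0 cF.
have p1 : 0 <= Int 0 s w.
  by apply: Int_ge0 => r /andP[r0 rs]; apply: w0; rewrite r0 (le_trans rs)// (le_trans st).
have p2 : 0 <= Int t T w.
  by apply: Int_ge0 => r /andP[tr rT]; apply: w0; rewrite rT (le_trans t0).
by rewrite addrCA lerDl addr_ge0.
Qed.

Lemma weight_ge0 : 0 <= Int s t w.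
Proof. by apply: Int_ge0 => r rst; exact: (car_w0 cFst). Qed.

Let Kst : expR (2 * Int s t w) <= K.
Proof. by rewrite ler_expR ler_wpM2l// weight_le. Qed.

Lemma flow_start x : Phi s x s = x.
Proof. exact: solution_start (sol x). Qed.

Lemma flow_lip x y : `|Phi s x t - Phi s y t| <= 2 * K * `|x - y|.
Proof.
apply: le_trans (solution_lipschitz st cFst (sol x) (sol y) tst) _.
by rewrite ler_wpM2r// ler_wpM2l.
Qed.

Lemma flow_bound x : 1 + `|Phi s x t| <= 2 * (1 + `|x|) * K.
Proof.
apply: le_trans (solution_bound st cFst (sol x) tst) _.
by rewrite ler_wpM2l// mulr_ge0// addr_ge0.
Qed.

Lemma flow_start_bound x : 1 + `|x| <= 2 * (1 + `|Phi s x t|) * K.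
Proof.
apply: le_trans (solution_start_bound st cFst (sol x)) _.
by rewrite ler_wpM2l// mulr_ge0// addr_ge0.
Qed.

End times.

Lemma flow_increment s t x : 0 <= s -> s <= t -> t <= T ->
  `|Phi s x t - x| <= 2 * (1 + `|x|) * K * Int s t w.
Proof.
move=> s0 st tT.
have sT : 0 <= s <= T by rewrite s0 (le_trans st).
have cFs := caratheodoryS s0 tT cF.
rewrite -[X in _ - X](flow_start s0 st tT x).
have -> : 2 * (1 + `|x|) * K = 1 + (2 * (1 + `|x|) * K - 1) by rewrite [RHS]addrC subrK.
apply: (solution_Int_norm cFs (solutionS tT (sPhi x sT))) => // r /andP[sr rt].
by rewrite lerBrDl flow_bound// (le_trans rt).
Qed.

(** Uniqueness: both sides solve the equation from the same point at time [t], and the Lipschitz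
    dependence on that point makes their distance 0. *)
Lemma flow_semigroup s t u x : 0 <= s -> s <= t -> t <= u -> u <= T ->
  Phi s x u = Phi t (Phi s x t) u.
Proof.
move=> s0 st tu uT; have tT := le_trans tu uT; have t0 := le_trans s0 st.
have sT : 0 <= s <= T by rewrite s0 (le_trans st).
have stT : s <= t <= T by rewrite st.
have t0T : 0 <= t <= T by rewrite t0.
have cFs := caratheodoryS s0 (lexx T) cF; have cFt := caratheodoryS t0 (lexx T) cF.
have h1 := solution_restart cFs stT (sPhi x sT).
have tuT : t <= u <= T by rewrite tu.
have := solution_lipschitz tT cFt h1 (sPhi (Phi s x t) t0T) tuT.
by rewrite subrr normr0 mulr0 normr_le0 subr_eq0 => /eqP.
Qed.

End flow.

Section linear_flow.
Context {R : realType} {n p : nat}.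
Notation V := 'cV[R]_n.
Variables (T Lf : R) (f : 'cV[R]_n -> 'cV[R]_p) (theta : R -> 'M[R]_(n, p)).
Variable Phi : R -> V -> R -> V.
Hypotheses (Lf1 : 1 <= Lf).
Hypothesis fL : forall x x', `|f x - f x'| <= Lf * `|x - x'|.
Hypothesis fG : forall x, `|f x| <= Lf * (1 + `|x|).
Hypothesis ith : forall i j, itg 0 T (fun r => theta r i j).
Hypothesis sPhi : forall s x, 0 <= s <= T ->
  solution s T (fun r x => theta r *m f x) x (Phi s x).
Let w := field_weight Lf theta.
Let K := expR (2 * Int 0 T w).
Let cF := field_caratheodory Lf1 fL fG ith.

(** The integral of the control, not divided by the length [t - s]: applied to [f x], it is the
    displacement over [s, t] to first order. *)
Definition mean_control (s t : R) : 'M[R]_(n, p) := \matrix_(i, j) Int s t (fun r => theta r i j).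

Lemma mean_control_norm s t : 0 <= s -> s <= t -> t <= T ->
  Lf * \sum_i \sum_j `|mean_control s t i j| <= Int s t w.
Proof.
move=> s0 st tT; have it i j : itg s t (fun r => theta r i j) by exact: itgS (ith i j).
rewrite /w /field_weight IntZ; last first.
  by apply: itg_sum => i; apply: itg_sum => j; exact: itg_norm.
rewrite ler_wpM2l ?(le_trans ler01)// Int_sum; last first.
  by move=> i; apply: itg_sum => j; exact: itg_norm.
apply: ler_sum => i _; rewrite Int_sum; last by move=> j; exact: itg_norm.
by apply: ler_sum => j _; rewrite mxE; apply: Int_norm => //; exact: itg_norm.
Qed.

(** The field may be frozen at a point [x'] other than the start. This freedom lets one
    displacement, computed at the centre of an averaging ball, serve all points of the ball. *)
Lemma flow_taylor s t x x' : 0 <= s -> s <= t -> t <= T ->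
  `|Phi s x t - x - mean_control s t *m f x'| <=
  (2 * (1 + `|x|) * K * Int s t w + `|x - x'|) * Int s t w.
Proof.
move=> s0 st tT; have sT : 0 <= s <= T by rewrite s0 (le_trans st).
have it i j : itg s t (fun r => theta r i j) by exact: itgS (ith i j).
have [mX [M XM] eX] := solutionS tT (sPhi x sT).
have cFst := caratheodoryS s0 tT cF.
have iw := car_itg cFst; have w0 := car_w0 cFst.
have mfX j : measurable_fun `[s, t] (fun r => f (Phi s x r) j 0).
  apply: (@measurable_continuous_coord _ _ _ _ _ _ _ (Phi s x) (fun x => f x j 0)) => //.
    by move=> k l; rewrite (ord1 l); exact: mX.
  apply: (@lip_continuous _ _ Lf) => y y'.
  have -> : f y j 0 - f y' j 0 = (f y - f y') j 0 by rewrite !mxE.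
  exact: le_trans (le_mx_norm _ _ _) (fL _ _).
have ifX i j : itg s t (fun r => theta r i j * f (Phi s x r) j 0).
  apply: (@itgM _ _ _ _ _ (Lf * (1 + M))) => // r rst.
  apply: le_trans (le_mx_norm _ _ _) _; apply: le_trans (fG _) _.
  by rewrite ler_wpM2l ?(le_trans ler01)// lerD2l; exact: XM.
have iM c : itg s t (fun r => c * w r) by exact: itgZ.
set c := 2 * (1 + `|x|) * K * Int s t w + `|x - x'|.
have -> : Phi s x t - x - mean_control s t *m f x' =
    VInt s t (fun r => theta r *m (f (Phi s x r) - f x')).
  rewrite {1}eX; last by rewrite st lexx.
  rewrite [x + _]addrC addrK; apply/colP => i; rewrite !mxE.
  rewrite (@Int_eq _ _ _ (fun r => (theta r *m f (Phi s x r)) i 0)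
    (fun r => \sum_j theta r i j * f (Phi s x r) j 0)); last by move=> r _; rewrite mxE.
  rewrite Int_sum//.
  rewrite (@Int_eq _ _ _ (fun r => (theta r *m (f (Phi s x r) - f x')) i 0)
    (fun r => \sum_j (theta r i j * f (Phi s x r) j 0 - f x' j 0 * theta r i j))); last first.
    by move=> r _; rewrite mxE; apply: eq_bigr => j _; rewrite !mxE mulrBr [f x' j 0 * _]mulrC.
  rewrite Int_sum; last by move=> j; apply: itgB => //; exact: itgZ.
  rewrite -sumrB; apply: eq_bigr => j _; rewrite IntB//; last exact: itgZ.
  by rewrite IntZ// mxE [_ * f x' j 0]mulrC.
rewrite -IntZ//; apply: VInt_norm => //.
  move=> i; apply: (measurable_ext (f := fun r => \sum_j theta r i j * (f (Phi s x r) j 0 - f x' j 0))).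
    by move=> r; rewrite mxE; apply: eq_bigr => j _; rewrite !mxE.
  apply: measurable_sum => j; apply: measurable_funM; first exact: itg_measurable.
  by apply: measurable_funB.
move=> r /andP[sr rt]; apply: le_trans (norm_mul_le _ _) _.
have s1 : 0 <= \sum_i \sum_j `|theta r i j| by apply: sumr_ge0 => i _; exact: sumr_ge0.
apply: (@le_trans _ _ ((\sum_i \sum_j `|theta r i j|) * (Lf * `|Phi s x r - x'|))).
  by rewrite ler_wpM2l.
rewrite mulrA [_ * Lf]mulrC -/(field_weight Lf theta r) mulrC ler_wpM2r ?w0 ?sr//.
rewrite -(subrK x (Phi s x r)) -addrA; apply: le_trans (ler_normD _ _) _.
rewrite lerD2r; apply: le_trans (flow_increment cF sPhi x s0 sr (le_trans rt tT)) _.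
apply: ler_wpM2l; first by rewrite !mulr_ge0// ?addr_ge0// expR_ge0.
exact: (Int_nonneg_le w0).
Qed.

End linear_flow.

Ltac nonneg := repeat first [done | apply: mulr_ge0 | apply: addr_ge0 | apply: exprn_ge0 |
  apply: sumr_ge0 => ? _].

(** * Uniqueness for the continuity equation *)

Section compactly_supported_lipschitz.
Context {R : realType} {U : normedModType R}.
Implicit Types (g h D : U -> R) (z : U).

Definition compactly_lip (K M rho : R) g :=
  [/\ lip K g, bounded_by M g & forall z, rho <= `|z| -> g z = 0].

(** [h] need be bounded only where [D] lives: either one of the two points lies in the ball, and the
    roles are symmetric, or both products vanish. *)
Lemma lip_product D h (KD Kh C B r : R) : 0 <= C -> 0 <= KD -> 0 <= Kh -> 0 <= B ->
  lip KD D -> lip Kh h -> bounded_by C D -> (forall z, r <= `|z| -> D z = 0) ->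
  (forall z, `|z| <= r -> `|h z| <= B) -> lip (C * Kh + KD * B) (fun z => D z * h z).
Proof.
move=> C0 KD0 Kh0 B0 DK hK DC Dr hB z z'.
have key x y : `|x| <= r -> `|D x * h x - D y * h y| <= (C * Kh + KD * B) * `|x - y|.
  move=> xr; have -> : D x * h x - D y * h y = D y * (h x - h y) + (D x - D y) * h x.
    by rewrite mulrBr mulrBl [X in _ = X]addrC addrACA subrr addr0 || ring.
  apply: le_trans (ler_normD _ _) _; rewrite !normrM mulrDl -mulrA; apply: lerD.
    by apply: ler_pM => //; exact: hK.
  by rewrite mulrAC; apply: ler_pM => //; exact: hB.
have [zr|/ltW zr] := leP `|z| r; first exact: key.
have [zr'|/ltW zr'] := leP `|z'| r; first by rewrite distrC [`|z - z'|]distrC; exact: key.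
rewrite !Dr// !mul0r subr0 normr0 mulr_ge0// addr_ge0// mulr_ge0//.
Qed.

End compactly_supported_lipschitz.

Section flux_estimates.
Context {R : realType} {n p : nat}.
Notation S := (state R n).
Notation E := (@state_basis_seq R n).
Variables (Lf : R) (f : 'cV[R]_n -> 'cV[R]_p).
Hypotheses (Lf0 : 0 <= Lf).
Hypothesis fL : forall x x', `|f x - f x'| <= Lf * `|x - x'|.
Hypothesis fG : forall x, `|f x| <= Lf * (1 + `|x|).
Variables (eta : R) (a : nat -> R -> R).
Hypothesis ka : smoothing_kernel eta a.

(** The constant depends on the class only and not on [g]: it will serve the whole family of
    transported functions. *)
Lemma flux_class (K M rho : R) L : 0 <= K -> 0 <= M -> unzip1 L = E ->
  exists2 C : R, 0 <= C & forall g i j, compactly_lip K M rho g ->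
    bounded_by C (flux f a g L i j) /\ lip C (flux f a g L i j).
Proof.
move=> K0 M0 LE; pose L' (i : 'I_n) := bumpk L (state_basis (inl i)).
have LE' i : unzip1 (L' i) = E by rewrite unzip1_bumpk.
have H1 i : exists C : R, 0 <= C /\ forall (g : S -> R) K, lip K g -> lip (C * K) (mollk a (L' i) g).
  by have [C C0 h] := mollk_lip ka (L' i); exists C.
have H2 i : exists C : R, 0 <= C /\ forall (g : S -> R) K M,
    lip K g -> bounded_by M g -> bounded_by (C * M) (mollk a (L' i) g).
  by have [C C0 h] := mollk_bound ka (L' i); exists C.
have [C1 HC1] := choice H1; have [C2 HC2] := choice H2.
pose r := rho + eta *+ size E; pose B := Lf * (1 + `|r|).
have B0 : 0 <= B by rewrite mulr_ge0// addr_ge0.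
pose c i := C2 i * M * B + (C2 i * M * Lf + C1 i * K * B).
have c10 i : 0 <= C2 i * M * B by rewrite !mulr_ge0//; case: (HC2 i).
have c20 i : 0 <= C2 i * M * Lf + C1 i * K * B.
  by rewrite addr_ge0// !mulr_ge0//; [case: (HC2 i)|case: (HC1 i)].
have c0 i : 0 <= c i by exact: addr_ge0.
have cle i : c i <= \sum_i c i by rewrite (bigD1 i)//= lerDl sumr_ge0.
exists (\sum_i c i) => [|g i j [gK gM g0]]; first exact: sumr_ge0.
have [C10 /(_ g K gK) h1] := HC1 i; have [C20 /(_ g K M gK gM) h2] := HC2 i.
have out z : r <= `|z| -> mollk a (L' i) g z = 0 by exact: mollk_outside.
have fj (z : S) : `|z| <= r -> `|f z.1 j 0| <= B.
  move=> zr; apply: le_trans (le_mx_norm _ _ _) _; apply: le_trans (fG _) _.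
  rewrite ler_wpM2l// lerD2l; apply: le_trans (norm_fst z) _.
  by apply: le_trans zr _; exact: ler_norm.
split.
  move=> z; apply: le_trans (cle i); apply: (@le_trans _ _ (C2 i * M * B)); last by rewrite lerDl.
  rewrite /flux -/(L' i) normrM; have [/out ->|/ltW zr] := leP r `|z|.
    by rewrite normr0 mul0r.
  by apply: ler_pM => //; exact: fj.
move=> z z'; apply: (@le_trans _ _ ((C2 i * M * Lf + C1 i * K * B) * `|z - z'|)); last first.
  by rewrite ler_wpM2r//; apply: le_trans (cle i); rewrite lerDr.
apply: (@lip_product _ _ _ (fun z => f z.1 j 0) _ _ _ _ r) => //; try exact: mulr_ge0.
move=> {}z {}z'.
have -> : f z.1 j 0 - f z'.1 j 0 = (f z.1 - f z'.1) j 0 by rewrite !mxE.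
apply: le_trans (le_mx_norm _ _ _) _; apply: le_trans (fL _ _) _.
by rewrite ler_wpM2l//; exact: (norm_fst (z - z')).
Qed.

End flux_estimates.

Section real_integrability_difference.
Context d {T : measurableType d} {R : realType} (m : {measure set T -> \bar R}) (D : set T).
Hypothesis mD : measurable D.

Lemma integrable_realB (f g : T -> R) : m.-integrable D (EFin \o f) ->
  m.-integrable D (EFin \o g) -> m.-integrable D (EFin \o (fun z => f z - g z)).
Proof. by move=> fi gi; apply: (integrableB mD fi gi). Qed.

End real_integrability_difference.

Section uniqueness.
Context {R : realType} {n p : nat}.
Notation S := (state R n).
Notation V := 'cV[R]_n.
Notation E := (@state_basis_seq R n).
Variables (T Lf : R) (Y : set 'cV[R]_n) (f : 'cV[R]_n -> 'cV[R]_p).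
Variables (mu : R -> probability (borel S) R) (theta : R -> 'M[R]_(n, p)).
Hypotheses (T0 : 0 < T) (cY : compact Y) (Lf1 : 1 <= Lf).
Hypothesis fL : forall x x', `|f x - f x'| <= Lf * `|x - x'|.
Hypothesis fG : forall x, `|f x| <= Lf * (1 + `|x|).
Hypothesis ith : forall i j, itg 0 T (fun r => theta r i j).
Hypothesis sol : solves_continuity T Y (fun t x => velocity f x (theta t)) mu.
Variable Phi : R -> V -> R -> V.
Hypothesis sPhi : forall s x, 0 <= s <= T ->
  solution s T (fun r x => theta r *m f x) x (Phi s x).
Let w := field_weight Lf theta.
Let KT := expR (2 * Int 0 T w).
Let cF := field_caratheodory Lf1 fL fG ith.
Let Lf0 : 0 <= Lf. Proof. exact: le_trans ler01 Lf1. Qed.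
Let D := RdY Y.
Let mD : measurable (D : set (borel S)). Proof. exact: measurable_RdY. Qed.

Let iEx g (K M r : R) : lip K g -> bounded_by M g -> (mu r).-integrable D (EFin \o g).
Proof.
by move=> gK gM; apply: continuous_expectation_integrable gM => //; exact: lip_continuous gK.
Qed.

Let Ex_le g (K M r : R) : 0 <= r <= T -> lip K g -> (forall z, `|g z| <= M) -> `|Ex (mu r) D g| <= M.
Proof.
move=> rT gK gM; apply: Ex_norm_le => //; first exact: (solution_mass sol rT).
by apply: measurable_funTS; apply: continuous_state_measurable; exact: lip_continuous gK.
Qed.

Let Ex_dist g h (K K' M M' c r : R) : 0 <= r <= T -> lip K g -> lip K' h -> bounded_by M g ->
  bounded_by M' h -> (forall z, `|g z - h z| <= c) -> `|Ex (mu r) D g - Ex (mu r) D h| <= c.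
Proof.
move=> rT gK hK gM hM gh; rewrite -ExB//; [|exact: iEx gK gM|exact: iEx hK hM].
apply: (@Ex_le _ (K + `|-1| * K')) => // z z'.
have := lipD gK (lipZ (-1) hK) z z'; rewrite !mulN1r; exact.
Qed.

Lemma flux_integral_bound (P : 'I_n -> 'I_p -> R -> R) (C s t : R) : 0 <= s -> s <= t -> t <= T ->
  (forall (i : 'I_n) (j : 'I_p) (r : R), s <= r <= t -> `|P i j r| <= C) ->
  (forall (i : 'I_n) (j : 'I_p), measurable_fun `[s, t] (P i j)) ->
  `|Int s t (fun r => \sum_i \sum_j theta r i j * P i j r)| <= C * Int s t w.
Proof.
move=> s0 st tT PC mP; have iw := itgS s0 tT (car_itg cF).
have it i j : itg s t (fun r => theta r i j) by exact: itgS (ith i j).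
have itP i j : itg s t (fun r => theta r i j * P i j r).
  by apply: (@itgM _ _ _ _ _ C) => // r; exact: PC.
rewrite -IntZ//; apply: Int_norm; last 1 first.
- move=> r rst; apply: (@le_trans _ _ (\sum_i \sum_j `|theta r i j| * C)).
    apply: le_trans (ler_norm_sum _ _ _) _; apply: ler_sum => i _.
    apply: le_trans (ler_norm_sum _ _ _) _; apply: ler_sum => j _.
    by rewrite normrM ler_wpM2l// PC.
  rewrite mulrC; under eq_bigr do rewrite -mulr_suml.
  rewrite -mulr_suml; have [C0|C0] := leP 0 C; first by rewrite ler_wpM2r// sum_le_field_weight.
  (* A negative [C] bounds absolute values only if there is no pair of indices at all, and then the
     weight vanishes. *)
  have n0 (i : 'I_n) (j : 'I_p) : False.
    by have := le_lt_trans (PC i j r rst) C0; rewrite normr_lt0.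
  suff -> : w r = 0 by rewrite mul0r big1 ?mul0r// => i _; rewrite big1// => j; case: (n0 i j).
  by rewrite /w /field_weight big1 ?mulr0// => i _; rewrite big1// => j; case: (n0 i j).
- by apply: itg_sum => i; exact: itg_sum.
- exact: itgZ.
Qed.

Let dist_halves (x x' y y' e c : R) : `|x' - x| <= e / 2 -> `|y' - y| <= e / 2 -> `|x' - y'| <= c ->
  `|x - y| <= e + c.
Proof.
by rewrite !ler_norml => /andP[? ?] /andP[? ?] /andP[? ?]; apply/andP; split; lra.
Qed.

(** Equicontinuity in time over a whole class: mollifying costs [e / 2] at each of the two times,
    and the weak formula bounds the rest. [C] depends on [e] through the scale of the mollifier. *)
Lemma expectation_modulus (K M rho e : R) : 0 <= K -> 0 <= M -> 0 < e ->
  exists2 C : R, 0 <= C & forall g, compactly_lip K M rho g -> forall s t, 0 <= s -> s <= t -> t <= T ->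
    `|Ex (mu t) D g - Ex (mu s) D g| <= e + C * Int s t w.
Proof.
move=> K0 M0 e0.
pose N : R := (size E)%:R; have N0 : 0 <= N by [].
pose eta := Num.min (1 / 2) (e / 2 / (K * N + 1)).
have q0 : 0 < K * N + 1 by rewrite ltr_wpDl// mulr_ge0.
have eta0 : 0 < eta by rewrite lt_min !divr_gt0.
have eta1 : eta <= 1 / 2 by rewrite ge_min lexx.
have Ke : K * (eta *+ size E) <= e / 2.
  rewrite -[eta *+ _]mulr_natr mulrCA; apply: (@le_trans _ _ (eta * (K * N + 1))).
    by rewrite ler_wpM2l ?(ltW eta0)// lerDl.
  by rewrite -ler_pdivlMr// ge_min lexx orbT.
have [a ka] : exists a, smoothing_kernel eta a.
  by apply: smoothing_kernel_exists; rewrite eta0.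
pose L := [seq (z, 0%N) | z <- E]; have LE : unzip1 L = E by rewrite /unzip1 -map_comp map_id.
have [C C0 HC] := flux_class Lf0 fL fG ka rho K0 M0 LE.
have [C1 C10 h1] := mollk_lip ka L; have [C2 C20 h2] := mollk_bound ka L.
exists C => // g [gK gM g0] s t s0 st tT.
have sT : 0 <= s <= T by rewrite s0 (le_trans st).
have tT' : 0 <= t <= T by rewrite (le_trans s0 st).
have near r : 0 <= r <= T -> `|Ex (mu r) D (mollk a L g) - Ex (mu r) D g| <= e / 2.
  move=> rT; apply: (Ex_dist rT (h1 _ _ gK) gK (h2 _ _ _ gK gM) gM) => z.
  apply: le_trans Ke; apply: (moll_near ka) => //; exact: state_basis_seq1.
have wf := weak_formula T0 cY Lf0 fL fG ith sol ka K0 gK gM g0 LE s0 st tT.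
have main : `|Ex (mu t) D (mollk a L g) - Ex (mu s) D (mollk a L g)| <= C * Int s t w.
  rewrite wf; apply: (@flux_integral_bound (fun i j r => Ex (mu r) D (flux f a g L i j)) C s t
    s0 st tT) => [i j r /andP[sr rt]|i j].
    have [fC fl] := HC g i j (And3 gK gM g0).
    by apply: (Ex_le _ fl) => //; rewrite (le_trans s0 sr) (le_trans rt).
  have [fC fl] := HC g i j (And3 gK gM g0).
  have := expectation_continuous sol (lip_continuous fl) fC.
  move=> /within_continuous_measurable; apply: measurable_funS => // r /=.
  by rewrite !in_itv/= => /andP[sr rt]; rewrite (le_trans s0 sr) (le_trans rt).
exact: dist_halves (near t tT') (near s sT) main.
Qed.

Let three_steps (x x' y y' c1 c2 c3 : R) : `|x' - x| <= c1 -> `|y' - y| <= c2 ->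
  `|x' - y'| <= c3 -> `|x - y| <= c1 + c2 + c3.
Proof.
by rewrite !ler_norml => /andP[? ?] /andP[? ?] /andP[? ?]; apply/andP; split; lra.
Qed.

Section transported_test_function.
Variables (phi : S -> R) (K M rho b : R).
Hypotheses (K0 : 0 <= K) (M0 : 0 <= M) (rho0 : 0 <= rho) (b0 : 0 <= b) (bT : b <= T).
Hypothesis phiC : compactly_lip K M rho phi.

(** Formally the solution of the backward transport equation with final value [phi] at time [b],
    which is why its expectations at times 0 and [b] turn out equal. *)
Definition transported (t : R) (z : S) : R := phi (Phi t z.1 b, z.2).

Let Lam := K * (2 * KT).
(** By backward Gronwall, a start of norm at least [rho'] leads to an end of norm at least [rho]. *)
Let rho' := 2 * (1 + rho) * KT.

Let KT1 : 1 <= KT.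
Proof.
have := @weight_ge0 _ _ T _ w cF 0 T (lexx 0) (lexx T) => h.
by rewrite -[leLHS]expR0 ler_expR mulr_ge0.
Qed.

Let KT0 : 0 <= KT. Proof. exact: le_trans ler01 KT1. Qed.

Let Lam0 : 0 <= Lam. Proof. by rewrite !mulr_ge0// (le_trans ler01). Qed.

Let rho_le : rho <= rho'.
Proof.
have : (1 + rho) * 1 <= (1 + rho) * KT by rewrite ler_wpM2l// addr_ge0.
by rewrite /rho' -mulrA; have := rho0; move: ((1 + rho) * KT) => y ? ?; lra.
Qed.

Lemma transported_class t : 0 <= t -> t <= b -> compactly_lip Lam M rho' (transported t).
Proof.
move=> t0 tb; case: phiC => phiK phiM phi0; split.
- move=> z z'; apply: le_trans (phiK _ _) _; rewrite /Lam -mulrA ler_wpM2l//.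
  apply: norm_pair_le => /=.
    apply: le_trans (flow_lip cF sPhi t0 tb bT _ _) _.
    by apply: ler_wpM2l; [rewrite mulr_ge0// expR_ge0|exact: (norm_fst (z - z'))].
  apply: le_trans (norm_snd (z - z')) _; rewrite ler_peMl//.
  by have := KT1; lra.
- by move=> z; exact: phiM.
- move=> -[x y]; rewrite norm_pair le_max => /orP[hx|hy]; apply: phi0; rewrite norm_pair le_max /=.
    apply/orP; left; rewrite leNgt; apply/negP => h.
    have := flow_start_bound cF sPhi t0 tb bT x; apply/negP; rewrite -ltNge.
    apply: (@lt_le_trans _ _ (1 + rho')); last by rewrite lerD2l.
    have k0 : 0 < KT := lt_le_trans ltr01 KT1.
    apply: (@lt_trans _ _ rho'); last by rewrite ltrDr.
    by rewrite /rho' ltr_pM2r// ltr_pM2l// ltrD2l.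
  by apply/orP; right; exact: le_trans rho_le hy.
Qed.

Lemma transported_end z : transported b z = phi z.
Proof. by rewrite /transported (flow_start sPhi b0 (lexx b) bT); case: z. Qed.

Lemma transported_semigroup s t z : 0 <= s -> s <= t -> t <= b ->
  transported s z = transported t (Phi s z.1 t, z.2).
Proof. by move=> s0 st tb; rewrite /transported (flow_semigroup cF sPhi _ s0 st tb bT). Qed.

Section one_scale.
Variables (eta : R) (a : nat -> R -> R).
Hypothesis ka : smoothing_kernel eta a.
Let del : R := eta *+ size E.
Let L := [seq (z, 0%N) | z <- E].
Let LE : unzip1 L = E. Proof. by rewrite /unzip1 -map_comp map_id. Qed.
Let r2 := rho' + del.
Let fluxes t i j z := flux f a (transported t) L i j z.

Let eta0 : 0 < eta. Proof. by case/andP: (ker_eta ka). Qed.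
Let del0 : 0 <= del. Proof. by rewrite mulrn_wge0// ltW. Qed.
Let r20 : 0 <= r2. Proof. by rewrite addr_ge0//; exact: le_trans rho_le. Qed.

(** The commutator estimate: the flow from [s] to [t] is replaced by the translation by [v], frozen
    at [z]. A point of the averaging ball is at distance at most [del] from [z], which gives the
    only error term linear in the weight. *)
Lemma transported_shift s t z : 0 <= s -> s <= t -> t <= b -> `|z| <= r2 ->
  `|moll a E (transported s) z -
    moll a E (transported t) (z + (mean_control theta s t *m f z.1, 0))| <=
  Lam * ((2 * (1 + (r2 + del)) * KT * Int s t w + del) * Int s t w).
Proof.
move=> s0 st tb zr; pose v : S := (mean_control theta s t *m f z.1, 0); rewrite -/v.
have sb := le_trans st tb; have t0 := le_trans s0 st.
have tT := le_trans tb bT.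
have [sK _ _] := transported_class s0 sb; have [tK _ _] := transported_class t0 tb.
have W0 : 0 <= Int s t w := weight_ge0 cF s0 tT.
have tKv : lip Lam (fun z => transported t (z + v)).
  by move=> x y; apply: le_trans (tK _ _) _; rewrite opprD addrACA subrr addr0.
(* Mollification commutes with translations, and [v] does not vary inside the average, so the
   difference is the mollification of a single function, to be estimated on the ball. *)
rewrite {2}/moll -mollk_shift -/(moll a E (fun z => transported t (z + v))).
rewrite /moll -(mollkB ka _ _ sK tKv).
apply: (moll_local ka (@state_basis_seq1 R n) (K := Lam + `|-1| * Lam)).
  by have := lipD sK (lipZ (-1) tKv); under eq_fun do rewrite mulN1r.
move=> z' hz'; rewrite (transported_semigroup _ s0 st tb).
apply: le_trans (tK _ _) _; rewrite ler_wpM2l//.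
apply: norm_pair_le; rewrite /= ?addr0 ?subrr ?normr0; last first.
  nonneg.
rewrite opprD addrA; apply: le_trans (flow_taylor Lf1 fL fG ith sPhi _ _ s0 st tT) _.
apply: ler_wpM2r => //; apply: lerD; last first.
  by apply: le_trans hz'; exact: (norm_fst (z' - z)).
rewrite ler_wpM2r// ler_wpM2r // ler_wpM2l// lerD2l.
apply: le_trans (norm_fst z') _; rewrite -(subrK z z'); apply: le_trans (ler_normD _ _) _.
by rewrite addrC lerD.
Qed.

Let expand_square (l dd W x y q : R) :
  (l * dd + (l * x + y * q ^+ 2) * W) * W = l * ((x * W + dd) * W) + y * (q * W) ^+ 2.
Proof. by ring. Qed.

Lemma transported_expansion : exists2 C : R, 0 <= C & forall s t, 0 <= s -> s <= t -> t <= b ->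
  forall z, `|moll a E (transported s) z - moll a E (transported t) z -
     \sum_i \sum_j mean_control theta s t i j * fluxes t i j z| <=
   (Lam * del + C * Int s t w) * Int s t w.
Proof.
have H1 i : exists C : R, 0 <= C /\ forall (g : S -> R) K M, lip K g -> bounded_by M g ->
    qd (C * M) (state_basis (inl i)) (mollk a L g) (mollk a (bumpk L (state_basis (inl i))) g).
  have [|C C0 h] := @mollk_qd _ _ _ _ ka L (state_basis (inl i)); last by exists C.
  by rewrite LE; exact: state_basis_seqP.
have H2 i : exists C : R, 0 <= C /\ forall (g : S -> R) K, lip K g ->
    lip (C * K) (mollk a (bumpk L (state_basis (inl i))) g).
  by have [C C0 h] := mollk_lip ka (bumpk L (state_basis (inl i))); exists C.
have [C1 HC1] := choice H1; have [C2 HC2] := choice H2.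
have C10 i : 0 <= C1 i by case: (HC1 i).
have C20 i : 0 <= C2 i by case: (HC2 i).
pose c1 := (\sum_i C1 i) * M; pose c2 := (\sum_i C2 i) * Lam.
have c10 : 0 <= c1 by rewrite mulr_ge0// sumr_ge0.
have c20 : 0 <= c2 by rewrite mulr_ge0// sumr_ge0.
(* The first summand comes from the motion of the trajectory in [transported_shift], the second from
   the quadratic remainder of the expansion. *)
pose C := Lam * (2 * (1 + (r2 + del)) * KT) + (c1 + c2) * (1 + r2) ^+ 2.
have C0 : 0 <= C.
  rewrite /C; nonneg.
exists C => // s t s0 st tb z; have t0 := le_trans s0 st; have tT := le_trans tb bT.
have sb := le_trans st tb.
have W0 : 0 <= Int s t w := weight_ge0 cF s0 tT.
set W := Int s t w in W0 *.
have [sK sM sz] := transported_class s0 sb; have [tK tM tz] := transported_class t0 tb.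
have [hz|/ltW hz] := leP r2 `|z|.
  rewrite /moll -/L (mollk_outside ka sz LE hz) (mollk_outside ka tz LE hz) subrr sub0r normrN.
  rewrite big1 ?normr0 => [|i _]; first by rewrite mulr_ge0// addr_ge0// mulr_ge0.
  rewrite big1// => j _; rewrite /fluxes /flux (mollk_outside ka tz _ hz) ?mul0r ?mulr0//.
  by rewrite unzip1_bumpk.
set Th := mean_control theta s t.
have e1 := transported_shift s0 st tb hz; rewrite -/Th -/W in e1.
pose c (i : 'I_n) := (Th *m f z.1) i 0.
have Dq i : qd c1 (state_basis (inl i)) (mollk a L (transported t))
    (mollk a (bumpk L (state_basis (inl i))) (transported t)).
  have [_ h] := HC1 i; move=> x q; apply: le_trans (h _ _ _ tK tM x q) _.
  by rewrite ler_wpM2r ?sqr_ge0// ler_wpM2r// (bigD1 i)//= lerDl sumr_ge0.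
have Dl i : lip c2 (mollk a (bumpk L (state_basis (inl i))) (transported t)).
  have [_ h] := HC2 i; move=> x q; apply: le_trans (h _ _ tK x q) _.
  by rewrite ler_wpM2r// ler_wpM2r// (bigD1 i)//= lerDl sumr_ge0.
have := qd_combination (index_enum 'I_n) c c10 c20 (fun i => state_basis_norm (inl i)) Dq Dl z.
rewrite -state_span_fst -/(moll a E (transported t)) => e2.
have cW : \sum_i `|c i| <= (1 + r2) * W.
  apply: (@le_trans _ _ ((Lf * \sum_i \sum_j `|Th i j|) * (1 + r2))); last first.
    rewrite mulrC; apply: ler_wpM2l; first nonneg.
    exact: (mean_control_norm Lf1 ith s0 st tT).
  rewrite [Lf * _]mulrC -mulrA mulr_suml; apply: ler_sum => i _.
  rewrite mulr_suml /c mxE; apply: le_trans (ler_norm_sum _ _ _) _; apply: ler_sum => j _.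
  rewrite normrM ler_wpM2l//; apply: le_trans (le_mx_norm _ _ _) _; apply: le_trans (fG _) _.
  by rewrite ler_wpM2l// lerD2l; exact: le_trans (norm_fst z) hz.
have {}e2 : `|moll a E (transported t) (z + (Th *m f z.1, 0)) - moll a E (transported t) z -
    \sum_i \sum_j Th i j * fluxes t i j z| <= (c1 + c2) * ((1 + r2) * W) ^+ 2.
  have <- : \sum_i c i * mollk a (bumpk L (state_basis (inl i))) (transported t) z =
      \sum_i \sum_j Th i j * fluxes t i j z.
    apply: eq_bigr => i _; rewrite /c mxE mulr_suml; apply: eq_bigr => j _.
    by rewrite /fluxes /flux -mulrA; congr (_ * _); rewrite mulrC.
  apply: le_trans e2 _; apply: ler_wpM2l; first exact: addr_ge0.
  by rewrite lerXn2r// nnegrE ?sumr_ge0// mulr_ge0// addr_ge0.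
have -> : (Lam * del + C * W) * W = Lam * ((2 * (1 + (r2 + del)) * KT * W + del) * W) +
    (c1 + c2) * ((1 + r2) * W) ^+ 2.
  exact: expand_square.
apply: le_trans (lerD e1 e2); apply: le_trans (ler_normD _ _).
by rewrite le_eqVlt; apply/orP; left; apply/eqP; congr (`|_|); rewrite addrA addrA subrK.
Qed.

Let F t := Ex (mu t) D (moll a E (transported t)).

Let flux_compact : exists2 C : R, 0 <= C & forall t i j, 0 <= t -> t <= b ->
  compactly_lip C C r2 (fluxes t i j).
Proof.
have [C C0 HC] := flux_class Lf0 fL fG ka rho' Lam0 M0 LE.
exists C => // t i j t0 tb; have tc := transported_class t0 tb.
have [h1 h2] := HC _ i j tc; split=> // z hz; case: tc => _ _ tz.
by rewrite /fluxes /flux (mollk_outside ka tz _ hz) ?mul0r// unzip1_bumpk.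
Qed.

Let assemble (x y q i c1 c2 : R) : `|y - q| <= c2 -> `|i| <= c1 -> x - i = q ->
  `|x - y| <= c1 + c2.
Proof.
rewrite !ler_norml => /andP[? ?] /andP[? ?] ?; apply/andP; split; lra.
Qed.

(** The measure and the function both move. The weak formula gives the change due to the measure,
    the expansion the change due to the function; their main terms cancel up to the oscillation of
    the flux expectations on [s, t], bounded by [e]. *)
Lemma smoothed_increment : exists2 C : R, 0 <= C & forall (s t e : R), 0 <= s -> s <= t -> t <= b ->
  (forall i j (r : R), s <= r <= t ->
     `|Ex (mu r) D (fluxes t i j) - Ex (mu s) D (fluxes t i j)| <= e) ->
  `|F t - F s| <= (e + (Lam * del + C * Int s t w)) * Int s t w.
Proof.
have [C C0 HC] := transported_expansion; have [Cf Cf0 HCf] := flux_compact.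
exists C => // s t e s0 st tb He.
have t0 := le_trans s0 st; have sb := le_trans st tb; have tT := le_trans tb bT.
have sT : 0 <= s <= T by rewrite s0 (le_trans sb).
have [sK sM sz] := transported_class s0 sb; have [tK tM tz] := transported_class t0 tb.
have [C1 C10 h1] := mollk_lip ka L; have [C2 C20 h2] := mollk_bound ka L.
have wf := weak_formula T0 cY Lf0 fL fG ith sol ka Lam0 tK tM tz LE s0 st tT.
have is_ r := iEx r (h1 _ _ sK) (h2 _ _ _ sK sM).
have it_ r := iEx r (h1 _ _ tK) (h2 _ _ _ tK tM).
have cf i j := HCf t i j t0 tb.
have if_ i j r : (mu r).-integrable D (EFin \o fluxes t i j).
  by case: (cf i j) => fl fb _; exact: iEx r fl fb.
have it i j : itg s t (fun r => theta r i j) by exact: itgS (ith i j).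
pose P i j r := Ex (mu r) D (fluxes t i j).
have mP i j : measurable_fun `[s, t] (P i j).
  case: (cf i j) => fl fb _.
  have := expectation_continuous sol (lip_continuous fl) fb.
  move=> /within_continuous_measurable; apply: measurable_funS => // r /=.
  by rewrite !in_itv/= => /andP[sr rt]; rewrite (le_trans s0 sr) (le_trans rt).
have iM i j : (mu s).-integrable D (EFin \o (fun z => mean_control theta s t i j * fluxes t i j z)).
  exact: (integrable_realZ mD _ (if_ i j s)).
have iM1 i : (mu s).-integrable D
    (EFin \o (fun z => \sum_j mean_control theta s t i j * fluxes t i j z)).
  exact: (@integrable_real_sum _ _ _ (mu s) _ mD _ _
    (fun j z => mean_control theta s t i j * fluxes t i j z)).
have iM2 : (mu s).-integrable D
    (EFin \o (fun z => \sum_i \sum_j mean_control theta s t i j * fluxes t i j z)).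
  exact: (@integrable_real_sum _ _ _ (mu s) _ mD _ _
    (fun i z => \sum_j mean_control theta s t i j * fluxes t i j z)).
have EM : Ex (mu s) D (fun z => \sum_i \sum_j mean_control theta s t i j * fluxes t i j z) =
    \sum_i \sum_j mean_control theta s t i j * P i j s.
  rewrite Ex_sum//; apply: eq_bigr => i _; rewrite Ex_sum//; apply: eq_bigr => j _.
  by rewrite ExZ.
have b1 : `|(Ex (mu s) D (moll a E (transported s)) - Ex (mu s) D (moll a E (transported t))) -
    \sum_i \sum_j mean_control theta s t i j * P i j s| <=
    (Lam * del + C * Int s t w) * Int s t w.
  rewrite -EM -(ExB mD (is_ s) (it_ s)) -(ExB mD (integrable_realB mD (is_ s) (it_ s)) iM2).
  have ii := integrable_realB mD (integrable_realB mD (is_ s) (it_ s)) iM2.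
  apply: Ex_norm_le => //; [exact: (solution_mass sol sT)| |by move=> z _; exact: HC].
  by apply/measurable_EFinP; exact: (measurable_int _ ii).
have iP i j : itg s t (fun r => theta r i j * P i j r).
  apply: (@itgM _ _ _ _ _ Cf) => // r /andP[sr rt]; case: (cf i j) => fl fb _.
  by apply: (Ex_le _ fl) => //; rewrite (le_trans s0 sr) (le_trans rt).
have b2 : `|Int s t (fun r => \sum_i \sum_j theta r i j * (P i j r - P i j s))| <=
    e * Int s t w.
  apply: (@flux_integral_bound (fun i j r => P i j r - P i j s) e s t s0 st tT).
    by move=> i j r; exact: He.
  by move=> i j; apply: measurable_funB => //; exact: measurable_cst.
have eqn : Int s t (fun r => \sum_i \sum_j theta r i j * P i j r) -
    Int s t (fun r => \sum_i \sum_j theta r i j * (P i j r - P i j s)) =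
    \sum_i \sum_j mean_control theta s t i j * P i j s.
  have iPs i j : itg s t (fun r => theta r i j * (P i j r - P i j s)).
    apply: (@itg_eq _ _ _ (fun r => theta r i j * P i j r - P i j s * theta r i j)).
      by move=> r _; rewrite mulrBr [P i j s * _]mulrC.
    by apply: itgB => //; exact: itgZ.
  rewrite -IntB; [|by apply: itg_sum => i; exact: itg_sum..].
  rewrite (@Int_eq _ _ _ _ (fun r => \sum_i \sum_j P i j s * theta r i j)); last first.
    move=> r _; rewrite -sumrB; apply: eq_bigr => i _; rewrite -sumrB; apply: eq_bigr => j _.
    by rewrite -mulrBr opprB addrC subrK mulrC.
  rewrite Int_sum; last by move=> i; apply: itg_sum => j; exact: itgZ.
  apply: eq_bigr => i _; rewrite Int_sum; last by move=> j; exact: itgZ.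
  by apply: eq_bigr => j _; rewrite IntZ// mxE mulrC.
have -> : F t - F s = (Ex (mu t) D (moll a E (transported t)) - Ex (mu s) D (moll a E (transported t))) -
    (Ex (mu s) D (moll a E (transported s)) - Ex (mu s) D (moll a E (transported t))).
  by rewrite opprB addrA subrK.
by rewrite mulrDl; apply: (assemble b1 b2); rewrite -eqn wf.
Qed.

(* The increments of [t |-> E_t (moll (transported t))] are of order
   [Lam * del * Int s t w] (a commutator estimate) up to a term quadratic in [Int s t w],
   which disappears when the increments are summed over a fine subdivision. *)
Lemma smoothed_total : `|F b - F 0| <= Lam * del * Int 0 b w.
Proof.
have [C C0 HC] := smoothed_increment; have [Cf Cf0 HCf] := flux_compact.
have iw := car_itg cF; have w0 := car_w0 cF.
suff H e : 0 < e -> `|F b - F 0| <= (Lam * del + e) * (Int 0 b w - Int 0 0 w).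
  apply/ler_addgt0Pr => e e0; have W0 := weight_ge0 cF (lexx 0) bT.
  have q0 : 0 < Int 0 b w + 1 by rewrite ltr_wpDl.
  apply: le_trans (H (e / (Int 0 b w + 1)) (divr_gt0 e0 q0)) _.
  rewrite Int_pt subr0 mulrDl lerD2l mulrAC ler_pdivrMr// ler_wpM2l ?(ltW e0)// lerDl//.
move=> e0; have e4 : 0 < e / 4 by rewrite divr_gt0.
(* On a short window the flux expectations move by at most [e / 2]: a quarter of [e] from the
   modulus itself, another from [C'] times the weight. *)
have [C' C'0 HC'] := expectation_modulus r2 Cf0 Cf0 e4.
apply: (@local_increments _ F (fun t => Int 0 t w) _ 0 b b0) => r /andP[r0 rb].
have q0 : 0 < C' + C + 1 by rewrite ltr_wpDl// addr_ge0.
have rT : 0 <= r <= T by rewrite r0 (le_trans rb).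
have [d d0 Hd] := Int_small iw w0 rT (divr_gt0 e4 q0).
exists d => // s t s0 st tb sd td; have tT := le_trans tb bT.
have t0 := le_trans s0 st.
have W0 := weight_ge0 cF s0 tT; have We := Hd s t s0 st tT sd td.
have We' : (C' + C) * Int s t w <= e / 4.
  apply: (@le_trans _ _ ((C' + C + 1) * Int s t w)); first by rewrite ler_wpM2r// lerDl.
  by rewrite mulrC -ler_pdivlMr.
have -> : Int 0 t w - Int 0 s w = Int s t w.
  by rewrite (@Int_split _ 0 s t w)//; [rewrite addrC addKr|exact: itgS iw].
apply: le_trans (HC s t (e / 2) s0 st tb _) _.
  move=> i j q /andP[sq qt].
  apply: le_trans (HC' _ (HCf t i j t0 tb) s q s0 sq (le_trans qt tT)) _.
  have -> : e / 2 = e / 4 + e / 4 by lra.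
  rewrite lerD2l; apply: le_trans We'; apply: ler_pM => //.
  - by have := weight_ge0 cF s0 (le_trans qt tT).
  - by rewrite lerDl.
  - apply: (Int_nonneg_le (b := t)) => //; last exact: itgS iw.
    by move=> x /andP[sx xt]; apply: w0; rewrite (le_trans s0 sx) (le_trans xt).
rewrite ler_wpM2r// addrCA lerD2l.
have : C * Int s t w <= (C' + C) * Int s t w by rewrite ler_wpM2r// lerDr.
by move: (C * _) We' => x; move: ((C' + C) * _) => y ? ?; lra.
Qed.

End one_scale.

(** The scale [eta] tends to 0 with everything else fixed. *)
Lemma expectation_transport : Ex (mu b) D phi = Ex (mu 0) D (fun z => phi (Phi 0 z.1 b, z.2)).
Proof.
have [phiK phiM phi0] := phiC.
have [zK zM zz] := transported_class (lexx 0) b0.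
have bb : 0 <= b <= T by rewrite b0. 
have z0 : (0 : R) <= 0 <= T by rewrite lexx ltW.
have W0 := weight_ge0 cF (lexx 0) bT.
pose N : R := (size E)%:R; have N0 : 0 <= N by [].
(* The three summands are the costs of mollifying [phi] at time [b], of mollifying the transported
   function at time 0, and of the accumulated commutator. *)
pose C := (K + Lam + Lam * Int 0 b w) * N.
have C0 : 0 <= C by rewrite /C; nonneg.
apply/eqP; rewrite -subr_eq0 -normr_le0; apply/ler_addgt0Pr => e e0; rewrite add0r.
have q0 : 0 < C + 1 by rewrite ltr_wpDl.
pose eta := Num.min (1 / 2) (e / (C + 1)).
have eta0 : 0 < eta by rewrite lt_min !divr_gt0.
have [a ka] : exists a, smoothing_kernel eta a.
  by apply: smoothing_kernel_exists; rewrite eta0 ge_min lexx.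
have h1 := smoothed_total ka.
have [C1 C10 l1] := mollk_lip ka [seq (z, 0%N) | z <- E].
have [C2 C20 l2] := mollk_bound ka [seq (z, 0%N) | z <- E].
have E1 := @state_basis_seq1 R n.
have tb : transported b = phi by apply/funext => z; exact: transported_end.
have h2 : `|Ex (mu b) D (moll a E phi) - Ex (mu b) D phi| <= K * (eta *+ size E).
  apply: (Ex_dist bb (l1 _ _ phiK) phiK (l2 _ _ _ phiK phiM) phiM) => z.
  exact: (moll_near ka E1).
have h3 : `|Ex (mu 0) D (moll a E (transported 0)) - Ex (mu 0) D (transported 0)| <=
    Lam * (eta *+ size E).
  apply: (Ex_dist z0 (l1 _ _ zK) zK (l2 _ _ _ zK zM) zM) => z.
  exact: (moll_near ka E1).
rewrite /= tb in h1.
have le_e : (K + Lam + Lam * Int 0 b w) * (eta *+ size E) <= e.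
  rewrite -[eta *+ _]mulr_natr [eta * _]mulrC mulrA -/N -/C.
  apply: (@le_trans _ _ ((C + 1) * eta)); first by rewrite ler_wpM2r ?(ltW eta0)// lerDl.
  by rewrite mulrC -ler_pdivlMr// ge_min lexx orbT.
apply: le_trans le_e; rewrite !mulrDl [Lam * _ * (eta *+ _)]mulrAC.
exact: three_steps h2 h3 h1.
Qed.

End transported_test_function.

End uniqueness.

(** * Push-forward by the flow *)

Section pushforward_measures.
Context d d' (T : measurableType d) (T' : measurableType d') {R : realType}.
Variable P : probability T R.

Definition is_push (X : T -> T') (Q : probability T' R) : Prop :=
  forall A, measurable A -> Q A = P (X @^-1` A).

Lemma push_exists (X : T -> T') : measurable_fun setT X -> exists Q, is_push X Q.
Proof.
move=> mX; exists (distribution P (mfun_Sub (mem_set mX) : {mfun T >-> T'})) => A mA.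
by [].
Qed.

Section push_integrals.
Variables (X : T -> T') (Q : probability T' R).
Hypotheses (mX : measurable_fun setT X) (QX : is_push X Q).

Lemma push_ge0_integral (D : set T') (f : T' -> \bar R) : measurable D -> measurable_fun D f ->
  (forall y, D y -> 0 <= f y)%E ->
  (\int[Q]_(y in D) f y = \int[P]_(x in X @^-1` D) f (X x))%E.
Proof.
move=> mD mf f0.
rewrite (@eq_measure_integral _ _ _ _ (distribution P (mfun_Sub (mem_set mX)))); last first.
  by move=> A mA _; exact: QX.
by rewrite /distribution /= ge0_integral_pushforward// => y /set_mem; exact: f0.
Qed.

Lemma push_integral (D : set T') (f : T' -> R) : measurable D -> measurable_fun setT f ->
  P.-integrable (X @^-1` D) (EFin \o (f \o X)) ->
  Ex Q D f = Ex P (X @^-1` D) (f \o X).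
Proof.
move=> mD mf fi; rewrite /Ex /Rintegral; congr fine.
rewrite (@eq_measure_integral _ _ _ _ (distribution P (mfun_Sub (mem_set mX)))); last first.
  by move=> A mA _; exact: QX.
rewrite /distribution /= integral_pushforward//; exact/measurable_EFinP.
Qed.

End push_integrals.

End pushforward_measures.

Section full_measure.
Context d (T : measurableType d) {R : realType} (P : probability T R) (D : set T).
Hypotheses (mD : measurable D) (PD : P D = 1%E).

Lemma full_measure_compl : P (~` D) = 0%E.
Proof. by rewrite probability_setC// PD subee. Qed.

Lemma full_integral (f : T -> \bar R) : P.-integrable setT f ->
  (\int[P]_(x in D) f x = \int[P]_x f x)%E.
Proof.
move=> fi; rewrite (@negligible_integral _ _ _ P setT (~` D))//; last first.
- exact: full_measure_compl.
- exact: measurableC.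
by rewrite setTD setCK.
Qed.

Lemma full_ge0_integral (E : set T) (f : T -> \bar R) : measurable E -> D `<=` E ->
  measurable_fun E f -> (forall x, E x -> 0 <= f x)%E ->
  (\int[P]_(x in D) f x = \int[P]_(x in E) f x)%E.
Proof.
move=> mE DE mf f0; rewrite [RHS](@ge0_negligible_integral _ _ _ P E (E `\` D))//.
- by rewrite setDD setIidr.
- exact: measurableD.
- apply/eqP; rewrite -measure_le0 -full_measure_compl; apply: le_measure; rewrite ?inE.
  + exact: measurableD.
  + exact: measurableC.
  + by move=> x [].
Qed.

End full_measure.

Section map_continuity.
Context {R : realType} {U V : normedModType R}.

Lemma lipschitz_map_continuous (K : R) (g : U -> V) :
  (forall z z', `|g z - g z'| <= K * `|z - z'|) -> continuous g.
Proof.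
move=> gK z; apply/cvgrPdist_lt => e e0.
near=> z'; apply: le_lt_trans (gK _ _) _.
apply: (@le_lt_trans _ _ ((`|K| + 1) * `|z - z'|)).
  by rewrite ler_wpM2r// (le_trans (ler_norm _))// lerDl.
rewrite mulrC -ltr_pdivlMr ?ltr_wpDl//.
near: z'; apply: cvgr_dist_lt => //; by rewrite divr_gt0// ltr_wpDl.
Unshelve. all: by end_near. Qed.

End map_continuity.

Section flow_map.
Context {R : realType} {n : nat}.
Notation S := (state R n).
Notation V := 'cV[R]_n.
Variables (T : R) (F : R -> V -> V) (w : R -> R) (Phi : R -> V -> R -> V).
Hypothesis cF : caratheodory 0 T F w.
Hypothesis sPhi : forall s x, 0 <= s <= T -> solution s T F x (Phi s x).
Let K := expR (2 * Int 0 T w).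

Definition flow_map (t : R) (z : S) : S := (Phi 0 z.1 t, z.2).

Lemma flow_weight_ge1 : 0 <= T -> 1 <= K.
Proof.
move=> T0; have h := @weight_ge0 _ _ T _ w cF 0 T (lexx 0) (lexx T).
by rewrite -[leLHS]expR0 ler_expR mulr_ge0.
Qed.

Lemma flow_map_lip t z z' : 0 <= t -> t <= T ->
  `|flow_map t z - flow_map t z'| <= 2 * K * `|z - z'|.
Proof.
move=> t0 tT; have K1 := flow_weight_ge1 (le_trans t0 tT).
apply: norm_pair_le => /=.
  apply: le_trans (flow_lip cF sPhi (lexx 0) t0 tT _ _) _.
  by apply: ler_wpM2l; [rewrite mulr_ge0// expR_ge0|exact: (norm_fst (z - z'))].
apply: le_trans (norm_snd (z - z')) _; rewrite ler_peMl//; lra.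
Qed.

Lemma flow_map_continuous t : 0 <= t -> t <= T -> continuous (flow_map t).
Proof.
move=> t0 tT; apply: (@lipschitz_map_continuous _ _ _ (2 * K)) => z z'.
exact: flow_map_lip.
Qed.

Lemma flow_map_measurable t : 0 <= t -> t <= T ->
  measurable_fun setT (flow_map t : borel S -> borel S).
Proof. by move=> t0 tT; apply: continuous_state_measurable_map; exact: flow_map_continuous. Qed.

End flow_map.

Section uniqueness_of_solutions.
Context {R : realType} {n p : nat}.
Notation S := (state R n).
Notation V := 'cV[R]_n.
Variables (T Lf : R) (Y : set 'cV[R]_n) (f : 'cV[R]_n -> 'cV[R]_p).
Variables (mu : R -> probability (borel S) R) (theta : R -> 'M[R]_(n, p)).
Variable mu0 : probability (borel S) R.
Hypotheses (T0 : 0 < T) (cY : compact Y) (Lf1 : 1 <= Lf).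
Hypothesis fL : forall x x', `|f x - f x'| <= Lf * `|x - x'|.
Hypothesis fG : forall x, `|f x| <= Lf * (1 + `|x|).
Hypothesis ith : forall i j, itg 0 T (fun r => theta r i j).
Hypothesis sol : solves_continuity T Y (fun t x => velocity f x (theta t)) mu.
Hypothesis mu00 : forall A : set (borel S), measurable A -> mu 0 A = mu0 A.
Variable Phi : R -> V -> R -> V.
Hypothesis sPhi : forall s x, 0 <= s <= T ->
  solution s T (fun r x => theta r *m f x) x (Phi s x).

(** Equality of measures is tested on compactly supported Lipschitz functions, for which
    [expectation_transport] compares the times 0 and [b]. *)
Theorem solution_is_push b : 0 <= b <= T -> is_push mu0 (flow_map Phi b : borel S -> borel S) (mu b).
Proof.
move=> bT; have /andP[b0 bT'] := bT.
have cF := field_caratheodory Lf1 fL fG ith.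
have mX := flow_map_measurable cF sPhi b0 bT'.
have [Q QX] := push_exists mu0 mX.
have mD := measurable_RdY cY.
have D1 r : 0 <= r <= T -> mu r (RdY Y) = 1%E by move=> rT; have := solution_mass sol rT.
have T00 : (0 : R) <= 0 <= T by rewrite lexx ltW.
suff H (A : set (borel S)) : measurable A -> mu b A = Q A.
  by move=> A mA; rewrite H// QX.
apply: eq_borel_measure => phi K rho K0 phiK phi01 phi0.
have phiM : bounded_by 1 phi by move=> z; have /andP[h1 h2] := phi01 z; rewrite ger0_norm.
have mphi := @continuous_state_measurable _ _ phi (lip_continuous phiK).
have mphiX : measurable_fun setT (phi \o flow_map Phi b : borel S -> R).
  apply: continuous_state_measurable => z; apply: continuous_comp.
    exact: (flow_map_continuous cF sPhi b0 bT').
  exact: (lip_continuous phiK).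
have ib (m : probability (borel S) R) (E : set (borel S)) (g : borel S -> R) : measurable E ->
    measurable_fun setT g -> bounded_by 1 (g : S -> R) -> m.-integrable E (EFin \o g).
  move=> mE mg g1; apply: (@bounded_integrable _ _ _ _ _ mE _ 1) => //.
  exact: measurable_funTS.
have phiXM : bounded_by 1 (phi \o flow_map Phi b) by move=> z; exact: phiM.
have phiC : compactly_lip K 1 `|rho| phi.
  by split=> // z hz; apply: phi0; apply: le_trans hz; exact: ler_norm.
have := expectation_transport T0 cY Lf1 fL fG ith sol sPhi K0 ler01 (normr_ge0 rho) b0 bT' phiC.
move=> main.
transitivity (Ex (mu b) (RdY Y) phi).
  rewrite /Ex /Rintegral; congr fine; apply/esym.
  by apply: full_integral => //; [exact: D1|exact: ib].
transitivity (Ex mu0 (RdY Y) (phi \o flow_map Phi b)).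
  rewrite main /Ex /Rintegral; congr fine.
  by apply: eq_measure_integral => B mB _; exact: mu00.
transitivity (Ex mu0 setT (phi \o flow_map Phi b)).
  rewrite /Ex /Rintegral; congr fine.
  by apply: full_integral => //; [rewrite -mu00//; exact: D1|exact: ib].
rewrite -[setT in LHS](preimage_setT (flow_map Phi b)).
rewrite -(push_integral mX QX)//.
by rewrite preimage_setT; exact: ib.
Qed.

End uniqueness_of_solutions.

(** * Joint continuity of the flow and the chain rule along trajectories *)

Section joint_measurability.
Context {R : realType} {n : nat}.
Notation S := (state R n).

(** Coordinates turn a point of the product into one column vector, so that continuity yields
    measurability for the product sigma-algebra. *)
Let encode (q : R * S) : 'cV[R]_(1 + (n + n)) := col_mx (const_mx q.1) (col_mx q.2.1 q.2.2).

Let decode (A : 'cV[R]_(1 + (n + n))) : R * S :=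
  (usubmx A 0 0, (usubmx (dsubmx A), dsubmx (dsubmx A))).

Let encodeK q : decode (encode q) = q.
Proof.
rewrite /decode /encode !col_mxKu !col_mxKd col_mxKu mxE; by case: q => t [x y].
Qed.

Let decode_lip A B : `|decode A - decode B| <= 1 * `|A - B|.
Proof.
rewrite mul1r.
have h i : `|A i 0 - B i 0| <= `|A - B|.
  by have := le_mx_norm (A - B) i 0; rewrite !mxE.
suff [h1 h2 h3] : [/\ `|(decode A - decode B).1| <= `|A - B|,
    `|(decode A - decode B).2.1| <= `|A - B| & `|(decode A - decode B).2.2| <= `|A - B|].
  by rewrite [leLHS](_ : _ = Num.max `|(decode A - decode B).1|
    (Num.max `|(decode A - decode B).2.1| `|(decode A - decode B).2.2|))// !ge_max h1 h2 h3.
split; first by rewrite /= !mxE; exact: h.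
  by apply: cV_norm_le => // i; rewrite /= !mxE; exact: h.
by apply: cV_norm_le => // i; rewrite /= !mxE; exact: h.
Qed.

Lemma continuous_joint_measurable (phi : R * S -> R) : continuous phi ->
  measurable_fun setT (phi : measurableTypeR R * borel S -> R).
Proof.
move=> cphi.
apply: (measurable_ext (f := fun q : measurableTypeR R * borel S => (phi \o decode) (encode q))).
  by move=> q; rewrite /= encodeK.
apply: (@measurable_continuous_coord _ _ (measurableTypeR R * borel S)%type setT measurableT
  _ _ encode (phi \o decode)).
  move=> i j; rewrite (ord1 j) /encode.
  case: (split_ordP i) => {}i ->.
    apply: (measurable_ext (f := fun q : measurableTypeR R * borel S => q.1)); last exact: measurable_fst.
    by move=> q; rewrite col_mxEu mxE.
  have mc (g : S -> R) : continuous g ->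
      measurable_fun setT (fun q : measurableTypeR R * borel S => g q.2).
    move=> cg; apply: (measurableT_comp (continuous_state_measurable cg)).
    exact: measurable_snd.
  have cfst k : continuous (fun z : S => z.1 k 0).
    apply: (@lip_continuous _ _ 1) => z z'; rewrite mul1r.
    have -> : z.1 k 0 - z'.1 k 0 = (z - z').1 k 0 by rewrite /= !mxE.
    exact: le_trans (le_mx_norm _ _ _) (norm_fst _).
  have csnd k : continuous (fun z : S => z.2 k 0).
    apply: (@lip_continuous _ _ 1) => z z'; rewrite mul1r.
    have -> : z.2 k 0 - z'.2 k 0 = (z - z').2 k 0 by rewrite /= !mxE.
    exact: le_trans (le_mx_norm _ _ _) (norm_snd _).
  case: (split_ordP i) => {}i ->.
    apply: (measurable_ext (f := fun q : measurableTypeR R * borel S => q.2.1 i 0)); last exact: (mc _ (cfst i)).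
    by move=> q; rewrite col_mxEd col_mxEu.
  apply: (measurable_ext (f := fun q : measurableTypeR R * borel S => q.2.2 i 0)); last exact: (mc _ (csnd i)).
  by move=> q; rewrite col_mxEd col_mxEd.
move=> A; apply: continuous_comp; last exact: cphi.
exact: (lipschitz_map_continuous decode_lip).
Qed.

Lemma continuous_bounded_on_cylinder (phi : R * S -> R) (a b rho : R) : continuous phi ->
  exists M : R, forall t z, a <= t <= b -> `|z| <= rho -> `|phi (t, z)| <= M.
Proof.
move=> cphi; pose C := `[a, b]%classic `*` [set z : S | `|z| <= rho].
have cC : compact C by apply: compact_setX; [exact: segment_compact|exact: compact_ball_state].
have : compact (phi @` C) by apply: continuous_compact => //; exact: continuous_subspaceT.
move=> /compact_bounded[M [_ HM]]; exists (M + 1) => t z tab zr.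
by apply: (HM (M + 1)); [rewrite ltrDl|exists (t, z) => //; split; rewrite //= in_itv].
Qed.

End joint_measurability.

Section continuously_differentiable.
Context {R : realType} {U : normedModType R}.
Variable psi : U -> R.
Hypothesis cpsi : continuous psi.

Lemma line_mvt (e q : U) (D : U -> R) (t : R) :
  (forall x, derivable psi x e /\ 'D_e psi x = D x) ->
  exists2 c : R, `|c| <= `|t| & psi (q + t *: e) - psi q = t * D (q + c *: e).
Proof.
move=> HD; pose phi s := psi (q + s *: e).
have dphi (s : R) : is_derive s (1 : R) phi (D (q + s *: e)).
  have [h1 h2] := HD (q + s *: e).
  have E : (fun h : R => h^-1 *: ((phi \o shift s) (h *: 1) - phi s)) =
      (fun h : R => h^-1 *: ((psi \o shift (q + s *: e)) (h *: e) - psi (q + s *: e))).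
    apply/funext => h; rewrite /phi /=; congr (_ *: (psi _ - _)).
    by rewrite scalerDl addrCA [h *: 1]mulr1.
  apply: DeriveDef; first by rewrite /derivable E.
  by rewrite -h2 /derive E.
have cphi : continuous phi by move=> s; apply: differentiable_continuous; exact/derivable1_diffP.
have c0 a b : {within `[a, b], continuous phi} by exact: continuous_subspaceT.
have phi0 : phi 0 = psi q by rewrite /phi scale0r addr0.
have [t0|/ltW t0] := leP 0 t.
  have [c] := MVT_segment t0 (fun x _ => dphi x) (c0 0 t).
  rewrite in_itv/= => /andP[c1 c2]; rewrite phi0 subr0 mulrC => cE.
  by exists c => //; rewrite !ger0_norm.
have [c] := MVT_segment t0 (fun x _ => dphi x) (c0 t 0).
rewrite in_itv/= => /andP[c1 c2]; rewrite phi0 sub0r mulrN => cE.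
exists c; first by rewrite !ler0_norm// lerN2.
by rewrite -[LHS]opprB cE opprK mulrC.
Qed.

(** Strict differentiability from continuous partial derivatives: the base point [q] moves while the
    derivatives stay frozen at [q0]. The mean value theorem is applied in one direction at a
    time. *)
Lemma C1_increment (I : eqType) (s : seq I) (e : I -> U) (D : I -> U -> R) (q0 : U) (ep : R) :
  (forall i, `|e i| <= 1) -> (forall i x, derivable psi x (e i) /\ 'D_(e i) psi x = D i x) ->
  (forall i, continuous (D i)) -> 0 < ep ->
  exists2 d : R, 0 < d & forall q c, `|q - q0| < d -> \sum_(i <- s) `|c i| < d ->
    `|psi (q + \sum_(i <- s) c i *: e i) - psi q - \sum_(i <- s) c i * D i q0| <=
    ep * \sum_(i <- s) `|c i|.
Proof.
move=> e1 HD cD ep0; elim: s => [|i s [d d0 Hd]].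
  by exists 1 => // q c _ _; rewrite !big_nil addr0 subrr subr0 normr0 mulr0.
have /cvgrPdist_lt /(_ ep ep0) := cD i q0; rewrite near_simpl => /nbhs_ballP[d' /= d'0 Hd'].
exists (Num.min d (d' / 2)); first by rewrite lt_min d0 divr_gt0.
move=> q c; rewrite !lt_min !big_cons => /andP[q1 q2] /andP[c1 c2].
set v := \sum_(j <- s) c j *: e j; set sc := \sum_(j <- s) `|c j| in c1 c2 *.
have sc0 : 0 <= sc by exact: sumr_ge0.
have vs : `|v| <= sc.
  apply: le_trans (ler_norm_sum _ _ _) _; apply: ler_sum => j _.
  by rewrite normrZ ler_piMr.
have ih : `|psi (q + v) - psi q - \sum_(j <- s) c j * D j q0| <= ep * sc.
  by apply: Hd => //; apply: le_lt_trans c1; rewrite lerDr.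
have [k kc kE] := line_mvt (q + v) (c i) (HD i).
have near : `|D i (q + v + k *: e i) - D i q0| <= ep.
  rewrite distrC ltW//; apply: Hd'; rewrite -ball_normE /ball_/= distrC.
  have -> : q + v + k *: e i - q0 = (q - q0) + (v + k *: e i) by rewrite -[q + v + _]addrA addrAC.
  apply: le_lt_trans (ler_normD _ _) _; rewrite (splitr d'); apply: ltrD => //.
  apply: le_lt_trans c2; apply: le_trans (ler_normD _ _) _; rewrite addrC; apply: lerD => //.
  by rewrite normrZ; apply: le_trans kc; rewrite ler_piMr.
have -> : q + (c i *: e i + v) = q + v + c i *: e i by rewrite [_ + v]addrC addrA.
have -> : psi (q + v + c i *: e i) - psi q - (c i * D i q0 + \sum_(j <- s) c j * D j q0) =
    (psi (q + v + c i *: e i) - psi (q + v) - c i * D i q0) +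
    (psi (q + v) - psi q - \sum_(j <- s) c j * D j q0).
  by move: (psi _) (psi _) (psi _) (c i * _) (\sum_(j <- s) _) => x1 x2 x3 x4 x5; ring.
apply: le_trans (ler_normD _ _) _; rewrite mulrDr; apply: lerD => //.
by rewrite kE -mulrBr normrM mulrC; apply: ler_pM.
Qed.

End continuously_differentiable.

Section clamp.
Context {R : realType}.
Variable T : R.
Hypothesis T0 : 0 <= T.

(** Trajectories are controlled on [0, T] only; stopping time at the ends extends them continuously
    to the whole line. *)
Definition clamp (r : R) : R := Num.max 0 (Num.min r T).

Lemma clamp_in r : 0 <= clamp r <= T.
Proof. by rewrite /clamp le_max lexx/= ge_max T0 ge_min lexx orbT. Qed.

Lemma clamp_id r : 0 <= r <= T -> clamp r = r.
Proof. by move=> /andP[r0 rT]; rewrite /clamp (min_idPl rT); exact/max_idPr. Qed.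

Lemma clamp_lip r s : `|clamp r - clamp s| <= `|r - s|.
Proof.
wlog sr : r s / s <= r.
  by move=> H; case: (leP s r) => [|/ltW] h; [|rewrite distrC [`|r - s|]distrC]; exact: H.
rewrite (ger0_norm (x := r - s)) ?subr_ge0// /clamp.
rewrite !maxEle !minEle; do 4 case: ifPn; rewrite -?ltNge => *; rewrite ler_norml; apply/andP; split; lra.
Qed.

End clamp.

Section trajectories.
Context {R : realType} {n : nat}.
Notation S := (state R n).
Notation V := 'cV[R]_n.
Variables (T : R) (F : R -> V -> V) (w : R -> R) (Phi : R -> V -> R -> V).
Hypothesis T0 : 0 <= T.
Hypothesis cF : caratheodory 0 T F w.
Hypothesis sPhi : forall s x, 0 <= s <= T -> solution s T F x (Phi s x).
Let K := expR (2 * Int 0 T w).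
Let K1 : 1 <= K. Proof. exact: flow_weight_ge1 cF T0. Qed.
Let K0 : 0 <= K. Proof. exact: le_trans ler01 K1. Qed.
Let iw := car_itg cF.
Let w0 := car_w0 cF.

Definition speed_bound (x : V) : R := 2 * (1 + `|x|) * K.

Lemma speed_bound_ge0 x : 0 <= speed_bound x.
Proof. by rewrite !mulr_ge0// addr_ge0. Qed.

Lemma trajectory_bound t x : 0 <= t <= T -> 1 + `|Phi 0 x t| <= speed_bound x.
Proof. by move=> /andP[t0 tT]; exact: (flow_bound cF sPhi (lexx 0) t0 tT). Qed.

Lemma trajectory_field r x : 0 <= r <= T -> `|F r (Phi 0 x r)| <= speed_bound x * w r.
Proof.
move=> rT; apply: le_trans (car_growth cF _ rT) _.
by rewrite mulrC ler_wpM2r ?w0// trajectory_bound.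
Qed.

Lemma trajectory_field_itg x i : itg 0 T (fun r => F r (Phi 0 x r) i 0).
Proof.
have T00 : (0 : R) <= 0 <= T by rewrite lexx.
have [mX [M XM] _] := sPhi x T00.
by apply: (itg_field_coord (M := M) cF).
Qed.

Lemma trajectory_diff s t x i : 0 <= s -> s <= t -> t <= T ->
  Phi 0 x t i 0 - Phi 0 x s i 0 = Int s t (fun r => F r (Phi 0 x r) i 0).
Proof.
move=> s0 st tT; have T00 : (0 : R) <= 0 <= T by rewrite lexx.
have [_ _ eX] := sPhi x T00.
have sT : 0 <= s <= T by rewrite s0 (le_trans st).
have tT' : 0 <= t <= T by rewrite (le_trans s0 st).
rewrite (eX s sT) (eX t tT') !mxE (@Int_split _ 0 s t)//; last first.
  exact: itgS (trajectory_field_itg x i).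
by rewrite [x i 0 + _]addrC opprD addrACA addrC addrK addrAC subrr add0r || ring.
Qed.

Lemma trajectory_increment s t x : 0 <= s -> s <= t -> t <= T ->
  `|Phi 0 x t - Phi 0 x s| <= speed_bound x * Int s t w.
Proof.
move=> s0 st tT.
have iws : itg s t w by exact: itgS iw.
rewrite -IntZ//; have ii := itgZ (speed_bound x) iws.
have p0 : 0 <= Int s t (fun r => speed_bound x * w r).
  apply: Int_ge0 => r /andP[sr rt]; rewrite mulr_ge0 ?speed_bound_ge0// w0//.
  by rewrite (le_trans s0 sr) (le_trans rt).
apply: cV_norm_le => // i; rewrite !mxE trajectory_diff//; apply: Int_norm => //.
  by apply: itgS (trajectory_field_itg x i).
move=> r /andP[sr rt]; apply: le_trans (le_mx_norm _ _ _) _; apply: trajectory_field.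
by rewrite (le_trans s0 sr) (le_trans rt).
Qed.

Lemma trajectory_near (r0 : R) (z : S) (e : R) : 0 <= r0 <= T -> 0 < e ->
  exists2 d : R, 0 < d & forall s, 0 <= s <= T -> `|s - r0| < d ->
    `|flow_map Phi s z - flow_map Phi r0 z| <= e.
Proof.
move=> r0T e0; have c0 := speed_bound_ge0 z.1.
have q0 : 0 < speed_bound z.1 + 1 by rewrite ltr_wpDl.
have [d d0 Hd] := Int_small iw w0 r0T (divr_gt0 e0 q0).
exists d => // s /andP[s0 sT]; rewrite ltr_norml => /andP[h1 h2]; have /andP[r00 r0T'] := r0T.
have l1 : r0 - d < s by rewrite addrC -ltrBrDr.
have l2 : s < r0 + d by rewrite addrC -ltrBlDr.
have fin W : 0 <= W -> W <= e / (speed_bound z.1 + 1) -> speed_bound z.1 * W <= e.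
  move=> W0; rewrite ler_pdivlMr// mulrC => h; apply: le_trans h.
  by rewrite ler_wpM2r// lerDl.
apply: norm_pair_le => /=; last by rewrite subrr normr0 ltW.
have [sr|/ltW rs] := leP s r0.
  rewrite distrC; apply: le_trans (trajectory_increment _ s0 sr r0T') _.
  apply: fin; first exact: (weight_ge0 cF s0 r0T').
  by apply: Hd => //; rewrite ltrDl.
apply: le_trans (trajectory_increment _ r00 rs sT) _.
apply: fin; first exact: (weight_ge0 cF r00 sT).
by apply: Hd => //; rewrite gtrBl.
Qed.

(** Time is kept as first component so that functions of time and state can be composed with the
    flow directly. *)
Lemma flow_joint_continuous :
  continuous (fun q : R * S => (q.1, flow_map Phi (clamp T q.1) q.2) : R * S).
Proof.
move=> [r z]; apply/cvgrPdist_lt => e e0.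
have e2 : 0 < e / 2 by rewrite divr_gt0.
have [d d0 Hd] := @trajectory_near (clamp T r) z (e / 4) (clamp_in T0 r) (ltac:(by rewrite divr_gt0)).
have q0 : 0 < 2 * K + 1 by rewrite ltr_wpDl// mulr_ge0.
have k0 : 0 < Num.min (e / 2) (Num.min d (e / 4 / (2 * K + 1))).
  by rewrite !lt_min e2 d0 !divr_gt0.
suff H (q : R * S) : `|(r, z) - q| < Num.min (e / 2) (Num.min d (e / 4 / (2 * K + 1))) ->
    `|((r, flow_map Phi (clamp T r) z) : R * S) - (q.1, flow_map Phi (clamp T q.1) q.2)| < e.
  near=> q; apply: H; near: q; apply: cvgr_dist_lt => //; exact: cvg_id.
case: q => [r' z']; rewrite [X in X < _](_ : _ = Num.max `|r - r'| `|z - z'|)// gt_max.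
move=> /andP[]; rewrite !lt_min => /and3P[h1 h2 _] /and3P[_ _ h3].
have [r'0 r'T] := andP (clamp_in T0 r').
rewrite [X in X < _](_ : _ = Num.max `|r - r'|
  `|flow_map Phi (clamp T r) z - flow_map Phi (clamp T r') z'|)// gt_max.
apply/andP; split; first by apply: lt_trans h1 _; rewrite ltr_pdivrMr// mulr_natr mulr2n ltrDl.
rewrite distrC; apply: le_lt_trans (ler_distD (flow_map Phi (clamp T r') z) _ _) _.
have a1 : `|flow_map Phi (clamp T r') z - flow_map Phi (clamp T r) z| <= e / 4.
  apply: Hd; first exact: clamp_in.
  by rewrite distrC in h2; apply: le_lt_trans h2; exact: clamp_lip.
have a2 : `|flow_map Phi (clamp T r') z' - flow_map Phi (clamp T r') z| <= e / 4.
  apply: le_trans (flow_map_lip cF sPhi _ _ r'0 r'T) _.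
  move: h3; rewrite ltr_pdivlMr// distrC => /ltW h3; apply: le_trans h3.
  by rewrite mulrC ler_wpM2l// lerDl.
apply: le_lt_trans (lerD a2 a1) _.
by move: e0; lra.
Unshelve. all: by end_near. Qed.

Lemma flow_map_cylinder_bound (t rho : R) (z : S) : 0 <= t <= T -> `|z| <= rho ->
  `|flow_map Phi t z| <= 2 * (1 + rho) * K.
Proof.
move=> tT zr; have r0 : 0 <= rho := le_trans (normr_ge0 z) zr.
have h : 1 + `|z.1| <= 1 + rho by rewrite lerD2l (le_trans (norm_fst z)).
apply: norm_pair_le => /=.
  apply: (@le_trans _ _ (speed_bound z.1)).
    by apply: le_trans (trajectory_bound _ tT); rewrite lerDr.
  by rewrite /speed_bound ler_wpM2r// ler_wpM2l.
apply: le_trans (norm_snd z) _; apply: le_trans zr _; apply: (@le_trans _ _ (1 + rho)).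
  by rewrite lerDr.
by rewrite mulrAC ler_peMl ?addr_ge0//; move: K1; lra.
Qed.

End trajectories.

Section chain_rule.
Context {R : realType} {n : nat}.
Notation S := (state R n).
Notation Q := (R * S)%type.
Notation V := 'cV[R]_n.
Variables (T : R) (F : R -> V -> V) (w : R -> R) (Phi : R -> V -> R -> V).
Hypothesis T0 : 0 <= T.
Hypothesis cF : caratheodory 0 T F w.
Hypothesis sPhi : forall s x, 0 <= s <= T -> solution s T F x (Phi s x).
Variable psi : Q -> R.
Hypothesis spsi : smooth psi.
Let iw := car_itg cF.
Let w0 := car_w0 cF.

(** Time and the x-directions only: the second component of the state is constant along
    trajectories. *)
Let dir (k : option 'I_n) : Q := if k is Some i then (0, (delta_mx i 0, 0)) else (1, (0, 0)).

Let nQ (t : R) (z : S) : `|(t, z) : Q| = Num.max `|t| `|z|.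
Proof. by []. Qed.

Let dir1 k : `|dir k| <= 1.
Proof.
case: k => [i|]; rewrite nQ ge_max.
  by rewrite normr0 ler01; exact: (state_basis_norm (inl i)).
by rewrite normr1 lexx (_ : (0, 0) = 0 :> S)// normr0 ler01.
Qed.

Let cpsi : continuous psi. Proof. by case: (spsi 0%N). Qed.

Let Dpsi (k : option 'I_n) : Q -> R := 'D_(dir k) psi.

Let dpsi k x : derivable psi x (dir k) /\ 'D_(dir k) psi x = Dpsi k x.
Proof. by have [_ /(_ (dir k))[h _]] := spsi 1%N; split. Qed.

Let cD k : continuous (Dpsi k).
Proof. by have [_ /(_ (dir k))[_ [h _]]] := spsi 1%N. Qed.

Let path (z : S) (r : R) : Q := (r, flow_map Phi (clamp T r) z).

Let cpath z : continuous (path z).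
Proof.
move=> r; have h := @flow_joint_continuous _ _ _ _ _ _ T0 cF sPhi (r, z).
apply: (@cvg_comp _ _ _ (fun r => (r, z) : Q) _ _ (nbhs (r, z)) _ _ h).
apply: (@lipschitz_map_continuous _ R Q 1 (fun r => (r, z) : Q)) => x y.
by rewrite [X in `|X|](_ : _ = ((x - y, z - z) : Q))// nQ subrr normr0 mul1r ge_max lexx/=.
Qed.

Let rate (z : S) (k : option 'I_n) (r : R) : R := if k is Some i then F r (Phi 0 z.1 r) i 0 else 1.

Let irate z k : itg 0 T (rate z k).
Proof.
case: k => [i|]; last exact: itg_cst.
exact: (trajectory_field_itg T0 cF sPhi).
Qed.

Definition total_derivative (z : S) (r : R) : R :=
  dt psi (r, flow_map Phi r z) +
  \sum_i grad_x psi (r, flow_map Phi r z) i 0 * F r (Phi 0 z.1 r) i 0.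

Notation dirs := (None :: [seq Some i | i <- index_enum 'I_n]).

Let sum_dirs (W : zmodType) (G : option 'I_n -> W) : \sum_(k <- dirs) G k = G None + \sum_i G (Some i).
Proof. by rewrite big_cons big_map. Qed.

Let total_derivativeE z r : 0 <= r <= T ->
  total_derivative z r = \sum_(k <- dirs) rate z k r * Dpsi k (path z r).
Proof.
move=> rT; rewrite sum_dirs /total_derivative /path (clamp_id rT) /= mul1r; congr (_ + _).
by apply: eq_bigr => i _; rewrite /grad_x mxE mulrC.
Qed.

Let iprod z k : itg 0 T (fun r => rate z k r * Dpsi k (path z r)).
Proof.
have [M HM] := continuous_bounded_on_cylinder 0 T (2 * (1 + `|z|) * expR (2 * Int 0 T w)) (@cD k).
apply: (@itgM _ _ _ _ _ M) => //.
  apply: measurable_funTS; apply: continuous_measurable_fun => r.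
  by apply: continuous_comp; [exact: cpath|exact: cD].
move=> r rT; apply: HM => //; rewrite (clamp_id rT).
exact: (flow_map_cylinder_bound T0 cF sPhi).
Qed.

Lemma itg_total_derivative z : itg 0 T (total_derivative z).
Proof.
apply: (@itg_eq _ _ _ (fun r => \sum_(k <- dirs) rate z k r * Dpsi k (path z r))).
  by move=> r /total_derivativeE ->.
exact: itg_sum.
Qed.

Let path_diff z s t : 0 <= s -> s <= t -> t <= T ->
  path z t = path z s + \sum_(k <- dirs) Int s t (rate z k) *: dir k.
Proof.
move=> s0 st tT.
have sT : 0 <= s <= T by rewrite s0 (le_trans st).
have tT' : 0 <= t <= T by rewrite (le_trans s0 st).
rewrite sum_dirs /path !clamp_id// Int_cst// mul1r /=.
have -> : \sum_i Int s t (rate z (Some i)) *: ((0, (delta_mx i 0, 0)) : Q) =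
    (0, (Phi 0 z.1 t - Phi 0 z.1 s, 0)).
  have f1 (I : Type) (q : seq I) (G : I -> Q) : \sum_(i <- q) G i =
      (\sum_(i <- q) (G i).1, \sum_(i <- q) (G i).2).
    by elim: q => [|i q ih]; rewrite ?big_nil// !big_cons ih.
  rewrite f1; congr pair; first by rewrite big1// => i _; rewrite /= scaler0.
  rewrite state_span_fst; apply: eq_bigr => i _ /=.
  by rewrite !mxE (trajectory_diff T0 cF sPhi).
rewrite [X in _ + (X + _)](_ : _ = ((t - s, 0) : Q)); last first.
  by congr pair; [exact: mulr1|exact: scaler0].
congr pair; first by rewrite /= addr0 addrC subrK.
by apply: state_ext; rewrite /= ?add0r ?addr0// addrC subrK.
Qed.

Let rates_le z s t : 0 <= s -> s <= t -> t <= T ->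
  \sum_(k <- dirs) Int s t (fun r => `|rate z k r|) <=
  (t - s) + n%:R * speed_bound T w z.1 * Int s t w.
Proof.
move=> s0 st tT; have iws : itg s t w by exact: itgS iw.
rewrite sum_dirs /= normr1 Int_cst// mul1r lerD2l.
apply: (@le_trans _ _ (\sum_(i < n) speed_bound T w z.1 * Int s t w)); last first.
  by rewrite sumr_const card_ord -mulrA [leRHS]mulr_natl.
apply: ler_sum => i _; rewrite -IntZ//; apply: Int_le.
- by apply: itg_norm; exact: itgS (irate z (Some i)).
- exact: itgZ.
move=> r /andP[sr rt]; apply: le_trans (le_mx_norm _ _ _) _.
by apply: (trajectory_field cF sPhi); rewrite (le_trans s0 sr) (le_trans rt).
Qed.

Let two_halves (x1 x2 x3 x4 y e : R) : `|x1 - x2 - x3| <= e / 2 * y -> `|x3 - x4| <= e / 2 * y ->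
  `|x1 - x2 - x4| <= e * y.
Proof.
move=> a1 a2; have -> : x1 - x2 - x4 = (x1 - x2 - x3) + (x3 - x4) by rewrite addrA subrK.
by apply: le_trans (ler_normD _ _) _; apply: le_trans (lerD a1 a2) _; rewrite -mulrDl -splitr.
Qed.

(** A trajectory is only absolutely continuous, so the chain rule is proved in increments with the
    clock [t + C * Int 0 t w], which dominates the variation of time and of all coordinates. Half of
    [e] pays for linearising [psi], half for freezing its derivatives at [r0]. *)
Lemma chain_rule z : psi (T, flow_map Phi T z) - psi (0, flow_map Phi 0 z) =
  Int 0 T (total_derivative z).
Proof.
have T00 : (0 : R) <= 0 <= T by rewrite lexx.
have TT : 0 <= T <= T by rewrite lexx T0.
pose C := n%:R * speed_bound T w z.1.
have C0 : 0 <= C by rewrite mulr_ge0// (speed_bound_ge0 T0 cF).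
have Int0 (t : R) : 0 <= t -> t <= T -> 0 <= Int 0 t w.
  by move=> t0 tT; apply: (weight_ge0 cF (lexx 0) tT).
have -> : psi (T, flow_map Phi T z) - psi (0, flow_map Phi 0 z) =
    psi (path z T) - psi (path z 0) by rewrite /path !clamp_id.
apply: (@FTC_local _ (fun t => psi (path z t)) _ (fun t => t + C * Int 0 t w)) => //.
  exact: itg_total_derivative.
move=> e r0 e0 r0T; have e2 : 0 < e / 2 by rewrite divr_gt0.
have [d d0 Hd] := C1_increment dirs (path z r0) dir1 dpsi cD e2.
have := @cpath z r0 => /cvgrPdist_lt /(_ d d0); rewrite near_simpl => /nbhs_ballP[d1 /= d10 Hd1].
have near_D : \forall r \near r0, forall k, `|Dpsi k (path z r0) - Dpsi k (path z r)| < e / 2.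
  apply: (@filter_forall _ _ (fun k r => `|Dpsi k (path z r0) - Dpsi k (path z r)| < e / 2) _ (nbhs_filter r0)) => k.
  have : {for r0, continuous (fun r => Dpsi k (path z r))}.
    by apply: continuous_comp; [exact: cpath|exact: cD].
  by move=> /cvgrPdist_lt; exact.
move: near_D => /nbhs_ballP[d2 /= d20 Hd2].
have q0 : 0 < C + 1 by rewrite ltr_wpDl.
have d2q : 0 < d / 2 / (C + 1) by rewrite !divr_gt0.
have [d3 d30 Hd3] := Int_small iw w0 r0T d2q.
exists (Num.min (Num.min d1 d2) (Num.min d3 (d / 4))).
  by rewrite !lt_min d10 d20 d30 divr_gt0.
move=> s t s0 st tT; rewrite ltrBlDr -!ltrBlDl.
move=> h1 h2; have [hs ht] : `|s - r0| < Num.min (Num.min d1 d2) (Num.min d3 (d / 4)) /\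
    `|t - r0| < Num.min (Num.min d1 d2) (Num.min d3 (d / 4)).
  by rewrite !ltr_norml; split; apply/andP; split; arith.
have inb r : s <= r <= t -> `|r - r0| < Num.min (Num.min d1 d2) (Num.min d3 (d / 4)).
  by move=> /andP[sr rt]; rewrite ltr_norml; apply/andP; split; arith.
move: hs ht; rewrite !lt_min => /andP[/andP[s1 s2] /andP[s3 s4]] /andP[/andP[t1 t2] /andP[t3 t4]].
have sT : 0 <= s <= T by rewrite s0 (le_trans st).
have ts_lt : t - s < d / 2.
  by move: s4 t4; rewrite !ltr_norml => /andP[? ?] /andP[? ?]; arith.
have W0 : 0 <= Int s t w by exact: (weight_ge0 cF s0 tT).
have CW : C * Int s t w <= d / 2.
  have h : Int s t w <= d / 2 / (C + 1).
    apply: Hd3 => //; first by move: s3; rewrite ltr_norml => /andP[? _]; rewrite ltrBlDr -ltrBlDl; arith.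
    by move: t3; rewrite ltr_norml => /andP[_ ?]; arith.
  by move: h; rewrite ler_pdivlMr// mulrC; apply: le_trans; rewrite ler_wpM2r// lerDl.
have irs k : itg s t (rate z k) by exact: itgS (irate z k).
pose c k := Int s t (rate z k).
have cle : \sum_(k <- dirs) `|c k| <= t - s + C * Int s t w.
  apply: le_trans (rates_le z s0 st tT); apply: ler_sum => k _.
  by apply: Int_norm => //; exact: itg_norm.
have a1 : `|psi (path z s + \sum_(k <- dirs) c k *: dir k) - psi (path z s) -
    \sum_(k <- dirs) c k * Dpsi k (path z r0)| <= e / 2 * (t - s + C * Int s t w).
  apply: (@le_trans _ _ (e / 2 * \sum_(k <- dirs) `|c k|)); last by rewrite ler_wpM2l ?(ltW e2).
  apply: Hd.
    by rewrite distrC; apply: Hd1; rewrite -ball_normE /ball_/= distrC.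
  by apply: le_lt_trans cle _; arith.
have a2 : `|\sum_(k <- dirs) c k * Dpsi k (path z r0) - Int s t (total_derivative z)| <=
    e / 2 * (t - s + C * Int s t w).
  have ip k : itg s t (fun r => rate z k r * Dpsi k (path z r)) by exact: itgS (iprod z k).
  have iq k : itg s t (fun r => Dpsi k (path z r0) * rate z k r) by exact: itgZ.
  rewrite (@Int_eq _ s t _ (fun r => \sum_(k <- dirs) rate z k r * Dpsi k (path z r))); last first.
    by move=> r /andP[sr rt]; apply: total_derivativeE; rewrite (le_trans s0 sr) (le_trans rt).
  rewrite Int_sum// -sumrB; apply: le_trans (ler_norm_sum _ _ _) _.
  apply: (@le_trans _ _ (e / 2 * \sum_(k <- dirs) Int s t (fun r => `|rate z k r|))); last first.
    by rewrite ler_wpM2l ?(ltW e2)//; exact: rates_le.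
  rewrite mulr_sumr; apply: ler_sum => k _.
  have -> : c k * Dpsi k (path z r0) = Int s t (fun r => Dpsi k (path z r0) * rate z k r).
    by rewrite IntZ// mulrC.
  rewrite -IntB// -IntZ; last exact: itg_norm.
  apply: Int_norm; [exact: itgB|by apply: itgZ; exact: itg_norm|].
  move=> r rst; rewrite [Dpsi k (path z r0) * _]mulrC -mulrBr normrM mulrC ler_wpM2r//.
  have := inb r rst; rewrite !lt_min => /andP[/andP[_ r2] _].
  by apply: ltW; apply: Hd2; rewrite -ball_normE /ball_/= distrC.
have -> : t + C * Int 0 t w - (s + C * Int 0 s w) = t - s + C * Int s t w.
  rewrite (@Int_split _ 0 s t)//; last exact: itgS iw.
  by rewrite mulrDr opprD addrACA; congr (_ + _); rewrite addrC addKr.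
rewrite (path_diff z s0 st tT) -/c.
exact: two_halves a1 a2.
Qed.

End chain_rule.

(** * The curve pushed by the flow is admissible *)

Section compact_support.
Context {R : realType} {n : nat}.
Notation S := (state R n).
Variable mu0 : probability (borel S) R.

Let rball (qk : ('cV[rat]_n * 'cV[rat]_n) * nat) : set S :=
  [set z | `|z - (map_mx ratr qk.1.1, map_mx ratr qk.1.2)| < qk.2.+1%:R^-1].

Let rball_open qk : open (rball qk).
Proof.
rewrite (_ : rball qk = ball ((map_mx ratr qk.1.1, map_mx ratr qk.1.2) : S) qk.2.+1%:R^-1).
  by apply: ball_open.
by apply/seteqP; split=> z /=; rewrite -ball_normE /ball_/= /rball/= distrC.
Qed.

Let rball_base (U : set S) z : open U -> U z -> exists2 qk, rball qk z & rball qk `<=` U.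
Proof.
move=> oU Uz; have /nbhs_ballP[e /= e0 eU] : nbhs z U by exact: open_nbhs_nbhs.
have [k kE] : exists k : nat, k.+1%:R^-1 < e / 2.
  have [N _ HN] := near_infty_natSinv_lt (PosNum (divr_gt0 e0 (ltr0n R 2))).
  by exists N; apply: (HN N) => /=.
have k0 : (0 : R) < k.+1%:R^-1 / 2 by rewrite divr_gt0.
have [q1 h1] := rational_matrix z.1 k0; have [q2 h2] := rational_matrix z.2 k0.
have hz : `|z - (map_mx ratr q1, map_mx ratr q2)| <= k.+1%:R^-1 / 2.
  exact: norm_pair_le.
exists ((q1, q2), k).
  apply: le_lt_trans hz _; rewrite ltr_pdivrMr// mulr_natr mulr2n ltrDl.
  by rewrite invr_gt0.
move=> z' hz'; apply: eU; rewrite -ball_normE /ball_/=.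
apply: le_lt_trans (ler_distD (map_mx ratr q1, map_mx ratr q2) _ _) _.
rewrite (splitr e); apply: ler_ltD; last by rewrite distrC (lt_trans hz').
apply: le_trans hz _; apply: ltW; apply: le_lt_trans kE.
by rewrite ler_pdivrMr// ler_peMr// ?ler1n// invr_ge0.
Qed.

(** The complement of the support is covered by null open sets, and countably many null rational
    balls suffice, so it is null; a bounded support then leaves all the mass in a ball. *)
Lemma support_ball : compact (msupport mu0) ->
  exists2 rho : R, 0 <= rho & mu0 [set z | `|z| <= rho] = 1%E.
Proof.
move=> /compact_bounded[M [_ HM]].
pose rho := `|M| + 1; exists rho; first by rewrite addr_ge0.
have supp z : msupport mu0 z -> `|z| <= rho.
  by apply: HM; rewrite /rho ltr_pwDr// ler_norm.
have cB : closed [set z : S | `|z| <= rho].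
  by apply: compact_closed; [exact: norm_hausdorff|exact: compact_ball_state].
have mB := closed_state_measurable cB.
(* Numbers that code no ball, or a ball of positive mass, stand for the empty set. *)
pose F (m : nat) : set S := if unpickle m is Some qk then
  (if `[< mu0 (rball qk) = 0%E >] then rball qk else set0) else set0.
have nF : mu0.-negligible (\bigcup_m F m).
  apply: negligible_bigcup => m; rewrite /F; case: unpickle => [qk|]; last exact: negligible_set0.
  case: asboolP => [h|_]; last exact: negligible_set0.
  by apply/negligibleP => //; apply: sub_sigma_algebra; exact: rball_open.
have sub : ~` [set z | `|z| <= rho] `<=` \bigcup_m F m.
  move=> z nz; have [U [oU Uz mU]] : exists U, [/\ open U, U z & mu0 U = 0%E].
    apply: contrapT => h; apply: nz; apply: supp => U oU Uz.
    rewrite lt0e measure_ge0 andbT; apply/eqP => mU; apply: h; by exists U.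
  have [qk qz qU] := rball_base oU Uz; exists (pickle qk); first exact: I.
  rewrite /F pickleK asboolT//; apply/eqP; rewrite -measure_le0 -mU.
  apply: le_measure; rewrite ?inE//; apply: sub_sigma_algebra => //; exact: rball_open.
have : mu0 (~` [set z | `|z| <= rho]) = 0%E.
  apply/negligibleP; first exact: measurableC.
  by case: nF => N [mN N0 FN]; exists N; split=> //; exact: subset_trans FN.
rewrite probability_setC// => /eqP; rewrite sube_eq// ?add0e.
by move=> /eqP <-.
Qed.

End compact_support.

Section pushed_curve.
Context {R : realType} {n : nat}.
Notation S := (state R n).
Notation V := 'cV[R]_n.
Variables (T : R) (Y : set V) (F : R -> V -> V) (w : R -> R) (Phi : R -> V -> R -> V).
Hypothesis T0 : 0 < T.
Hypothesis cY : compact Y.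
Hypothesis cF : caratheodory 0 T F w.
Hypothesis sPhi : forall s x, 0 <= s <= T -> solution s T F x (Phi s x).
Variables (mu0 : probability (borel S) R) (mu : R -> probability (borel S) R) (rho : R).
Hypothesis rho0 : 0 <= rho.
Hypothesis mu0Y : mu0 (RdY Y) = 1%E.
Hypothesis mu0rho : mu0 [set z | `|z| <= rho] = 1%E.
Hypothesis pmu : forall t, 0 <= t <= T ->
  is_push mu0 (flow_map Phi t : borel S -> borel S) (mu t).

Let T0' : 0 <= T := ltW T0.
Let D : set S := RdY Y.
Let mD : measurable (D : set (borel S)). Proof. exact: measurable_RdY. Qed.

(** All the mass of [mu0] lies here; expectations are pulled back to this compact set, where
    trajectories are bounded uniformly. *)
Definition core : set S := RdY Y `&` [set z | `|z| <= rho].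

Let closed_ball_rho : closed [set z : S | `|z| <= rho].
Proof. by apply: compact_closed; [exact: norm_hausdorff|exact: compact_ball_state]. Qed.

Lemma core_closed : closed core.
Proof. by apply: closedI => //; exact: closed_RdY. Qed.

Lemma core_compact : compact core.
Proof.
apply: (subclosed_compact core_closed (compact_ball_state (rho := rho))).
by move=> z [].
Qed.

Lemma core_measurable : measurable (core : set (borel S)).
Proof. exact: closed_state_measurable core_closed. Qed.

Lemma core_mass : mu0 core = 1%E.
Proof.
have mB := closed_state_measurable closed_ball_rho.
have h1 : mu0 (~` D) = 0%E := full_measure_compl mD mu0Y.
have h2 : mu0 (~` [set z | `|z| <= rho]) = 0%E := full_measure_compl mB mu0rho.
rewrite -[core]setCK probability_setC; last exact: measurableC core_measurable.
rewrite /core setCI [X in (_ - X)%E](_ : _ = 0%E) ?sube0//.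
apply/negligibleP; first by apply: measurableU; exact: measurableC.
by apply: negligibleU; apply/negligibleP => //; exact: measurableC.
Qed.

Lemma core_RdY : core `<=` RdY Y. Proof. by move=> z []. Qed.

Let mflow t : 0 <= t <= T -> measurable_fun setT (flow_map Phi t : borel S -> borel S).
Proof. by move=> /andP[t0 tT]; exact: (flow_map_measurable cF sPhi). Qed.

Lemma measurable_along_flow t d' (T' : measurableType d') (f : S -> T') : 0 <= t <= T ->
  measurable_fun (D : set (borel S)) (f : borel S -> T') ->
  measurable_fun (D : set (borel S)) (fun z : borel S => f (flow_map Phi t z)).
Proof.
move=> tT mf _ A mA; have := mflow tT measurableT (mf mD A mA).
by rewrite setTI preimage_setI.
Qed.

Lemma pushed_mass t : 0 <= t <= T -> mu t D = 1%E.
Proof. by move=> tT; rewrite (pmu tT mD). Qed.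

Lemma pushed_ge0_integral t (f : S -> \bar R) : 0 <= t <= T ->
  measurable_fun (D : set (borel S)) (f : borel S -> \bar R) -> (forall z, D z -> 0 <= f z)%E ->
  (\int[mu t]_(z in D) f z = \int[mu0]_(z in core) f (flow_map Phi t z))%E.
Proof.
move=> tT mf f0; rewrite (push_ge0_integral (mflow tT) (pmu tT) mD mf f0).
rewrite (_ : _ @^-1` D = D)//.
apply/esym; apply: (full_ge0_integral core_measurable core_mass mD core_RdY).
  exact: measurable_along_flow mf.
by move=> z Dz; exact: f0.
Qed.

Lemma pushed_integral t (f : S -> \bar R) : 0 <= t <= T ->
  measurable_fun (D : set (borel S)) (f : borel S -> \bar R) ->
  (\int[mu t]_(z in D) f z = \int[mu0]_(z in core) f (flow_map Phi t z))%E.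
Proof.
move=> tT mf; rewrite integralE [RHS]integralE.
rewrite (@pushed_ge0_integral t (f ^\+)%E) ?(@pushed_ge0_integral t (f ^\-)%E)//.
- congr (_ - _)%E; apply: eq_integral => z _.
    exact: (congr1 (@^~ z) (esym (funepos_comp f (flow_map Phi t)))).
  exact: (congr1 (@^~ z) (esym (funeneg_comp f (flow_map Phi t)))).
- exact: measurable_funeneg.
- exact: measurable_funepos.
Qed.

Lemma flow_time_continuous z : continuous (fun r => flow_map Phi (clamp T r) z).
Proof.
move=> r; apply/cvgrPdist_le => e e0.
have [d d0 Hd] := trajectory_near T0' cF sPhi z (clamp_in T0' r) e0.
near=> s; rewrite distrC; apply: Hd; first exact: clamp_in.
apply: le_lt_trans (clamp_lip _ _ _) _; rewrite distrC.
by near: s; apply: cvgr_dist_lt => //; exact: cvg_id.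
Unshelve. all: by end_near. Qed.

Lemma pushed_narrowly_continuous : narrowly_continuous T (RdY Y) mu.
Proof.
split=> [t|phi cphi [M HM]]; first by rewrite in_itv/=; exact: pushed_mass.
have mphi : measurable_fun (D : set (borel S)) phi.
  exact: within_continuous_state_measurable (closed_RdY cY) cphi.
have mphit t : measurable_fun (core : set (borel S)) (fun z => phi (flow_map Phi (clamp T t) z)).
  have h := measurable_along_flow (clamp_in T0' t) mphi.
  by apply: measurable_funS h => //; exact: core_RdY.
have E t : 0 <= t <= T -> \int[mu t]_(z in D) phi z =
    \int[mu0]_(z in core) phi (flow_map Phi (clamp T t) z).
  move=> tT; rewrite /Rintegral (pushed_integral tT (f := EFin \o phi)) ?(clamp_id tT)//.
  exact/measurable_EFinP.
(* An open interval around [0, T], with [clamp] extending the integrand beyond the end points. *)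
have cont : {in `]-1, (T + 1)[%classic, continuous
    (fun t => \int[mu0]_(z in core) phi (flow_map Phi (clamp T t) z))}.
  apply: (@continuity_under_integral R _ _ mu0 (fun t z => phi (flow_map Phi (clamp T t) z))
    core core_measurable (-1) (T + 1) _ _ (fun=> M)).
  - move=> t _; apply: (@bounded_integrable _ _ _ _ _ core_measurable _ M) => //.
    by move=> z [Dz _]; apply: HM.
  (* [phi] is continuous only within [D], but [flow_map] fixes the second component and hence stays
     in [D]. *)
  - apply: aeW => z [Dz _] t _; apply: (@cvg_trans _ (phi x @[x --> within D (nbhs (flow_map Phi (clamp T t) z))])).
      move=> A hA.
      have H : \forall r \near t, D (flow_map Phi (clamp T r) z) -> A (phi (flow_map Phi (clamp T r) z)).
        exact: (flow_time_continuous hA).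
      change (\forall r \near t, A (phi (flow_map Phi (clamp T r) z))).
      by apply: filterS H => r; apply.
    by move/subspace_continuousP : cphi; apply.
  - by apply: (@bounded_integrable _ _ _ _ _ core_measurable _ `|M|).
  - by move=> t _; apply: aeW => z [Dz _]; exact: HM.
apply/subspace_continuousP => t; rewrite /= in_itv/= => tT.
move=> A; rewrite /from_subspace (E t tT) => hA.
have tI : t \in `]-1, (T + 1)[%classic.
  by rewrite inE /= in_itv/=; case/andP: tT => t0 tT; apply/andP; split; lra.
have H : \forall s \near t, A (\int[mu0]_(z in core) phi (flow_map Phi (clamp T s) z)).
  exact: (cont t tI A hA).
change (\forall s \near t, `[0, T]%classic s -> A (\int[mu s]_(z in RdY Y) phi z)).
by apply: filterS H => s As; rewrite /= in_itv/= => sT; rewrite (E s sT).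
Qed.

End pushed_curve.

Section euclidean_distance.
Context {R : realType} {n : nat}.
Notation S := (state R n).

Lemma eucl_dist_sqr (z z' : S) : eucl_dist z z' ^+ 2 =
  enorm (z.1 - z'.1) ^+ 2 + enorm (z.2 - z'.2) ^+ 2.
Proof. by rewrite sqr_sqrtr// addr_ge0// sqr_ge0. Qed.

Lemma eucl_dist_sqr_le (z z' : S) : eucl_dist z z' ^+ 2 <= 2 * (n%:R * `|z - z'|) ^+ 2.
Proof.
rewrite eucl_dist_sqr mulr2n mulrDl mul1r; apply: lerD.
  rewrite lerXn2r// ?nnegrE ?enorm_ge0 ?mulr_ge0//; apply: le_trans (enorm_le_norm _) _.
  by rewrite muln1 ler_wpM2l//; exact: (norm_fst (z - z')).
rewrite lerXn2r// ?nnegrE ?enorm_ge0 ?mulr_ge0//; apply: le_trans (enorm_le_norm _) _.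
by rewrite muln1 ler_wpM2l//; exact: (norm_snd (z - z')).
Qed.

Lemma measurable_eucl_dist_sqr d (T : measurableType d) (X X' : T -> borel S) :
  measurable_fun setT X -> measurable_fun setT X' ->
  measurable_fun setT (fun t => eucl_dist (X t) (X' t) ^+ 2).
Proof.
move=> mX mX'.
have c1 i : measurable_fun setT (fun z : borel S => z.1 i 0).
  apply: continuous_state_measurable; apply: (@lip_continuous _ _ 1) => z z'; rewrite mul1r.
  have -> : z.1 i 0 - z'.1 i 0 = (z - z').1 i 0 by rewrite /= !mxE.
  exact: le_trans (le_mx_norm _ _ _) (norm_fst _).
have c2 i : measurable_fun setT (fun z : borel S => z.2 i 0).
  apply: continuous_state_measurable; apply: (@lip_continuous _ _ 1) => z z'; rewrite mul1r.
  have -> : z.2 i 0 - z'.2 i 0 = (z - z').2 i 0 by rewrite /= !mxE.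
  exact: le_trans (le_mx_norm _ _ _) (norm_snd _).
apply: (measurable_ext (f := fun t => \sum_i ((X t).1 i 0 - (X' t).1 i 0) ^+ 2 +
    \sum_i ((X t).2 i 0 - (X' t).2 i 0) ^+ 2)).
  move=> t; rewrite eucl_dist_sqr !enorm_sqr; congr (_ + _); apply: eq_bigr => i _;
    by rewrite big_ord1 !mxE.
apply: measurable_funD; apply: measurable_sum => i; apply: measurable_funX;
  apply: measurable_funB.
- exact: (measurableT_comp (c1 i) mX).
- exact: (measurableT_comp (c1 i) mX').
- exact: (measurableT_comp (c2 i) mX).
- exact: (measurableT_comp (c2 i) mX').
Qed.

End euclidean_distance.

Section pushed_curve_continuity.
Context {R : realType} {n : nat}.
Notation S := (state R n).
Notation V := 'cV[R]_n.
Variables (T : R) (Y : set V) (F : R -> V -> V) (w : R -> R) (Phi : R -> V -> R -> V).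
Hypothesis T0 : 0 < T.
Hypothesis cY : compact Y.
Hypothesis cF : caratheodory 0 T F w.
Hypothesis sPhi : forall s x, 0 <= s <= T -> solution s T F x (Phi s x).
Variables (mu0 : probability (borel S) R) (mu : R -> probability (borel S) R) (rho : R).
Hypothesis rho0 : 0 <= rho.
Hypothesis mu0Y : mu0 (RdY Y) = 1%E.
Hypothesis mu0rho : mu0 [set z | `|z| <= rho] = 1%E.
Hypothesis pmu : forall t, 0 <= t <= T ->
  is_push mu0 (flow_map Phi t : borel S -> borel S) (mu t).
Let T0' : 0 <= T := ltW T0.
Let D : set S := RdY Y.
Let B : set S := core Y rho.
Let mB : measurable (B : set (borel S)). Proof. exact: core_measurable. Qed.
Let muB : mu0 B = 1%E. Proof. exact: core_mass. Qed.
Let mD : measurable (D : set (borel S)). Proof. exact: measurable_RdY. Qed.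
Let K := expR (2 * Int 0 T w).
Let K1 : 1 <= K. Proof. exact: flow_weight_ge1 cF T0'. Qed.
Let K0 : 0 <= K. Proof. exact: le_trans ler01 K1. Qed.

Let mflow t : 0 <= t <= T -> measurable_fun setT (flow_map Phi t : borel S -> borel S).
Proof. by move=> /andP[t0 tT]; exact: (flow_map_measurable cF sPhi). Qed.

Lemma core_bounded_integral (f : S -> R) (M : R) : measurable_fun (B : set (borel S)) (f : borel S -> R) ->
  (forall z, B z -> 0 <= f z <= M) -> (\int[mu0]_(z in B) (f z)%:E <= M%:E)%E.
Proof.
move=> mf fM; have M0 : 0 <= M.
  have [B0|/set0P[z Bz]] := eqVneq B set0.
    by have := muB; rewrite B0 measure0 => /eqP; rewrite eq_sym onee_eq0.
  by have /andP[h1 h2] := fM z Bz; exact: le_trans h2.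
apply: (@le_trans _ _ (\int[mu0]_(z in B) (cst M%:E) z)%E).
  apply: ge0_le_integral => //.
  - by move=> z /fM/andP[]; rewrite lee_fin.
  - exact/measurable_EFinP.
  - by move=> z /fM/andP[_]; rewrite lee_fin.
by rewrite integral_cst// [X in (_ * X)%E](_ : _ = 1%E) ?mule1.
Qed.

Lemma pushed_P2 t : 0 <= t <= T -> P2 (RdY Y) (mu t).
Proof.
move=> tT; split; first by rewrite /Pborel/= (pmu tT mD).
have [zb Bz] : exists z, B z.
  have [B0|/set0P//] := eqVneq B set0.
  by have := muB; rewrite B0 measure0 => /eqP; rewrite eq_sym onee_eq0.
exists zb; first by case: Bz.
have mf : measurable_fun setT (fun z : borel S => eucl_dist z zb ^+ 2).
  apply: (@measurable_eucl_dist_sqr _ _ _ (borel S) idfun (fun=> zb)).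
    exact: measurable_id.
  exact: measurable_cst.
rewrite (pushed_ge0_integral cY cF sPhi mu0Y mu0rho pmu tT (f := fun z => (eucl_dist z zb ^+ 2)%:E)).
- apply: (@le_lt_trans _ _ (2 * (n%:R * (2 * (1 + rho) * K + `|zb|)) ^+ 2)%:E); last exact: ltry.
  apply: core_bounded_integral.
    apply: measurable_funTS.
    apply: (@measurable_eucl_dist_sqr _ _ _ (borel S) (flow_map Phi t) (fun=> zb)).
      exact: mflow.
    exact: measurable_cst.
  move=> z [_ zr]; rewrite sqr_ge0/=; apply: le_trans (eucl_dist_sqr_le _ _) _.
  rewrite ler_wpM2l// lerXn2r// ?nnegrE.
  + by rewrite mulr_ge0.
  + by rewrite mulr_ge0// addr_ge0// !mulr_ge0// addr_ge0.
  + rewrite ler_wpM2l//; apply: le_trans (ler_normB _ _) _; rewrite lerD2r.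
    exact: (flow_map_cylinder_bound T0' cF sPhi).
- by apply/measurable_EFinP; apply: measurable_funTS.
- by move=> z _; rewrite lee_fin sqr_ge0.
Qed.

(** The image of [mu0] under the pair of flow maps at times [s] and [t] is a coupling, and it moves
    mass by at most [e] in the sup norm. *)
Lemma W2_pushed_le s t (e : R) : 0 <= s <= T -> 0 <= t <= T -> 0 <= e ->
  (forall z, B z -> `|flow_map Phi s z - flow_map Phi t z| <= e) ->
  (W2 (mu s) (mu t) <= (Num.sqrt (2 * (n%:R * e) ^+ 2))%:E)%E.
Proof.
move=> sT tT e0 He.
have mpair : measurable_fun setT
    (fun z : borel S => (flow_map Phi s z, flow_map Phi t z) : borel S * borel S).
  by apply: measurable_fun_pair; exact: mflow.
have [pi hpi] := push_exists mu0 mpair.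
have coup : is_coupling (mu s) (mu t) pi.
  move=> A mA; split.
    rewrite hpi; last exact: measurableX.
    rewrite (pmu sT mA); congr (mu0 _).
    by apply/seteqP; split=> z /=; [case|split].
  rewrite hpi; last exact: measurableX.
  rewrite (pmu tT mA); congr (mu0 _).
  by apply/seteqP; split=> z /=; [case|split].
have md : measurable_fun setT
    (fun z : borel S * borel S => (eucl_dist z.1 z.2 ^+ 2)).
  by apply: (@measurable_eucl_dist_sqr _ _ _ (borel S * borel S)%type fst snd);
    [exact: measurable_fst|exact: measurable_snd].
have mdf : measurable_fun setT
    (fun z : borel S => eucl_dist (flow_map Phi s z) (flow_map Phi t z) ^+ 2).
  by apply: measurable_eucl_dist_sqr; exact: mflow.
have -> : (Num.sqrt (2 * (n%:R * e) ^+ 2))%:E = sqrte (2 * (n%:R * e) ^+ 2)%:E by [].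
rewrite /W2 lee_sqrt; last by rewrite lee_fin mulr_ge0// sqr_ge0.
apply: (@le_trans _ _ (\int[pi]_z (eucl_dist z.1 z.2 ^+ 2)%:E)%E).
  by apply: ereal_inf_lbound; exists pi.
rewrite (push_ge0_integral mpair hpi measurableT)//; last first.
- by move=> z _; rewrite lee_fin sqr_ge0.
- exact/measurable_EFinP.
rewrite preimage_setT /=.
rewrite -(full_ge0_integral mB muB measurableT)//; last first.
- by move=> z _; rewrite lee_fin sqr_ge0.
- exact/measurable_EFinP.
apply: core_bounded_integral; first exact: measurable_funTS.
move=> z Bz; rewrite sqr_ge0/=; apply: le_trans (eucl_dist_sqr_le _ _) _.
rewrite ler_wpM2l// lerXn2r// ?nnegrE ?mulr_ge0//.
by rewrite ler_wpM2l// He.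
Qed.

Lemma trajectory_near_uniform (t e : R) : 0 <= t <= T -> 0 < e ->
  exists2 d : R, 0 < d & forall s z, 0 <= s <= T -> `|s - t| < d -> B z ->
    `|flow_map Phi s z - flow_map Phi t z| <= e.
Proof.
move=> tT e0; pose sb := 2 * (1 + rho) * K.
have sb0 : 0 <= sb by rewrite !mulr_ge0// addr_ge0.
have q0 : 0 < sb + 1 by rewrite ltr_wpDl.
have [d d0 Hd] := Int_small (car_itg cF) (car_w0 cF) tT (divr_gt0 e0 q0).
exists d => // s z /andP[s0 sT]; rewrite ltr_norml => /andP[h1 h2] [_ zr].
have /andP[t0 tT'] := tT.
have l1 : t - d < s by rewrite addrC -ltrBrDr.
have l2 : s < t + d by rewrite addrC -ltrBlDr.
have zsb : speed_bound T w z.1 <= sb.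
  by rewrite /speed_bound /sb ler_wpM2r// ler_wpM2l// lerD2l (le_trans (norm_fst z)).
have fin W : 0 <= W -> W <= e / (sb + 1) -> speed_bound T w z.1 * W <= e.
  move=> W0; rewrite ler_pdivlMr// mulrC => h; apply: le_trans h.
  by rewrite ler_wpM2r// (le_trans zsb)// lerDl.
apply: norm_pair_le => /=; last by rewrite subrr normr0 ltW.
have [sr|/ltW rs] := leP s t.
  rewrite distrC; apply: le_trans (trajectory_increment T0' cF sPhi _ s0 sr tT') _.
  apply: fin; first exact: (weight_ge0 cF s0 tT').
  by apply: Hd => //; rewrite ltrDl.
apply: le_trans (trajectory_increment T0' cF sPhi _ t0 rs sT) _.
apply: fin; first exact: (weight_ge0 cF t0 sT).
by apply: Hd => //; rewrite gtrBl.
Qed.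

Lemma pushed_W2_curve : W2_curve T (RdY Y) mu.
Proof.
split=> t; rewrite in_itv/= => tT; first exact: pushed_P2.
have key e : 0 < e -> \forall s \near within `[0, T] (nbhs t),
    (0 <= W2 (mu s) (mu t) <= e%:E)%E.
  move=> e0; have q0 : 0 < Num.sqrt 2 * n%:R + 1 :> R by rewrite ltr_wpDl// mulr_ge0.
  have [d d0 Hd] := trajectory_near_uniform tT (divr_gt0 e0 q0).
  have hd : \forall s \near t, `|t - s| < d by apply/nbhs_ballP; exists d.
  rewrite near_withinE; apply: filterS hd => s hs; rewrite /= in_itv/= => sT; rewrite sqrte_ge0/=.
  have q1 : 0 <= e / (Num.sqrt 2 * n%:R + 1) by rewrite ltW// divr_gt0.
  apply: le_trans (W2_pushed_le sT tT q1 _) _.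
    by move=> z Bz; apply: Hd => //; rewrite distrC.
  set x := e / _ in q1 *; have x1 : (Num.sqrt 2 * n%:R + 1) * x = e.
    by rewrite /x mulrC mulfVK// gt_eqF.
  have -> : 2 * (n%:R * x) ^+ 2 = (Num.sqrt 2 * n%:R * x) ^+ 2.
    by rewrite -[Num.sqrt 2 * _ * _]mulrA [RHS]exprMn sqr_sqrtr.
  rewrite lee_fin sqrtr_sqr ger0_norm; last by rewrite mulr_ge0// mulr_ge0.
  by rewrite -x1 ler_wpM2r// lerDl.
apply/fine_cvgP; split.
  apply: filterS (key 1 ltr01) => s /andP[h1 h2].
  by rewrite ge0_fin_numE// (le_lt_trans h2)// ltry.
apply/cvgrPdist_le => e e0; apply: filterS (key e e0) => s /andP[h1 h2] /=.
have hf : W2 (mu s) (mu t) \is a fin_num by rewrite ge0_fin_numE// (le_lt_trans h2)// ltry.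
by rewrite sub0r normrN ger0_norm ?fine_ge0// -lee_fin fineK.
Qed.

End pushed_curve_continuity.

Section pushed_curve_equation.
Context {R : realType} {n p : nat}.
Notation S := (state R n).
Notation V := 'cV[R]_n.
Variables (T Lf : R) (Y : set 'cV[R]_n) (f : 'cV[R]_n -> 'cV[R]_p).
Variable theta : R -> 'M[R]_(n, p).
Hypotheses (T0 : 0 < T) (cY : compact Y) (Lf1 : 1 <= Lf).
Hypothesis fL : forall x x', `|f x - f x'| <= Lf * `|x - x'|.
Hypothesis fG : forall x, `|f x| <= Lf * (1 + `|x|).
Hypothesis ith : forall i j, itg 0 T (fun r => theta r i j).
Variable Phi : R -> V -> R -> V.
Hypothesis sPhi : forall s x, 0 <= s <= T ->
  solution s T (fun r x => theta r *m f x) x (Phi s x).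
Variables (mu0 : probability (borel S) R) (mu : R -> probability (borel S) R) (rho : R).
Hypothesis rho0 : 0 <= rho.
Hypothesis mu0Y : mu0 (RdY Y) = 1%E.
Hypothesis mu0rho : mu0 [set z | `|z| <= rho] = 1%E.
Hypothesis pmu : forall t, 0 <= t <= T ->
  is_push mu0 (flow_map Phi t : borel S -> borel S) (mu t).
Let T0' : 0 <= T := ltW T0.
Let cF := field_caratheodory Lf1 fL fG ith.
Let Lf0 : 0 <= Lf. Proof. exact: le_trans ler01 Lf1. Qed.
Let D : set S := RdY Y.
Let B : set S := core Y rho.
Let mB : measurable (B : set (borel S)). Proof. exact: core_measurable. Qed.
Let mD : measurable (D : set (borel S)). Proof. exact: measurable_RdY. Qed.
Let I : set R := `[0, T]%classic.
Let mI : measurable (I : set (measurableTypeR R)). Proof. exact: measurable_cc. Qed.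

Section one_test.
Variable psi : R * S -> R.
Hypothesis tpsi : test_function T psi.

Let spsi : smooth psi. Proof. by case: tpsi. Qed.

Let dt_continuous : continuous (dt psi).
Proof. by have [_ /(_ (1, (0, 0)))[_ [h _]]] := spsi 1%N. Qed.

Let grad_continuous i : continuous (fun q => grad_x psi q i 0).
Proof.
have [_ /(_ (0, (delta_mx i 0, 0)))[_ [h _]]] := spsi 1%N.
by rewrite (_ : (fun q => _) = 'D_(0, (delta_mx i 0, 0)) psi)//; apply/funext => q; rewrite /grad_x mxE.
Qed.

Let path (q : R * S) : R * S := (q.1, flow_map Phi (clamp T q.1) q.2).

Let path_continuous : continuous path.
Proof. exact: flow_joint_continuous T0' cF sPhi. Qed.

Let H0 (q : R * S) : R := dt psi (path q).

Let H (i : 'I_n) (j : 'I_p) (q : R * S) : R := grad_x psi (path q) i 0 * f (path q).2.1 j 0.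

Let H0_continuous : continuous H0.
Proof. by move=> q; apply: continuous_comp; [exact: path_continuous|exact: dt_continuous]. Qed.

Let cfj (j : 'I_p) : continuous (fun q : R * S => f q.2.1 j 0).
Proof.
move=> q; apply: (@continuous_comp _ _ _ snd (fun z : S => f z.1 j 0)); first exact: cvg_snd.
exact: (continuous_f_coord Lf0 fL).
Qed.

Let H_continuous i j : continuous (H i j).
Proof.
move=> q; apply: (@continuous_comp _ _ _ path (fun q => grad_x psi q i 0 * f q.2.1 j 0)).
  exact: path_continuous.
by apply: cvgM; [exact: grad_continuous|exact: cfj].
Qed.

Let th i j : R -> R := (fun r => theta r i j) \_ I.

(** The integrand pulled back to [mu0] and extended by 0 outside [0, T] and [core], so that Fubini
    applies on the whole product. *)
Let G (q : R * S) : R :=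
  \1_B q.2 * (\1_I q.1 * H0 q + \sum_i \sum_j th i j q.1 * H i j q).

Let G_measurable : measurable_fun setT (G : measurableTypeR R * borel S -> R).
Proof.
have m1 : measurable_fun setT (fun q : measurableTypeR R * borel S => \1_B q.2 : R).
  by apply: (measurableT_comp (measurable_indic mB)); exact: measurable_snd.
have m2 : measurable_fun setT (fun q : measurableTypeR R * borel S => \1_I q.1 : R).
  by apply: (measurableT_comp (measurable_indic mI)); exact: measurable_fst.
apply: measurable_funM => //; apply: measurable_funD.
  by apply: measurable_funM => //; exact: continuous_joint_measurable.
apply: measurable_sum => i; apply: measurable_sum => j; apply: measurable_funM.
  have mth : measurable_fun setT (th i j).
    by have /(measurable_restrictT _ mI) := itg_measurable (ith i j).
  by apply: (measurableT_comp mth); exact: measurable_fst.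
exact: continuous_joint_measurable.
Qed.

Let G_total t z : I t -> B z ->
  G (t, z) = total_derivative (fun r x => theta r *m f x) Phi psi z t.
Proof.
move=> It Bz; have tT : 0 <= t <= T by move: It; rewrite /I /= in_itv.
rewrite /G /= !indicE !mem_set// !mul1r /total_derivative /H0 /path /= (clamp_id tT).
congr (_ + _); apply: eq_bigr => i _; rewrite [(_ *m _) i 0]mxE mulr_sumr; apply: eq_bigr => j _.
rewrite /th patchE mem_set// /H /path /= (clamp_id tT) mulrCA; congr (_ * _).
Qed.

Let G_out t z : ~ (I t /\ B z) -> G (t, z) = 0.
Proof.
move=> h; have [Bz|nBz] := pselect (B z); last by rewrite /G indicE memNset// mul0r.
have nIt : ~ I t by move=> It; apply: h.
rewrite /G /= [\1_I t]indicE memNset// mul0r add0r big1 ?mulr0// => i _; rewrite big1// => j _.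
by rewrite /th patchE memNset// mul0r.
Qed.

Let M_exists : exists2 M : R, 0 <= M & forall t z, I t -> B z ->
  `|H0 (t, z)| <= M /\ forall i j, `|H i j (t, z)| <= M.
Proof.
have [M0 HM0] := continuous_bounded_on_cylinder 0 T rho H0_continuous.
have h (ij : 'I_n * 'I_p) : exists M : R, forall t z, 0 <= t <= T -> `|z| <= rho ->
    `|H ij.1 ij.2 (t, z)| <= M.
  exact: (continuous_bounded_on_cylinder 0 T rho (@H_continuous ij.1 ij.2)).
have [M HM] := choice h.
exists (`|M0| + \sum_ij `|M ij|) => [|t z]; first by rewrite addr_ge0// sumr_ge0.
rewrite /I /= in_itv/= => It [_ Bz]; split.
  apply: le_trans (HM0 _ _ It Bz) _; apply: le_trans (ler_norm _) _.
  by rewrite lerDl sumr_ge0.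
move=> i j; apply: le_trans (HM (i, j) _ _ It Bz) _; apply: le_trans (ler_norm _) _.
rewrite (bigD1 (i, j))//= addrCA lerDl addr_ge0// sumr_ge0//.
Qed.

Let omega (M t : R) : R := M * (1 + \sum_i \sum_j `|theta t i j|).

Let omega_ge0 M t : 0 <= M -> 0 <= omega M t.
Proof.
by move=> M0; rewrite mulr_ge0// addr_ge0// sumr_ge0// => i _; exact: sumr_ge0.
Qed.

Let omega_itg M : itg 0 T (omega M).
Proof.
apply: itgZ; apply: itgD; first exact: itg_cst.
by apply: itg_sum => i; apply: itg_sum => j; exact: itg_norm.
Qed.

Let mG : measurable_fun setT (EFin \o G : measurableTypeR R * borel S -> \bar R).
Proof. exact/measurable_EFinP. Qed.

Let mGt (t : measurableTypeR R) : measurable_fun setT (fun z : borel S => (G (t, z))%:E).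
Proof.
apply: (measurableT_comp mG (g := fun z : borel S => (t, z))).
by apply: measurable_fun_pair; [exact: measurable_cst|exact: measurable_id].
Qed.

Let G_bound : exists2 M : R, 0 <= M & forall t z, `|G (t, z)| <= (omega M \_ I) t.
Proof.
have [M M0 HM] := M_exists; exists M => // t z; rewrite patchE.
have [It|nIt] := pselect (I t); last first.
  by rewrite memNset// G_out ?normr0// => -[].
rewrite mem_set//; have [Bz|nBz] := pselect (B z); last first.
  by rewrite G_out ?normr0 ?omega_ge0// => -[].
have [h1 h2] := HM t z It Bz.
rewrite /G /= !indicE !mem_set// !mul1r /omega mulrDr mulr1.
apply: le_trans (ler_normD _ _) _; apply: lerD => //.
rewrite mulr_sumr; apply: le_trans (ler_norm_sum _ _ _) _; apply: ler_sum => i _.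
rewrite mulr_sumr; apply: le_trans (ler_norm_sum _ _ _) _; apply: ler_sum => j _.
by rewrite /th patchE mem_set// normrM mulrC ler_wpM2r.
Qed.

Let G_integrable : (lebesgue_measure \x mu0)%E.-integrable setT
  (EFin \o G : measurableTypeR R * borel S -> \bar R).
Proof.
apply/(integrable12ltyP lebesgue_measure mu0 mG).
have [M M0 HM] := G_bound.
have iom := omega_itg M.
apply: (@le_lt_trans _ _ (\int[lebesgue_measure]_x ((EFin \o omega M) \_ I) x)%E); last first.
  rewrite -integral_mkcond.
  have := iom => /integrableP[_]; apply: le_lt_trans.
  by apply: le_integral => //; [exact: integrable_abse|move=> t _; exact: lee_abs].
apply: ge0_le_integral => //.
- by move=> t _; apply: integral_ge0.
- apply: (measurable_fun_fubini_tonelli_F (m2 := mu0) (abse \o (EFin \o G))) => //=.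
  exact: measurableT_comp.
- by have /(measurable_restrictT _ mI) := measurable_int _ iom.
move=> t _; have -> : ((EFin \o omega M) \_ I) t = (((omega M) \_ I) t)%:E.
  by rewrite !patchE; case: ifP.
apply: (@le_trans _ _ (\int[mu0]_y (cst ((omega M \_ I) t)%:E) y)%E); last first.
  by rewrite integral_cst// [X in (_ * X)%E](_ : _ = 1%E) ?mule1//; exact: probability_setT.
apply: ge0_le_integral => //.
- by apply: measurableT_comp => //; exact: mGt.
- by move=> z _; rewrite lee_fin HM.
Qed.

Let psi_boundary z : psi (0, z) = 0 /\ psi (T, z) = 0.
Proof.
have [_ _ sup] := tpsi.
have out t : ~ (0 < t < T) -> psi (t, z) = 0.
  move=> h; apply/eqP; apply: contrapT => /negP nz; apply: h.
  have [|/=] := sup (t, z); first exact: subset_closure.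
  by rewrite in_itv.
by split; apply: out; rewrite ltxx ?andbF.
Qed.

(** After Fubini, the inner integral is that of a total derivative along one trajectory, equal to
    the difference of [psi] at the two end times, where [psi] vanishes. *)
Lemma pushed_weak_equation :
  (\int[lebesgue_measure]_(t in `[0%R, T]) \int[mu t]_(z in RdY Y)
    (dt psi (t, z) + \sum_i grad_x psi (t, z) i 0 * velocity f z.1 (theta t) i 0)%:E = 0)%E.
Proof.
transitivity (\int[lebesgue_measure]_t \int[mu0]_z (G (t, z))%:E)%E.
  rewrite integral_mkcond; apply: eq_integral => t _; rewrite patchE.
  case: ifPn => [/set_mem It|/negP nIt]; last first.
    rewrite integral0_eq// => z _; rewrite G_out// => -[It _]; apply: nIt; exact: mem_set.
  have tT : 0 <= t <= T by move: It; rewrite /= in_itv.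
  have mint : measurable_fun (D : set (borel S)) (fun z : borel S =>
      (dt psi (t, z) + \sum_i grad_x psi (t, z) i 0 * velocity f z.1 (theta t) i 0)%:E).
    apply/measurable_EFinP; apply: measurable_funTS.
    have mt (h : R * S -> R) : continuous h -> measurable_fun setT (fun z : borel S => h (t, z)).
      move=> ch; apply: (measurableT_comp (continuous_joint_measurable ch)
        (g := fun z : borel S => ((t : measurableTypeR R), z))).
      by apply: measurable_fun_pair; [exact: measurable_cst|exact: measurable_id].
    apply: measurable_funD; first exact: mt.
    apply: measurable_sum => i; apply: measurable_funM; first exact: mt (@grad_continuous i).
    apply: (measurable_ext (f := fun z : borel S => \sum_j theta t i j * f z.1 j 0)).
      by move=> z; rewrite /velocity mxE.
    apply: measurable_sum => j; apply: measurable_funM; first exact: measurable_cst.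
    by apply: continuous_state_measurable; exact: (continuous_f_coord Lf0 fL).
  rewrite (pushed_integral cY cF sPhi mu0Y mu0rho pmu tT mint) integral_mkcond.
  apply: eq_integral => z _; rewrite patchE; case: ifPn => [/set_mem Bz|/negP nBz].
    by rewrite G_total.
  by rewrite G_out// => -[_ Bz]; apply: nBz; exact: mem_set.
rewrite (Fubini G_integrable) integral0_eq// => z _.
have [Bz|nBz] := pselect (B z); last first.
  by rewrite integral0_eq// => t _; rewrite /= G_out// => -[].
transitivity (\int[lebesgue_measure]_(t in `[0%R, T])
    (total_derivative (fun r x => theta r *m f x) Phi psi z t)%:E)%E.
  rewrite [RHS]integral_mkcond; apply: eq_integral => t _; rewrite patchE.
  case: ifPn => [/set_mem It|/negP nIt]; first by rewrite /= G_total.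
  by rewrite /= G_out// => -[It _]; apply: nIt; exact: mem_set.
have itot := itg_total_derivative T0' cF sPhi spsi z.
have := chain_rule T0' cF sPhi spsi z.
have [_ ->] := psi_boundary (flow_map Phi T z); have [-> _] := psi_boundary (flow_map Phi 0 z).
rewrite subrr Int.unlock /Rintegral => h.
by rewrite -[LHS]fineK ?(integrable_fin_num mI itot)// -h.
Qed.

End one_test.

Lemma pushed_admissible (thL2 : in_L2 T theta) : admissible T Y f mu0 (mu, theta).
Proof.
split=> //=.
- exact: (pushed_W2_curve T0 cY cF sPhi rho0 mu0Y mu0rho pmu).
- split; first exact: (pushed_narrowly_continuous T0 cY cF sPhi mu0Y mu0rho pmu).
  exact: pushed_weak_equation.
- move=> A mA; rewrite (pmu _ mA) ?lexx//; congr (mu0 _).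
  apply/seteqP; split=> -[x y] /=; rewrite /flow_map /= (flow_start sPhi (lexx 0) T0' (lexx T)) //.
Qed.

End pushed_curve_equation.

(** * Weak compactness of square integrable functions *)

Section square_integrable_functions.
Context {R : realType}.
Variables (a b : R).
Implicit Types u v w x : R -> R.

Definition sqitg u := measurable_fun `[a, b] u /\ itg a b (fun r => u r ^+ 2).
(** The squared norm of the space of square integrable functions; [ip] is its inner product.
    Functions are not identified almost everywhere. *)
Definition sqN u := Int a b (fun r => u r ^+ 2).
Definition ip u v := Int a b (fun r => u r * v r).

Let mul_le (s t : R) : `|s * t| <= s ^+ 2 + t ^+ 2.
Proof. by rewrite ler_norml; have := sqr_ge0 (s + t); have := sqr_ge0 (s - t); nra. Qed.

Lemma sqitg_mul u v : sqitg u -> sqitg v -> itg a b (fun r => u r * v r).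
Proof.
move=> [mu iu] [mv iv]; apply: itg_dom (itgD iu iv) _; first exact: measurable_funM.
by move=> r _; exact: mul_le.
Qed.

Lemma sqitg_cst (k : R) : sqitg (fun=> k).
Proof. by split; [exact: measurable_cst|exact: itg_cst]. Qed.

Lemma sqitg_itg u : sqitg u -> itg a b u.
Proof.
by move=> uL; apply: itg_eq (sqitg_mul uL (sqitg_cst 1)) => r _; rewrite mulr1.
Qed.

Lemma sqitg_lin (s : R) u v : sqitg u -> sqitg v -> sqitg (fun r => u r + s * v r).
Proof.
move=> uL vL; have [[mu iu] [mv iv]] := (uL, vL); split.
  by apply: measurable_funD => //; apply: measurable_funM.
apply: (@itg_eq _ _ _ (fun r => (u r ^+ 2 + (2 * s) * (u r * v r)) + s ^+ 2 * v r ^+ 2)).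
  by move=> r _; ring.
by apply: itgD; [apply: itgD => //; apply/itgZ/sqitg_mul|exact: itgZ].
Qed.

Lemma sqitgZ (s : R) u : sqitg u -> sqitg (fun r => s * u r).
Proof.
move=> [mu iu]; split; first exact: measurable_funM.
by apply: itg_eq (itgZ (s ^+ 2) iu) => r _; rewrite exprMn.
Qed.

Lemma sqitgB u v : sqitg u -> sqitg v -> sqitg (fun r => u r - v r).
Proof.
move=> uL vL; have [mw iw] := sqitg_lin (-1) uL vL; split.
  by apply: measurable_ext mw => r; rewrite mulN1r.
by apply: itg_eq iw => r _; rewrite mulN1r.
Qed.

Lemma sqN_ge0 u : 0 <= sqN u.
Proof. by apply: Int_ge0 => r _; exact: sqr_ge0. Qed.

Lemma sqN_lin (s : R) u v : sqitg u -> sqitg v ->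
  sqN (fun r => u r + s * v r) = sqN u + 2 * s * ip u v + s ^+ 2 * sqN v.
Proof.
move=> uL vL; have [[mu iu] [mv iv]] := (uL, vL); have iuv := sqitg_mul uL vL.
rewrite /sqN /ip (@Int_eq _ _ _ _ (fun r => (u r ^+ 2 + (2 * s) * (u r * v r)) + s ^+ 2 * v r ^+ 2)).
  by rewrite IntD ?IntD ?IntZ//; [exact: itgZ|apply: itgD => //; exact: itgZ|exact: itgZ].
by move=> r _; ring.
Qed.

Lemma ip_linr (s : R) u v w : sqitg u -> sqitg v -> sqitg w ->
  ip u (fun r => v r + s * w r) = ip u v + s * ip u w.
Proof.
move=> uL vL wL; have h1 := sqitg_mul uL vL; have h2 := sqitg_mul uL wL.
rewrite /ip -IntZ// -IntD//; last exact: itgZ.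
by apply: Int_eq => r _; ring.
Qed.

Lemma ipBl u v w : sqitg u -> sqitg v -> sqitg w ->
  ip (fun r => u r - v r) w = ip u w - ip v w.
Proof.
move=> uL vL wL; have h1 := sqitg_mul uL wL; have h2 := sqitg_mul vL wL.
by rewrite /ip -IntB//; apply: Int_eq => r _; ring.
Qed.

(** Young's inequality with a free parameter, used in place of Cauchy-Schwarz. *)
Lemma ip_bound (s : R) u v : 0 < s -> sqitg u -> sqitg v ->
  `|ip u v| <= s * sqN u + sqN v / s.
Proof.
move=> s0 uL vL; have [[mu iu] [mv iv]] := (uL, vL).
rewrite /sqN -IntZ// [_ / s]mulrC -IntZ// -IntD; [|exact: itgZ|exact: itgZ].
apply: Int_norm; [exact: sqitg_mul|by apply: itgD; exact: itgZ|] => r _.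
have -> : s * u r ^+ 2 + s^-1 * v r ^+ 2 = s^-1 * ((s * u r) ^+ 2 + v r ^+ 2).
  by field; rewrite gt_eqF.
have -> : u r * v r = s^-1 * (s * u r * v r) by field; rewrite gt_eqF.
have si0 : 0 < s^-1 by rewrite invr_gt0.
by rewrite normrM (gtr0_norm si0) ler_pM2l//; exact: mul_le.
Qed.

Lemma integral_le_itg (h : R -> R) (c : R) : measurable_fun `[a, b] h ->
  (forall r, a <= r <= b -> 0 <= h r) ->
  (\int[lebesgue_measure]_(r in `[a, b]) (h r)%:E <= c%:E)%E ->
  itg a b h /\ Int a b h <= c.
Proof.
move=> mh h0 hc.
have ih : itg a b h.
  apply/integrableP; split; first exact/measurable_EFinP.
  apply: le_lt_trans (ltry c); apply: le_trans hc.
  rewrite le_eqVlt; apply/orP; left; apply/eqP; apply: eq_integral => r.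
  by rewrite inE/= in_itv/= => /h0 hr; rewrite ger0_norm.
split=> //; rewrite Int.unlock /Rintegral -lee_fin fineK//.
exact: integrable_fin_num.
Qed.

(** Completeness in the manner of Riesz and Fischer. Weighting the squared increments by [4 ^ k]
    leaves a series with integrable sum [g]; where [g] is finite, the increments decay like
    [1 / 2 ^ k], so the limit exists pointwise with a rate. *)
Lemma sqitg_complete (z : nat -> R -> R) (C : R) : (forall k, sqitg (z k)) ->
  (forall k, sqN (fun r => z k.+1 r - z k r) <= C / 16 ^+ k) ->
  exists2 zeta, sqitg zeta &
  exists D : R, forall k, sqN (fun r => z k r - zeta r) <= D / 4 ^+ k.
Proof.
move=> zL zC.
pose e k r := 4 ^+ k * (z k.+1 r - z k r) ^+ 2.
have p4 k : (0 : R) < 4 ^+ k by rewrite exprn_gt0.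
have e0 k r : 0 <= e k r by rewrite mulr_ge0 ?sqr_ge0// ltW.
have C0 : 0 <= C by have := le_trans (sqN_ge0 _) (zC 0%N); rewrite expr0 divr1.
have eL k : itg a b (e k) by apply: itgZ; case: (sqitgB (zL k.+1) (zL k)).
have me k : measurable_fun `[a, b] (EFin \o e k) by apply/measurable_EFinP; exact: itg_measurable (eL k).
pose g r : \bar R := (\sum_(0 <= k <oo) (e k r)%:E)%E.
have mI := measurable_cc a b.
have mg : measurable_fun `[a, b] g.
  apply: (@ge0_emeasurable_sum _ _ _ _ (fun k r => (e k r)%:E) xpredT) => [k r _ _|k _].
    by rewrite lee_fin.
  exact: me.
have g0 r : (0 <= g r)%E by apply: nneseries_ge0 => k _ _; rewrite lee_fin.
have Ie k : (\int[lebesgue_measure]_(r in `[a, b]) (e k r)%:E <= (C / 4 ^+ k)%:E)%E.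
  have -> : (\int[lebesgue_measure]_(r in `[a, b]) (e k r)%:E)%E = (Int a b (e k))%:E.
    by rewrite Int.unlock /Rintegral fineK//; apply: (integrable_fin_num _ (eL k)).
  rewrite lee_fin /e IntZ; last by case: (sqitgB (zL k.+1) (zL k)).
  rewrite -[X in _ <= X](_ : 4 ^+ k * (C / 16 ^+ k) = _); first by rewrite ler_pM2l//; exact: zC.
  have -> : (16 : R) = 4 * 4 by ring.
  by rewrite exprMn; field; rewrite gt_eqF.
have gs n : \sum_(0 <= k < n) C / 4 ^+ k <= 2 * C - 2 * (C / 4 ^+ n).
  elim: n => [|n ih]; first by rewrite big_nil expr0; arith.
  rewrite big_nat_recr//=; move: ih; rewrite exprS.
  have -> : C / (4 * 4 ^+ n) = (C / 4 ^+ n) / 4 by field; rewrite gt_eqF.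
  have : 0 <= C / 4 ^+ n by rewrite divr_ge0// ltW.
  by set q := C / _; arith.
have Ig : (\int[lebesgue_measure]_(r in `[a, b]) g r <= (2 * C)%:E)%E.
  rewrite /g integral_nneseries//; last by move=> k r _; rewrite lee_fin.
  apply: lime_le.
    by apply: is_cvg_nneseries => k _ _; apply: integral_ge0 => r _; rewrite lee_fin.
  near=> n; apply: (@le_trans _ _ (\sum_(0 <= k < n) (C / 4 ^+ k)%:E)%E).
    exact: lee_sum.
  rewrite sumEFin lee_fin.
  by apply: le_trans (gs n) _; rewrite gerBl mulr_ge0// divr_ge0// ltW.
pose E := `[a, b]%classic `&` [set r | g r \is a fin_num].
have mE : measurable E by exact: emeasurable_fin_num.
have e_le k r : E r -> e k r <= fine (g r).
  move=> [_ gr]; rewrite -lee_fin fineK//.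
  apply: le_trans (@nneseries_lim_ge _ _ xpredT 0 k.+1 _); last by move=> *; rewrite lee_fin.
  by rewrite sumEFin lee_fin big_nat_recr//= lerDr sumr_ge0.
have step k r : E r -> `|z k.+1 r - z k r| <= Num.sqrt (fine (g r)) / 2 ^+ k.
  move=> Er; rewrite ler_pdivlMr ?exprn_gt0//.
  rewrite -(@ger0_norm _ (2 ^+ k)) ?exprn_ge0// -normrM -sqrtr_sqr ler_wsqrtr//.
  rewrite exprMn -exprM mulnC exprM (_ : 2 ^+ 2 = 4); last by rewrite expr2; ring.
  by rewrite mulrC; exact: e_le.
have [zeta zetaP] : exists zeta : R -> R, forall r, (E r -> forall k,
    `|z k r - zeta r| <= 2 * Num.sqrt (fine (g r)) / 2 ^+ k) /\ (~ E r -> zeta r = 0).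
  suff h r : exists l : R, (E r -> forall k,
      `|z k r - l| <= 2 * Num.sqrt (fine (g r)) / 2 ^+ k) /\ (~ E r -> l = 0).
    by have [l lP] := choice h; exists l => r; exact: lP.
  have [Er|nE] := pselect (E r); last by exists 0.
  by have [l lP] := geometric_limit (fun k => step k r Er); exists l; split.
have mzeta : measurable_fun `[a, b] zeta.
  apply: (@measurable_fun_cvg _ _ _ _ (fun k r => z k r * \1_E r)).
    move=> k; apply: measurable_funM; first by case: (zL k).
    exact: measurable_indic.
  move=> r _; have [Er|nE] := pselect (E r).
    apply: (@geometric_cvg _ _ (2 * Num.sqrt (fine (g r)))) => k.
    by rewrite indicE mem_set// mulr1; apply: (zetaP r).1.
  rewrite (zetaP r).2// indicE memNset//.
  apply: (@geometric_cvg _ _ 0) => k; rewrite (_ : z k r * _ - _ = 0) ?normr0 ?mul0r//.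
  by rewrite /= mulr0 subr0.
have four : (2 : R) ^+ 2 = 4 by rewrite expr2; ring.
(* Where [g] is infinite the right-hand side is too, so the bound holds at every point and no null
   set has to be discarded. *)
have key k r : a <= r <= b -> (((z k r - zeta r) ^+ 2)%:E <= (4 / 4 ^+ k)%:E * g r)%E.
  move=> rab; have [gr|] := boolP (g r \is a fin_num).
    have Er : E r by split=> //=; rewrite in_itv.
    rewrite -(fineK gr) -EFinM lee_fin.
    have := (zetaP r).1 Er k; have G0 : 0 <= fine (g r) by exact: fine_ge0.
    move=> h; rewrite -real_normK ?num_real//.
    apply: le_trans (_ : (2 * Num.sqrt (fine (g r)) / 2 ^+ k) ^+ 2 <= _).
      by rewrite ler_pXn2r ?nnegrE ?divr_ge0 ?mulr_ge0 ?sqrtr_ge0 ?exprn_ge0.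
    rewrite exprMn exprVn exprMn sqr_sqrtr// -exprM mulnC exprM four.
    by rewrite -!mulrA [_^-1 * _]mulrC.
  have inf_ (x : \bar R) : (0 <= x)%E -> x \isn't a fin_num -> x = +oo%E by case: x.
  move=> /(inf_ _ (g0 r)) ->.
  by rewrite gt0_muley ?leey// lte_fin divr_gt0.
have final k : itg a b (fun r => (z k r - zeta r) ^+ 2) /\
    sqN (fun r => z k r - zeta r) <= 8 * C / 4 ^+ k.
  apply: integral_le_itg.
  - by apply: measurable_funX; apply: measurable_funB => //; case: (zL k).
  - by move=> r _; exact: sqr_ge0.
  apply: (@le_trans _ _ (\int[lebesgue_measure]_(r in `[a, b]) ((4 / 4 ^+ k)%:E * g r))%E).
    apply: ge0_le_integral => //.
    + by move=> r _; rewrite lee_fin sqr_ge0.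
    + by apply/measurable_EFinP/measurable_funX; apply: measurable_funB => //; case: (zL k).
    + exact: measurable_funeM.
    + by move=> r /=; rewrite in_itv/=; exact: key.
  have k0 : 0 <= 4 / 4 ^+ k :> R by rewrite divr_ge0// ltW.
  rewrite ge0_integralZl//.
  apply: le_trans (lee_wpmul2l _ Ig) _; first by rewrite lee_fin divr_ge0// ltW.
  by rewrite -EFinM lee_fin le_eqVlt; apply/orP; left; apply/eqP; field; rewrite gt_eqF.
exists zeta; last by exists (8 * C) => k; exact: (final k).2.
have zz : sqitg (fun r => z 0%N r - zeta r).
  by split; [apply: measurable_funB => //; case: (zL 0%N)|exact: (final 0%N).1].
have [_ h] := sqitgB (zL 0%N) zz; split=> //.
by apply: itg_eq h => r _; rewrite opprB addrC subrK.
Unshelve. all: by end_near. Qed.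

Section limits_along_ultrafilters.
Variables (F : set_system nat) (UF : UltraFilter F).

Lemma ultra_bounded_cvg (x : nat -> R) (M : R) : (forall n, `|x n| <= M) ->
  exists2 l : R, x @ F --> l & `|l| <= M.
Proof.
move=> xM; have PF : ProperFilter F by exact: ultra_proper.
have FM : (x @ F) `[- M, M]%classic by apply: (@filterE _ F) => n; have := xM n; rewrite ler_norml /= in_itv.
have [l [lM cl]] := @segment_compact R (- M) M (x @ F) _ FM.
exists l; last by rewrite ler_norml; move: lM; rewrite /= in_itv.
move=> B lB; case: (in_ultra_setVsetC (x @^-1` B) UF) => // nB.
by have [y []] := cl (~` B) B nB lB.
Qed.

(* The weak limit minimises [sqN x - 2 lim <u_k, x>]; up to the scaling chosen in
   [Q] below, a minimising sequence is Cauchy by the parallelogram identity. *)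
Lemma sqitg_weak_limit (u : nat -> R -> R) (C : R) : (forall n, sqitg (u n)) ->
  (forall n, sqN (u n) <= C) ->
  exists2 zeta, sqitg zeta &
  forall x, sqitg x -> ip (u n) x @[n --> F] --> ip zeta x.
Proof.
move=> uL uC; have PF : ProperFilter F by exact: ultra_proper.
have bd x n : sqitg x -> `|ip (u n) x| <= C / 2 + 2 * sqN x.
  move=> xL; have := @ip_bound 2^-1 (u n) x ltac:(by rewrite invr_gt0) (uL n) xL.
  by have := uC n; rewrite invrK; arith.
(* The limits of all pairings are chosen at once; [ell] inherits linearity from the pairings. *)
have [ell ellP] : exists ell : (R -> R) -> R, forall x, sqitg x ->
    ip (u n) x @[n --> F] --> ell x /\ `|ell x| <= C / 2 + 2 * sqN x.
  suff h x : exists l : R, sqitg x ->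
      ip (u n) x @[n --> F] --> l /\ `|l| <= C / 2 + 2 * sqN x.
    by have [ell ellP] := choice h; exists ell => x; exact: ellP.
  have [xL|nx] := pselect (sqitg x); last by exists 0.
  by have [l l1 l2] := ultra_bounded_cvg (fun n => bd x n xL); exists l.
have ell_lin s x y : sqitg x -> sqitg y ->
    ell (fun r => x r + s * y r) = ell x + s * ell y.
  move=> xL yL; have xyL := sqitg_lin s xL yL.
  apply: (cvg_unique (@norm_hausdorff _ R) (ellP _ xyL).1).
  have -> : (fun n => ip (u n) (fun r => x r + s * y r)) = (fun n => ip (u n) x + s * ip (u n) y).
    by apply/funext => n; rewrite ip_linr.
  by apply: cvgD; [exact: (ellP _ xL).1|apply: cvgMr; exact: (ellP _ yL).1].
(* The coefficient 2 matches the bound on [ell], so [Q] is bounded below by [- C / 2]. At a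
   minimiser [zeta] the first variation gives [4 <zeta, x> = ell x], hence the factor 4 in the
   witness. *)
pose Q x := 2 * sqN x - ell x.
have Qge x : sqitg x -> - (C / 2) <= Q x.
  by move=> xL; have := (ellP _ xL).2; rewrite ler_norml /Q => /andP[_]; arith.
have Qlin s x y : sqitg x -> sqitg y -> Q (fun r => x r + s * y r) =
    Q x + s * (4 * ip x y - ell y) + 2 * s ^+ 2 * sqN y.
  by move=> xL yL; rewrite /Q sqN_lin// ell_lin//; ring.
pose QS := [set Q x | x in sqitg].
have hQ : has_inf QS.
  split; first by exists (Q (fun=> 0)); exists (fun=> 0) => //; exact: sqitg_cst.
  by exists (- (C / 2)) => _ [x xL <-]; exact: Qge.
(* An excess of [1 / 16 ^ k] over the infimum bounds the squared increments at the rate required by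
   [sqitg_complete]. *)
have [z zP] : exists z : nat -> R -> R, forall k, sqitg (z k) /\ Q (z k) <= inf QS + 1 / 16 ^+ k.
  suff h k : exists z : R -> R, sqitg z /\ Q z <= inf QS + 1 / 16 ^+ k.
    by have [z zP] := choice h; exists z => k; exact: zP.
  have k0 : (0 : R) < 1 / 16 ^+ k by rewrite divr_gt0// exprn_gt0.
  by have [_ [x xL <-] /ltW h] := inf_adherent k0 hQ; exists x.
have zL k : sqitg (z k) by exact: (zP k).1.
have infQ x : sqitg x -> inf QS <= Q x by move=> xL; apply: ge_inf; [exact: hQ.2|exists x].
have [zeta zetaL [D zetaD]] : exists2 zeta, sqitg zeta &
    exists D : R, forall k, sqN (fun r => z k r - zeta r) <= D / 4 ^+ k.
  apply: (@sqitg_complete z 2) => // k.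
  have dL := sqitgB (zL k.+1) (zL k).
  pose mid r := z k r + 1 / 2 * (z k.+1 r - z k r).
  have midL : sqitg mid by exact: sqitg_lin.
  have e1 := @Qlin (1 / 2) _ _ (zL k) dL.
  have e2 := @Qlin 1 _ _ (zL k) dL.
  have e3 : (fun r => z k r + 1 * (z k.+1 r - z k r)) = z k.+1.
    by apply/funext => r; ring.
  rewrite e3 in e2; have h0 := infQ _ midL; have h1 := (zP k).2; have h2 := (zP k.+1).2.
  have h3 : 1 / 16 ^+ k.+1 = (1 / 16 ^+ k) / 16 :> R by rewrite exprS; field; rewrite expf_neq0.
  have h4 : 2 / 16 ^+ k = 2 * (1 / 16 ^+ k) :> R by rewrite mulrA mulr1.
  have h5 : (0 : R) <= 1 / 16 ^+ k by rewrite divr_ge0// exprn_ge0.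
  move: e1 e2 h0 h1 h2; rewrite -/mid h3 h4; move: h5.
  set q := 1 / 16 ^+ k; set A := sqN _; set B := Q (z k.+1); set B' := Q (z k); set L := 4 * _ - _.
  by move: (Q mid) (inf QS) => Qm I q0 e1 e2 h0 h1 h2; arith.
exists (fun r => 4 * zeta r); first exact: sqitgZ.
move=> x xL; suff -> : ip (fun r => 4 * zeta r) x = ell x by exact: (ellP _ xL).1.
have -> : ip (fun r => 4 * zeta r) x = 4 * ip zeta x.
  rewrite /ip -IntZ; last exact: sqitg_mul.
  by apply: Int_eq => r _; ring.
pose K := 4 * D + 6 * sqN x + 1.
have near k : `|4 * ip zeta x - ell x| <= K / 2 ^+ k.
  have p2 : (0 : R) < 2 ^+ k by rewrite exprn_gt0.
  (* [z k] is varied by [s ^ 2 x] in both directions: an excess of order [s ^ 4] then leaves a first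
     variation of order [s ^ 2]. *)
  pose s : R := 1 / 2 ^+ k.
  have s0 : 0 < s by rewrite divr_gt0.
  have s1 : s <= 1 by rewrite ler_pdivrMr// mul1r exprn_ege1// ler1n.
  have s4 : 1 / 4 ^+ k = s ^+ 2.
    by rewrite /s expr_div_n expr1n -exprM mulnC exprM (_ : (2 : R) ^+ 2 = 4)// expr2; ring.
  have s16 : 1 / 16 ^+ k = s ^+ 4.
    by rewrite /s expr_div_n expr1n -exprM mulnC exprM (_ : (2 : R) ^+ 4 = 16)// !exprS expr0; ring.
  have v1 := @Qlin (s ^+ 2) _ _ (zL k) xL.
  have v2 := @Qlin (- s ^+ 2) _ _ (zL k) xL.
  have w1 := infQ _ (sqitg_lin (s ^+ 2) (zL k) xL).
  have w2 := infQ _ (sqitg_lin (- s ^+ 2) (zL k) xL).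
  have w3 := (zP k).2; rewrite s16 in w3.
  have A1 : `|4 * ip (z k) x - ell x| <= s ^+ 2 * (1 + 2 * sqN x).
    have q0 : 0 < s ^+ 2 by rewrite exprn_gt0.
    move: v1 v2 w1 w2 w3; rewrite (_ : s ^+ 4 = s ^+ 2 * s ^+ 2); last by ring.
    move: (s ^+ 2) q0 (4 * ip (z k) x - ell x) (Q (z k)) => q q0 L Qz.
    move: (Q _) (Q _) (inf QS) (sqN x) => Q1 Q2 I N -> -> h1 h2 h3.
    rewrite ler_norml; apply/andP; split.
      rewrite -(ler_pM2l q0); nra.
    rewrite -(ler_pM2l q0); nra.
  have A2 := ip_bound (divr_gt0 ltr01 s0) (sqitgB (zL k) zetaL) xL.
  rewrite ipBl// in A2.
  have A3 := zetaD k.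
  have D4 : D / 4 ^+ k = s ^+ 2 * D by rewrite -s4 mul1r mulrC.
  rewrite D4 in A3.
  have A4 : `|ip (z k) x - ip zeta x| <= s * (D + sqN x).
    apply: le_trans A2 _.
    have -> : sqN x / (1 / s) = s * sqN x by field; rewrite gt_eqF.
    rewrite mulrDr lerD2r.
    apply: le_trans (ler_wpM2l _ A3) _; first by rewrite divr_ge0 ?ltW.
    by rewrite le_eqVlt; apply/orP; left; apply/eqP; field; rewrite gt_eqF.
  have -> : K / 2 ^+ k = s * K by rewrite /s mul1r mulrC.
  have -> : 4 * ip zeta x - ell x = (4 * ip (z k) x - ell x) - 4 * (ip (z k) x - ip zeta x) by ring.
  apply: le_trans (ler_normB _ _) _; rewrite normrM (@ger0_norm _ 4)//.
  have A5 : s ^+ 2 * (1 + 2 * sqN x) <= s * (1 + 2 * sqN x).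
    apply: ler_wpM2r; first by have := sqN_ge0 x; arith.
    by rewrite expr2 ler_piMr// ltW.
  rewrite /K; move: (`|4 * _ - _|) (`|ip _ _ - _|) A1 A4 A5 => X1 X2 A1 A4 A5.
  apply: le_trans (_ : s * (1 + 2 * sqN x) + 4 * (s * (D + sqN x)) <= _).
    by apply: lerD; [exact: le_trans A1 A5|rewrite ler_pM2l].
  by rewrite le_eqVlt; apply/orP; left; apply/eqP; ring.
have c1 : (fun _ : nat => 4 * ip zeta x - ell x) @ \oo --> (0 : R).
  by apply: (@geometric_cvg _ _ K) => k; rewrite subr0.
have c2 : (fun _ : nat => 4 * ip zeta x - ell x) @ \oo --> 4 * ip zeta x - ell x by exact: cvg_cst.
by apply/eqP; rewrite -subr_eq0; apply/eqP; exact: (cvg_unique (@norm_hausdorff _ R) c2 c1).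
Qed.

End limits_along_ultrafilters.
End square_integrable_functions.

(** * Oscillating integrals and convergence of flows *)

Section uniformity_along_ultrafilters.
Variables (F : set_system nat) (UF : UltraFilter F).

Lemma ultra_compact_cvg (X : topologicalType) (K : set X) (x : nat -> X) : compact K ->
  (forall n, K (x n)) -> exists2 l, K l & x @ F --> l.
Proof.
move=> cK Kx; have PF : ProperFilter F by exact: ultra_proper.
have FK : (x @ F) K by apply: (@filterE _ F).
have [l [Kl cl]] := cK (x @ F) _ FK; exists l => // B lB.
case: (in_ultra_setVsetC (x @^-1` B) UF) => // nB.
by have [y []] := cl (~` B) B nB lB.
Qed.

(* Uniformity on a compact set from convergence along sequences: a sequence of
   counterexamples converges along the ultrafilter. *)
Lemma ultra_uniform (X : topologicalType) (K : set X) (P : nat -> X -> Prop) : compact K ->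
  (forall q (z : nat -> X), K q -> (forall n, K (z n)) -> z @ F --> q -> F [set n | P n (z n)]) ->
  F [set n | forall q, K q -> P n q].
Proof.
move=> cK h; have PF : ProperFilter F by exact: ultra_proper.
have [[k0 Kk0]|K0] := pselect (exists k, K k); last first.
  by apply: (@filterE _ F) => n q Kq; case: K0; exists q.
(* [z n] is a counterexample when there is one and any point of [K] otherwise. *)
suff bad n : exists z, K z /\ (P n z -> forall q, K q -> P n q).
  have [z zP] := choice bad; have [l Kl zl] := ultra_compact_cvg cK (fun n => (zP n).1).
  apply: (@filterS _ F _ [set n | P n (z n)] _ _ (h l z Kl (fun n => (zP n).1) zl)).
  by move=> n /= Pn; exact: (zP n).2.
have [[z [Kz nP]]|all_] := pselect (exists z, K z /\ ~ P n z); first by exists z.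
exists k0; split=> // _ q Kq; apply: contrapT => nP; apply: all_; by exists q.
Qed.

End uniformity_along_ultrafilters.

Section oscillating_integrals.
Context {R : realType} {n : nat}.
Notation V := 'cV[R]_n.

Lemma Int_sub_le (a b s t : R) (w : R -> R) : itg a b w -> (forall r, a <= r <= b -> 0 <= w r) ->
  a <= s -> s <= t -> t <= b -> Int s t w <= Int a b w.
Proof.
move=> iw w0 as_ st tb; have ab : a <= b by rewrite (le_trans as_)// (le_trans st).
rewrite (Int_split as_ (le_trans st tb) iw) (Int_split st tb (itgS as_ (lexx b) iw)).
have h1 : 0 <= Int a s w.
  by apply: Int_ge0 => r /andP[ar rs]; apply: w0; rewrite ar (le_trans rs)// (le_trans st).
have h2 : 0 <= Int t b w.
  apply: Int_ge0 => r /andP[tr rb]; apply: w0; rewrite rb andbT.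
  by rewrite (le_trans as_)// (le_trans st).
arith.
Qed.

(** An integral up to a variable time becomes an integral over the whole interval, to which weak
    convergence applies. *)
Lemma Int_prefix (a t b : R) (g : R -> R) : a <= t -> t <= b ->
  Int a t g = Int a b (fun r => g r * \1_(`[a, t]) r).
Proof.
move=> at_ tb; rewrite Int.unlock /Rintegral.
have -> : `[a, t]%classic = `[a, b]%classic `&` `[a, t]%classic.
  rewrite eqEsubset; split=> r /=; last by case.
  by rewrite !in_itv/= => /andP[ar rt]; rewrite ar rt (le_trans rt).
rewrite integral_mkcondr; congr fine; apply: eq_integral => r rab.
rewrite /patch indicE in_setI; move: rab => ->; rewrite andTb.
by case: ifP => _; rewrite ?mulr1 ?mulr0.
Qed.

Lemma sqitg_indic_mul (a b t B : R) (g : R -> R) : measurable_fun `[a, b] g ->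
  (forall r, a <= r <= b -> `|g r| <= B) -> sqitg a b (fun r => g r * \1_(`[a, t]) r).
Proof.
move=> mg gB; have m1 : measurable_fun `[a, b] (fun r => g r * \1_(`[a, t]) r).
  by apply: measurable_funM => //; apply: measurable_indic; exact: measurable_cc.
split=> //; apply: (@itg_bounded _ _ _ _ (B ^+ 2)); first exact: measurable_funX.
move=> r rab; rewrite normrX ler_pXn2r ?nnegrE//; last first.
  exact: le_trans (normr_ge0 _) (gB r rab).
rewrite normrM; apply: le_trans (gB r rab); rewrite ler_piMr//.
by rewrite indicE; case: (_ \in _); rewrite ?normr1 ?normr0.
Qed.

Variables (F : set_system nat) (UF : UltraFilter F).
Variables (T C B : R) (dl : nat -> R -> R) (K : set V) (phi : R -> V -> R).
Hypotheses (T0 : 0 <= T) (B0 : 0 <= B) (cK : compact K).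
Hypothesis dL : forall k, sqitg 0 T (dl k).
Hypothesis dC : forall k, sqN 0 T (dl k) <= C.
Hypothesis dw : forall x, sqitg 0 T x -> ip 0 T (dl k) x @[k --> F] --> (0 : R).
Hypothesis mphi : forall x, K x -> measurable_fun `[0, T] (phi^~ x).
Hypothesis phiB : forall r x, 0 <= r <= T -> K x -> `|phi r x| <= B.
Hypothesis phiL : forall r x y, 0 <= r <= T -> K x -> K y -> `|phi r x - phi r y| <= B * `|x - y|.

Let C0 : 0 <= C. Proof. exact: le_trans (sqN_ge0 _ _ _) (dC 0%N). Qed.

Let young (d s c A : R) : 0 < s -> `|c| <= A -> `|d * c| <= A * (s * d ^+ 2 + s^-1).
Proof.
move=> s0 cA; rewrite normrM mulrC.
have A0 : 0 <= A by exact: le_trans (normr_ge0 _) cA.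
apply: le_trans (_ : A * `|d| <= _); first by rewrite ler_wpM2r.
apply: ler_wpM2l => //.
have -> : s * d ^+ 2 + s^-1 = s^-1 * ((s * `|d|) ^+ 2 + 1).
  by rewrite exprMn real_normK ?num_real//; field; rewrite gt_eqF.
rewrite [leLHS](_ : _ = s^-1 * (s * `|d|)); last by field; rewrite gt_eqF.
rewrite ler_pM2l ?invr_gt0//; move: (s * _) => y.
by have := sqr_ge0 (y - 1 / 2); nra.
Qed.

(** With [sg] chosen first and [t - s] small afterwards, the integrals over short intervals are
    small uniformly in [k]. *)
Lemma window_integral_le (k : nat) (psi : R -> R) (A s t sg : R) : 0 < sg -> 0 <= A ->
  0 <= s -> s <= t -> t <= T -> measurable_fun `[0, T] psi ->
  (forall r, 0 <= r <= T -> `|psi r| <= A) ->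
  `|Int s t (fun r => dl k r * psi r)| <= A * (sg * C + (t - s) / sg).
Proof.
move=> sg0 A0 s0 st tT mpsi psiA.
have inT r : s <= r <= t -> 0 <= r <= T.
  by move=> /andP[sr rt]; rewrite (le_trans s0)//= (le_trans rt).
have [md id_] := dL k.
have id' : itg s t (fun r => dl k r ^+ 2) by exact: itgS s0 tT id_.
have ig : itg s t (fun r => A * (sg * dl k r ^+ 2 + sg^-1)).
  by apply/itgZ/itgD; [exact: itgZ|exact: itg_cst].
apply: le_trans (Int_norm _ ig _) _.
- apply: itg_dom ig _ => [|r rst]; last by apply: young => //; exact/psiA/inT.
  apply: measurable_funS (measurable_cc 0 T) _ (measurable_funM md mpsi).
  by move=> r /=; rewrite !in_itv/=; exact: inT.
- by move=> r rst; apply: young => //; exact/psiA/inT.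
- rewrite IntZ; last by apply: itgD; [exact: itgZ|exact: itg_cst].
  rewrite IntD; [|exact: itgZ|exact: itg_cst].
  rewrite IntZ// Int_cst// [_ / sg]mulrC; apply: ler_wpM2l => //; rewrite lerD2r ler_pM2l//.
  apply: le_trans (dC k); apply: Int_sub_le => // r _; exact: sqr_ge0.
Qed.

(** Along points (s, y) tending to (t, x), [y] is replaced by [x] through the Lipschitz bound and
    [s] by [t] at the cost of a short interval; weak convergence settles the fixed point (t, x), and
    [ultra_uniform] makes the result uniform. *)
Lemma uniform_oscillation (e : R) : 0 < e ->
  F [set k | forall q : R * V, (`[0, T]%classic `*` K) q ->
    `|Int 0 q.1 (fun r => dl k r * phi r q.2)| <= e].
Proof.
move=> e0; have PF : ProperFilter F by exact: ultra_proper.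
apply: (@ultra_uniform F UF (R * V)%type) => [|[t x] z].
  by apply: compact_setX => //; exact: segment_compact.
move=> [/= tT Kx] zK /cvgrPdist_le zq; rewrite in_itv/= in tT; have [t0 tT'] := andP tT.
pose h := fun r => phi r x * \1_(`[0, t]) r.
have hL : sqitg 0 T h by apply: sqitg_indic_mul (mphi Kx) _ => r rT; exact: phiB.
have e4 : 0 < e / 4 by rewrite divr_gt0.
(* [sg] and [d2] each account for [e / 8] in the change of end time, and [d1] for [e / 4] in the
   change of the point of [K]. *)
pose sg := e / 8 / (B + 1) / (C + 1).
have B1 : 0 < B + 1 by rewrite ltr_wpDl.
have C1 : 0 < C + 1 by rewrite ltr_wpDl.
have sg0 : 0 < sg by rewrite !divr_gt0.
pose d2 := e / 8 / (B + 1) * sg.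
have d20 : 0 < d2 by rewrite mulr_gt0// !divr_gt0.
pose d1 := e / 4 / (B + 1) / (C + T + 1).
have CT : 0 < C + T + 1 by rewrite ltr_wpDl// addr_ge0.
have d10 : 0 < d1 by rewrite !divr_gt0.
have m0 : 0 < Num.min d1 d2 by rewrite lt_min d10 d20.
have := dw hL => /cvgrPdist_le /(_ _ e4) ev1; have ev2 := zq _ m0.
apply: filterS2 ev1 ev2 => k /=; rewrite sub0r normrN => h1.
rewrite (_ : `|(t, x) - z k| = Num.max `|t - (z k).1| `|x - (z k).2|)//.
rewrite ge_max !le_min => /andP[/andP[_ td] /andP[xd _]].
have [/= sT Ky] := zK k; rewrite in_itv/= in sT; have [s0 sT'] := andP sT.
move: td xd; move: (z k) s0 sT' Ky sT => [s y] /= s0 sT' Ky sT td xd.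
have mx := mphi Kx; have my := mphi Ky; have [md _] := dL k.
have ig c a b : K c -> 0 <= a -> b <= T -> itg a b (fun r => dl k r * phi r c).
  move=> Kc a0 bT; apply: itgS a0 bT _.
  by apply: itgM (sqitg_itg (dL k)) (mphi Kc) _ => r rT; exact: phiB.
have p1 : `|Int 0 s (fun r => dl k r * phi r y) - Int 0 s (fun r => dl k r * phi r x)| <=
    (B * `|x - y|) * (1 * C + (s - 0) / 1).
  rewrite -IntB; [|exact: ig|exact: ig].
  have -> : Int 0 s (fun r => dl k r * phi r y - dl k r * phi r x) =
            Int 0 s (fun r => dl k r * (phi r y - phi r x)).
    by apply: Int_eq => r _; rewrite mulrBr.
  apply: window_integral_le => //.
  - by rewrite mulr_ge0.
  - exact: measurable_funB.
  - by move=> r rT; rewrite distrC; exact: phiL.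
have p2 : `|Int 0 s (fun r => dl k r * phi r x) - Int 0 t (fun r => dl k r * phi r x)| <=
    B * (sg * C + `|t - s| / sg).
  have [st|/ltW ts] := leP s t.
    rewrite (Int_split s0 st (ig x 0 t Kx (lexx 0) tT')) opprD addrA subrr sub0r normrN.
    by rewrite (@ger0_norm _ (t - s)) ?subr_ge0//; apply: window_integral_le => // r rT; exact: phiB.
  rewrite (Int_split t0 ts (ig x 0 s Kx (lexx 0) sT')) addrAC subrr add0r.
  by rewrite [`|t - s|]distrC (@ger0_norm _ (s - t)) ?subr_ge0//; apply: window_integral_le => // r rT; exact: phiB.
have p3 : `|Int 0 t (fun r => dl k r * phi r x)| <= e / 4.
  rewrite (Int_prefix _ t0 tT'); move: h1; rewrite /ip /h.
  by under Int_eq do rewrite mulrA.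
have q1 : (B * `|x - y|) * (1 * C + (s - 0) / 1) <= e / 4.
  rewrite mul1r subr0 divr1.
  apply: le_trans (_ : ((B + 1) * d1) * (C + T + 1) <= _); last first.
    by rewrite le_eqVlt /d1; apply/orP; left; apply/eqP; field; rewrite !gt_eqF.
  apply: ler_pM; rewrite ?mulr_ge0 ?addr_ge0//; last by rewrite -addrA lerD2l; arith.
  by apply: ler_pM => //; arith.
have q2 : B * (sg * C + `|t - s| / sg) <= e / 4.
  apply: le_trans (_ : (B + 1) * (sg * (C + 1) + d2 / sg) <= _); last first.
    rewrite le_eqVlt /d2; apply/orP; left; apply/eqP.
    by rewrite mulfK ?gt_eqF// /sg; field; rewrite !gt_eqF.
  apply: ler_pM => //; [|arith|].
    by apply: addr_ge0; [apply: mulr_ge0 => //; exact: ltW|apply: divr_ge0 => //; exact: ltW].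
  apply: lerD; first by rewrite ler_pM2l//; arith.
  by rewrite ler_pM2r// invr_gt0.
move: p1 p2 p3 q1 q2.
move: (Int 0 s _) (Int 0 s _) (Int 0 t _) (B * _ * _) (B * (_ + _)) => a1 a2 a3 b1 b2.
by rewrite !ler_norml; arith.
Qed.

End oscillating_integrals.

Section products_of_weak_and_uniform_limits.
Context {R : realType}.
Variables (F : set_system nat) (UF : UltraFilter F).

(** Replacing [m k] by its limit costs the uniform distance times the integral of [|al k * be|],
    itself at most [C + sqN 0 T be]; what is left is weak convergence tested against the fixed
    function [be * m0]. *)
Lemma weak_uniform_product (T B C : R) (al : nat -> R -> R) (al0 be : R -> R)
    (m : nat -> R -> R) (m0 : R -> R) :
  (forall k, sqitg 0 T (al k)) -> (forall k, sqN 0 T (al k) <= C) -> sqitg 0 T al0 ->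
  (forall x, sqitg 0 T x -> ip 0 T (al k) x @[k --> F] --> ip 0 T al0 x) -> sqitg 0 T be ->
  (forall k, measurable_fun `[0, T] (m k)) -> measurable_fun `[0, T] m0 ->
  (forall k r, 0 <= r <= T -> `|m k r| <= B) -> (forall r, 0 <= r <= T -> `|m0 r| <= B) ->
  (forall e : R, 0 < e -> F [set k | forall r, 0 <= r <= T -> `|m k r - m0 r| <= e]) ->
  Int 0 T (fun r => al k r * be r * m k r) @[k --> F] --> Int 0 T (fun r => al0 r * be r * m0 r).
Proof.
move=> aL aC a0L weak bL mm mm0 mB m0B unif; have PF : ProperFilter F by exact: ultra_proper.
have C0 : 0 <= C by exact: le_trans (sqN_ge0 _ _ _) (aC 0%N).
have N0 := sqN_ge0 0 T be.
have bmL : sqitg 0 T (fun r => be r * m0 r).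
  have [mb ib] := bL; split; first exact: measurable_funM.
  apply: itg_dom (itgZ (B ^+ 2) ib) _ => [|r rT].
    by apply: measurable_funX; exact: measurable_funM.
  rewrite ger0_norm ?sqr_ge0// exprMn mulrC ler_wpM2r ?sqr_ge0//.
  by rewrite -real_normK ?num_real// ler_pXn2r ?nnegrE//; [exact: m0B|exact: le_trans (m0B r rT)].
have iab k := sqitg_mul (aL k) bL.
have iabm k : itg 0 T (fun r => al k r * be r * m k r).
  by apply: itgM (iab k) (mm k) _ => r rT; exact: mB.
have iabm0 k : itg 0 T (fun r => al k r * be r * m0 r).
  by apply: itgM (iab k) mm0 _ => r rT; exact: m0B.
apply/cvgrPdist_le => e e0; have e2 : 0 < e / 2 by rewrite divr_gt0.
have := weak _ bmL => /cvgrPdist_le /(_ _ e2) ev1.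
have CN : 0 < C + sqN 0 T be + 1 by lra.
have d0 : 0 < e / 2 / (C + sqN 0 T be + 1) by rewrite divr_gt0.
apply: filterS2 ev1 (unif _ d0) => k; rewrite /ip /= => h1 h2.
have h3 : `|Int 0 T (fun r => al k r * be r * m k r) - Int 0 T (fun r => al k r * be r * m0 r)| <= e / 2.
  rewrite -IntB//.
  pose dd := e / 2 / (C + sqN 0 T be + 1).
  have ig : itg 0 T (fun r => dd * `|al k r * be r|) by apply/itgZ/itg_norm.
  apply: le_trans (Int_norm (itgB (iabm k) (iabm0 k)) ig _) _.
    move=> r rT; rewrite -mulrBr normrM mulrC ler_wpM2r//; exact: h2.
  have ibnd : itg 0 T (fun r => al k r ^+ 2 + be r ^+ 2).
    by apply: itgD; [case: (aL k)|case: bL].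
  rewrite IntZ; last exact: itg_norm.
  apply: le_trans (_ : dd * (C + sqN 0 T be + 1) <= _); last first.
    by rewrite /dd divfK// gt_eqF.
  rewrite ler_pM2l//; apply: le_trans (Int_le (itg_norm (iab k)) ibnd _) _.
    move=> r _; rewrite ler_norml.
    by have := sqr_ge0 (al k r + be r); have := sqr_ge0 (al k r - be r); nra.
  rewrite IntD; [|by case: (aL k)|by case: bL].
  by have := aC k; rewrite /sqN; lra.
have e1 : Int 0 T (fun r => al0 r * (be r * m0 r)) = Int 0 T (fun r => al0 r * be r * m0 r).
  by apply: Int_eq => r _; rewrite mulrA.
have e3 : Int 0 T (fun r => al k r * (be r * m0 r)) = Int 0 T (fun r => al k r * be r * m0 r).
  by apply: Int_eq => r _; rewrite mulrA.
move: h1 h3; rewrite e1 e3.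
move: (Int 0 T _) (Int 0 T _) (Int 0 T _) => x y z.
by rewrite !ler_norml; lra.
Qed.

End products_of_weak_and_uniform_limits.

Section convergence_of_flows.
Context {R : realType} {n p : nat}.
Notation V := 'cV[R]_n.
Variables (T Lf C : R) (f : 'cV[R]_n -> 'cV[R]_p).
Hypotheses (T0 : 0 <= T) (Lf1 : 1 <= Lf).
Hypothesis fL : forall x x', `|f x - f x'| <= Lf * `|x - x'|.
Hypothesis fG : forall x, `|f x| <= Lf * (1 + `|x|).

(** From [|x| <= 1 + x ^ 2]. It makes the Gronwall constant uniform over controls of bounded
    norm. *)
Lemma field_weight_Int_le (theta : R -> 'M[R]_(n, p)) :
  (forall i j, sqitg 0 T (fun r => theta r i j)) ->
  (forall i j, sqN 0 T (fun r => theta r i j) <= C) ->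
  Int 0 T (field_weight Lf theta) <= Lf * \sum_(i < n) \sum_(j < p) (T + C).
Proof.
move=> tL tC; have it i j := itg_norm (sqitg_itg (tL i j)).
have its i : itg 0 T (fun r => \sum_(j < p) `|theta r i j|) by exact: itg_sum.
rewrite /field_weight IntZ; last exact: itg_sum.
apply: ler_wpM2l; first exact: le_trans ler01 Lf1.
rewrite Int_sum//; apply: ler_sum => i _; rewrite Int_sum//; apply: ler_sum => j _.
have i1 : itg 0 T (fun r => 1 + theta r i j ^+ 2).
  by apply: itgD; [exact: itg_cst|case: (tL i j)].
apply: le_trans (Int_le (it i j) i1 _) _.
  by move=> r _; rewrite ler_norml; have := sqr_ge0 (theta r i j + 1);
     have := sqr_ge0 (theta r i j - 1); nra.
rewrite IntD; [|exact: itg_cst|by case: (tL i j)].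
by rewrite Int_cst// mul1r subr0 lerD2l; exact: tC.
Qed.

Variables (F : set_system nat) (UF : UltraFilter F).
Variables (thn : nat -> R -> 'M[R]_(n, p)) (th : R -> 'M[R]_(n, p)).
Hypothesis thnL : forall k i j, sqitg 0 T (fun r => thn k r i j).
Hypothesis thnC : forall k i j, sqN 0 T (fun r => thn k r i j) <= C.
Hypothesis thL : forall i j, sqitg 0 T (fun r => th r i j).
Hypothesis weak : forall i j x, sqitg 0 T x ->
  ip 0 T (fun r => thn k r i j) x @[k --> F] --> ip 0 T (fun r => th r i j) x.
Variables (Phn : nat -> R -> V -> R -> V) (Ph : R -> V -> R -> V).
Hypothesis sPhn : forall k s x, 0 <= s <= T ->
  solution s T (fun r x => thn k r *m f x) x (Phn k s x).
Hypothesis sPh : forall s x, 0 <= s <= T ->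
  solution s T (fun r x => th r *m f x) x (Ph s x).
Variable rho : R.
Hypothesis rho0 : 0 <= rho.

Let cF := field_caratheodory Lf1 fL fG (fun i j => sqitg_itg (thL i j)).
Let cFn k := field_caratheodory Lf1 fL fG (fun i j => sqitg_itg (thnL k i j)).
Let Lf0 : 0 <= Lf. Proof. exact: le_trans ler01 Lf1. Qed.
Let K := expR (2 * Int 0 T (field_weight Lf th)).
Let B := Lf * (2 * (1 + rho) * K).
Let W := Lf * \sum_(i < n) \sum_(j < p) (T + C).
Let phi j r x := f (Ph 0 x r) j 0.
Let zz : 0 <= (0 : R) <= T. Proof. by rewrite lexx T0. Qed.

Lemma flow_component_measurable x j : measurable_fun `[0, T] (fun r => f (Ph 0 x r) j 0).
Proof.
have [mX _ _] := sPh x zz.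
apply: (@measurable_continuous_coord _ _ _ _ (measurable_cc 0 T) _ _ (Ph 0 x) (fun y => f y j 0)).
  by move=> i k; rewrite ord1; exact: mX.
apply: (@lipschitz_map_continuous _ _ _ Lf) => y z; apply: le_trans (fL y z).
by have := le_mx_norm (f y - f z) j 0; rewrite !mxE.
Qed.

Lemma flow_component_bound r x j : 0 <= r <= T -> `|x| <= rho ->
  `|f (Ph 0 x r) j 0| <= Lf * (2 * (1 + rho) * K).
Proof.
move=> /andP[r0 rT] xr; apply: le_trans (le_mx_norm _ _ _) _; apply: le_trans (fG _) _.
apply: ler_wpM2l => //; apply: le_trans (flow_bound cF sPh (lexx 0) r0 rT x) _.
by rewrite ler_wpM2r ?expR_ge0// ler_wpM2l// lerD2l.
Qed.

Lemma flow_component_lip r x y j : 0 <= r <= T ->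
  `|f (Ph 0 x r) j 0 - f (Ph 0 y r) j 0| <= Lf * (2 * K) * `|x - y|.
Proof.
move=> /andP[r0 rT]; have := le_mx_norm (f (Ph 0 x r) - f (Ph 0 y r)) j 0.
rewrite !mxE => h; apply: le_trans h _; apply: le_trans (fL _ _) _; rewrite -mulrA.
by apply: ler_wpM2l => //; exact: (flow_lip cF sPh (lexx 0) r0 rT).
Qed.

(** The function tested is [f] along the limit flow, which does not depend on [k]; it is Lipschitz
    in the initial point with constant at most [B], as [uniform_oscillation] requires. *)
Lemma control_oscillation (e : R) : 0 < e ->
  F [set k | forall i j t x, 0 <= t <= T -> `|x| <= rho ->
    `|Int 0 t (fun r => (thn k r i j - th r i j) * f (Ph 0 x r) j 0)| <= e].
Proof.
move=> e0; have PF : ProperFilter F by exact: ultra_proper.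
have B0 : 0 <= B by rewrite !mulr_ge0// ?expR_ge0// addr_ge0.
have C0 i j : 0 <= C + sqN 0 T (fun r => th r i j).
  by rewrite addr_ge0 ?sqN_ge0//; apply: le_trans (sqN_ge0 _ _ _) (thnC 0%N i j).
have one (ij : 'I_n * 'I_p) : F [set k | forall q : R * V,
    (`[0, T]%classic `*` [set x | `|x| <= rho]) q ->
    `|Int 0 q.1 (fun r => (thn k r ij.1 ij.2 - th r ij.1 ij.2) * phi ij.2 r q.2)| <= e].
  case: ij => i j.
  have T2 := @uniform_oscillation R n F UF T (2 * (C + sqN 0 T (fun r => th r i j))) B
    (fun k r => thn k r i j - th r i j) [set x | `|x| <= rho] (phi j).
  apply: T2 => //.
  - exact: compact_ball_cV.
  - by move=> k; exact: sqitgB.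
  - move=> k; rewrite mulrDr.
    have [[_ h1] [_ h2]] := (thnL k i j, thL i j).
    apply: le_trans (_ : 2 * sqN 0 T (fun r => thn k r i j) + 2 * sqN 0 T (fun r => th r i j) <= _).
      rewrite /sqN -IntZ// -IntZ// -IntD; [|exact: itgZ|exact: itgZ].
      apply: Int_le; first by case: (sqitgB (thnL k i j) (thL i j)).
        by apply: itgD; exact: itgZ.
      by move=> r _; have := sqr_ge0 (thn k r i j + th r i j); nra.
    by rewrite lerD2r ler_pM2l.
  - move=> x xL.
    have -> : (fun k => ip 0 T (fun r => thn k r i j - th r i j) x) =
        (fun k => ip 0 T (fun r => thn k r i j) x - ip 0 T (fun r => th r i j) x).
      by apply/funext => k; rewrite ipBl.
    have := @cvgB _ _ _ _ _ _ _ _ _ (@weak i j x xL) (@cvg_cst _ (ip 0 T (fun r => th r i j) x) _ F _).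
    by move=> /(_ _ _); rewrite subrr; apply.
  - by move=> x _; exact: flow_component_measurable.
  - by move=> r x rT xr; exact: flow_component_bound.
  - move=> r x y rT _ _; apply: le_trans (flow_component_lip _ _ _ rT) _.
    rewrite ler_wpM2r// /B; apply: ler_wpM2l => //; rewrite ler_wpM2r ?expR_ge0//.
    by rewrite ler_peMr// lerDl.
have all_ := @filter_forall _ _ _ _ PF one.
apply: filterS all_ => k h i j t x tT xr.
by apply: (h (i, j) (t, x)); split=> //=; rewrite in_itv.
Qed.

(** The difference of the equations splits into an oscillating term, with both fields taken along
    the limit trajectory, and a term in which both trajectories have the control [thn k], which
    Gronwall absorbs. *)
Lemma flow_converges (e : R) : 0 < e ->
  F [set k | forall t x, 0 <= t <= T -> `|x| <= rho -> `|Phn k 0 x t - Ph 0 x t| <= e].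
Proof.
move=> e0; have PF : ProperFilter F by exact: ultra_proper.
(* Each coordinate collects [p] oscillating integrals, and Gronwall multiplies by at most
   [2 * expR (2 * W)]. *)
pose e1 := e / (2 * (p%:R + 1) * expR (2 * W)).
have p0 : (0 : R) < p%:R + 1 by rewrite ltr_wpDl.
have e10 : 0 < e1 by rewrite divr_gt0// !mulr_gt0// expR_gt0.
apply: filterS (control_oscillation e10) => k h t x tT xr.
have [mX [MX XM] Xeq] := sPhn k x zz; have [mY [MY YM] Yeq] := sPh x zz.
have iwn := car_itg (cFn k); have w0 := car_w0 (cFn k).
pose u r := `|Phn k 0 x r - Ph 0 x r|.
have mu : measurable_fun `[0, T] u by apply: measurable_norm_cV; exact: measurable_coordB.
have uM r : 0 <= r <= T -> 0 <= u r <= MX + MY.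
  move=> rT; rewrite normr_ge0 /=; apply: le_trans (ler_normB _ _) _.
  by apply: lerD; [exact: XM|exact: YM].
have pre s (g : R -> R) : s <= T -> measurable_fun `[0, T] g -> measurable_fun `[0, s] g.
  move=> sT; apply: measurable_funS; first exact: measurable_cc.
  by move=> r /=; rewrite !in_itv/= => /andP[-> rs]; exact: le_trans rs sT.
have osc s : 0 <= s <= T -> `|VInt 0 s (fun r => thn k r *m f (Ph 0 x r)) -
    VInt 0 s (fun r => th r *m f (Ph 0 x r))| <= p%:R * e1.
  move=> sT; have [s0 sT'] := andP sT; apply: cV_norm_le => [|i].
    by rewrite mulr_ge0// ltW.
  have ig (a : R -> 'M[R]_(n, p)) j : (forall i j, sqitg 0 T (fun r => a r i j)) ->
      itg 0 s (fun r => a r i j * f (Ph 0 x r) j 0).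
    move=> aL; apply: (itgS (lexx 0) sT').
    apply: itgM (sqitg_itg (aL i j)) (flow_component_measurable x j) _.
    by move=> r rT; exact: flow_component_bound.
  rewrite !mxE.
  have ex (a : R -> 'M[R]_(n, p)) : (forall i j, sqitg 0 T (fun r => a r i j)) ->
      Int 0 s (fun r => (a r *m f (Ph 0 x r)) i 0) =
      \sum_(j < p) Int 0 s (fun r => a r i j * f (Ph 0 x r) j 0).
    move=> aL; rewrite -Int_sum => [|j]; last exact: ig.
    by apply: Int_eq => r _; rewrite mxE.
  rewrite (ex (thn k))// (ex th)// -sumrB.
  apply: le_trans (ler_norm_sum _ _ _) _.
  apply: le_trans (_ : \sum_(j < p) e1 <= _); last first.
    by rewrite sumr_const card_ord mulr_natl.
  apply: ler_sum => j _; rewrite -IntB; [|exact: ig|exact: ig].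
  rewrite (@Int_eq _ _ _ _ (fun r => (thn k r i j - th r i j) * f (Ph 0 x r) j 0)); last first.
    by move=> r _; rewrite mulrBl.
  exact: h.
have k0 : 0 <= p%:R * e1 by rewrite mulr_ge0// ltW.
have ineq s : 0 <= s <= T -> u s <= p%:R * e1 + Int 0 s (fun r => field_weight Lf (thn k) r * u r).
  move=> sT; have [s0 sT'] := andP sT.
  have -> : u s = `|(VInt 0 s (fun r => thn k r *m f (Ph 0 x r)) - VInt 0 s (fun r => th r *m f (Ph 0 x r))) +
     (VInt 0 s (fun r => thn k r *m f (Phn k 0 x r)) - VInt 0 s (fun r => thn k r *m f (Ph 0 x r)))|.
    by rewrite addrC subrKA /u (Xeq s sT) (Yeq s sT) opprD addrACA subrr add0r.
  apply: le_trans (ler_normD _ _) _; apply: lerD; first exact: osc.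
  apply: (VIntB_field (cFn k)) => //.
  - by move=> i; apply: pre (mX i).
  - by move=> i; apply: pre (mY i).
  - by exists MX => r /andP[r0 rs]; apply: XM; rewrite r0 (le_trans rs).
  - by exists MY => r /andP[r0 rs]; apply: YM; rewrite r0 (le_trans rs).
have := gronwall T0 iwn w0 k0 mu uM ineq tT; rewrite -/(u t) => gr; apply: le_trans gr _.
have [t0 tT'] := andP tT.
have wW : expR (2 * Int 0 t (field_weight Lf (thn k))) <= expR (2 * W).
  rewrite ler_expR ler_pM2l//; apply: le_trans (field_weight_Int_le (thnL k) (thnC k)).
  exact: (weight_le (cFn k) (lexx 0) t0 tT').
apply: le_trans (_ : 2 * (p%:R * e1) * expR (2 * W) <= _).
  by apply: ler_wpM2l => //; rewrite mulr_ge0.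
rewrite /e1; have E0 : 0 < expR (2 * W) by exact: expR_gt0.
rewrite [leLHS](_ : _ = e * (p%:R / (p%:R + 1))); last first.
  by move: E0; move: (expR _) => y y0; field; rewrite !gt_eqF.
by apply: ler_piMr; [exact: ltW|rewrite ler_pdivrMr// mul1r lerDl].
Qed.

End convergence_of_flows.

(** * The cost as a functional of the control *)

Section square_integrable_controls.
Context {R : realType} {n p : nat}.
Variables (T : R) (theta : R -> 'M[R]_(n, p)).

Lemma coord_borel_measurable i j : measurable_fun setT ((fun A => A i j) : borel 'M[R]_(n, p) -> R).
Proof.
apply: generated_measurable_fun => a b; apply: open_comp => // A _.
apply: (@lipschitz_map_continuous _ _ _ 1 (fun A : 'M[R]_(n, p) => A i j)) => M N; rewrite mul1r.
by have := le_mx_norm (M - N) i j; rewrite !mxE.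
Qed.

Lemma in_L2_coord : in_L2 T theta -> forall i j, sqitg 0 T (fun r => theta r i j).
Proof.
move=> [mth ith].
have mc i j : measurable_fun `[0, T] (fun r => theta r i j).
  exact: (measurableT_comp (coord_borel_measurable i j) mth).
have ms : measurable_fun `[0, T] (fun r => enorm (theta r) ^+ 2).
  apply: (@measurable_ext _ _ _ _ _ (fun r => \sum_i \sum_j theta r i j ^+ 2)) => [r|].
    by rewrite enorm_sqr.
  by apply: measurable_sum => i; apply: measurable_sum => j; exact: measurable_funX.
set I := (\int[_]_(_ in _) _)%E in ith.
have I0 : (0 <= I)%E by apply: integral_ge0 => r _; rewrite lee_fin sqr_ge0.
have If : I = (fine I)%:E by rewrite fineK// ge0_fin_numE.
have [ie _] := @integral_le_itg R 0 T (fun r => enorm (theta r) ^+ 2) (fine I) ms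
  (fun r _ => sqr_ge0 _) ltac:(by rewrite -If).
move=> i j; split; first exact: mc.
apply: itg_dom ie _ => [|r _]; first exact: measurable_funX.
rewrite ger0_norm ?sqr_ge0// enorm_sqr (bigD1 i)//= (bigD1 j)//= -addrA lerDl addr_ge0//.
  by apply: sumr_ge0 => k _; exact: sqr_ge0.
by apply: sumr_ge0 => k _; apply: sumr_ge0 => k' _; exact: sqr_ge0.
Qed.

Lemma coord_in_L2 : (forall i j, sqitg 0 T (fun r => theta r i j)) -> in_L2 T theta.
Proof.
move=> tL; split; first by apply: measurable_borel_mx => // i j; case: (tL i j).
have ie : itg 0 T (fun r => \sum_i \sum_j theta r i j ^+ 2).
  by apply: itg_sum => i; apply: itg_sum => j; case: (tL i j).
have := integrable_fin_num (measurable_cc 0 T) ie; rewrite ge0_fin_numE.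
  by apply: le_lt_trans; rewrite le_eqVlt; apply/orP; left; apply/eqP;
    apply: eq_integral => r _; rewrite enorm_sqr.
apply: integral_ge0 => r _; rewrite lee_fin.
by apply: sumr_ge0 => i _; apply: sumr_ge0 => j _; exact: sqr_ge0.
Qed.

End square_integrable_controls.

Section kinetic_energy.
Context d {Om : measurableType d} {R : realType} {n p : nat}.
Variables (P : probability Om R) (D : set Om).
Hypotheses (mD : measurable D) (PD : P D = 1%E).
Notation V := 'cV[R]_n.
Notation Vp := 'cV[R]_p.
Implicit Types (Z : Om -> Vp) (A : 'M[R]_(n, p)).

Definition moment Z (j k : 'I_p) : R := Ex P D (fun z => Z z j 0 * Z z k 0).
(** The expectation of the inner product of [A Z] and [A' Z], with the randomness gathered in the
    moments so that bilinearity in the matrices is visible. *)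
Definition energy Z A A' : R := \sum_i \sum_j \sum_k A i j * A' i k * moment Z j k.

Section one_map.
Variables (Z : Om -> Vp) (B : R).
Hypothesis mZ : forall j, measurable_fun D (fun z => Z z j 0).
Hypothesis ZB : forall j z, D z -> `|Z z j 0| <= B.

Let mul_bound j k z : D z -> `|Z z j 0 * Z z k 0| <= B * B.
Proof. by move=> Dz; rewrite normrM; apply: ler_pM => //; exact: ZB. Qed.

Lemma moment_bound j k : `|moment Z j k| <= B * B.
Proof.
apply: Ex_norm_le => //; first exact: measurable_funM.
by move=> z Dz; exact: mul_bound.
Qed.

Lemma moment_integrable j k : P.-integrable D (EFin \o (fun z => Z z j 0 * Z z k 0)).
Proof.
apply: (@bounded_integrable _ _ _ _ _ mD _ (B * B)); first exact: measurable_funM.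
by move=> z Dz; exact: mul_bound.
Qed.

Lemma energyE A :
  P.-integrable D (EFin \o (fun z => enorm (A *m Z z) ^+ 2)) /\
  Ex P D (fun z => enorm (A *m Z z) ^+ 2) = energy Z A A.
Proof.
have expand z : enorm (A *m Z z) ^+ 2 =
    \sum_i \sum_j \sum_k (A i j * A i k) * (Z z j 0 * Z z k 0).
  rewrite enorm_sqr; apply: eq_bigr => i _; rewrite big_ord1 mxE expr2 mulr_suml.
  apply: eq_bigr => j _; rewrite mulr_sumr; apply: eq_bigr => k _; ring.
have ik i j k : P.-integrable D (EFin \o (fun z => (A i j * A i k) * (Z z j 0 * Z z k 0))).
  by apply: integrable_realZ => //; exact: moment_integrable.
have ij i j : P.-integrable D (EFin \o (fun z => \sum_k (A i j * A i k) * (Z z j 0 * Z z k 0))).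
  by apply: integrable_real_sum => // k.
have ii i : P.-integrable D (EFin \o (fun z => \sum_j \sum_k (A i j * A i k) * (Z z j 0 * Z z k 0))).
  by apply: integrable_real_sum => // j.
rewrite (_ : (fun z => enorm (A *m Z z) ^+ 2) =
    (fun z => \sum_i \sum_j \sum_k (A i j * A i k) * (Z z j 0 * Z z k 0))); last exact/funext.
split; first by apply: integrable_real_sum => // i.
rewrite Ex_sum//; apply: eq_bigr => i _; rewrite Ex_sum//; apply: eq_bigr => j _.
rewrite Ex_sum//; apply: eq_bigr => k _; rewrite ExZ//; exact: moment_integrable.
Qed.

Lemma energy_ge0 A : 0 <= energy Z A A.
Proof.
by rewrite -(energyE A).2; apply: Rintegral_ge0 => z _; exact: sqr_ge0.
Qed.

End one_map.

Lemma energyB Z A A' :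
  energy Z (A - A') (A - A') = energy Z A A - energy Z A A' - energy Z A' A + energy Z A' A'.
Proof.
rewrite /energy -!sumrB -big_split; apply: eq_bigr => i _; rewrite -!sumrB -big_split.
apply: eq_bigr => j _; rewrite -!sumrB -big_split; apply: eq_bigr => k _ /=.
by rewrite !mxE; ring.
Qed.

Lemma moment_diff Z Z' (B e : R) j k : 
  (forall j, measurable_fun D (fun z => Z z j 0)) -> (forall j z, D z -> `|Z z j 0| <= B) ->
  (forall j, measurable_fun D (fun z => Z' z j 0)) -> (forall j z, D z -> `|Z' z j 0| <= B) ->
  (forall z, D z -> `|Z z - Z' z| <= e) -> `|moment Z j k - moment Z' j k| <= 2 * B * e.
Proof.
move=> mZ ZB mZ' ZB' dZ; rewrite /moment -ExB//; [|exact: (moment_integrable mZ ZB)|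
  exact: (moment_integrable mZ' ZB')].
apply: Ex_norm_le => //.
  by apply: measurable_funB; exact: measurable_funM.
move=> z Dz; have e1 i : `|Z z i 0 - Z' z i 0| <= e.
  by apply: le_trans (dZ z Dz); have := le_mx_norm (Z z - Z' z) i 0; rewrite !mxE.
have -> : Z z j 0 * Z z k 0 - Z' z j 0 * Z' z k 0 =
  Z z j 0 * (Z z k 0 - Z' z k 0) + Z' z k 0 * (Z z j 0 - Z' z j 0) by ring.
apply: le_trans (ler_normD _ _) _; rewrite !normrM -mulrA mulr2n mulrDl mul1r.
by apply: lerD; apply: ler_pM => //; [exact: ZB|exact: ZB'].
Qed.

End kinetic_energy.

Section cost_of_a_control.
Context {R : realType} {n p : nat}.
Notation S := (state R n).
Notation V := 'cV[R]_n.
Variables (T lambda eps Lf : R) (Y : set 'cV[R]_n) (l : S -> R) (f : 'cV[R]_n -> 'cV[R]_p).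
Variables (mu0 : probability (borel S) R) (rho : R).
Hypotheses (T0 : 0 < T) (lambda0 : 0 <= lambda) (eps0 : 0 < eps) (cY : compact Y) (Lf1 : 1 <= Lf).
Hypothesis fL : forall x x', `|f x - f x'| <= Lf * `|x - x'|.
Hypothesis fG : forall x, `|f x| <= Lf * (1 + `|x|).
Hypothesis l0 : forall z, RdY Y z -> 0 <= l z.
Hypothesis lc : {within RdY Y, continuous l}.
Hypothesis rho0 : 0 <= rho.
Hypothesis mu0Y : mu0 (RdY Y) = 1%E.
Hypothesis mu0rho : mu0 [set z | `|z| <= rho] = 1%E.
Notation D := (core Y rho).

Let mD : measurable (D : set (borel S)) := core_measurable cY rho.
Let PD := core_mass cY mu0Y mu0rho.
Let Lf0 : 0 <= Lf. Proof. exact: le_trans ler01 Lf1. Qed.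
Let T0' := ltW T0.

Definition control_cost (Phi : R -> V -> R -> V) (theta : R -> 'M[R]_(n, p)) : R :=
  Ex mu0 D (fun z => l (flow_map Phi T z)) +
  Int 0 T (fun t => lambda / 2 * energy mu0 D (fun z => f (Phi 0 z.1 t)) (theta t) (theta t) +
                    eps / 2 * \sum_i \sum_j theta t i j ^+ 2).

Lemma core_bounded (r : R) : exists M : R, forall z, core Y r z -> `|l z| <= M.
Proof.
have cl : {within core Y r, continuous l} by apply: continuous_subspaceW lc; exact: core_RdY.
have /compact_bounded [M [_ MP]] := continuous_compact cl (core_compact cY (rho := r)).
exists (M + 1) => z Dz; apply: (MP (M + 1)); first by rewrite ltrDl.
by exists z.
Qed.

Section one_control.
Variables (theta : R -> 'M[R]_(n, p)) (Phi : R -> V -> R -> V).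
Hypothesis thL : forall i j, sqitg 0 T (fun r => theta r i j).
Hypothesis sPhi : forall s x, 0 <= s <= T ->
  solution s T (fun r x => theta r *m f x) x (Phi s x).

Let ith i j := sqitg_itg (thL i j).
Let cF := field_caratheodory Lf1 fL fG ith.
Let K := expR (2 * Int 0 T (field_weight Lf theta)).
Let B := Lf * (2 * (1 + rho) * K).
Let Z t (z : S) := f (Phi 0 z.1 t).

Lemma flow_value_measurable t j : 0 <= t <= T ->
  measurable_fun (D : set (borel S)) (fun z : borel S => f (Phi 0 z.1 t) j 0).
Proof.
move=> /andP[t0 tT]; apply: measurable_funTS.
exact: (measurableT_comp (continuous_state_measurable (continuous_f_coord Lf0 fL (j := j)))
  (flow_map_measurable cF sPhi t0 tT)).
Qed.

Lemma flow_value_bound t j z : 0 <= t <= T -> D z -> `|f (Phi 0 z.1 t) j 0| <= B.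
Proof.
move=> tT [_ zr]; apply: (flow_component_bound Lf1 fL fG thL sPhi j tT).
exact: le_trans (norm_fst z) zr.
Qed.

Let mZ t (tT : 0 <= t <= T) j := flow_value_measurable j tT.
Let ZB t (tT : 0 <= t <= T) j z := @flow_value_bound t j z tT.

(** The moments are even continuous in time, because trajectories from [core] are equicontinuous. *)
Lemma moment_time_measurable j k : measurable_fun `[0, T] (fun t => moment mu0 D (Z t) j k).
Proof.
apply: within_continuous_measurable; apply/subspace_continuousP => t /=.
rewrite in_itv/= => tT; apply/cvgrPdist_le => e e0.
pose q := 2 * B * Lf + 1.
have B0 : 0 <= B by rewrite !mulr_ge0// ?expR_ge0// addr_ge0.
have q0 : 0 < q by rewrite ltr_wpDl// mulr_ge0// mulr_ge0.
have [dl dl0 Hd] := trajectory_near_uniform Y T0 cF sPhi rho0 tT (divr_gt0 e0 q0).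
have hd : \forall s \near t, `|s - t| < dl.
  by apply/nbhs_ballP; exists dl => // s; rewrite /ball/= distrC.
rewrite near_withinE; apply: filterS hd => s hs; rewrite /= in_itv/= => sT; rewrite distrC.
change (`|moment mu0 D (Z s) j k - moment mu0 D (Z t) j k| <= e).
have md := @moment_diff _ _ R p mu0 D mD PD (Z s) (Z t) B (Lf * (e / q)) j k.
apply: le_trans (md (mZ sT) (ZB sT) (mZ tT) (ZB tT) _) _.
  move=> z Dz; apply: le_trans (fL _ _) _; rewrite ler_wpM2l//.
  apply: le_trans (Hd s z sT hs Dz).
  exact: (norm_fst (flow_map Phi s z - flow_map Phi t z)).
rewrite mulrA (_ : 2 * B * Lf * (e / q) = e * (2 * B * Lf / q)); last by ring.
by apply: ler_piMr; [exact: ltW|rewrite ler_pdivrMr// mul1r lerDl].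
Qed.

Lemma energy_itg : itg 0 T (fun t => energy mu0 D (Z t) (theta t) (theta t)).
Proof.
apply: itg_sum => i; apply: itg_sum => j; apply: itg_sum => k.
apply: itgM (sqitg_mul (thL i j) (thL i k)) (moment_time_measurable j k) _ => t tT.
exact: (moment_bound mD PD (mZ tT) (ZB tT)).
Qed.

Lemma norm_sqr_itg : itg 0 T (fun t => \sum_i \sum_j theta t i j ^+ 2).
Proof. by apply: itg_sum => i; apply: itg_sum => j; case: (thL i j). Qed.

Lemma terminal_cost_integrable :
  mu0.-integrable (D : set (borel S)) (EFin \o (fun z => l (flow_map Phi T z))).
Proof.
have TT : 0 <= T <= T by rewrite T0' lexx.
have [M MP] := core_bounded (2 * (1 + rho) * K).
apply: (@bounded_integrable _ _ _ _ _ mD _ M).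
  apply: measurable_funS (measurable_RdY cY) (@core_RdY _ _ Y rho) _.
  apply: (measurable_along_flow cY cF sPhi TT).
  exact: within_continuous_state_measurable (closed_RdY cY) lc.
move=> z [Yz zr]; apply: MP; split; first by case: Yz.
exact: (flow_map_cylinder_bound T0' cF sPhi TT zr).
Qed.

(** Coercivity: the two other terms of the cost are nonnegative. It bounds minimising sequences in
    the square norm. *)
Lemma control_cost_lower :
  eps / 2 * Int 0 T (fun t => \sum_i \sum_j theta t i j ^+ 2) <= control_cost Phi theta.
Proof.
rewrite /control_cost IntD; [|exact: itgZ energy_itg|exact: itgZ norm_sqr_itg].
rewrite [X in _ + (_ + X)]IntZ; last exact: norm_sqr_itg.
rewrite addrA lerDr addr_ge0//.
  by apply: Rintegral_ge0 => z [Yz _]; apply: l0; case: Yz.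
apply: Int_ge0 => t tT; rewrite mulr_ge0 ?divr_ge0//.
exact: (energy_ge0 mu0 mD (mZ tT) (ZB tT)).
Qed.

Lemma J_control_cost (mu : R -> probability (borel S) R) :
  (forall t, 0 <= t <= T -> is_push mu0 (flow_map Phi t : borel S -> borel S) (mu t)) ->
  J T lambda eps Y l f mu theta = (control_cost Phi theta)%:E.
Proof.
move=> pmu; have TT : 0 <= T <= T by rewrite T0' lexx.
have ml : measurable_fun (RdY Y : set (borel S)) (fun z : borel S => (l z)%:E).
  by apply/measurable_EFinP; exact: within_continuous_state_measurable (closed_RdY cY) lc.
rewrite /J (pushed_integral cY cF sPhi mu0Y mu0rho pmu TT ml).
rewrite [X in (X + _)%E](Ex_EFin mD terminal_cost_integrable) /control_cost EFinD; congr (_ + _)%E.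
have irun : itg 0 T (fun t => lambda / 2 * energy mu0 D (Z t) (theta t) (theta t) +
    eps / 2 * \sum_i \sum_j theta t i j ^+ 2).
  by apply: itgD; [exact: itgZ energy_itg|exact: itgZ norm_sqr_itg].
transitivity (\int[lebesgue_measure]_(t in `[0%R, T])
  (lambda / 2 * energy mu0 D (Z t) (theta t) (theta t) +
    eps / 2 * \sum_i \sum_j theta t i j ^+ 2)%:E)%E; last first.
  by rewrite Int.unlock /Rintegral fineK//; apply: (integrable_fin_num _ irun).
apply: eq_integral => t; rewrite inE /= in_itv/= => tT.
have [ien een] := energyE mu0 mD (mZ tT) (ZB tT) (theta t).
have mvel : measurable_fun (RdY Y : set (borel S)) (fun z : borel S =>
    (lambda / 2 * enorm (velocity f z.1 (theta t)) ^+ 2 + eps / 2 * enorm (theta t) ^+ 2)%:E).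
  apply: measurable_funTS; apply/measurable_EFinP; apply: measurable_funD => //.
  apply: measurable_funM => //.
  apply: (@measurable_ext _ _ _ _ _ (fun z : borel S =>
     \sum_i (\sum_j theta t i j * f z.1 j 0) ^+ 2)) => [z|].
    by rewrite enorm_sqr; apply: eq_bigr => i _; rewrite big_ord1 mxE.
  apply: measurable_sum => i; apply: measurable_funX; apply: measurable_sum => j.
  apply: measurable_funM => //.
  exact: (continuous_state_measurable (continuous_f_coord Lf0 fL (j := j))).
rewrite (pushed_integral cY cF sPhi mu0Y mu0rho pmu tT mvel) /velocity /=.
have i1 := integrable_realZ mD (lambda / 2) ien.
have i2 : mu0.-integrable (D : set (borel S)) (EFin \o (fun=> eps / 2 * enorm (theta t) ^+ 2)).
  exact: (@bounded_integrable _ _ _ _ _ mD _ `|eps / 2 * enorm (theta t) ^+ 2|).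
have i3 := integrable_realD mD i1 i2.
rewrite (Ex_EFin mD i3) (ExD mD i1 i2) ExZ// een; congr (_ + _)%:E.
rewrite -enorm_sqr; apply/eqP; rewrite -eqe -(Ex_EFin mD i2) integral_cst//.
by rewrite [X in (_ * X)%E](_ : _ = 1%E) ?mule1.
Qed.

End one_control.
End cost_of_a_control.

(** * Lower semicontinuity and existence *)

Section lower_semicontinuity.
Context {R : realType} {n p : nat}.
Notation S := (state R n).
Notation V := 'cV[R]_n.

Lemma cvg_finite_sum (F : set_system nat) (FF : Filter F) (I : Type) (s : seq I)
    (u : I -> nat -> R) (v : I -> R) : (forall i, u i @ F --> v i) ->
  (fun k => \sum_(i <- s) u i k) @ F --> \sum_(i <- s) v i.
Proof.
move=> uv; elim: s => [|i s ih].
  rewrite big_nil (_ : (fun k => _) = fun=> (0 : R)); first exact: cvg_cst.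
  by apply/funext => k; rewrite big_nil.
rewrite big_cons (_ : (fun k => _) = (fun k => u i k + \sum_(j <- s) u j k)).
  by apply: cvgD; [exact: uv|exact: ih].
by apply/funext => k; rewrite big_cons.
Qed.

Variables (T lambda eps Lf C : R) (Y : set 'cV[R]_n) (l : S -> R) (f : 'cV[R]_n -> 'cV[R]_p).
Variables (mu0 : probability (borel S) R) (rho : R).
Hypotheses (T0 : 0 < T) (lambda0 : 0 <= lambda) (eps0 : 0 < eps) (cY : compact Y) (Lf1 : 1 <= Lf).
Hypothesis fL : forall x x', `|f x - f x'| <= Lf * `|x - x'|.
Hypothesis fG : forall x, `|f x| <= Lf * (1 + `|x|).
Hypothesis l0 : forall z, RdY Y z -> 0 <= l z.
Hypothesis lc : {within RdY Y, continuous l}.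
Hypothesis rho0 : 0 <= rho.
Hypothesis mu0Y : mu0 (RdY Y) = 1%E.
Hypothesis mu0rho : mu0 [set z | `|z| <= rho] = 1%E.
Notation D := (core Y rho).

Let mD : measurable (D : set (borel S)) := core_measurable cY rho.
Let PD := core_mass cY mu0Y mu0rho.
Let Lf0 : 0 <= Lf. Proof. exact: le_trans ler01 Lf1. Qed.
Let T0' := ltW T0.
Let TT : 0 <= T <= T. Proof. by rewrite T0' lexx. Qed.
Let W := Lf * \sum_(i < n) \sum_(j < p) (T + C).
(** Bounds [f] along all trajectories from [core], for every control whose entries have squared norm
    at most [C]. *)
Let B := Lf * (2 * (1 + rho) * expR (2 * W)).

Section one_flow.
Variables (theta : R -> 'M[R]_(n, p)) (Phi : R -> V -> R -> V).
Hypothesis thL : forall i j, sqitg 0 T (fun r => theta r i j).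
Hypothesis thC : forall i j, sqN 0 T (fun r => theta r i j) <= C.
Hypothesis sPhi : forall s x, 0 <= s <= T ->
  solution s T (fun r x => theta r *m f x) x (Phi s x).

Lemma flow_value_uniform_bound t j z : 0 <= t <= T -> D z -> `|f (Phi 0 z.1 t) j 0| <= B.
Proof.
move=> tT Dz; apply: le_trans (flow_value_bound Lf1 fL fG thL sPhi j tT Dz) _.
rewrite /B; apply: ler_wpM2l => //; apply: ler_wpM2l; first by rewrite mulr_ge0// addr_ge0.
by rewrite ler_expR ler_pM2l//; exact: field_weight_Int_le.
Qed.

Lemma moment_uniform_bound t j k : 0 <= t <= T ->
  `|moment mu0 D (fun z => f (Phi 0 z.1 t)) j k| <= B * B.
Proof.
move=> tT; apply: (moment_bound mD PD) => [i|i z].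
  exact: (flow_value_measurable Lf1 fL fG thL sPhi i tT).
exact: flow_value_uniform_bound.
Qed.

Lemma cross_energy_Int (a a' : R -> 'M[R]_(n, p)) :
  (forall i j, sqitg 0 T (fun r => a r i j)) -> (forall i j, sqitg 0 T (fun r => a' r i j)) ->
  itg 0 T (fun t => energy mu0 D (fun z => f (Phi 0 z.1 t)) (a t) (a' t)) /\
  Int 0 T (fun t => energy mu0 D (fun z => f (Phi 0 z.1 t)) (a t) (a' t)) =
  \sum_i \sum_j \sum_k
    Int 0 T (fun t => a t i j * a' t i k * moment mu0 D (fun z => f (Phi 0 z.1 t)) j k).
Proof.
move=> aL a'L.
have mm := moment_time_measurable T0 cY Lf1 fL fG rho0 mu0Y mu0rho thL sPhi.
have i3 i j k : itg 0 T (fun t => a t i j * a' t i k * moment mu0 D (fun z => f (Phi 0 z.1 t)) j k).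
  apply: itgM (sqitg_mul (aL i j) (a'L i k)) (mm j k) _ => t tT.
  exact: moment_uniform_bound.
split; first by apply: itg_sum => i; apply: itg_sum => j; exact: itg_sum.
rewrite /energy Int_sum; last by move=> i; apply: itg_sum => j; exact: itg_sum.
apply: eq_bigr => i _; rewrite Int_sum; last by move=> j; exact: itg_sum.
by apply: eq_bigr => j _; rewrite Int_sum.
Qed.

End one_flow.

Variables (F : set_system nat) (UF : UltraFilter F).
Variables (thn : nat -> R -> 'M[R]_(n, p)) (th : R -> 'M[R]_(n, p)).
Hypothesis thnL : forall k i j, sqitg 0 T (fun r => thn k r i j).
Hypothesis thnC : forall k i j, sqN 0 T (fun r => thn k r i j) <= C.
Hypothesis thL : forall i j, sqitg 0 T (fun r => th r i j).
Hypothesis thC : forall i j, sqN 0 T (fun r => th r i j) <= C.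
Hypothesis weak : forall i j x, sqitg 0 T x ->
  ip 0 T (fun r => thn k r i j) x @[k --> F] --> ip 0 T (fun r => th r i j) x.
Variables (Phn : nat -> R -> V -> R -> V) (Ph : R -> V -> R -> V).
Hypothesis sPhn : forall k s x, 0 <= s <= T ->
  solution s T (fun r x => thn k r *m f x) x (Phn k s x).
Hypothesis sPh : forall s x, 0 <= s <= T ->
  solution s T (fun r x => th r *m f x) x (Ph s x).

Let cF := field_caratheodory Lf1 fL fG (fun i j => sqitg_itg (thL i j)).
Let flow_cvg := flow_converges T0' Lf1 fL fG UF thnL thnC thL weak sPhn sPh rho0.
Let Zn k t (z : S) := f (Phn k 0 z.1 t).
Let Z t (z : S) := f (Ph 0 z.1 t).
Let B0 : 0 <= B. Proof. by rewrite !mulr_ge0// ?expR_ge0// addr_ge0. Qed.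

(** [l] is continuous only within [RdY Y]. Compactness of [core] and [ultra_uniform] reduce
    uniformity to sequences [zn] tending to [z], for which the two end points are compared with that
    of [z] through the limit flow started at [zn k]. *)
Lemma terminal_cost_converges (e : R) : 0 < e ->
  F [set k | `|Ex mu0 D (fun z => l (flow_map (Phn k) T z)) -
               Ex mu0 D (fun z => l (flow_map Ph T z))| <= e].
Proof.
move=> e0; have PF : ProperFilter F by exact: ultra_proper.
have unif : F [set k | forall z, D z -> `|l (flow_map (Phn k) T z) - l (flow_map Ph T z)| <= e].
  apply: (@ultra_uniform F UF S) => [|z zn Dz Dzn zncv]; first exact: core_compact.
  pose w := flow_map Ph T z.
  have Yw : RdY Y w by case: Dz => -[_ Yz] _.
  have e2 : 0 < e / 2 by rewrite divr_gt0.
  have /subspace_continuousP lc' := lc; have := lc' w Yw => /cvgrPdist_le /(_ _ e2).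
  rewrite near_withinE => /nbhs_ballP [dl /= dl0 Hd].
  have near_w y : RdY Y y -> `|w - y| < dl -> `|l w - l y| <= e / 2.
    by move=> Yy wy; apply: Hd => //; rewrite -ball_normE.
  have K0 : 0 < 2 * expR (2 * Int 0 T (field_weight Lf th)) by rewrite mulr_gt0// expR_gt0.
  set K := 2 * _ in K0.
  have d4 : 0 < dl / 4 by rewrite divr_gt0.
  have dK : 0 < dl / 4 / K by rewrite divr_gt0.
  have := zncv => /cvgrPdist_le /(_ _ dK) ev1.
  apply: filterS2 ev1 (flow_cvg d4) => k /= h1 h2.
  have Yzk : RdY Y (zn k) by case: (Dzn k).
  have c1 : `|w - flow_map Ph T (zn k)| <= dl / 4.
    apply: le_trans (flow_map_lip cF sPh _ _ T0' (lexx T)) _.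
    apply: le_trans (ler_wpM2l (ltW K0) h1) _.
    by rewrite mulrC divfK// gt_eqF.
  have c2 : `|flow_map Ph T (zn k) - flow_map (Phn k) T (zn k)| <= dl / 4.
    have -> : flow_map Ph T (zn k) - flow_map (Phn k) T (zn k) =
        (Ph 0 (zn k).1 T - Phn k 0 (zn k).1 T, 0) :> S.
      by apply: state_ext; rewrite /flow_map //= subrr.
    have pair0 (a : V) : `|(a, 0) : S| = `|a|.
      change (Num.max `|a| `|0 : V| = `|a|); rewrite normr0; exact: max_l.
    rewrite pair0 distrC.
    by apply: h2 => //; case: (Dzn k) => _ h; exact: le_trans (norm_fst _) h.
  have c3 := near_w (flow_map Ph T (zn k)) ltac:(by case: Yzk).
  have c4 := near_w (flow_map (Phn k) T (zn k)) ltac:(by case: Yzk).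
  have h3 : `|l w - l (flow_map Ph T (zn k))| <= e / 2.
    by apply: c3; apply: le_lt_trans c1 _; rewrite ltr_pdivrMr//; lra.
  have h4 : `|l w - l (flow_map (Phn k) T (zn k))| <= e / 2.
    apply: c4; rewrite -(subrKA (flow_map Ph T (zn k))).
    apply: le_lt_trans (ler_normD _ _) _; apply: le_lt_trans (lerD c1 c2) _; lra.
  by move: h3 h4; rewrite !ler_norml; lra.
have it := terminal_cost_integrable mu0 rho T0 cY Lf1 fL fG lc thL sPh.
have itn k := terminal_cost_integrable mu0 rho T0 cY Lf1 fL fG lc (thnL k) (sPhn k).
apply: filterS unif => k h /=.
rewrite -(ExB mD (itn k) it); apply: (Ex_norm_le mD PD) => //.
by apply: measurable_funB; apply/measurable_EFinP; [exact: measurable_int (itn k)|exact: measurable_int it].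
Qed.

Lemma moments_converge j k (e : R) : 0 < e ->
  F [set m | forall t, 0 <= t <= T -> `|moment mu0 D (Zn m t) j k - moment mu0 D (Z t) j k| <= e].
Proof.
move=> e0; have PF : ProperFilter F by exact: ultra_proper.
pose q := 2 * B * Lf + 1.
have q0 : 0 < q by rewrite ltr_wpDl// mulr_ge0// mulr_ge0.
apply: filterS (flow_cvg (divr_gt0 e0 q0)) => m h t tT.
have md := @moment_diff _ _ R p mu0 D mD PD (Zn m t) (Z t) B (Lf * (e / q)) j k.
have m1 i : measurable_fun (D : set (borel S)) (fun z => Zn m t z i 0).
  exact: (flow_value_measurable Lf1 fL fG (thnL m) (sPhn m) i tT).
have m2 i : measurable_fun (D : set (borel S)) (fun z => Z t z i 0).
  exact: (flow_value_measurable Lf1 fL fG thL sPh i tT).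
have b1 i z := @flow_value_uniform_bound _ _ (thnL m) (thnC m) (sPhn m) t i z tT.
have b2 i z := @flow_value_uniform_bound _ _ thL thC sPh t i z tT.
apply: le_trans (md m1 b1 m2 b2 _) _.
  move=> z [_ zr]; apply: le_trans (fL _ _) _; rewrite ler_wpM2l//.
  by apply: h => //; exact: le_trans (norm_fst z) zr.
rewrite mulrA (_ : 2 * B * Lf * (e / q) = e * (2 * B * Lf / q)); last by ring.
by apply: ler_piMr; [exact: ltW|rewrite ler_pdivrMr// mul1r lerDl].
Qed.

Let mom_lim (a : nat -> R -> R) (a0 b : R -> R) j k :
  (forall m, sqitg 0 T (a m)) -> (forall m, sqN 0 T (a m) <= C) -> sqitg 0 T a0 ->
  (forall x, sqitg 0 T x -> ip 0 T (a m) x @[m --> F] --> ip 0 T a0 x) -> sqitg 0 T b ->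
  Int 0 T (fun r => a m r * b r * moment mu0 D (Zn m r) j k) @[m --> F] -->
  Int 0 T (fun r => a0 r * b r * moment mu0 D (Z r) j k).
Proof.
move=> aL aC a0L aw bL.
apply: (@weak_uniform_product _ F UF T (B * B) C a a0 b (fun m r => moment mu0 D (Zn m r) j k)
  (fun r => moment mu0 D (Z r) j k) aL aC a0L aw bL).
- by move=> m; exact: (moment_time_measurable T0 cY Lf1 fL fG rho0 mu0Y mu0rho (thnL m) (sPhn m)).
- exact: (moment_time_measurable T0 cY Lf1 fL fG rho0 mu0Y mu0rho thL sPh).
- by move=> m r rT; exact: (moment_uniform_bound (thnL m) (thnC m) (sPhn m)).
- by move=> r rT; exact: (moment_uniform_bound thL thC sPh).
- by move=> e e0; exact: moments_converge.
Qed.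

Let E m (a a' : R -> 'M[R]_(n, p)) (t : R) := energy mu0 D (Zn m t) (a t) (a' t).

Let cross_lim (a a' : nat -> R -> 'M[R]_(n, p)) :
  (forall i j k, Int 0 T (fun t => a m t i j * a' m t i k * moment mu0 D (Zn m t) j k) @[m --> F] -->
     Int 0 T (fun t => th t i j * th t i k * moment mu0 D (Z t) j k)) ->
  (forall m i j, sqitg 0 T (fun r => a m r i j)) -> (forall m i j, sqitg 0 T (fun r => a' m r i j)) ->
  Int 0 T (fun t => E m (a m) (a' m) t) @[m --> F] -->
  Int 0 T (fun t => energy mu0 D (Z t) (th t) (th t)).
Proof.
move=> h aL a'L; have PF : ProperFilter F by exact: ultra_proper.
rewrite (cross_energy_Int thL thC sPh thL thL).2.
rewrite (_ : (fun m => _) = (fun m => \sum_i \sum_j \sum_k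
    Int 0 T (fun t => a m t i j * a' m t i k * moment mu0 D (Zn m t) j k))).
  by apply: cvg_finite_sum => i; apply: cvg_finite_sum => j; apply: cvg_finite_sum => k; exact: h.
apply/funext => m; exact: (cross_energy_Int (thnL m) (thnC m) (sPhn m) (aL m) (a'L m)).2.
Qed.

Let run (a : R -> 'M[R]_(n, p)) (X : R -> S -> 'cV[R]_p) t :=
  lambda / 2 * energy mu0 D (X t) (a t) (a t) + eps / 2 * \sum_i \sum_j a t i j ^+ 2.

(* The lower bound obtained from nonnegativity of the quadratic integrand at
   [thn m t - th t]; it is affine in [thn m], hence passes to the weak limit. *)
Let low m t := lambda / 2 * (E m (thn m) th t + E m th (thn m) t - E m th th t) +
  eps / 2 * (2 * (\sum_i \sum_j thn m t i j * th t i j) - \sum_i \sum_j th t i j ^+ 2).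

Let iS (a a' : R -> 'M[R]_(n, p)) : (forall i j, sqitg 0 T (fun r => a r i j)) ->
  (forall i j, sqitg 0 T (fun r => a' r i j)) ->
  itg 0 T (fun t => \sum_i \sum_j a t i j * a' t i j).
Proof. by move=> aL a'L; apply: itg_sum => i; apply: itg_sum => j; exact: sqitg_mul. Qed.

Let iE m (a a' : R -> 'M[R]_(n, p)) : (forall i j, sqitg 0 T (fun r => a r i j)) ->
  (forall i j, sqitg 0 T (fun r => a' r i j)) -> itg 0 T (E m a a').
Proof. by move=> aL a'L; exact: (cross_energy_Int (thnL m) (thnC m) (sPhn m) aL a'L).1. Qed.

Let iN := norm_sqr_itg thL.

Let ilow1 m : itg 0 T (fun t => E m (thn m) th t + E m th (thn m) t - E m th th t).
Proof. by apply: itgB; [apply: itgD; exact: iE|exact: iE]. Qed.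

Let ilow2 m : itg 0 T (fun t => 2 * (\sum_i \sum_j thn m t i j * th t i j) -
  \sum_i \sum_j th t i j ^+ 2).
Proof. by apply: itgB => //; apply: itgZ; exact: iS. Qed.

Let low_le m t : 0 <= t <= T -> low m t <= run (thn m) (Zn m) t.
Proof.
move=> tT.
have m1 i : measurable_fun (D : set (borel S)) (fun z => Zn m t z i 0).
  exact: (flow_value_measurable Lf1 fL fG (thnL m) (sPhn m) i tT).
have b1 i z := @flow_value_uniform_bound _ _ (thnL m) (thnC m) (sPhn m) t i z tT.
have h1 := energy_ge0 mu0 mD m1 b1 (thn m t - th t).
rewrite energyB in h1.
apply: lerD.
  by apply: ler_wpM2l; [exact: divr_ge0|rewrite /E; move: h1; rewrite /Zn; lra].
apply: ler_wpM2l; first by rewrite divr_ge0// ltW.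
rewrite mulr_sumr -sumrB; apply: ler_sum => i _.
rewrite mulr_sumr -sumrB; apply: ler_sum => j _.
by have := sqr_ge0 (thn m t i j - th t i j); nra.
Qed.

(** Every cross term is a sum of integrals of a weakly convergent entry, possibly constant, times a
    fixed entry, times a moment converging uniformly in time. *)
Let low_lim : Int 0 T (low m) @[m --> F] --> Int 0 T (run th Z).
Proof.
have PF : ProperFilter F by exact: ultra_proper.
set N := Int 0 T (fun t => \sum_i \sum_j th t i j ^+ 2).
set En := Int 0 T (fun t => energy mu0 D (Z t) (th t) (th t)).
have c1 := @cross_lim thn (fun=> th) (fun i j k => @mom_lim (fun m r => thn m r i j) (fun r => th r i j) (fun r => th r i k) j k (fun m => thnL m i j)
  (fun m => thnC m i j) (thL i j) (@weak i j) (thL i k)) thnL (fun=> thL).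
have c2 : Int 0 T (fun t => E m th (thn m) t) @[m --> F] --> En.
  apply: cross_lim => // i j k.
  have := @mom_lim (fun m r => thn m r i k) (fun r => th r i k) (fun r => th r i j) j k (fun m => thnL m i k) (fun m => thnC m i k) (thL i k) (@weak i k) (thL i j).
  have sw (a : R -> 'M[R]_(n, p)) (X : R -> S -> 'cV[R]_p) :
      Int 0 T (fun r => a r i k * th r i j * moment mu0 D (X r) j k) =
      Int 0 T (fun r => th r i j * a r i k * moment mu0 D (X r) j k).
    by apply: Int_eq => r _; rewrite [_ * th r i j]mulrC.
  by rewrite sw; under eq_fun do rewrite sw.
have c3 : Int 0 T (fun t => E m th th t) @[m --> F] --> En.
  apply: (@cross_lim (fun=> th) (fun=> th)) => // i j k.
  apply: (@mom_lim (fun=> (fun r => th r i j)) (fun r => th r i j) (fun r => th r i k) j k (fun=> thL i j) (fun=> thC i j) (thL i j) _ (thL i k)).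
  by move=> x _; exact: cvg_cst.
have c4 : Int 0 T (fun t => \sum_i \sum_j thn m t i j * th t i j) @[m --> F] --> N.
  have -> : N = \sum_i \sum_j ip 0 T (fun r => th r i j) (fun r => th r i j).
    rewrite /N Int_sum; last by move=> i; apply: itg_sum => j; case: (thL i j).
    apply: eq_bigr => i _; rewrite Int_sum; last by move=> j; case: (thL i j).
    by apply: eq_bigr => j _; apply: Int_eq => r _; rewrite expr2.
  rewrite (_ : (fun m => _) = (fun m => \sum_i \sum_j
      ip 0 T (fun r => thn m r i j) (fun r => th r i j))).
    by apply: cvg_finite_sum => i; apply: cvg_finite_sum => j; exact: weak.
  apply/funext => m; rewrite Int_sum; last by move=> i; apply: itg_sum => j; exact: sqitg_mul.
  by apply: eq_bigr => i _; rewrite Int_sum// => j; exact: sqitg_mul.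
have -> : Int 0 T (run th Z) = lambda / 2 * (En + En - En) + eps / 2 * (2 * N - N).
  have ie : itg 0 T (fun t => energy mu0 D (Z t) (th t) (th t)).
    exact: (cross_energy_Int thL thC sPh thL thL).1.
  rewrite /run IntD; [|exact: itgZ|exact: itgZ].
  by rewrite !IntZ// -/En -/N; ring.
have -> : (fun m => Int 0 T (low m)) = (fun m =>
   lambda / 2 * (Int 0 T (E m (thn m) th) + Int 0 T (E m th (thn m)) - Int 0 T (E m th th)) +
   eps / 2 * (2 * Int 0 T (fun t => \sum_i \sum_j thn m t i j * th t i j) - N)).
  apply/funext => m; rewrite /low IntD; [|exact: itgZ|exact: itgZ].
  rewrite IntZ// IntZ// IntB; [|by apply: itgD; exact: iE|exact: iE].
  rewrite IntD; [|exact: iE|exact: iE].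
  by rewrite IntB//; [rewrite IntZ//; exact: iS|apply: itgZ; exact: iS].
apply: cvgD; apply: cvgMr.
  by apply: cvgB => //; apply: cvgD.
by apply: cvgB; [apply: cvgMr|exact: cvg_cst].
Qed.

(** Lower semicontinuity along the ultrafilter, stated up to [e] in place of a lower limit. *)
Lemma control_cost_lsc (e : R) : 0 < e ->
  F [set m | control_cost T lambda eps Y l f mu0 rho Ph th <=
             control_cost T lambda eps Y l f mu0 rho (Phn m) (thn m) + e].
Proof.
move=> e0; have PF : ProperFilter F by exact: ultra_proper.
have e2 : 0 < e / 2 by rewrite divr_gt0.
have := low_lim => /cvgrPdist_le /(_ _ e2) ev.
apply: filterS2 (terminal_cost_converges e2) ev => m h1 h2 /=.
have h3 : Int 0 T (low m) <= Int 0 T (run (thn m) (Zn m)).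
  apply: Int_le => [||t tT]; last exact: low_le.
    by apply: itgD; exact: itgZ.
  by apply: itgD; [apply: itgZ; exact: iE|apply: itgZ; exact: (norm_sqr_itg (thnL m))].
move: h1 h2 h3; rewrite /control_cost -/(run th Z) -/(run (thn m) (Zn m)) /= => /ler_normlP[+ +] /ler_normlP[].
set a := Ex _ _ _; set a' := Ex _ _ _; set b := Int _ _ _; set b' := Int _ _ _.
by set c := Int _ _ _; lra.
Qed.

End lower_semicontinuity.

Section minimising_sequences.
Context {R : realType}.

Lemma sequence_to_inf (A : Type) (D : set A) (c : A -> R) (m : R) : D !=set0 ->
  (forall a, D a -> m <= c a) ->
  exists al : nat -> A, forall k, D (al k) /\ c (al k) <= inf [set c a | a in D] + k.+1%:R^-1.
Proof.
move=> [a0 Da0] cm; have hi : has_inf [set c a | a in D].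
  by split; [exists (c a0); exists a0|exists m => _ [a Da <-]; exact: cm].
suff h k : exists a, D a /\ c a <= inf [set c a | a in D] + k.+1%:R^-1.
  by have [al alP] := choice h; exists al.
have k0 : 0 < k.+1%:R^-1 :> R by rewrite invr_gt0.
by have [_ [a Da <-] /ltW ca] := inf_adherent k0 hi; exists a.
Qed.

End minimising_sequences.

Section existence.
Context {R : realType} {n p : nat}.
Notation S := (state R n).
Notation V := 'cV[R]_n.
Variables (T lambda eps Lf : R) (Y : set 'cV[R]_n) (l : S -> R) (f : 'cV[R]_n -> 'cV[R]_p).
Variables (mu0 : probability (borel S) R) (rho : R).
Hypotheses (T0 : 0 < T) (lambda0 : 0 <= lambda) (eps0 : 0 < eps) (cY : compact Y) (Lf1 : 1 <= Lf).
Hypothesis fL : forall x x', `|f x - f x'| <= Lf * `|x - x'|.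
Hypothesis fG : forall x, `|f x| <= Lf * (1 + `|x|).
Hypothesis l0 : forall z, RdY Y z -> 0 <= l z.
Hypothesis lc : {within RdY Y, continuous l}.
Hypothesis rho0 : 0 <= rho.
Hypothesis mu0Y : mu0 (RdY Y) = 1%E.
Hypothesis mu0rho : mu0 [set z | `|z| <= rho] = 1%E.
Variable Phi : (R -> 'M[R]_(n, p)) -> R -> V -> R -> V.
Hypothesis sPhi : forall theta, in_L2 T theta -> forall s x, 0 <= s <= T ->
  solution s T (fun r x => theta r *m f x) x (Phi theta s x).

Let cost theta := control_cost T lambda eps Y l f mu0 rho (Phi theta) theta.
Let T0' := ltW T0.

Let cost_lower theta : in_L2 T theta ->
  eps / 2 * Int 0 T (fun t => \sum_i \sum_j theta t i j ^+ 2) <= cost theta.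
Proof.
move=> th2; exact: (control_cost_lower eps T0 lambda0 cY Lf1 fL fG l0 rho0 mu0Y mu0rho
  (in_L2_coord th2) (sPhi th2)).
Qed.

Let cost_ge0 theta : in_L2 T theta -> 0 <= cost theta.
Proof.
move=> th2; apply: le_trans (cost_lower th2); apply: mulr_ge0.
  by rewrite divr_ge0// ltW.
apply: Int_ge0 => r _; apply: sumr_ge0 => i _; apply: sumr_ge0 => j _; exact: sqr_ge0.
Qed.

Lemma optimal_control_exists :
  exists2 th, in_L2 T th & forall theta, in_L2 T theta ->
    control_cost T lambda eps Y l f mu0 rho (Phi th) th <=
    control_cost T lambda eps Y l f mu0 rho (Phi theta) theta.
Proof.
have z2 : in_L2 T (fun=> 0 : 'M[R]_(n, p)).
  apply: coord_in_L2 => i j; have [h1 h2] := sqitg_cst 0 T (0 : R); split.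
    by apply: measurable_ext h1 => r; rewrite mxE.
  by apply: itg_eq h2 => r _; rewrite mxE.
have [thn thnP] := sequence_to_inf (ex_intro _ _ z2 : in_L2 T !=set0) cost_ge0.
set c := inf _ in thnP.
have thn2 k : in_L2 T (thn k) := (thnP k).1.
have thnL k := in_L2_coord (thn2 k).
(* The costs along the sequence are at most [c + 1], and coercivity divides by [eps / 2]. *)
pose C := (c + 1) / (eps / 2).
have e2 : 0 < eps / 2 by rewrite divr_gt0.
have thnC k i j : sqN 0 T (fun r => thn k r i j) <= C.
  rewrite ler_pdivlMr// mulrC; apply: (@le_trans _ _ (cost (thn k))); last first.
    by apply: le_trans (thnP k).2 _; rewrite lerD2l invf_le1// ler1n.
  apply: le_trans (cost_lower (thn2 k)); rewrite ler_pM2l//.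
  apply: Int_le; [by case: (thnL k i j)|exact: norm_sqr_itg (thnL k)|move=> r _].
  rewrite (bigD1 i)//= (bigD1 j)//= -addrA lerDl addr_ge0//.
    by apply: sumr_ge0 => k' _; exact: sqr_ge0.
  by apply: sumr_ge0 => k' _; apply: sumr_ge0 => k'' _; exact: sqr_ge0.
(* The ultrafilter is finer than convergence to infinity, so what holds for all large [k] still
   holds along it. *)
have [F [UF Foo]] := ultraFilterLemma (eventually_filter : ProperFilter \oo).
have PF : ProperFilter F by exact: ultra_proper.
have lims (ij : 'I_n * 'I_p) : exists zeta : R -> R, sqitg 0 T zeta /\ forall x, sqitg 0 T x ->
    ip 0 T (fun r => thn k r ij.1 ij.2) x @[k --> F] --> ip 0 T zeta x.
  have [zeta zL zw] := sqitg_weak_limit UF (fun k => thnL k ij.1 ij.2) (fun k => thnC k ij.1 ij.2).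
  by exists zeta.
have [zeta zetaP] := choice lims.
pose th r : 'M[R]_(n, p) := \matrix_(i, j) zeta (i, j) r.
have thE i j : (fun r => th r i j) = zeta (i, j) by apply/funext => r; rewrite mxE.
have thL i j : sqitg 0 T (fun r => th r i j) by rewrite thE; exact: (zetaP (i, j)).1.
have weak i j x : sqitg 0 T x ->
    ip 0 T (fun r => thn k r i j) x @[k --> F] --> ip 0 T (fun r => th r i j) x.
  by rewrite thE; exact: (zetaP (i, j)).2.
have th2 := coord_in_L2 thL.
(* A common bound for the sequence and its limit; enlarging [C] avoids comparing their norms. *)
pose C' := Num.max C (\sum_i \sum_j sqN 0 T (fun r => th r i j)).
have thC i j : sqN 0 T (fun r => th r i j) <= C'.
  rewrite le_max; apply/orP; right; rewrite (bigD1 i)//= (bigD1 j)//= -addrA lerDl addr_ge0//.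
    by apply: sumr_ge0 => k' _; exact: sqN_ge0.
  by apply: sumr_ge0 => k' _; apply: sumr_ge0 => k'' _; exact: sqN_ge0.
have thnC' k i j : sqN 0 T (fun r => thn k r i j) <= C' by rewrite le_max thnC.
exists th => // theta theta2; apply/ler_addgt0Pr => e e0.
have e20 : 0 < e / 2 by rewrite divr_gt0.
have ev1 := control_cost_lsc T0 lambda0 eps0 cY Lf1 fL fG lc rho0 mu0Y mu0rho UF thnL thnC' thL thC
  weak (fun k => sPhi (thn2 k)) (sPhi th2) e20.
have ev2 : F [set k | k.+1%:R^-1 <= e / 2 :> R].
  apply: Foo; have := @cvg_harmonic R => /cvgrPdist_le /(_ _ e20); apply: filterS => k.
  by rewrite sub0r normrN ger0_norm// harmonic_ge0.
have [k [/= h1 h2]] := filter_ex (filterI ev1 ev2).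
have h3 := (thnP k).2.
have h4 : c <= cost theta.
  by apply: ge_inf; [exists 0 => _ [t t2 <-]; exact: cost_ge0|exists theta].
have h1' : cost th <= cost (thn k) + e / 2 by exact: h1.
change (cost th <= cost theta + e); move: h1' h2 h3 h4.
by move: (cost th) (cost theta) (cost (thn k)) (k.+1%:R^-1) => x y z w; lra.
Qed.

Lemma control_admissible theta : in_L2 T theta ->
  exists mu : R -> probability (borel S) R, admissible T Y f mu0 (mu, theta).
Proof.
move=> th2; have thL := in_L2_coord th2.
have ith i j := sqitg_itg (thL i j).
have cF := field_caratheodory Lf1 fL fG ith.
(* [clamp] makes a push-forward available at every real time, as a curve is a total function of
   time. *)
have push t : exists Q : probability (borel S) R,
    is_push mu0 (flow_map (Phi theta) (clamp T t) : borel S -> borel S) Q.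
  have /andP[t0 tT] := clamp_in T0' t.
  exact: (push_exists mu0 (flow_map_measurable cF (sPhi th2) t0 tT)).
have [mu muP] := choice push; exists mu.
apply: (pushed_admissible T0 cY Lf1 fL fG ith (sPhi th2) rho0 mu0Y mu0rho _ th2) => t tT.
by have := muP t; rewrite clamp_id.
Qed.

Lemma admissible_cost mu theta : admissible T Y f mu0 (mu, theta) ->
  in_L2 T theta /\
  J T lambda eps Y l f mu theta = (control_cost T lambda eps Y l f mu0 rho (Phi theta) theta)%:E.
Proof.
move=> [_ /= th2 sol mu00]; split=> //; have thL := in_L2_coord th2.
apply: (J_control_cost lambda eps T0 cY Lf1 fL fG lc rho0 mu0Y mu0rho thL (sPhi th2)) => t tT.
exact: (solution_is_push T0 cY Lf1 fL fG (fun i j => sqitg_itg (thL i j)) sol mu00 (sPhi th2) tT).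
Qed.

End existence.

Theorem theorem1p5 (R : realType) (d p : nat) (hd : (1 <= d)%N) (hp : (1 <= p)%N)
  (T lambda eps : R) (hT : 0 < T) (hlambda : 0 <= lambda) (heps : 0 < eps)
  (Y : set 'cV[R]_d) (hY : compact Y)
  (l : state R d -> R)
  (hl0 : forall z, RdY Y z -> 0 <= l z)
  (hlc : {within RdY Y, continuous l})
  (hl2 : two_growth (RdY Y) l)
  (f : 'cV[R]_d -> 'cV[R]_p) (hf : elipschitz f)
  (mu0 : probability (borel (state R d)) R) (hmu0 : Pc (RdY Y) mu0) :
  exists (mu : R -> probability (borel (state R d)) R) (theta : R -> 'M[R]_(d, p)),
    admissible T Y f mu0 (mu, theta) /\
    J T lambda eps Y l f mu theta =
      ereal_inf [set J T lambda eps Y l f mt.1 mt.2 | mt in admissible T Y f mu0].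
Proof.
have [mu0Y cmu0] := hmu0.
have [rho rho0 mu0rho] := support_ball cmu0.
have [Lf [Lf1 fL fG]] := elipschitz_sup hf.
(* One flow is fixed for each square integrable control, so that the cost becomes a function of the
   control; for other controls the value is an arbitrary default. *)
have flows theta : exists Psi : R -> 'cV[R]_d -> R -> 'cV[R]_d, in_L2 T theta ->
    forall s x, 0 <= s <= T -> solution s T (fun r x => theta r *m f x) x (Psi s x).
  have [th2|no] := pselect (in_L2 T theta); last by exists (fun _ _ _ => 0).
  have [Psi sPsi] := flow_exists
    (field_caratheodory Lf1 fL fG (fun i j => sqitg_itg (in_L2_coord th2 i j))).
  by exists Psi.
have [Phi sPhi] := choice flows.
have [th th2 th_min] := optimal_control_exists hT hlambda heps hY Lf1 fL fG hl0 hlc rho0 mu0Y mu0rho sPhi.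
have [mu adm] := control_admissible hT hY Lf1 fL fG rho0 mu0Y mu0rho sPhi th2.
have cost_adm := admissible_cost lambda eps hT hY Lf1 fL fG hlc rho0 mu0Y mu0rho sPhi.
exists mu, th; split=> //; apply/eqP; rewrite eq_le; apply/andP; split.
  (* The cost of an admissible pair depends on its control alone, so minimality among controls is
     minimality among pairs. *)
  apply: le_ereal_inf_tmp => _ [[nu theta] nadm <-] /=.
  have [_ ->] := cost_adm _ _ adm; have [t2 ->] := cost_adm _ _ nadm.
  by rewrite lee_fin; exact: th_min.
by apply: ereal_inf_lbound; exists (mu, th).
Qed.
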